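(* Let $d=1$, $s\in\mathbb{N}$ with $s\ge1$, and $i\in\{1,2,3\}$, and let the sets $\mathcal{P}_1,\mathcal{P}_2,\mathcal{P}_3$ (which cover $(\mathbb{R}^+\setminus\{1\})\times\mathbb{R}^2$) and the operators $P^i_{\gamma,\mu,\sigma}$ be as in the context. There exist a (relatively) open set $\mathscr{U}^i_s$ with $$\mathcal{P}_i\times\{0\}^{\ell+1}\times\{0\}^{\ell+1}\subset\mathscr{U}_s^i\subset\mathcal{P}_i\times(H^s(\mathbb{R}))^{\ell+1}\times(H^s(\mathbb{R}))^{\ell+1}$$ and a family of radii $\{\varepsilon^i_{s,\mathbf{p}}\}_{\mathbf{p}\in\mathcal{P}_i}\subset\mathbb{R}^+$ such that the following hold. (1) To each $(\gamma,\mu,\sigma,\{\tau_j\}_{j=0}^\ell,\{\varphi_j\}_{j=0}^\ell)\in\mathscr{U}^i_s$ there exists a unique $\eta$ satisfying $P^i_{\gamma,\mu,\sigma}\eta\in B_{H^s}(0,\varepsilon^i_{s,(\gamma,\mu,\sigma)})$ such that, upon defining $v=\gamma\eta/(1+\eta)$, the pair $(v,\eta)$ is a solution to $$\begin{cases}\nabla\cdot((1+\eta)(v-\gamma e_1))=0,\\ (1+\eta)(v-\gamma e_1)\cdot\nabla v+v-\mu^2\nabla\cdot((1+\eta)\mathbb{S}v)+(1+\eta)(I-\sigma^2\Delta)\nabla\eta+\mathcal{F}=0\end{cases}$$ on $\mathbb{R}$ with $\mathcal{F}=\sum_{j=0}^\ell\eta^j(\tau_j\nabla\eta+\varphi_j)$.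 (2) The following mappings, where $(v,\eta)$ is the pair from (1), are well-defined and continuous: $$\mathscr{U}^i_s\ni(\gamma,\mu,\sigma,\{\tau_j\}_{j=0}^\ell,\{\varphi_j\}_{j=0}^\ell)\mapsto\begin{cases}(v,\eta)\in(H^{1+s}(\mathbb{R}))^2,\\ \mu^2(v,\eta)\in(H^{2+s}(\mathbb{R}))^2,\\ \sigma^2(v,\eta)\in(H^{3+s}(\mathbb{R}))^2.\end{cases}$$
   Context: $\ell\in\mathbb{N}=\{0,1,2,\dots\}$ is fixed, $\mathbb{R}^+=(0,\infty)$, $\langle x\rangle=\sqrt{1+x^2}$. In dimension $d=1$: $\nabla$ and $\nabla\cdot$ are the derivative, $e_1=1$, $\mathbb{S}v=4v'$ (in general $\mathbb{S}v=\nabla v+\nabla v^{\mathrm t}+2(\nabla\cdot v)I$). The Fourier transform has kernel $e^{-2\pi i x\xi}$. For $(\gamma,\mu,\sigma)\in(\mathbb{R}^+\setminus\{1\})\times\mathbb{R}^2$ and $i\in\{1,2,3\}$, $P^i_{\gamma,\mu,\sigma}$ is the Fourier multiplier operator with symbol $$p^i_{\gamma,\mu,\sigma}(\xi)=\langle\mu\xi\rangle^2+\begin{cases}\langle\xi\rangle\langle\sigma\xi\rangle^2&i=1,\\ \langle\xi\rangle&i=2,\\ (\langle\sigma\xi\rangle+\langle\mu\xi\rangle)\langle\sigma\xi\rangle^2&i=3.\end{cases}$$ The parameter sets, subsets of $(\mathbb{R}^+\setminus\{1\})\times\mathbb{R}^2$, are $\mathcal{P}_1=\{(\gamma,\mu,\sigma):\gamma<1\}$,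 $\mathcal{P}_2=\{(\gamma,\mu,\sigma):\gamma>1,\ \sigma=0\}$, $\mathcal{P}_3=\{(\gamma,\mu,\sigma):\gamma>1,\ |\mu|+|\sigma|>0\}$. $B_{H^s}(0,\varepsilon)$ is the open ball in $H^s(\mathbb{R})$. *)

(* Defs.v *)
From HB Require Import structures.
From mathcomp Require Import all_boot all_order all_algebra.
From mathcomp Require Import complex.
From mathcomp Require Import all_classical all_reals all_analysis.
Set Implicit Arguments.
Unset Strict Implicit.
Unset Printing Implicit Defensive.
Import Order.TTheory GRing.Theory Num.Theory.
Import numFieldNormedType.Exports.
Local Open Scope classical_set_scope.
Local Open Scope ring_scope.

Section Fourier.
Context {R : realType}.
Local Notation mu := (@lebesgue_measure R).
Implicit Types (f g : R -> R) (F : R -> R[i]) (m : R -> R) (s : nat).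

Definition bracket (x : R) : R := Num.sqrt (1 + x ^+ 2).

(* xi |-> \int_(-n)^n f(x) e^(-2 pi i x xi) dx *)
Definition fourier_trunc f (n : nat) : R -> R[i] := fun xi =>
  (Complex (\int[mu]_(x in `[- n%:R, n%:R]) (f x * cos (2 * pi * x * xi)))
         (- \int[mu]_(x in `[- n%:R, n%:R]) (f x * sin (2 * pi * x * xi)))).

(* the norm of L^2(R, <xi>^(2s) d xi) *)
Definition wnorm s F : \bar R :=
  Lnorm mu 2%:E (fun xi => (bracket xi ^+ s * Normc.normc (F xi))%:E).

(* F represents the Fourier transform of f in L^2(R): the limit in L^2 of the
   transforms of the truncations of f. It is only determined up to a.e.
   equality. *)
Definition is_fourier f F : Prop :=
  [/\ f \in Lfun mu 2%:E,
      measurable_fun setT (fun xi => complex.Re (F xi)),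
      measurable_fun setT (fun xi => complex.Im (F xi)) &
      wnorm 0 (fun xi => F xi - fourier_trunc f n xi) @[n --> \oo] --> 0%E].

Definition fourier f : R -> R[i] := xget (fun=> 0) (is_fourier f).

Definition sobolev s f : Prop :=
  exists2 F, is_fourier f F & (wnorm s F < +oo)%E.

(* only meaningful when [sobolev s f] holds *)
Definition sobolev_norm s f : \bar R := wnorm s (fourier f).

(* g = m(D) f *)
Definition fourier_multiplier m f g : Prop :=
  exists2 F, is_fourier f F & is_fourier g (fun xi => (m xi)%:C%C * F xi).

Lemma fourier_trunc0 n : fourier_trunc (cst 0) n = fun=> 0.
Proof.
apply/funext => xi; rewrite /fourier_trunc /Rintegral.
under eq_integral do rewrite mul0r.
under [in X in Complex _ X]eq_integral do rewrite mul0r.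
by rewrite !integral0 /= oppr0.
Qed.

Lemma wnorm0 s : wnorm s (fun=> 0) = 0%E.
Proof.
rewrite /wnorm -[RHS](@Lnorm0 _ _ R mu 2%:E) ?eqe//.
by apply: eq_Lnorm => xi; rewrite Normc.normc0 mulr0.
Qed.

Lemma sobolev0 s : sobolev s (cst 0).
Proof.
exists (fun=> 0); last by rewrite wnorm0 ltry.
split=> //.
- have h : (1 <= 2%:E :> \bar R)%E by rewrite lee_fin ler1n.
  apply/andP; split; rewrite inE /=; first exact: measurable_cst.
  exact: (finite_norm_cst0 mu h).
- rewrite (_ : (fun n => _) = fun=> 0%E); first exact: cvg_cst.
  apply/funext => n; rewrite fourier_trunc0 -[RHS](wnorm0 0).
  by congr wnorm; apply/funext => xi; rewrite subr0.
Qed.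

End Fourier.

(* Elements of H^s(R) are represented by functions; two representatives of the
   same element are a.e. equal, hence at distance 0. *)
Record Hs (R : realType) (s : nat) := MkHs {
  Hs_fun :> R -> R;
  Hs_sobolev : sobolev s Hs_fun }.

Definition Hs0 (R : realType) (s : nat) : Hs R s := MkHs (sobolev0 s).

HB.instance Definition _ (R : realType) (s : nat) := gen_eqMixin (Hs R s).
HB.instance Definition _ (R : realType) (s : nat) := gen_choiceMixin (Hs R s).

Section HsTopology.
Context (R : realType) (s : nat).

Definition Hs_ball (f : Hs R s) (r : R) : set (Hs R s) :=
  [set g | (sobolev_norm s (fun x => g x - f x)%R < r%:E)%E].

Definition Hs_open : set_system (Hs R s) :=
  [set A | forall f, A f -> exists2 r : R, 0 < r & Hs_ball f r `<=` A].

Lemma Hs_openT : Hs_open setT.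
Proof. by move=> f _; exists 1. Qed.

Lemma Hs_openI : setI_closed Hs_open.
Proof.
move=> A B oA oB f [/oA[r r0 rA] /oB[t t0 tB]].
exists (Num.min r t); first by rewrite lt_min r0.
by move=> g fg; split; [apply: rA|apply: tB]; apply: lt_le_trans fg _;
  rewrite lee_fin ge_min lexx ?orbT.
Qed.

Lemma Hs_open_bigU (I : Type) (A : I -> set (Hs R s)) :
  (forall i, Hs_open (A i)) -> Hs_open (\bigcup_i A i).
Proof.
move=> oA f [i _ /oA[r r0 rA]]; exists r => //.
by move=> g /rA Ag; exists i.
Qed.

HB.instance Definition _ :=
  isOpenTopological.Build (Hs R s) Hs_openT Hs_openI Hs_open_bigU.

End HsTopology.

Section WeakDerivative.
Context {R : realType}.
Local Notation mu := (@lebesgue_measure R).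

Definition test_function (phi : R -> R) : Prop :=
  (forall n x, derivable (derive1n n phi) x 1) /\
  (exists M, forall x, M < `|x| -> phi x = 0).

(* g is the k-th distributional derivative of f *)
Definition weak_derive (k : nat) (f g : R -> R) : Prop :=
  [/\ locally_integrable setT f, locally_integrable setT g &
      forall phi, test_function phi ->
        \int[mu]_x (f x * derive1n k phi x)
        = (-1) ^+ k * \int[mu]_x (g x * phi x)].

End WeakDerivative.

Inductive regime := regime1 | regime2 | regime3.

Section ShallowWater.
Context {R : realType}.
Local Notation mu := (@lebesgue_measure R).

(* (gamma, mu, sigma) *)
Definition param : Type := (R * R * R)%type.

Definition param_set (i : regime) : set param :=
  [set p | let: (gam, m, sig) := p in
    match i with
    | regime1 => 0 < gam < 1
    | regime2 => 1 < gam /\ sig = 0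
    | regime3 => 1 < gam /\ 0 < `|m| + `|sig|
    end].

Definition symbol (i : regime) (p : param) (xi : R) : R :=
  let: (_, m, sig) := p in
  bracket (m * xi) ^+ 2 +
  match i with
  | regime1 => bracket xi * bracket (sig * xi) ^+ 2
  | regime2 => bracket xi
  | regime3 => (bracket (sig * xi) + bracket (m * xi)) * bracket (sig * xi) ^+ 2
  end.

(* The data (gamma, mu, sigma, {tau_j}, {phi_j}), j = 0, ..., l. *)
Definition data (l s : nat) : Type :=
  (param * prod_topology (fun _ : 'I_l.+1 => Hs R s)
         * prod_topology (fun _ : 'I_l.+1 => Hs R s))%type.

(* The derivatives are distributional. The factors mu^2 and sigma^2 are kept
   inside the differentiated functions, so that nothing is required of the
   corresponding derivatives when mu = 0 or sigma = 0. *)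
Definition traveling_wave (l : nat) (p : param) (tau phi : 'I_l.+1 -> R -> R)
    (v eta : R -> R) : Prop :=
  let: (gam, m, sig) := p in
  exists v' eta' visc capil : R -> R,
  [/\ weak_derive 1 v v',
      weak_derive 1 eta eta',
      weak_derive 1 (fun x => m ^+ 2 * ((1 + eta x) * (4 * v' x))) visc,
      weak_derive 3 (fun x => sig ^+ 2 * eta x) capil &
      weak_derive 1 (fun x => (1 + eta x) * (v x - gam)) (cst 0) /\
      {ae mu, forall x,
        (1 + eta x) * (v x - gam) * v' x + v x - visc x
        + (1 + eta x) * (eta' x - capil x)
        + \sum_(j < l.+1) eta x ^+ j * (tau j x * eta' x + phi j x) = 0}].

Definition velocity (gam : R) (eta : R -> R) : R -> R :=
  fun x => gam * eta x / (1 + eta x).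

(* P^i eta belongs to the ball of radius eps of H^s and (v, eta) solves the
   system, where v = gamma eta / (1 + eta). As the symbol is smooth and at
   least 1, P^i eta in H^s forces eta in L^2. *)
Definition wave_in_ball (i : regime) (l s : nat) (eps : R) (x : data l s)
    (eta : R -> R) : Prop :=
  let: (p, tau, phi) := x in
  [/\ exists g : Hs R s, fourier_multiplier (symbol i p) eta g
        /\ (sobolev_norm s g < eps%:E)%E,
      {ae mu, forall y, 1 + eta y != 0} &
      traveling_wave p tau phi (velocity p.1.1 eta) eta].

(* [S] is a map into H^r x H^r, continuous on [U], whose value at each [x] in
   [U] is (the class of) [c x] times the pair (v, eta) for [x]. *)
Definition scaled_solution_map (l s r : nat) (U : set (data l s))
    (sol : data l s -> (R -> R) -> Prop) (c : data l s -> R)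
    (S : data l s -> Hs R r * Hs R r) : Prop :=
  {within U, continuous S} /\
  forall x eta, U x -> sol x eta ->
    {ae mu, forall y, (S x).1 y = c x * velocity x.1.1.1.1 eta y} /\
    {ae mu, forall y, (S x).2 y = c x * eta y}.

End ShallowWater.

(* Main.v *)
Require Import Defs.
From HB Require Import structures.
From mathcomp Require Import all_boot all_order all_algebra.
From mathcomp Require Import complex ring lra.
From mathcomp Require Import all_classical all_reals all_analysis measurable_realfun.
Set Implicit Arguments.
Unset Strict Implicit.
Unset Printing Implicit Defensive.
Import Order.TTheory GRing.Theory Num.Theory.
Import numFieldNormedType.Exports.
Local Open Scope classical_set_scope.
Local Open Scope ring_scope.

(* The derivation works with g = P eta. Everything is transported to the Fourier
   side by the Hartley transform, with kernel cos + sin: it is real, symmetric and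
   its own inverse on L^2 (the Plancherel identity follows from a Poisson kernel
   regularization), and h(xi), h(-xi) recover the Fourier transform. For s >= 1,
   H^s consists of continuous functions and is an algebra.

   Integrating the mass equation gives v = gamma eta / (1 + eta). Multiplied by
   (1 + eta)^2, the momentum equation becomes Lin g + Rem g = 0, where Lin is the
   multiplier of symbol
     (gamma + 16 pi^2 gamma mu^2 xi^2
       + 2 pi i xi (1 - gamma^2 + 4 pi^2 sigma^2 xi^2)) / p(xi)
   and Rem is quadratic in g up to the small data. In each of the three parameter
   regimes this symbol is bounded above and below, so that g |-> - Lin^-1 (Rem g)
   is a contraction of a small ball. All bounds are powers of a quantity depending
   continuously on (gamma, mu, sigma), which gives the open set; sequential
   continuity of the fixed point follows from that of the multipliers, which
   converge strongly (though not in norm) by dominated convergence. *)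

(** * The Lebesgue integral and L2 *)

(** The unknown [g] lives in one fixed space H^s although the order of the equation drops as mu or
    sigma tends to zero. The functions eta', mu^2 eta'' and sigma^2 eta''' are all controlled in H^s
    by [g], with constants locally uniform in the parameters, whereas eta'' alone may leave H^s.
    Hence second and third derivatives always appear with their factor mu^2 or sigma^2 attached,
    which also accounts for the three scales of regularity in the conclusion. Multiplying by (1 +
    eta)^2 clears the denominators of v and of its derivatives, so the remainder is polynomial in
    functions of H^s and the algebra property handles it. The delicate point of the linear theory is
    gamma > 1 with sigma nonzero: the odd part of the symbol then has a zero at a nonzero frequency,
    near which everything rests on the even part, whose numerator never falls below gamma. Since H^s
    consists of a.e. classes, the construction works with continuous representatives and returns to
    classes at the end. Each data point is probed through a countable family of neighbourhoods,
    which is why sequences decide continuity. *)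

Section LebesgueBasics.
Context {R : realType}.
Local Notation mu := (@lebesgue_measure R).
Implicit Types (f g h u : R -> R).

Definition aeq f g := {ae mu, forall x, f x = g x}.
Definition L1 f := mu.-integrable setT (EFin \o f).
(** The coercion that follows lets a proof of [L2 f] serve as a pair: [.1] is measurability and [.2]
    is square integrability. The same device recurs for [loc], [prim] and [Wt]. *)
Record L2 f : Prop := MkL2 { _ : measurable_fun setT f; _ : L1 (fun x => f x ^+ 2) }.
Coercion pair_of_L2 f (H : L2 f) := let: MkL2 m i := H in (m, i).
Definition ip f g := \int[mu]_x (f x * g x).
(* Sealed, here and below, so that conversion never unfolds it to the integral. *)
Fact n2_sig : {n : (R -> R) -> R | forall f, n f = Num.sqrt (\int[mu]_x (f x ^+ 2))}.
Proof. by eexists. Qed.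
Definition n2 := sval n2_sig.

Lemma n2E f : n2 f = Num.sqrt (\int[mu]_x (f x ^+ 2)).
Proof. exact: svalP n2_sig f. Qed.

Lemma aeqW f g : (forall x, f x = g x) -> aeq f g.
Proof. by move=> fg; exact: aeW. Qed.

Lemma ae_S (P Q : R -> Prop) : (forall x, P x -> Q x) ->
  {ae mu, forall x, P x} -> {ae mu, forall x, Q x}.
Proof. by move=> PQ; apply: (@filterS _ _ (ae_filter_ringOfSetsType mu)). Qed.

Lemma ae_S2 (P P' Q : R -> Prop) : (forall x, P x -> P' x -> Q x) ->
  {ae mu, forall x, P x} -> {ae mu, forall x, P' x} -> {ae mu, forall x, Q x}.
Proof. by move=> PQ; apply: (@filterS2 _ _ (ae_filter_ringOfSetsType mu)). Qed.

Lemma aeq_sym f g : aeq f g -> aeq g f.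
Proof. exact: ae_S. Qed.

Lemma aeq_trans f g h : aeq f g -> aeq g h -> aeq f h.
Proof. by apply: ae_S2 => x -> ->. Qed.

Lemma L1_meas f : L1 f -> measurable_fun setT f.
Proof. by move=> /measurable_int/measurable_EFinP. Qed.

Lemma L1D f g : L1 f -> L1 g -> L1 (fun x => f x + g x).
Proof. by move=> Lf Lg; exact: (integrableD measurableT Lf Lg). Qed.

Lemma L1Z k f : L1 f -> L1 (fun x => k * f x).
Proof. by move=> Lf; exact: (integrableZl measurableT k Lf). Qed.

Lemma eq_L1 f g : (forall x, f x = g x) -> L1 f -> L1 g.
Proof. by move=> /funext ->. Qed.

Lemma L1N f : L1 f -> L1 (fun x => - f x).
Proof. by move=> /(@L1Z (-1)); apply: eq_L1 => x; rewrite mulN1r. Qed.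

Lemma L1B f g : L1 f -> L1 g -> L1 (fun x => f x - g x).
Proof. by move=> Lf Lg; exact: L1D Lf (L1N Lg). Qed.

Lemma L1_norm f : L1 f -> L1 (fun x => `|f x|).
Proof. by move=> /(integrable_norm). Qed.

Lemma L1_le f g : measurable_fun setT f -> (forall x, `|f x| <= g x) ->
  L1 g -> L1 f.
Proof.
move=> mf fg; apply: le_integrable => //; first exact/measurable_EFinP.
by move=> x _; rewrite lee_fin (le_trans (fg x))// ler_norm.
Qed.

Lemma L1M_bd C f g : L1 f -> measurable_fun setT g -> (forall x, `|g x| <= C) ->
  L1 (fun x => f x * g x).
Proof.
move=> Lf mg gC; apply: (@L1_le _ (fun x => C * `|f x|)).
- by apply: measurable_funM => //; exact: L1_meas.
- by move=> x; rewrite normrM mulrC ler_wpM2r.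
- exact/L1Z/L1_norm.
Qed.

Lemma L10 : L1 (fun=> 0).
Proof. exact: integrable0. Qed.

Lemma intD f g : L1 f -> L1 g ->
  \int[mu]_x (f x + g x) = \int[mu]_x f x + \int[mu]_x g x.
Proof. exact: RintegralD. Qed.

Lemma intB f g : L1 f -> L1 g ->
  \int[mu]_x (f x - g x) = \int[mu]_x f x - \int[mu]_x g x.
Proof. exact: RintegralB. Qed.

Lemma intZ k f : L1 f -> \int[mu]_x (k * f x) = k * \int[mu]_x f x.
Proof. exact: RintegralZl. Qed.

Lemma eq_int f g : (forall x, f x = g x) -> \int[mu]_x f x = \int[mu]_x g x.
Proof. by move=> /funext ->. Qed.

Lemma int_le f g : L1 f -> L1 g -> (forall x, f x <= g x) ->
  \int[mu]_x f x <= \int[mu]_x g x.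
Proof. by move=> Lf Lg fg; apply: le_Rintegral. Qed.

Lemma int_ge0 f : (forall x, 0 <= f x) -> 0 <= \int[mu]_x f x.
Proof. by move=> f0; exact: Rintegral_ge0. Qed.

Lemma int_norm f : L1 f -> `|\int[mu]_x f x| <= \int[mu]_x `|f x|.
Proof. exact: le_normr_Rintegral. Qed.

Lemma EFin_int f : L1 f -> (\int[mu]_x (f x)%:E)%E = (\int[mu]_x f x)%:E.
Proof. by move=> Lf; rewrite fineK//; exact: (integrable_fin_num _ Lf). Qed.

Lemma ge0_L1P f : measurable_fun setT f -> (forall x, 0 <= f x) ->
  L1 f <-> (\int[mu]_x (f x)%:E < +oo)%E.
Proof.
move=> mf f0; have e : (\int[mu]_x `|(f x)%:E| = \int[mu]_x (f x)%:E)%E.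
  by apply: eq_integral => x _; rewrite gee0_abs// lee_fin.
split=> [/integrableP[_]|h]; rewrite ?e//.
by apply/integrableP; split; [exact/measurable_EFinP|rewrite e].
Qed.

Lemma L1_aeq f g : measurable_fun setT g -> aeq f g -> L1 f -> L1 g.
Proof.
move=> mg fg Lf; apply/integrableP; split; first exact/measurable_EFinP.
case/integrableP: (Lf) => _.
rewrite (@ae_eq_integral _ (measurableTypeR R) _ mu setT
  (fun x => `|(g x)%:E|%E) (fun x => `|(f x)%:E|%E))//.
- by apply/measurableT_comp/measurable_EFinP => //; exact: L1_meas.
- by apply/measurableT_comp/measurable_EFinP.
- by apply: ae_S fg => x /= ->.
Qed.

Lemma int_aeq f g : measurable_fun setT f -> measurable_fun setT g ->
  aeq f g -> \int[mu]_x f x = \int[mu]_x g x.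
Proof.
move=> mf mg fg; rewrite /Rintegral; congr fine; apply: ae_eq_integral => //.
- exact/measurable_EFinP.
- exact/measurable_EFinP.
- by apply: ae_S fg => x ->.
Qed.

Lemma int_eq0 f : L1 f -> (forall x, 0 <= f x) -> \int[mu]_x f x = 0 ->
  aeq f (fun=> 0).
Proof.
move=> Lf f0 i0.
have : (\int[mu]_x `|(f x)%:E| = 0)%E.
  under eq_integral do rewrite gee0_abs ?lee_fin//.
  by rewrite EFin_int// i0.
move/(ae_eq_integral_abs mu measurableT).
move=> /(_ _)/wrap[]; first by apply/measurable_EFinP; exact: L1_meas.
by apply: ae_S => x /(_ I) [].
Qed.

Lemma dct (F : nat -> R -> R) f g : (forall n, measurable_fun setT (F n)) ->
  measurable_fun setT f -> {ae mu, forall x, F ^~ x @ \oo --> f x} ->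
  L1 g -> (forall n x, `|F n x| <= g x) ->
  L1 f /\ (\int[mu]_x F n x @[n --> \oo] --> \int[mu]_x f x).
Proof.
move=> mF mf Ff Lg Fg.
have mF' n : measurable_fun setT (EFin \o F n) by exact/measurable_EFinP.
have mf' : measurable_fun setT (EFin \o f) by exact/measurable_EFinP.
have Ff' : {ae mu, forall x, setT x -> (fun n => (F n x)%:E) @ \oo --> (f x)%:E}.
  by apply: ae_S Ff => x h _; apply: cvg_EFin => //; exact: nearW.
have Fg' : {ae mu, forall x n, setT x -> (`|(F n x)%:E| <= (EFin \o g) x)%E}.
  by apply: aeW => x n _; rewrite lee_fin.
have [Lf _ cF] := @dominated_convergence _ (measurableTypeR R) R mu setT
  measurableT (fun n x => (F n x)%:E) _ _ mF' mf' Ff' Lg Fg'.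
split=> //; have LF n : L1 (F n) by exact: L1_le (Fg n) Lg.
have := cF; rewrite EFin_int// => /fine_cvgP[_].
apply: cvg_trans; apply: near_eq_cvg; exact: nearW.
Qed.

(** Fatou's lemma in a form that delivers integrability of the limit together with its bound. This
    is how functions obtained as pointwise limits are placed in L2. *)
Lemma fatouR (F : nat -> R -> R) f C : (forall n, L1 (F n)) ->
  (forall n x, 0 <= F n x) -> (forall x, 0 <= f x) ->
  measurable_fun setT f -> {ae mu, forall x, F ^~ x @ \oo --> f x} ->
  (\forall n \near \oo, \int[mu]_x F n x <= C) ->
  L1 f /\ \int[mu]_x f x <= C.
Proof.
move=> LF F0 f0 mf Ff FC.
have mF n : measurable_fun setT (fun x => (F n x)%:E).
  by apply/measurable_EFinP; exact: L1_meas.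
have e : (\int[mu]_x (f x)%:E = \int[mu]_x limn_einf (fun n => (F n x)%:E))%E.
  apply: ae_eq_integral => //; first exact/measurable_EFinP.
    apply: measurableT_comp; first exact: oppe_measurable.
    apply: measurable_fun_limn_esup => n.
    exact: (measurableT_comp (@oppe_measurable R setT) (mF n)).
  apply: ae_S Ff => x h _.
  have h' : (fun n => (F n x)%:E) @ \oo --> (f x)%:E.
    by apply: cvg_EFin => //; exact: nearW.
  by have [-> _] := cvg_limn_einf_sup h'.
have iC : (\int[mu]_x (f x)%:E <= C%:E)%E.
  rewrite e; apply: le_trans.
    by apply: fatou => // n x _; rewrite lee_fin.
  rewrite limn_einf_lim; apply: lime_le; first exact: is_cvg_einfs.
  near=> n; apply: (@le_trans _ _ (\int[mu]_x (F n x)%:E)%E).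
    by apply: ereal_inf_lbound; exists n => /=.
  by rewrite EFin_int// lee_fin; near: n.
have Lf : L1 f by apply/ge0_L1P => //; exact: le_lt_trans iC (ltry _).
by split=> //; move: iC; rewrite EFin_int.
Unshelve. all: by end_near. Qed.

Lemma L2_le f g : measurable_fun setT f -> (forall x, `|f x| <= g x) ->
  L2 g -> L2 f.
Proof.
move=> mf fg [mg Lg]; split=> //; apply: L1_le Lg => [|x].
  exact: measurable_funX.
by rewrite normrX ler_pXn2r ?nnegrE ?normr_ge0//; exact: le_trans (fg x).
Qed.

Lemma L2M f g : L2 f -> L2 g -> L1 (fun x => f x * g x).
Proof.
move=> [mf Lf] [mg Lg]; apply: L1_le (L1D Lf Lg) => [|x].
  exact: measurable_funM.
rewrite ler_norml; apply/andP; split; [have := sqr_ge0 (f x + g x)|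
  have := sqr_ge0 (f x - g x)]; have := sqr_ge0 (f x); have := sqr_ge0 (g x);
  by rewrite !expr2; nra.
Qed.

Lemma L2D f g : L2 f -> L2 g -> L2 (fun x => f x + g x).
Proof.
move=> Lf Lg; have [[mf Sf] [mg Sg]] := (Lf, Lg).
split; first exact: measurable_funD.
apply: eq_L1 (L1D (L1D Sf Sg) (L1Z 2 (L2M Lf Lg))) => x; ring.
Qed.

Lemma L2Z k f : L2 f -> L2 (fun x => k * f x).
Proof.
move=> [mf Lf]; split; first exact: measurable_funM.
by apply: eq_L1 (L1Z (k ^+ 2) Lf) => x; rewrite exprMn.
Qed.

Lemma eq_L2 f g : (forall x, f x = g x) -> L2 f -> L2 g.
Proof. by move=> /funext ->. Qed.

Lemma L2N f : L2 f -> L2 (fun x => - f x).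
Proof. by move=> /(L2Z (-1)); apply: eq_L2 => x; rewrite mulN1r. Qed.

Lemma L2B f g : L2 f -> L2 g -> L2 (fun x => f x - g x).
Proof. by move=> Lf Lg; exact: L2D Lf (L2N Lg). Qed.

Lemma L20 : L2 (fun=> 0).
Proof. by split => //; apply: eq_L1 L10 => x; rewrite expr0n. Qed.

Lemma L2M_bd C f g : L2 f -> measurable_fun setT g -> (forall x, `|g x| <= C) ->
  L2 (fun x => f x * g x).
Proof.
move=> [mf Lf] mg gC; split; first exact: measurable_funM.
apply: eq_L1 (@L1M_bd (C ^+ 2) _ (fun x => g x ^+ 2) Lf _ _).
- by move=> x; rewrite exprMn.
- exact: measurable_funX.
- by move=> x; rewrite normrX lerXn2r ?nnegrE ?(le_trans _ (gC x)).
Qed.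

Lemma L2_aeq f g : measurable_fun setT g -> aeq f g -> L2 f -> L2 g.
Proof.
move=> mg fg [mf Lf]; split => //; apply: L1_aeq Lf; first exact: measurable_funX.
by apply: ae_S fg => x ->.
Qed.

Lemma n2_ge0 f : 0 <= n2 f.
Proof. by rewrite n2E sqrtr_ge0. Qed.

Lemma n2sq f : n2 f ^+ 2 = \int[mu]_x (f x ^+ 2).
Proof. by rewrite n2E sqr_sqrtr// int_ge0// => x; exact: sqr_ge0. Qed.

Lemma eq_n2 f g : (forall x, f x = g x) -> n2 f = n2 g.
Proof. by move=> /funext ->. Qed.

Lemma n2Z k f : L2 f -> n2 (fun x => k * f x) = `|k| * n2 f.
Proof.
move=> [_ Lf]; rewrite !n2E -sqrtr_sqr -sqrtrM ?sqr_ge0// -intZ//.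
by congr Num.sqrt; apply: eq_int => x; rewrite exprMn.
Qed.

Lemma n2N f : n2 (fun x => - f x) = n2 f.
Proof. by rewrite !n2E; congr Num.sqrt; apply: eq_int => x; rewrite sqrrN. Qed.

Lemma n20 : n2 (fun=> 0) = 0.
Proof.
rewrite !n2E (_ : \int[mu]_x _ = 0) ?sqrtr0//.
by rewrite expr0n /Rintegral integral0.
Qed.

Lemma n2_aeq f g : measurable_fun setT f -> measurable_fun setT g ->
  aeq f g -> n2 f = n2 g.
Proof.
move=> mf mg fg; rewrite !n2E; congr Num.sqrt; apply: int_aeq.
- exact: measurable_funX.
- exact: measurable_funX.
- by apply: ae_S fg => x ->.
Qed.

Lemma n2_le f g : L2 f -> L2 g -> (forall x, `|f x| <= `|g x|) -> n2 f <= n2 g.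
Proof.
move=> [_ Lf] [_ Lg] fg; rewrite !n2E; apply: ler_wsqrtr; apply: int_le => // x.
by rewrite -real_normK ?num_real// -[leRHS]real_normK ?num_real// lerXn2r ?nnegrE.
Qed.

Lemma n2_eq0 f : L2 f -> n2 f = 0 -> aeq f (fun=> 0).
Proof.
move=> [mf Lf] f0; have := int_eq0 Lf (fun x => sqr_ge0 (f x)).
rewrite -n2sq f0 expr0n => /(_ erefl); apply: ae_S => x /eqP.
by rewrite sqrf_eq0 => /eqP.
Qed.

Lemma ipC f g : ip f g = ip g f.
Proof. by apply: eq_int => x; rewrite mulrC. Qed.

Lemma ip_aeq f f' g g' : measurable_fun setT f -> measurable_fun setT f' ->
  measurable_fun setT g -> measurable_fun setT g' ->
  aeq f f' -> aeq g g' -> ip f g = ip f' g'.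
Proof.
move=> mf mf' mg mg' ff gg; apply: int_aeq; [exact: measurable_funM..|].
by apply: ae_S2 ff gg => x -> ->.
Qed.

Lemma ipBl f g h : L2 f -> L2 g -> L2 h ->
  ip (fun x => f x - g x) h = ip f h - ip g h.
Proof.
move=> Lf Lg Lh; rewrite /ip -intB; [|exact: L2M..].
by apply: eq_int => x; rewrite mulrBl.
Qed.

Lemma n2D_sq f g : L2 f -> L2 g ->
  n2 (fun x => f x + g x) ^+ 2 = n2 f ^+ 2 + 2 * ip f g + n2 g ^+ 2.
Proof.
move=> Lf Lg; have [[_ Sf] [_ Sg]] := (Lf, Lg); rewrite !n2sq /ip.
rewrite -intZ; last exact: L2M.
rewrite -intD//; last by apply: L1Z; exact: L2M.
rewrite -intD//; last by apply: L1D => //; apply: L1Z; exact: L2M.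
by apply: eq_int => x; ring.
Qed.

(** Discriminant argument on the squared norm of [f + t g]. *)
Lemma cauchy_schwarz f g : L2 f -> L2 g -> `|ip f g| <= n2 f * n2 g.
Proof.
move=> Lf Lg.
have quad t : 0 <= n2 f ^+ 2 + 2 * (t * ip f g) + t ^+ 2 * n2 g ^+ 2.
  have -> : t ^+ 2 * n2 g ^+ 2 = n2 (fun x => t * g x) ^+ 2.
    by rewrite n2Z// exprMn real_normK ?num_real.
  rewrite (_ : t * ip f g = ip f (fun x => t * g x)).
    by rewrite -n2D_sq ?sqr_ge0//; exact: L2Z.
  by rewrite /ip -intZ; [apply: eq_int => x; ring|exact: L2M].
rewrite -(ler_pXn2r (n := 2))// ?nnegrE ?mulr_ge0 ?n2_ge0//.
rewrite real_normK ?num_real// exprMn.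
have := n2_ge0 g; rewrite le_eqVlt => /predU1P[g0|g0].
  move: quad; rewrite -g0 expr0n/= mulr0.
  have [->|b0] := eqVneq (ip f g) 0; first by rewrite expr0n.
  (* With [n2 g = 0] the quadratic is affine in [t]; at this [t] it would equal -1. *)
  move=> /(_ (- (n2 f ^+ 2 + 1) / (2 * ip f g))).
  rewrite (_ : 2 * _ = - (n2 f ^+ 2 + 1)); last by field.
  by rewrite mulr0; lra.
have := quad (- ip f g / n2 g ^+ 2).
have gn : n2 g != 0 by rewrite gt_eqF.
rewrite (_ : _ + _ = n2 f ^+ 2 - ip f g ^+ 2 / n2 g ^+ 2); last by field.
by rewrite subr_ge0 ler_pdivrMr// exprn_gt0.
Qed.

Lemma n2D f g : L2 f -> L2 g -> n2 (fun x => f x + g x) <= n2 f + n2 g.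
Proof.
move=> Lf Lg; rewrite -(ler_pXn2r (n := 2))// ?nnegrE ?addr_ge0 ?n2_ge0//.
rewrite n2D_sq//; have := cauchy_schwarz Lf Lg.
move=> /(le_trans (ler_norm _)); rewrite !expr2; nra.
Qed.

Lemma n2B f g : L2 f -> L2 g -> n2 (fun x => f x - g x) <= n2 f + n2 g.
Proof. by move=> Lf Lg; rewrite -(n2N g); apply: n2D => //; exact: L2N. Qed.

Lemma n2BC f g : n2 (fun x => f x - g x) = n2 (fun x => g x - f x).
Proof. by rewrite -n2N; apply: eq_n2 => x; rewrite opprB. Qed.

Lemma n2_tri g f h : L2 f -> L2 g -> L2 h ->
  n2 (fun x => f x - h x) <= n2 (fun x => f x - g x) + n2 (fun x => g x - h x).
Proof.
move=> Lf Lg Lh; apply: le_trans (n2D (L2B Lf Lg) (L2B Lg Lh)).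
by rewrite le_eqVlt; apply/orP; left; apply/eqP/eq_n2 => x; rewrite addrA subrK.
Qed.

Lemma n2_sum (F : nat -> R -> R) n : (forall i, L2 (F i)) ->
  L2 (fun x => \sum_(i < n) F i x) /\
  n2 (fun x => \sum_(i < n) F i x) <= \sum_(i < n) n2 (F i).
Proof.
move=> LF; elim: n => [|n [L IH]].
  have e : (fun x => \sum_(i < 0) F i x) = fun=> 0.
    by apply/funext => x; rewrite big_ord0.
  by rewrite e big_ord0 n20; split => //; exact: L20.
have e : (fun x => \sum_(i < n.+1) F i x) = fun x => \sum_(i < n) F i x + F n x.
  by apply/funext => x; rewrite big_ord_recr.
rewrite e big_ord_recr; split; first exact: L2D.
by apply: le_trans (n2D L (LF n)) _; rewrite lerD2r.
Qed.

Lemma L2_norm f : L2 f -> L2 (fun x => `|f x|).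
Proof.
move=> [mf Lf]; split; first exact: measurableT_comp.
by apply: eq_L1 Lf => x; rewrite real_normK ?num_real.
Qed.

Lemma n2_norm f : n2 (fun x => `|f x|) = n2 f.
Proof.
by rewrite !n2E; congr Num.sqrt; apply: eq_int => x; rewrite real_normK ?num_real.
Qed.

Lemma sum_geo2 (J : nat) : \sum_(j < J) 2 ^- j = 2 - 2 * 2 ^- J :> R.
Proof.
elim: J => [|J IH]; first by rewrite big_ord0 expr0 invr1; ring.
by rewrite big_ord_recr/= IH exprS; field; rewrite expf_neq0.
Qed.

(** By Minkowski the partial sums [g] of the absolute increments have norm at most the geometric sum
    2. Monotone convergence makes the limit of their squares integrable, hence a.e. finite, and the
    telescoping series of [v] converges absolutely there. *)
Lemma summable_cvg_ae (v : nat -> R -> R) : (forall n, L2 (v n)) ->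
  (forall j, n2 (fun x => v j.+1 x - v j x) <= 2 ^- j) ->
  {ae mu, forall x, cvgn (v ^~ x)}.
Proof.
move=> Lv vj; pose d (j : nat) (x : R) : R := `|v j.+1 x - v j x|.
have Ld j : L2 (d j) by apply: L2_norm; exact: L2B.
pose g (J : nat) (x : R) : R := \sum_(j < J) d j x.
have Lg J : L2 (g J) by have [] := @n2_sum d J Ld.
have ng J : n2 (g J) <= 2.
  have [_ /le_trans] := @n2_sum d J Ld; apply.
  have sJ : \sum_(i < J) n2 (d i) <= \sum_(i < J) 2 ^- i.
    by apply: ler_sum => j _; rewrite n2_norm.
  apply: le_trans sJ _; rewrite sum_geo2.
  have p : (0 : R) <= 2 ^- J by rewrite invr_ge0 exprn_ge0.
  by move: p; lra.
have g0 J x : 0 <= g J x by apply: sumr_ge0 => i _; exact: normr_ge0.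
have gS J x : g J x <= g J.+1 x by rewrite /g big_ord_recr lerDl normr_ge0.
have gnd x : nondecreasing_seq (g ^~ x) by apply/nondecreasing_seqP => J.
pose h J x := (g J x ^+ 2)%:E.
have mh J : measurable_fun setT (h J).
  by apply/measurable_EFinP/measurable_funX; case: (Lg J).
have h0 J x : setT x -> (0 <= h J x)%E by rewrite lee_fin sqr_ge0.
have hnd x : setT x -> nondecreasing_seq (h ^~ x).
  move=> _ i j ij; rewrite lee_fin lerXn2r ?nnegrE//; exact: gnd.
pose H x := limn (h ^~ x).
have cH x : h ^~ x @ \oo --> H x by apply: ereal_nondecreasing_is_cvgn; exact: hnd.
have iH : (\int[mu]_x H x <= 4%:E)%E.
  rewrite (monotone_convergence mu measurableT mh h0 hnd).
  apply: lime_le.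
    apply: ereal_nondecreasing_is_cvgn => i j ij; apply: ge0_le_integral => //;
      by [move=> x _; exact: h0|exact: mh|move=> x _; exact: hnd].
  apply: nearW => J; rewrite EFin_int; last by case: (Lg J).
  rewrite lee_fin -n2sq (_ : 4 = 2 ^+ 2 :> R); last by rewrite -natrX.
  by rewrite lerXn2r ?nnegrE ?n2_ge0.
have mH : measurable_fun setT H.
  by apply: (@emeasurable_fun_cvg _ (measurableTypeR R) R setT h) => // x _; exact: cH.
have H0 x : (0 <= H x)%E.
  by apply: lime_ge; [exact: cH|apply: nearW => J; exact: h0].
have LH : mu.-integrable setT H.
  apply/integrableP; split => //; under eq_integral do rewrite gee0_abs//.
  exact: le_lt_trans iH (ltry _).
have := integrable_ae measurableT LH; apply: ae_S => x /(_ I) Hx.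
have gB J : g J x <= 1 + fine (H x).
  have : (h J x <= H x)%E.
    by apply: lime_ge; [exact: cH|exists J => // m Jm; exact: hnd].
  by rewrite -(fineK Hx) lee_fin; have := g0 J x; have := sqr_ge0 (g J x - 1); rewrite !expr2; nra.
have cd : cvgn (series (d ^~ x)).
  rewrite seriesEord; apply: nondecreasing_is_cvgn; first exact: gnd.
  by exists (1 + fine (H x)) => _ [J _ <-]; exact: gB.
have cs : cvgn (series (telescope (v ^~ x))) by exact: normed_cvg.
have -> : v ^~ x = (fun n => v 0%N x + series (telescope (v ^~ x)) n).
  by apply/funext => n; rewrite -eq_sum_telescope.
by apply: is_cvgD => //; exact: is_cvg_cst.
Qed.

(** A rapidly Cauchy subsequence converges a.e.; Fatou along that subsequence then bounds the
    distance from every late [u n] to its limit. *)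
Lemma riesz_fischer (u : nat -> R -> R) : (forall n, L2 (u n)) ->
  (forall e, 0 < e -> exists N, forall n m, (N <= n)%N -> (N <= m)%N ->
     n2 (fun x => u n x - u m x) <= e) ->
  exists2 f, L2 f & n2 (fun x => u n x - f x) @[n --> \oo] --> 0.
Proof.
move=> Lu Cu.
have pw j : (0 : R) < 2 ^- j by rewrite invr_gt0 exprn_gt0.
pose k0 j := projT1 (cid (Cu _ (pw j))).
have k0P j n m : (k0 j <= n)%N -> (k0 j <= m)%N ->
  n2 (fun x => u n x - u m x) <= 2 ^- j.
  by move: n m; exact: (projT2 (cid (Cu _ (pw j)))).
(* The maximum puts both [k j] and [k j.+1] beyond the threshold [k0 j]; the summand [j] makes the
   indices tend to infinity. *)
pose k j := (j + \max_(i < j.+1) k0 i)%N.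
have kk0 i j : (i <= j)%N -> (k0 i <= k j)%N.
  move=> ij; apply: leq_trans (leq_addl _ _).
  exact: (@leq_bigmax _ (fun i : 'I_j.+1 => k0 i) (Ordinal (ij : (i < j.+1)%N))).
pose v j := u (k j).
have Lv j : L2 (v j) by exact: Lu.
have vj j : n2 (fun x => v j.+1 x - v j x) <= 2 ^- j by apply: k0P; exact: kk0.
(* An upper limit is measurable everywhere, including where the subsequence diverges. *)
pose f x := fine (limn_esup (fun j => (v j x)%:E)).
have mf : measurable_fun setT f.
  apply: measurableT_comp => //; apply: measurable_fun_limn_esup => j.
  by apply/measurable_EFinP; case: (Lv j).
have vf : {ae mu, forall x, v ^~ x @ \oo --> f x}.
  apply: ae_S (summable_cvg_ae Lv vj) => x /cvg_ex[l vl].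
  have vl' : (fun j => (v j x)%:E) @ \oo --> l%:E.
    by apply: cvg_EFin => //; exact: nearW.
  by have [_ e] := cvg_limn_einf_sup vl'; rewrite /f e.
have main e : 0 < e -> exists N, forall n, (N <= n)%N ->
    L2 (fun x => u n x - f x) /\ n2 (fun x => u n x - f x) <= e.
  move=> e0; have [N NP] := Cu _ e0; exists N => n Nn.
  have mD : measurable_fun setT (fun x => u n x - f x).
    by apply: measurable_funB => //; case: (Lu n).
  have [] := @fatouR (fun j x => (u n x - v j x) ^+ 2)
      (fun x => (u n x - f x) ^+ 2) (e ^+ 2).
  - by move=> j; case: (L2B (Lu n) (Lv j)).
  - by move=> j x; exact: sqr_ge0.
  - by move=> x; exact: sqr_ge0.
  - exact: measurable_funX.
  - apply: ae_S vf => x vfx.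
    have c : (fun j => u n x - v j x) @ \oo --> u n x - f x.
      by apply: cvgB vfx; exact: cvg_cst.
    exact: (cvgM c c).
  - near=> j; rewrite -n2sq lerXn2r ?nnegrE ?n2_ge0 ?(ltW e0)//.
    apply: NP => //; apply: leq_trans (leq_addr _ _); near: j.
    exact: nbhs_infty_ge.
  - move=> Lf le_e; split => //; rewrite -(ler_pXn2r (n := 2))// ?nnegrE ?n2_ge0 ?(ltW e0)//.
    by rewrite n2sq.
exists f.
  have [N /(_ N (leqnn _))[LN _]] := main 1 ltr01.
  by apply: eq_L2 (L2B (Lu N) LN) => x; rewrite opprB addrC subrK.
apply/cvgrPdist_le => e e0; have [N NP] := main e e0; near=> n.
rewrite sub0r normrN ger0_norm ?n2_ge0//; apply: (NP n _).2.
by near: n; exact: nbhs_infty_ge.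
Unshelve. all: by end_near. Qed.

(** Lebesgue measure is its own image under [x |-> - x]. In later names [refl] likewise stands for
    this reflection. *)
Lemma ge0_int_refl (f : R -> \bar R) : measurable_fun setT f ->
  (forall x, (0 <= f x)%E) -> (\int[mu]_x f x = \int[mu]_x f (- x)%R)%E.
Proof.
move=> mf f0.
transitivity (\int[pushforward mu (-%R : _ -> measurableTypeR R)]_x f x)%E.
  by apply: eq_measure_integral => A mA _; exact/esym/lebesgue_measureN.
by rewrite ge0_integral_pushforward//; apply: eq_integral.
Qed.

Lemma L1_refl f : L1 f -> L1 (fun x => f (- x)).
Proof.
move=> Lf; have mf := L1_meas Lf; case/integrableP: Lf => _ Lf.
have mr : measurable_fun setT (fun x : R => f (- x)).
  by apply: measurableT_comp => //; exact: oppr_measurable.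
apply/integrableP; split; first exact/measurable_EFinP.
rewrite (_ : (\int[mu]_x _)%E = (\int[mu]_x `|(f x)%:E|)%E)//.
rewrite [RHS]ge0_int_refl// => x; apply: measurableT_comp => //; exact/measurable_EFinP.
Qed.

Lemma int_refl f : L1 f -> \int[mu]_x f (- x) = \int[mu]_x f x.
Proof.
move=> Lf; have mf := L1_meas Lf.
have Lp : L1 (fun x => Num.max (f x) 0).
  apply: L1_le (L1_norm Lf); first exact: measurable_maxr.
  by move=> x; rewrite ger0_norm ?le_max ?lexx ?orbT// ge_max normr_ge0 ler_norm.
have Ln : L1 (fun x => Num.max (- f x) 0).
  apply: L1_le (L1_norm Lf); first by apply: measurable_maxr => //; exact: measurable_funN.
  by move=> x; rewrite ger0_norm ?le_max ?lexx ?orbT// ge_max normr_ge0 lerNl lerNnormlW.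
have e x : f x = Num.max (f x) 0 - Num.max (- f x) 0.
  case: (leP (f x) 0) => h; case: (leP (- f x) 0) => h'; lra.
have g0 (g : R -> R) : L1 g -> (forall x, 0 <= g x) -> \int[mu]_x g (- x) = \int[mu]_x g x.
  move=> Lg g0; rewrite /Rintegral; congr fine; apply/esym.
  rewrite ge0_int_refl//; first by apply/measurable_EFinP; exact: L1_meas.
rewrite (eq_int e) (@eq_int (fun x => f (- x)) _ (fun x => e (- x))) !intB//.
- by congr (_ - _); [apply: (g0 _ Lp)|apply: (g0 _ Ln)] => x; rewrite le_max lexx orbT.
- exact: (L1_refl Lp).
- exact: (L1_refl Ln).
Qed.

Lemma L2_refl f : L2 f -> L2 (fun x => f (- x)).
Proof.
move=> [mf Lf]; split; first by apply: measurableT_comp => //; exact: oppr_measurable.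
exact: (L1_refl Lf).
Qed.

Lemma n2_refl f : L2 f -> n2 (fun x => f (- x)) = n2 f.
Proof. by move=> [_ Lf]; rewrite !n2E (int_refl Lf). Qed.

End LebesgueBasics.

(** * Fubini for bounded kernels, indicators of intervals, local integrability *)

Section Fubini.
Context {R : realType}.
Local Notation mu := (@lebesgue_measure R).
Implicit Types (f g h u w : R -> R) (k : R -> R -> R).

Definition meas2 k := measurable_fun setT (fun z : R * R => k z.1 z.2).

Lemma meas2_section k x : meas2 k -> measurable_fun setT (k x).
Proof.
move=> mk; have := measurableT_comp mk (pair1_measurable x).
by [].
Qed.

Lemma meas2_sectionr k y : meas2 k -> measurable_fun setT (k ^~ y).
Proof.
move=> mk; have := measurableT_comp mk (pair2_measurable y).
by [].
Qed.

Lemma meas2_fst f : measurable_fun setT f -> meas2 (fun x _ => f x).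
Proof. by move=> mf; exact: measurableT_comp. Qed.

Lemma meas2_snd f : measurable_fun setT f -> meas2 (fun _ y => f y).
Proof. by move=> mf; exact: measurableT_comp. Qed.

Lemma meas2M k k' : meas2 k -> meas2 k' -> meas2 (fun x y => k x y * k' x y).
Proof. exact: measurable_funM. Qed.

Lemma meas2B k k' : meas2 k -> meas2 k' -> meas2 (fun x y => k x y - k' x y).
Proof. exact: measurable_funB. Qed.

Lemma meas2_comp f k : measurable_fun setT f -> meas2 k -> meas2 (fun x y => f (k x y)).
Proof. exact: measurableT_comp. Qed.

(** The kernel is bounded, so absolute integrability on the product reduces to that of [u] and [w]
    separately. The Hartley kernel, the Poisson kernel and the indicator of [y <= x] all enter
    through this form. *)
Lemma swap C k u w : L1 u -> L1 w -> meas2 k -> (forall x y, `|k x y| <= C) ->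
  L1 (fun x => u x * \int[mu]_y (w y * k x y)) /\
  \int[mu]_x (u x * \int[mu]_y (w y * k x y)) =
  \int[mu]_y (w y * \int[mu]_x (u x * k x y)).
Proof.
move=> Lu Lw mk kC.
have Lwk x : L1 (fun y => w y * k x y) by apply: L1M_bd (kC x) => //; exact: meas2_section.
have Luk y : L1 (fun x => u x * k x y) by apply: L1M_bd (kC^~ y) => //; exact: meas2_sectionr.
pose f (z : R * R) := (u z.1 * (w z.2 * k z.1 z.2))%:E.
have mf : measurable_fun setT f.
  apply/measurable_EFinP/measurable_funM.
    by apply: measurableT_comp => //; exact: L1_meas.
  by apply: measurable_funM => //; apply: measurableT_comp => //; exact: L1_meas.
have C0 : 0 <= C by apply: le_trans (kC 0 0).
have Lf : (mu \x mu)%E.-integrable setT f.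
  apply/integrable12ltyP => //.
  have b x : (\int[mu]_y `|f (x, y)| <= (`|u x| * (C * \int[mu]_y `|w y|))%:E)%E.
    have L := L1_norm (L1Z (u x) (Lwk x)).
    rewrite (_ : (\int[mu]_y _)%E = (\int[mu]_y `|u x * (w y * k x y)|)%:E); last first.
      by rewrite -EFin_int.
    rewrite lee_fin -(intZ C (L1_norm Lw)) -(intZ _ (L1Z C (L1_norm Lw))).
    apply: int_le => //; first exact: (L1Z _ (L1Z C (L1_norm Lw))).
    by move=> y; rewrite !normrM ler_wpM2l// mulrC ler_wpM2r.
  apply: (@le_lt_trans _ _ (\int[mu]_x (`|u x| * (C * \int[mu]_y `|w y|))%:E)%E).
    apply: ge0_le_integral => //.
    - by move=> x _; apply: integral_ge0.
    - have mF := @measurable_fun_fubini_tonelli_F _ _ (measurableTypeR R)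
        (measurableTypeR R) R mu (fun z => `|f z|%E).
      by apply: mF => //; exact: measurableT_comp.
    - apply/measurable_EFinP/measurable_funM => //.
      by apply: measurableT_comp => //; exact: L1_meas.
  have L : L1 (fun x => `|u x| * (C * \int[mu]_y `|w y|)).
    by apply: eq_L1 (L1Z (C * \int[mu]_y `|w y|) (L1_norm Lu)) => x; rewrite mulrC.
  by rewrite EFin_int// ltry.
have FE : fubini_F mu f = EFin \o (fun x => u x * \int[mu]_y (w y * k x y)).
  apply/funext => x; rewrite /fubini_F /f /= -intZ// EFin_int//; exact: L1Z.
have GE : fubini_G mu f = EFin \o (fun y => w y * \int[mu]_x (u x * k x y)).
  apply/funext => y; rewrite /fubini_G /f /= -intZ// -EFin_int.
    by apply: eq_integral => x _; congr EFin; ring.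
  exact: L1Z.
have L := integrable_fubini_F Lf; split; first by rewrite /L1 -FE.
have e := etrans (integral12_prod_meas1 Lf) (esym (integral21_prod_meas1 Lf)).
apply: (congr1 fine).
transitivity (\int[mu]_x fubini_F mu f x)%E.
  by apply: eq_integral => x _; have /= -> := congr1 (@^~ x) FE.
rewrite [LHS]e; apply: eq_integral => y _.
exact: (congr1 (@^~ y) GE).
Qed.

(** Fubini needs an integrable weight in [x]: a Gaussian is inserted, measurability is read off the
    integrability given by [swap], and the Gaussian, being positive, is divided out. *)
Lemma meas_int C k w : L1 w -> meas2 k -> (forall x y, `|k x y| <= C) ->
  measurable_fun setT (fun x => \int[mu]_y (w y * k x y)).
Proof.
move=> Lw mk kC; have [L _] := @swap C k gauss_fun w (@integrableT_gauss R) Lw mk kC.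
have e : (fun x => \int[mu]_y (w y * k x y)) =
  fun x => expR (x ^+ 2) * (gauss_fun x * \int[mu]_y (w y * k x y)).
  by apply/funext => x; rewrite mulrA /gauss_fun expRN divff ?mul1r// gt_eqF ?expR_gt0.
rewrite e; apply: measurable_funM; last exact: L1_meas.
by apply: measurableT_comp => //; exact: exprn_measurable.
Qed.

(* Both truncations to [-n, n] and to arbitrary bounded intervals are integrals of
   products with indicator functions. *)
Definition ind (a b : R) (x : R) : R := (x \in `[a, b])%:R.

Lemma indE a b x : ind a b x = \1_(`[a, b]%classic) x.
Proof. by rewrite /ind indicE mem_setE. Qed.

Lemma meas_ind a b : measurable_fun setT (ind a b).
Proof.
rewrite (_ : ind a b = \1_(`[a, b]%classic)); first exact: measurable_indic.
by apply/funext => x; exact: indE.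
Qed.

Lemma L1_ind a b : L1 (ind a b).
Proof. by apply: eq_L1 (integrable_indic_itv a b true false) => x; rewrite indE. Qed.

Lemma ind01 a b x : 0 <= ind a b x <= 1.
Proof. by rewrite /ind; case: (_ \in _); rewrite ?lexx ler01. Qed.

Lemma ind_norm a b x : `|ind a b x| <= 1.
Proof. by rewrite ger0_norm; case/andP: (ind01 a b x). Qed.

Lemma ind_sqr a b x : ind a b x ^+ 2 = ind a b x.
Proof. by rewrite /ind; case: (_ \in _); rewrite ?expr0n ?expr1n. Qed.

Lemma L2_ind a b : L2 (ind a b).
Proof.
split; first exact: meas_ind.
by apply: eq_L1 (L1_ind a b) => x; rewrite ind_sqr.
Qed.

Lemma int_itv f a b : \int[mu]_(x in `[a, b]) f x = \int[mu]_x (f x * ind a b x).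
Proof.
rewrite Rintegral_mkcond; apply: eq_int => x; rewrite patchE indE indicE.
by case: (_ \in _); rewrite ?mulr1 ?mulr0.
Qed.

(** Equivalent to [locally_integrable setT] by [loc_locint] and [locint_loc]. Products with
    indicators keep all integrals on the whole line, where the calculus of [L1] applies. *)
Record loc f : Prop :=
  MkLoc { _ : measurable_fun setT f; _ : forall a b, L1 (fun x => f x * ind a b x) }.
Coercion pair_of_loc f (H : loc f) := let: MkLoc m i := H in (m, i).

Lemma L1_itv f a b : measurable_fun setT f ->
  L1 (fun x => f x * ind a b x) <-> mu.-integrable `[a, b] (EFin \o f).
Proof.
move=> mf; have -> : (fun x => f x * ind a b x) = f \_ `[a, b].
  by apply/funext => x; rewrite patchE indE indicE; case: (_ \in _); rewrite ?mulr1 ?mulr0.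
by rewrite /L1 -restrict_EFin; apply: iff_sym; exact: integrable_mkcond.
Qed.

Lemma L1_loc f : L1 f -> loc f.
Proof.
move=> Lf; split; first exact: L1_meas.
by move=> a b; exact: L1M_bd Lf (meas_ind a b) (ind_norm a b).
Qed.

Lemma L2_loc f : L2 f -> loc f.
Proof. by move=> Lf; split; [case: Lf|move=> a b; exact: L2M (L2_ind a b)]. Qed.

Lemma cont_loc f : continuous f -> loc f.
Proof.
move=> cf; have mf := continuous_measurable_fun cf; split=> // a b.
apply/L1_itv => //; apply: continuous_compact_integrable; first exact: segment_compact.
exact: continuous_subspaceT.
Qed.

Lemma locD f g : loc f -> loc g -> loc (fun x => f x + g x).
Proof.
move=> [mf Lf] [mg Lg]; split; first exact: measurable_funD.
by move=> a b; apply: eq_L1 (L1D (Lf a b) (Lg a b)) => x; rewrite mulrDl.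
Qed.

Lemma locZ c f : loc f -> loc (fun x => c * f x).
Proof.
move=> [mf Lf]; split; first exact: measurable_funM.
by move=> a b; apply: eq_L1 (L1Z c (Lf a b)) => x; rewrite mulrA.
Qed.

Lemma locB f g : loc f -> loc g -> loc (fun x => f x - g x).
Proof.
move=> Lf /(locZ (-1)) Lg; have [m L] := locD Lf Lg.
by rewrite (_ : (fun x => f x - g x) = fun x => f x + -1 * g x)//;
  apply/funext => x; rewrite mulN1r.
Qed.

Lemma loc_locint f : loc f -> locally_integrable setT f.
Proof.
move=> [mf Lf]; split => //; first exact: openT.
move=> K _ cK.
have [M [_ /(_ (`|M| + 1)) MK]] := compact_bounded cK.
have {}MK x : K x -> `|x| <= `|M| + 1.
  by apply: MK; rewrite (le_lt_trans (ler_norm _))// ltrDl.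
have mK := compact_measurable cK.
have /(L1_itv _ _ mf)/integrableP[mf' Li] := Lf (- (`|M| + 1)) (`|M| + 1).
apply: le_lt_trans Li; apply: ge0_subset_integral => //.
- exact: (measurableT_comp (@abse_measurable R setT) mf').
- by move=> x /MK; rewrite /= in_itv/= ler_norml.
Qed.

Lemma locint_loc f : locally_integrable setT f -> loc f.
Proof.
move=> [mf _ Lf]; split => // a b; apply/L1_itv => //.
apply/integrableP; split; last by apply: Lf => //; exact: segment_compact.
by apply/measurable_EFinP; exact: measurable_funTS.
Qed.

(** Lebesgue differentiation: the primitive of [f] from [-n] vanishes identically, so its
    derivative, which is [f] almost everywhere, is zero to the right of [-n]. Countably many [n]
    exhaust the line. *)
Lemma int_itv0_aeq f : loc f -> (forall a b, a < b -> \int[mu]_x (f x * ind a b x) = 0) ->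
  aeq f (fun=> 0).
Proof.
move=> Lf f0; have [mf Li] := Lf.
suff main (n : nat) : {ae mu, forall x, ((- n%:R)%:E < x%:E)%E -> f x = 0}.
  have /ae_foralln : forall n : nat, {ae mu, forall x, ((- n%:R)%:E < x%:E)%E -> f x = 0} by [].
  apply: ae_S => x /(_ (Num.Def.truncn `|x|).+1); apply; rewrite lte_fin ltrNl.
  by apply: le_lt_trans (truncnS_gt `|x|); rewrite -normrN ler_norm.
have h := @FTC1 R f (BLeft (- n%:R)) _ (loc_locint Lf).
have {h} := h (fun y => (L1_itv _ _ mf).1 (Li _ _)).
apply: ae_S => x h nx; have {h} := h nx; set F := fun _ => _.
have -> : F = fun=> 0.
  apply/funext => y; rewrite /F int_itv; have [ny|ny] := ltP (- n%:R) y; first exact: f0.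
  move: ny; rewrite le_eqVlt => /predU1P[->|ny].
    by rewrite -int_itv set_itv1 Rintegral_set1.
  rewrite (@eq_int _ _ (fun=> 0)) ?/Rintegral ?integral0// => z.
  rewrite /ind in_itv/= (_ : (_ <= _ <= _) = false) ?mulr0//.
  by apply/negP => /andP[a b]; have := lt_le_trans (lt_le_trans ny a) b; rewrite ltxx.
by move=> [_ <-]; rewrite derive1_cst.
Qed.

Lemma ip_ind_aeq f g : L2 f -> L2 g -> (forall a b, a < b ->
  ip f (ind a b) = ip g (ind a b)) -> aeq f g.
Proof.
move=> Lf Lg fg; have L := L2B Lf Lg.
have := int_itv0_aeq (L2_loc L); have h a b : a < b -> \int[mu]_x ((f x - g x) * ind a b x) = 0.
  by move=> /fg e; have := ipBl Lf Lg (L2_ind a b); rewrite e subrr.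
by move=> /(_ h); apply: ae_S => x /subr0_eq.
Qed.

Lemma ind_cvg (x : R) : (fun n : nat => ind (- n%:R) n%:R x) @ \oo --> (1 : R).
Proof.
apply: cvg_near_cst; near=> n; apply/eqP; rewrite /ind in_itv/= -ler_norml.
rewrite (_ : _ <= _)//; apply: (@le_trans _ _ (Num.Def.truncn `|x|).+1%:R).
  by apply/ltW; rewrite truncnS_gt.
by rewrite ler_nat; near: n; exact: nbhs_infty_ge.
Unshelve. all: by end_near. Qed.

Lemma int_trunc_cvg f : L1 f ->
  (fun n : nat => \int[mu]_x (f x * ind (- n%:R) n%:R x)) @ \oo --> \int[mu]_x f x.
Proof.
move=> Lf; have mf := L1_meas Lf.
have [|||_ //] := @dct _ (fun n x => f x * ind (- n%:R) n%:R x) f _ _ mf _ (L1_norm Lf).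
- by move=> n; apply: measurable_funM => //; exact: meas_ind.
- apply: aeW => x; rewrite -[X in _ --> X]mulr1; apply: cvgM; [exact: cvg_cst|exact: ind_cvg].
- by move=> n x; rewrite normrM ler_piMr ?ind_norm.
Qed.

Lemma n2_trunc_cvg f : L2 f ->
  n2 (fun x => f x - f x * ind (- n%:R) n%:R x) @[n --> \oo] --> 0.
Proof.
move=> [mf Lf]; under eq_fun do rewrite n2E.
have <- : Num.sqrt 0 = 0 :> R by exact: sqrtr0.
apply: continuous_cvg; first exact: sqrt_continuous.
have z : \int[mu]_x (fun=> 0 : R) x = 0 by rewrite /Rintegral integral0.
rewrite -z; have mi n : measurable_fun setT (fun x => f x - f x * ind (- n%:R) n%:R x).
  by apply: measurable_funB => //; apply: measurable_funM => //; exact: meas_ind.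
have [||||_ //] := @dct _ (fun n x => (f x - f x * ind (- n%:R) n%:R x) ^+ 2) (fun=> 0) _ _ _ _ Lf.
- by move=> n; exact: measurable_funX.
- exact: measurable_cst.
- apply: aeW => x; have c : (fun n : nat => f x - f x * ind (- n%:R) n%:R x) @ \oo --> (0 : R).
    rewrite -[X in _ --> X](subrr (f x)); apply: cvgB; first exact: cvg_cst.
    by rewrite -[X in _ --> X]mulr1; apply: cvgM; [exact: cvg_cst|exact: ind_cvg].
  by rewrite -[X in _ --> X](mulr0 0); exact: (cvgM c c).
- move=> n x; rewrite -{1}[f x]mulr1 -mulrBr exprMn ger0_norm; last by apply: mulr_ge0; exact: sqr_ge0.
  by rewrite ler_piMr ?sqr_ge0//; case/andP: (ind01 (- n%:R) n%:R x); rewrite !expr2; nra.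
Qed.

Lemma ind_split f a b c : loc f -> a <= b -> b <= c ->
  \int[mu]_x (f x * ind a c x) =
  \int[mu]_x (f x * ind a b x) + \int[mu]_x (f x * ind b c x).
Proof.
move=> Lf ab bc; have [mf Li] := Lf; rewrite -!int_itv.
have iac : mu.-integrable `[a, c] (EFin \o f) by exact/L1_itv.
have := @Rintegral_itvB R f (BLeft a) (BRight c) b iac; rewrite !bnd_simp => /(_ ab bc).
rewrite [in RHS]Rintegral_itv_obnd_cbnd => [<-|]; first by rewrite addrC subrK.
by apply: integrableS iac => //; apply: subset_itvr; rewrite bnd_simp.
Qed.

Lemma ftc2 (F f : R -> R) a b : a <= b -> (forall x : R, is_derive x 1 F (f x)) ->
  continuous f -> \int[mu]_x (f x * ind a b x) = F b - F a.
Proof.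
rewrite le_eqVlt => /predU1P[->|ab] dF cf; rewrite -int_itv.
  by rewrite set_itv1 Rintegral_set1 subrr.
have cF : continuous F.
  by move=> x; apply: differentiable_continuous; apply/derivable1_diffP; exact: ex_derive.
rewrite /Rintegral (@continuous_FTC2 _ f F a b)//.
- exact: continuous_subspaceT.
- split; first by move=> x _; exact: ex_derive.
  + by apply: cvg_at_right_filter; exact: cF.
  + by apply: cvg_at_left_filter; exact: cF.
- by move=> x _; rewrite derive1E; exact: derive_val.
Qed.

Lemma cvg0_le (a b : nat -> R) : (forall n, 0 <= a n <= b n) ->
  b n @[n --> \oo] --> 0 -> a n @[n --> \oo] --> 0.
Proof.
move=> ab b0; apply/cvgrPdist_le => e e0.
have /cvgrPdist_le/(_ e e0) := b0; apply: filterS => n; rewrite !sub0r !normrN.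
have /andP[a0 /[dup] anb /(le_trans a0) bn0] := ab n.
by rewrite !ger0_norm//; exact: le_trans.
Qed.

Lemma cvg0D (a b : nat -> R) : a @ \oo --> (0 : R) -> b @ \oo --> (0 : R) ->
  (fun n => a n + b n) @ \oo --> (0 : R).
Proof. by move=> a0 b0; rewrite -[X in _ --> X](addr0 (0 : R)); exact: cvgD a0 b0. Qed.

Lemma cvg0Z (c : R) (a : nat -> R) : a @ \oo --> (0 : R) -> (fun n => c * a n) @ \oo --> (0 : R).
Proof.
by move=> a0; rewrite -[X in _ --> X](mulr0 c); apply: cvgM a0; exact: cvg_cst.
Qed.

End Fubini.

(** * The Hartley transform *)

Section Hartley.
Context {R : realType}.
Local Notation mu := (@lebesgue_measure R).
Implicit Types (f g h u w : R -> R) (a b c d x y e xi : R).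

Definition cas x : R := cos x + sin x.

Lemma cas_bd x : `|cas x| <= 2.
Proof.
rewrite (le_trans (ler_normD _ _))// (_ : 2 = 1 + 1)//.
by rewrite lerD ?cos_max ?sin_max.
Qed.

Lemma casM x y : cas x * cas y = cos (x - y) + sin (x + y).
Proof. by rewrite /cas cosB sinD; ring. Qed.

Lemma cont_cas : continuous cas.
Proof. by move=> x; apply: cvgD; [exact: continuous_cos|exact: continuous_sin]. Qed.

Lemma meas_cas : measurable_fun setT cas.
Proof. exact: continuous_measurable_fun cont_cas. Qed.

Definition kH x xi := cas (2 * pi * x * xi).

Lemma kHC x xi : kH x xi = kH xi x.
Proof. by rewrite /kH mulrAC. Qed.

Lemma kH_bd x xi : `|kH x xi| <= 2.
Proof. exact: cas_bd. Qed.

Lemma kH_meas2 : meas2 kH.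
Proof.
apply: meas2_comp meas_cas _; apply: meas2M; last exact: meas2_snd.
by apply: meas2_fst; exact: measurable_funM.
Qed.

Lemma meas_kH x : measurable_fun setT (kH x).
Proof. exact: meas2_section kH_meas2. Qed.

Lemma meas_kHr x : measurable_fun setT (kH ^~ x).
Proof. exact: meas2_sectionr kH_meas2. Qed.

Fact H1_sig : {H : (R -> R) -> R -> R | forall f xi, H f xi = \int[mu]_x (f x * kH x xi)}.
Proof. by eexists. Qed.
Definition H1 := sval H1_sig.

Lemma H1E0 f xi : H1 f xi = \int[mu]_x (f x * kH x xi).
Proof. exact: svalP H1_sig f xi. Qed.

Lemma H1E f xi : H1 f xi = \int[mu]_x (f x * kH xi x).
Proof. by rewrite H1E0; apply: eq_int => x; rewrite kHC. Qed.

Lemma H1_meas f : L1 f -> measurable_fun setT (H1 f).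
Proof.
move=> Lf; rewrite (_ : H1 f = fun xi => \int[mu]_x (f x * kH xi x)).
  exact: meas_int Lf kH_meas2 kH_bd.
by apply/funext => xi; exact: H1E.
Qed.

Lemma L1_kH f xi : L1 f -> L1 (fun x => f x * kH x xi).
Proof. by move=> Lf; apply: L1M_bd Lf (meas_kHr xi) (kH_bd^~ xi). Qed.

Lemma H1_bd f xi : L1 f -> `|H1 f xi| <= 2 * \int[mu]_x `|f x|.
Proof.
move=> Lf; rewrite H1E0; apply: le_trans (int_norm (L1_kH xi Lf)) _.
rewrite -intZ; last exact: L1_norm.
apply: int_le; [exact/L1_norm/L1_kH|exact/L1Z/L1_norm|].
by move=> x; rewrite normrM mulrC ler_wpM2r ?kH_bd.
Qed.

Lemma H1B f g xi : L1 f -> L1 g -> H1 (fun x => f x - g x) xi = H1 f xi - H1 g xi.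
Proof.
move=> Lf Lg; rewrite !H1E0 -intB; [|exact: L1_kH..].
by apply: eq_int => x; rewrite mulrBl.
Qed.

Lemma H1D f g xi : L1 f -> L1 g -> H1 (fun x => f x + g x) xi = H1 f xi + H1 g xi.
Proof.
move=> Lf Lg; rewrite !H1E0 -intD; [|exact: L1_kH..].
by apply: eq_int => x; rewrite mulrDl.
Qed.

Lemma H1Z k f xi : L1 f -> H1 (fun x => k * f x) xi = k * H1 f xi.
Proof.
move=> Lf; rewrite !H1E0 -intZ; last exact: L1_kH.
by apply: eq_int => x; rewrite mulrA.
Qed.

Lemma H1_sym f g : L1 f -> L1 g -> ip (H1 f) g = ip f (H1 g).
Proof.
move=> Lf Lg; have [_ e] := swap Lf Lg kH_meas2 kH_bd.
rewrite ipC /ip; transitivity (\int[mu]_x (g x * \int[mu]_y (f y * kH y x))).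
  by apply: eq_int => x; rewrite H1E0.
by rewrite -[LHS]e; apply: eq_int => x; rewrite H1E; congr (_ * _).
Qed.

(** * The Poisson kernel *)

Definition iS x : R := (1 + x ^+ 2)^-1.

Lemma iS_gt0 x : 0 < iS x.
Proof. by rewrite invr_gt0 ltr_pwDl// sqr_ge0. Qed.

Lemma cont_iS : continuous iS.
Proof. exact: continuous_oneDsqrV. Qed.

Lemma L1_iS : L1 iS.
Proof.
have m := continuous_measurable_fun cont_iS.
apply/ge0_L1P => // [x|]; first exact/ltW/iS_gt0.
rewrite ge0_symfun_integralT.
- by rewrite -set_itvcy integral0y_oneDsqr -EFinM ltry.
- by move=> x; exact/ltW/iS_gt0.
- exact: cont_iS.
- by move=> x; rewrite /iS /= sqrrN.
Qed.

(* The regularizing weight whose transform is the Poisson kernel [PK e]. *)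
Definition wP e xi : R := expR (- (2 * pi * e * `|xi|)).

Lemma wP_gt0 e xi : 0 < wP e xi.
Proof. exact: expR_gt0. Qed.

Lemma wP_le1 e xi : 0 <= e -> wP e xi <= 1.
Proof.
by move=> e0; rewrite -expR0 ler_expR oppr_le0 !mulr_ge0// ?pi_ge0.
Qed.

Lemma cont_wP e : continuous (wP e).
Proof.
move=> x; apply: continuous_comp; last exact: continuous_expR.
apply: cvgN; apply: cvgM; first exact: cvg_cst.
exact: norm_continuous.
Qed.

Lemma L1_wP e : 0 < e -> L1 (wP e).
Proof.
move=> e0; have m := continuous_measurable_fun (@cont_wP e).
pose A := pi * e; have A0 : 0 < A by rewrite mulr_gt0 ?pi_gt0.
apply: (@L1_le _ _ (fun x => (1 + A ^- 2) * iS x)) m _ (L1Z _ L1_iS) => x.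
rewrite ger0_norm ?(ltW (wP_gt0 _ _))// /wP /iS.
(* Halving the exponent allows the bound [1 + t <= expR t] to be used twice, which yields quadratic
   decay and hence comparison with [iS]. *)
have -> : - (2 * pi * e * `|x|) = - (A * `|x|) + - (A * `|x|) by rewrite /A; ring.
rewrite expRD expRN.
set t := A * `|x|; have t0 : 0 <= t by rewrite mulr_ge0// ltW.
have E : 1 + t <= expR t by exact: expR_ge1Dx.
have E0 : 0 < expR t by exact: expR_gt0.
rewrite -invfM ler_pdivlMr; last by rewrite ltr_pwDl// sqr_ge0.
rewrite mulrC ler_pdivrMr ?mulr_gt0//.
have tx : x ^+ 2 = A ^- 2 * t ^+ 2.
  by rewrite /t [(_ * `|x|) ^+ 2]exprMn -normrX (ger0_norm (sqr_ge0 x)) mulrA mulVf ?mul1r// expf_neq0// gt_eqF.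
rewrite tx; set B := A ^- 2; have B0 : 0 < B by rewrite invr_gt0 exprn_gt0.
have EE : (1 + t) * (1 + t) <= expR t * expR t by rewrite ler_pM// ?addr_ge0.
apply: (@le_trans _ _ ((1 + B) * ((1 + t) * (1 + t)))); last by rewrite ler_pM2l ?addr_gt0.
rewrite expr2; nra.
Qed.

Lemma dervM f g a b x : is_derive x 1 f a -> is_derive x 1 g b ->
  is_derive x 1 (fun x => f x * g x) (a * g x + f x * b).
Proof.
move=> df dg; have -> : (fun x => f x * g x) = f * g by [].
apply: (@is_derive_eq _ _ _ _ _ _ _ _ (is_deriveM df dg)).
by rewrite /GRing.scale/= addrC [g x * _]mulrC.
Qed.

Lemma dervD f g a b x : is_derive x 1 f a -> is_derive x 1 g b ->
  is_derive x 1 (fun x => f x + g x) (a + b).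
Proof. by move=> df dg; exact: (is_deriveD df dg). Qed.

Lemma derv_cst c x : is_derive x 1 (fun=> c) 0.
Proof. exact: is_derive_cst. Qed.

Lemma derv_id x : is_derive x 1 (fun x => x) 1.
Proof. exact: is_derive_id. Qed.

Lemma dervZ c f a x : is_derive x 1 f a -> is_derive x 1 (fun x => c * f x) (c * a).
Proof.
by move=> df; apply: (is_derive_eq (dervM (derv_cst c x) df)); rewrite mul0r add0r.
Qed.

Lemma derv_lin c x : is_derive x 1 (fun x => c * x) c.
Proof. by apply: (is_derive_eq (dervZ c (derv_id x))); rewrite mulr1. Qed.

Lemma derv_comp f g a b x : is_derive (g x) 1 f a -> is_derive x 1 g b ->
  is_derive x 1 (fun x => f (g x)) (a * b).
Proof. by move=> df dg; exact: (is_derive1_comp df dg). Qed.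

Lemma derv_explin c x : is_derive x 1 (fun x => expR (c * x)) (expR (c * x) * c).
Proof. exact: (derv_comp (f := expR) (is_derive_expR _) (derv_lin c x)). Qed.

Lemma derv_sinlin c x : is_derive x 1 (fun x => sin (c * x)) (cos (c * x) * c).
Proof. exact: (derv_comp (f := sin) (is_derive_sin _) (derv_lin c x)). Qed.

Lemma derv_coslin c x : is_derive x 1 (fun x => cos (c * x)) (- sin (c * x) * c).
Proof. exact: (derv_comp (f := cos) (is_derive_cos _) (derv_lin c x)). Qed.

(** The primitive is the real part of exp((A + iB) x) / (A + iB). *)
Lemma is_derive_expcos (A B : R) x : A ^+ 2 + B ^+ 2 != 0 ->
  is_derive x 1 (fun x => expR (A * x) * (B * sin (B * x) + A * cos (B * x)) *
     (A ^+ 2 + B ^+ 2)^-1)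
   (expR (A * x) * cos (B * x)).
Proof.
move=> D0.
have h := dervM (dervM (derv_explin A x) (dervD (dervZ B (derv_sinlin B x))
  (dervZ A (derv_coslin B x)))) (derv_cst (A ^+ 2 + B ^+ 2)^-1 x).
by apply: (is_derive_eq h); field.
Qed.

Lemma cont_derv f f' : (forall x, is_derive x 1 f (f' x)) -> continuous f.
Proof.
by move=> df x; apply: differentiable_continuous; apply/derivable1_diffP; exact: ex_derive.
Qed.

Lemma int_expcos (A B : R) a b : A ^+ 2 + B ^+ 2 != 0 -> a <= b ->
  \int[mu]_x (expR (A * x) * cos (B * x) * ind a b x) =
  (expR (A * b) * (B * sin (B * b) + A * cos (B * b)) -
  expR (A * a) * (B * sin (B * a) + A * cos (B * a))) / (A ^+ 2 + B ^+ 2).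
Proof.
move=> D0 ab; rewrite (ftc2 ab (fun x => is_derive_expcos x D0)); first by rewrite -mulrBl.
exact: (cont_derv (fun x => dervM (derv_explin A x) (derv_coslin B x))).
Qed.

Lemma expRNn_cvg0 A : 0 < A -> (fun n : nat => expR (- (A * n%:R))) @ \oo --> (0 : R).
Proof.
move=> A0; apply: (@cvg0_le _ _ (fun n => (1 + A^-1) * harmonic n)).
  move=> n; rewrite ltW ?expR_gt0//= expRN /harmonic.
  have An : 0 <= A * n%:R by rewrite mulr_ge0// ltW.
  have p : 0 < 1 + A * n%:R by rewrite ltr_pwDl.
  apply: (@le_trans _ _ (1 + A * n%:R)^-1).
    by rewrite lef_pV2 ?posrE ?expR_gt0// expR_ge1Dx.
  rewrite ler_pdivlMr ?ltr0n// mulrC ler_pdivrMr// -natr1.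
  have -> : (1 + A^-1) * (1 + A * n%:R) = 1 + A * n%:R + A^-1 + n%:R.
    by field; rewrite gt_eqF.
  by have : 0 <= A^-1 by [rewrite invr_ge0 ltW]; lra.
rewrite -[X in _ --> X](mulr0 (1 + A^-1)); apply: cvgM; first exact: cvg_cst.
exact: cvg_harmonic.
Qed.

Lemma int_wPcos e B : 0 < e -> \int[mu]_xi (wP e xi * cos (B * xi)) =
  2 * (2 * pi * e) / ((2 * pi * e) ^+ 2 + B ^+ 2).
Proof.
move=> e0; set A := 2 * pi * e; have A0 : 0 < A by rewrite !mulr_gt0 ?pi_gt0.
have D0 : 0 < A ^+ 2 + B ^+ 2 by rewrite ltr_pwDl ?exprn_gt0 ?sqr_ge0.
have mc : measurable_fun setT (fun xi => cos (B * xi)).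
  exact: continuous_measurable_fun (cont_derv (derv_coslin B)).
have L : L1 (fun xi => wP e xi * cos (B * xi)).
  by apply: L1M_bd (L1_wP e0) mc _ => x; exact: cos_max.
have lc : loc (fun xi => wP e xi * cos (B * xi)) by exact: L1_loc.
rewrite -(cvg_lim (@Rhausdorff R) (int_trunc_cvg L)); apply: cvg_lim => //.
rewrite (_ : (fun n => _) = fun n : nat => 2 * A / (A ^+ 2 + B ^+ 2) +
  expR (- (A * n%:R)) * (2 * (B * sin (B * n%:R) - A * cos (B * n%:R)) / (A ^+ 2 + B ^+ 2))).
  rewrite -[X in _ --> X]addr0; apply: cvgD; first exact: cvg_cst.
  apply/norm_cvg0P; apply: (@cvg0_le _ _ (fun n => expR (- (A * n%:R)) *
    (2 * (`|B| + A) / (A ^+ 2 + B ^+ 2)))) => [n|].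
    rewrite normr_ge0/= !normrM (gtr0_norm (expR_gt0 _)) ler_pM2l ?expR_gt0//.
    rewrite [`|_^-1|]gtr0_norm ?invr_gt0// ler_pM2r ?invr_gt0//.
    rewrite ger0_norm// ler_pM2l// (le_trans (ler_normB _ _))// (normrM B) (normrM A).
    by rewrite lerD ?ler_piMr ?sin_max// (gtr0_norm A0) ler_piMr ?cos_max// ltW.
  rewrite -[X in _ --> X](mul0r (2 * (`|B| + A) / (A ^+ 2 + B ^+ 2))).
  by apply: cvgM; [exact: expRNn_cvg0|exact: cvg_cst].
apply/funext => n; have n0 : (0 : R) <= n%:R by exact: ler0n.
rewrite (@ind_split _ _ (- n%:R) 0) ?oppr_le0//.
rewrite (@eq_int _ _ (fun x => expR (A * x) * cos (B * x) * ind (- n%:R) 0 x)); last first.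
  move=> x; rewrite /ind in_itv/=; case: (boolP (_ && _)) => [/andP[_ x0]|_]; last by rewrite !mulr0.
  by rewrite /wP ler0_norm// mulrN opprK.
rewrite [X in _ + X](@eq_int _ _ (fun x => expR (- A * x) * cos (B * x) * ind 0 n%:R x)); last first.
  move=> x; rewrite /ind in_itv/=; case: (boolP (_ && _)) => [/andP[x0 _]|_]; last by rewrite !mulr0.
  by rewrite /wP ger0_norm// mulNr.
rewrite !int_expcos ?oppr_le0 ?sqrrN ?gt_eqF//.
rewrite !mulr0 sin0 cos0 expR0 !mulrN !mulNr sinN cosN.
by field; rewrite gt_eqF.
Qed.

Lemma int_wPsin e B : 0 < e -> \int[mu]_xi (wP e xi * sin (B * xi)) = 0.
Proof.
move=> e0; have mc : measurable_fun setT (fun xi => sin (B * xi)).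
  exact: continuous_measurable_fun (cont_derv (derv_sinlin B)).
have L : L1 (fun xi => wP e xi * sin (B * xi)).
  by apply: L1M_bd (L1_wP e0) mc _ => x; exact: sin_max.
have := int_refl L; rewrite (@eq_int _ _ (fun x => -1 * (wP e x * sin (B * x)))).
  by rewrite intZ//; lra.
by move=> x; rewrite /wP normrN mulrN sinN; ring.
Qed.

Definition PK e x := e / (pi * (e ^+ 2 + x ^+ 2)).

Lemma PK_ge0 e x : 0 <= e -> 0 <= PK e x.
Proof.
by move=> e0; rewrite divr_ge0// mulr_ge0 ?pi_ge0// addr_ge0 ?sqr_ge0.
Qed.

(** By [casM] the product of two kernels is a cosine of the difference plus a sine of the sum. The
    sine is odd in xi and vanishes against the even weight, which leaves a convolution kernel. *)
Lemma int_wPcas e x y : 0 < e ->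
  \int[mu]_xi (wP e xi * (kH x xi * kH y xi)) = PK e (x - y).
Proof.
move=> e0; have E xi : wP e xi * (kH x xi * kH y xi) =
    wP e xi * cos (2 * pi * (x - y) * xi) + wP e xi * sin (2 * pi * (x + y) * xi).
  by rewrite /kH casM -mulrDr; congr (_ * (cos _ + sin _)); ring.
rewrite (eq_int E) intD.
- rewrite int_wPcos// int_wPsin// addr0 /PK.
  have q : 0 < e ^+ 2 + (x - y) ^+ 2 by rewrite ltr_pwDl ?exprn_gt0 ?sqr_ge0.
  have := pi_gt0 R; move: (pi : R) => p p0.
  have -> : (2 * p * e) ^+ 2 + (2 * p * (x - y)) ^+ 2 =
    4 * p ^+ 2 * (e ^+ 2 + (x - y) ^+ 2) by ring.
  by field; rewrite !gt_eqF.
- apply: L1M_bd (L1_wP e0) _ _ => [|z]; last exact: cos_max.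
  exact: continuous_measurable_fun (cont_derv (derv_coslin _)).
- apply: L1M_bd (L1_wP e0) _ _ => [|z]; last exact: sin_max.
  exact: continuous_measurable_fun (cont_derv (derv_sinlin _)).
Qed.

Lemma PK_cont e : 0 < e -> continuous (PK e).
Proof.
move=> e0 x; apply: cvgM; first exact: cvg_cst.
apply: cvgV; first by rewrite gt_eqF// mulr_gt0 ?pi_gt0// ltr_pwDl ?exprn_gt0 ?sqr_ge0.
apply: cvgM; first exact: cvg_cst.
by apply: cvgD; [exact: cvg_cst|exact: (@exprn_continuous R 2)].
Qed.

Lemma PK_bd e x : 0 < e -> `|PK e x| <= (pi * e)^-1.
Proof.
move=> e0; rewrite ger0_norm ?PK_ge0 ?(ltW e0)// /PK.
have p0 : 0 < (pi : R) by exact: pi_gt0.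
have q : 0 < e ^+ 2 + x ^+ 2 by rewrite ltr_pwDl ?exprn_gt0 ?sqr_ge0.
rewrite ler_pdivrMr ?mulr_gt0// invfM mulrACA mulVf ?gt_eqF// mul1r.
rewrite mulrDr expr2 mulKf ?gt_eqF// lerDl.
by apply: mulr_ge0; rewrite ?sqr_ge0 ?invr_ge0 ?(ltW e0).
Qed.

Lemma PK_meas2 e : 0 < e -> meas2 (fun x y => PK e (x - y)).
Proof.
move=> e0; apply: meas2_comp; first exact: continuous_measurable_fun (PK_cont e0).
by apply: meas2B; [exact: meas2_fst|exact: meas2_snd].
Qed.

Lemma int_PK_ind e x a b : 0 < e -> a <= b ->
  \int[mu]_y (ind a b y * PK e (x - y)) =
  (atan ((b - x) / e) - atan ((a - x) / e)) / pi.
Proof.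
move=> e0 ab; have d y : is_derive y 1 (fun y => pi^-1 * atan ((y - x) / e)) (PK e (x - y)).
  have dl : is_derive y 1 (fun y => (y - x) / e) e^-1.
    have h := dervM (dervD (derv_id y) (derv_cst (- x) y)) (derv_cst e^-1 y).
    by apply: (is_derive_eq h); rewrite mulr0 !addr0 mul1r.
  have h := dervZ pi^-1 (derv_comp (f := atan) (is_derive1_atan _) dl).
  apply: (is_derive_eq h); rewrite /PK.
  have q : 0 < e ^+ 2 + (x - y) ^+ 2 by rewrite ltr_pwDl ?exprn_gt0 ?sqr_ge0.
  have -> : 1 + ((y - x) / e) ^+ 2 = (e ^+ 2 + (x - y) ^+ 2) / e ^+ 2.
    by field; rewrite gt_eqF.
  have := pi_gt0 R; move: (pi : R) => p p0.
  by field; rewrite !gt_eqF.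
rewrite (@eq_int _ _ (fun y => PK e (x - y) * ind a b y)); last by move=> y; rewrite mulrC.
rewrite (ftc2 ab d); first by rewrite -mulrBr mulrC.
move=> y; apply: (@continuous_comp _ _ _ (fun y => x - y)); last exact: PK_cont.
by apply: cvgB; [exact: cvg_cst|exact: cvg_id].
Qed.

Definition supp f a b := forall x, f x * ind a b x = f x.

Lemma supp_ind f a b : supp (fun x => f x * ind a b x) a b.
Proof. by move=> x; rewrite -mulrA -expr2 ind_sqr. Qed.

Lemma supp_L1 f a b : L2 f -> supp f a b -> L1 f.
Proof. by move=> Lf sf; apply: eq_L1 (L2M Lf (L2_ind a b)) => x; exact: sf. Qed.

(** A regularized Plancherel identity. The weight makes the frequency integral absolutely
    convergent, so both transforms can be unfolded by [swap], one after the other. *)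
Lemma H1_bilinear f g e : 0 < e -> L1 f -> L1 g ->
  \int[mu]_xi (wP e xi * H1 g xi * H1 f xi) =
  \int[mu]_x (f x * \int[mu]_y (g y * PK e (x - y))).
Proof.
move=> e0 Lf Lg.
have Lu : L1 (fun xi => wP e xi * H1 g xi).
  by apply: L1M_bd (L1_wP e0) (H1_meas Lg) _ => xi; exact: H1_bd.
have [_ E] := swap Lu Lf kH_meas2 kH_bd.
rewrite (@eq_int _ _ (fun xi => wP e xi * H1 g xi * \int[mu]_y (f y * kH xi y))); last first.
  by move=> xi; congr (_ * _); rewrite H1E.
rewrite E; apply: eq_int => x; congr (_ * _).
have Lc : L1 (fun xi => wP e xi * kH x xi).
  by apply: L1M_bd (L1_wP e0) (meas_kH x) (kH_bd x).
have [_ E2] := swap Lc Lg kH_meas2 kH_bd.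
rewrite (@eq_int _ _ (fun xi => wP e xi * kH x xi * \int[mu]_y (g y * kH xi y))); last first.
  by move=> xi; rewrite (kHC xi x) -H1E; ring.
rewrite E2; apply: eq_int => y; congr (_ * _).
rewrite -(int_wPcas _ _ e0); apply: eq_int => xi; rewrite (kHC xi y); ring.
Qed.

Lemma wP_cvg1 xi : (fun n : nat => wP n.+1%:R^-1 xi) @ \oo --> (1 : R).
Proof.
rewrite -[X in _ --> X]expR0; apply: continuous_cvg; first exact: continuous_expR.
rewrite -[X in _ --> X]oppr0; apply: cvgN; rewrite -[X in _ --> X](mul0r `|xi|); apply: cvgM; last exact: cvg_cst.
rewrite -[X in _ --> X](mulr0 (2 * pi)); apply: cvgM; first exact: cvg_cst.
exact: cvg_harmonic.
Qed.

Lemma wP_cvgM xi c d : (fun n : nat => wP n.+1%:R^-1 xi * c * d) @ \oo --> c * d.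
Proof.
rewrite -[c in X in _ --> X]mul1r.
by apply: cvgM; [apply: cvgM; [exact: wP_cvg1|exact: cvg_cst]|exact: cvg_cst].
Qed.

(* Schur's test: the Poisson kernel has mass at most one. *)
Lemma schur_PK f e a b : 0 < e -> a <= b -> L2 f -> supp f a b ->
  \int[mu]_x (f x * \int[mu]_y (f y * PK e (x - y))) <= \int[mu]_x (f x ^+ 2).
Proof.
have half (I J K : R) : K = I + I -> I <= J -> 2^-1 * K <= J by move=> ->; lra.
move=> e0 ab Lf sf; have [mf Sf] := Lf; have Lf1 := supp_L1 Lf sf.
have mP := PK_meas2 e0; have bP x y := PK_bd (x - y) e0.
have [A AE] : exists A, forall x, A x = \int[mu]_y (ind a b y * PK e (x - y)) by eexists.
have A01 x : 0 <= A x <= 1.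
  rewrite AE int_PK_ind//; have p0 := pi_gt0 R.
  apply/andP; split.
    apply: divr_ge0 (ltW p0); rewrite subr_ge0 le_atan//.
    by rewrite ler_pM2r ?invr_gt0// lerD2r.
  rewrite ler_pdivrMr// mul1r.
  by have := atan_ltpi2 ((b - x) / e); have := atan_gtNpi2 ((a - x) / e); lra.
have mA : measurable_fun setT A.
  by rewrite (funext AE); exact: meas_int (L1_ind a b) mP bP.
have LSA : L1 (fun x => f x ^+ 2 * A x).
  by apply: (L1M_bd (C := 1)) Sf mA _ => x; rewrite ger0_norm; case/andP: (A01 x).
have [LB EB] := swap (L1_ind a b) Sf mP bP.
have [LI _] := swap Lf1 Lf1 mP bP.
have SA : \int[mu]_x (ind a b x * \int[mu]_y (f y ^+ 2 * PK e (x - y))) =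
    \int[mu]_x (f x ^+ 2 * A x).
  rewrite EB; apply: eq_int => y; rewrite AE; congr (_ * _); apply: eq_int => x; congr (_ * _).
  by rewrite /PK -[y - x]opprB sqrrN.
(* The bound f(x) f(y) <= (f(x)^2 + f(y)^2) / 2 under the double integral. By symmetry of the kernel
   both halves integrate to the same quantity, at most half the integral of f^2 each. *)
pose D x := 2^-1 * (f x ^+ 2 * A x + ind a b x * \int[mu]_y (f y ^+ 2 * PK e (x - y))).
have LD : L1 D by exact: (L1Z _ (L1D LSA LB)).
apply: (@le_trans _ _ (\int[mu]_x D x)).
  apply: (int_le LI LD) => x; rewrite /D AE.
  have Ly (g : R -> R) : L1 g -> L1 (fun y => g y * PK e (x - y)).
    by move=> Lg; apply: L1M_bd Lg (meas2_section x mP) (bP x).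
  have L1a := L1Z (f x) (Ly _ Lf1).
  have L1b := L1Z (f x ^+ 2) (Ly _ (L1_ind a b)).
  have L1c := L1Z (ind a b x) (Ly _ Sf).
  rewrite -(intZ _ (Ly _ Lf1)) -(intZ _ (Ly _ (L1_ind a b))) -(intZ _ (Ly _ Sf)).
  rewrite -(intD L1b L1c) -(intZ _ (L1D L1b L1c)).
  apply: (int_le L1a (L1Z _ (L1D L1b L1c))) => y.
  have K0 := @PK_ge0 e (x - y) (ltW e0); move: K0; set K := PK e (x - y) => K0.
  rewrite -(sf x) -(sf y) !exprMn !ind_sqr.
  have := ind_sqr a b x; have := ind_sqr a b y.
  move: (ind01 a b x) (ind01 a b y); set p := ind a b x; set q := ind a b y => p1 q1 qq pp.
  rewrite -subr_ge0.
  have -> : 2^-1 * (f x ^+ 2 * p * (q * K) + p * (f y ^+ 2 * q * K)) -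
    f x * p * (f y * q * K) = 2^-1 * (p * q * K * (f x - f y) ^+ 2).
    by field.
  have [[p0 _] [q0 _]] := (andP p1, andP q1).
  apply: mulr_ge0; first by rewrite invr_ge0.
  exact: mulr_ge0 (mulr_ge0 (mulr_ge0 p0 q0) K0) (sqr_ge0 _).
rewrite /D (intZ _ (L1D LSA LB)).
have le : \int[mu]_x (f x ^+ 2 * A x) <= \int[mu]_x (f x ^+ 2).
  apply: (int_le LSA Sf) => x; have /andP[_ A1] := A01 x.
  exact: (ler_piMr (sqr_ge0 (f x)) A1).
have E := etrans (intD LSA LB) (congr1 (+%R (\int[mu]_x (f x ^+ 2 * A x))) SA).
exact: (half _ _ _ E le).
Qed.

(** [schur_PK] bounds the weighted square of the transform uniformly in the weight, and Fatou
    removes the weight. Only an inequality is obtained here; equality comes from inversion in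
    [hart_n2]. *)
Lemma H1_contr f a b : a <= b -> L2 f -> supp f a b -> L2 (H1 f) /\ n2 (H1 f) <= n2 f.
Proof.
move=> ab Lf sf; have Lf1 := supp_L1 Lf sf; have mH := H1_meas Lf1.
have e0 n : (0 : R) < n.+1%:R^-1 by rewrite invr_gt0 ltr0n.
have [] := @fatouR R (fun n xi => wP n.+1%:R^-1 xi * H1 f xi * H1 f xi)
   (fun xi => H1 f xi ^+ 2) (\int[mu]_x (f x ^+ 2)).
- move=> n; have bd xi := H1_bd xi Lf1.
  have L := L1M_bd (L1_wP (e0 n)) (H1_meas Lf1) bd.
  exact: (L1M_bd L (H1_meas Lf1) bd).
- by move=> n xi; rewrite -mulrA -expr2 mulr_ge0 ?sqr_ge0// ltW// wP_gt0.
- by move=> xi; exact: sqr_ge0.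
- exact: measurable_funX.
- by apply: aeW => xi; rewrite expr2; exact: wP_cvgM.
- by apply: nearW => n; rewrite H1_bilinear//; exact: schur_PK ab Lf sf.
- by move=> LH le; split=> //; rewrite !n2E ler_wsqrtr.
Qed.

Lemma atan_cvg x : (fun n : nat => atan (x / n.+1%:R^-1)) @ \oo -->
  (if 0 < x then pi / 2 else if x < 0 then - (pi / 2) else 0 : R).
Proof.
have h t : 0 < t -> (fun n : nat => atan (t / n.+1%:R^-1)) @ \oo --> (pi / 2 : R).
  move=> t0; apply: (cvg_comp _ _ _ (@cvgy_atan R)).
  apply/cvgryPge => A; near=> n; rewrite invrK -ler_pdivrMl//.
  apply: (@le_trans _ _ n%:R); last by rewrite ler_nat.
  by near: n; exact: nbhs_infty_ger.
case: ltrgtP => x0; last by rewrite -x0; under eq_fun do rewrite mul0r atan0; exact: cvg_cst.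
  exact: h.
have -> : (fun n : nat => atan (x / n.+1%:R^-1)) = (fun n : nat => - atan (- x / n.+1%:R^-1)).
  by apply/funext => n; rewrite mulNr atanN opprK.
by apply: cvgN; apply: h; rewrite oppr_gt0.
Unshelve. all: by end_near. Qed.

Lemma ae_neq a : {ae mu, forall x, x != a}.
Proof.
exists [set a]; split => //; first exact: lebesgue_measure_set1.
by move=> x /= /negP; rewrite negbK => /eqP.
Qed.

(** Both sides of [H1_bilinear] converge as the weight tends to one: on the frequency side by
    dominated convergence, on the space side because the Poisson average of an indicator is an
    explicit difference of arctangents tending to the indicator. *)
Lemma H1_parseval_ind f c d a b : a < b -> c <= d -> L2 f -> supp f c d ->
  ip (H1 f) (H1 (ind a b)) = ip f (ind a b).
Proof.
move=> ab cd Lf sf; have Lf1 := supp_L1 Lf sf; have mf := L1_meas Lf1.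
have Li := L1_ind a b; have p0 := pi_gt0 R.
have [LH _] := H1_contr cd Lf sf.
have [LI _] : L2 (H1 (ind a b)) /\ n2 (H1 (ind a b)) <= n2 (ind a b).
  apply: (H1_contr (ltW ab) (L2_ind a b)) => x; by rewrite -expr2 ind_sqr.
have e0 n : (0 : R) < n.+1%:R^-1 by rewrite invr_gt0 ltr0n.
have LM := L2M LH LI.
have [||||_ c1] := @dct R (fun n xi => wP n.+1%:R^-1 xi * H1 (ind a b) xi * H1 f xi)
  (fun xi => H1 f xi * H1 (ind a b) xi) _ _ _ _ (L1_norm LM).
- move=> n; apply: measurable_funM; last exact: H1_meas.
  by apply: measurable_funM; [exact: L1_meas (L1_wP (e0 n))|exact: H1_meas].
- exact: L1_meas LM.
- by apply: aeW => xi; rewrite [H1 f xi * H1 _ _]mulrC; exact: wP_cvgM.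
- move=> n xi; rewrite -mulrA normrM [H1 (ind a b) xi * _]mulrC ler_piMl//.
  by rewrite ger0_norm ?wP_le1 ?(ltW (wP_gt0 _ _))// ltW.
pose G n x := (atan ((b - x) / n.+1%:R^-1) - atan ((a - x) / n.+1%:R^-1)) / pi.
have GE n x : \int[mu]_y (ind a b y * PK n.+1%:R^-1 (x - y)) = G n x by rewrite int_PK_ind// ltW.
have mG n : measurable_fun setT (G n).
  rewrite (_ : G n = fun x => \int[mu]_y (ind a b y * PK n.+1%:R^-1 (x - y))).
    exact: meas_int Li (PK_meas2 (e0 n)) (fun x y => PK_bd (x - y) (e0 n)).
  by apply/funext => x; rewrite GE.
have [||||_ c2] := @dct R (fun n x => f x * G n x) (fun x => f x * ind a b x) _ _ _ _ (L1_norm Lf1).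
- by move=> n; apply: measurable_funM.
- by apply: measurable_funM => //; exact: meas_ind.
(* At the two endpoints the averages tend to 1/2 instead. *)
- apply: ae_S2 (ae_neq a) (ae_neq b) => x xa xb.
  apply: cvgM; first exact: cvg_cst.
  have c0 : G ^~ x @ \oo -->
    ((if 0 < b - x then pi / 2 else if b - x < 0 then - (pi / 2) else 0) -
     (if 0 < a - x then pi / 2 else if a - x < 0 then - (pi / 2) else 0)) / pi.
    by apply: cvgM; [apply: cvgB; exact: atan_cvg|exact: cvg_cst].
  apply: cvg_trans c0 _; rewrite (_ : _ / pi = ind a b x)//.
  rewrite !subr_gt0 !subr_lt0 /ind in_itv/=.
  case: (ltgtP x a) xa => // xa _; case: (ltgtP x b) xb => // xb _ /=.
  - by rewrite subrr mul0r.
  - by have := lt_trans xa (lt_trans ab xb); rewrite ltxx.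
  - by rewrite opprK -splitr divff// gt_eqF.
  - by rewrite subrr mul0r.
- move=> n x; rewrite normrM ler_piMr// /G normrM [`|pi^-1|]gtr0_norm ?invr_gt0//.
  rewrite ler_pdivrMr// mul1r ler_norml.
  have := atan_ltpi2 ((b - x) / n.+1%:R^-1); have := atan_gtNpi2 ((a - x) / n.+1%:R^-1).
  have := atan_ltpi2 ((a - x) / n.+1%:R^-1); have := atan_gtNpi2 ((b - x) / n.+1%:R^-1).
  by move=> *; apply/andP; split; lra.
rewrite /ip -(cvg_lim (@Rhausdorff R) c1) -(cvg_lim (@Rhausdorff R) c2); rewrite (_ : (fun n => _) = fun n => \int[mu]_x (f x * G n x))//.
apply/funext => n; rewrite H1_bilinear//; by apply: eq_int => x; rewrite GE.
Qed.

Lemma H1_aeq f g xi : L1 f -> L1 g -> aeq f g -> H1 f xi = H1 g xi.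
Proof.
move=> Lf Lg fg; rewrite !H1E0; apply: int_aeq (L1_meas (L1_kH xi Lf)) (L1_meas (L1_kH xi Lg)) _.
by apply: ae_S fg => y ->.
Qed.

(** * Extension of the transform to L2, and inversion *)

Definition trunc (n : nat) f x := f x * ind (- n%:R) n%:R x.

Lemma trunc_supp n f : supp (trunc n f) (- n%:R) n%:R.
Proof. exact: supp_ind. Qed.

Lemma nn_le (n : nat) : - n%:R <= n%:R :> R.
Proof. by rewrite -subr_ge0 opprK addr_ge0 ?ler0n. Qed.

Lemma trunc_L2 n f : L2 f -> L2 (trunc n f).
Proof. by move=> Lf; exact: L2M_bd Lf (meas_ind _ _) (ind_norm _ _). Qed.

Lemma trunc_L1 n f : L2 f -> L1 (trunc n f).
Proof. by move=> Lf; exact: supp_L1 (trunc_L2 n Lf) (@trunc_supp n f). Qed.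

Lemma trunc_cvg f : L2 f -> n2 (fun x => trunc n f x - f x) @[n --> \oo] --> 0.
Proof. by move=> Lf; under eq_fun do rewrite n2BC; exact: n2_trunc_cvg. Qed.

Lemma H1_trunc n f : L2 f -> L2 (H1 (trunc n f)) /\ n2 (H1 (trunc n f)) <= n2 (trunc n f).
Proof. by move=> Lf; exact: H1_contr (nn_le n) (trunc_L2 n Lf) (@trunc_supp n f). Qed.

Lemma n2_cvg_uniq (u : nat -> R -> R) F G : (forall n, L2 (u n)) -> L2 F -> L2 G ->
  n2 (fun x => u n x - F x) @[n --> \oo] --> 0 ->
  n2 (fun x => u n x - G x) @[n --> \oo] --> 0 -> aeq F G.
Proof.
move=> Lu LF LG uF uG; have L := L2B LF LG.
suff : n2 (fun x => F x - G x) = 0 by move/(n2_eq0 L); apply: ae_S => x /subr0_eq.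
apply/eqP; rewrite eq_le n2_ge0 andbT; apply/ler_addgt0Pl => e e0; rewrite addr0.
have e2 : 0 < e / 2 by rewrite divr_gt0.
have /cvgrPdist_lt/(_ _ e2) h1 := uF; have /cvgrPdist_lt/(_ _ e2) h2 := uG.
near \oo => n; apply: le_trans (n2_tri LF (Lu n) LG) _; rewrite n2BC [e]splitr.
rewrite lerD//; apply/ltW; [near: n; move: h1|near: n; move: h2];
  by apply: filterS => n; rewrite sub0r normrN ger0_norm// n2_ge0.
Unshelve. all: by end_near. Qed.

Lemma n2_cvg_cauchy (u : nat -> R -> R) F : (forall n, L2 (u n)) -> L2 F ->
  n2 (fun x => u n x - F x) @[n --> \oo] --> 0 ->
  forall e, 0 < e -> exists N, forall n m, (N <= n)%N -> (N <= m)%N ->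
     n2 (fun x => u n x - u m x) <= e.
Proof.
move=> Lu LF uF e e0; have e2 : 0 < e / 2 by rewrite divr_gt0.
have /cvgrPdist_lt/(_ _ e2)[N _ NP] := uF; exists N => n m Nn Nm.
have h k : (N <= k)%N -> n2 (fun x => u k x - F x) < e / 2.
  by move=> Nk; have := NP k Nk; rewrite /= sub0r normrN ger0_norm// n2_ge0.
apply: le_trans (n2_tri (Lu n) LF (Lu m)) _; rewrite [e]splitr.
by apply: lerD; apply: ltW; [exact: h|rewrite n2BC; exact: h].
Qed.

(** The limit is determined only up to a.e. equality and [hart] picks one value by choice, so
    identities about [hart] are a.e. identities. *)
Definition hart_lim f F :=
  L2 F /\ n2 (fun x => H1 (trunc n f) x - F x) @[n --> \oo] --> 0.

Fact hart_sig : {H : (R -> R) -> R -> R | forall f, H f = xget (fun=> 0) (hart_lim f)}.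
Proof. by eexists. Qed.
Definition hart := sval hart_sig.

(** The difference of two truncations is supported in the larger interval, so [H1_contr] applies to
    it. *)
Lemma H1_trunc_cauchy f : L2 f -> forall e, 0 < e ->
  exists N, forall n m, (N <= n)%N -> (N <= m)%N ->
    n2 (fun x => H1 (trunc n f) x - H1 (trunc m f) x) <= e.
Proof.
move=> Lf e e0.
have [N NP] := n2_cvg_cauchy (fun n => trunc_L2 n Lf) Lf (trunc_cvg Lf) e0.
exists N => n m Nn Nm; apply: le_trans (NP n m Nn Nm).
have E : (fun x => H1 (trunc n f) x - H1 (trunc m f) x) =
    H1 (fun x => trunc n f x - trunc m f x).
  by apply/funext => x; rewrite H1B//; exact: trunc_L1.
rewrite E; pose k := maxn n m.
have sk j : (j <= k)%N -> forall x, trunc j f x * ind (- k%:R) k%:R x = trunc j f x.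
  move=> jk x; rewrite /trunc -mulrA /ind !in_itv/= -!ler_norml.
  case: (lerP `|x| j%:R) => xj; last by rewrite mul0r.
  by rewrite (le_trans xj) ?mulr1// ler_nat.
apply: (H1_contr (nn_le k) (L2B (trunc_L2 n Lf) (trunc_L2 m Lf)) _).2.
by move=> x; rewrite mulrBl !sk// ?leq_maxl ?leq_maxr.
Qed.

Lemma hartP f : L2 f -> hart_lim f (hart f).
Proof.
move=> Lf; have L n := (H1_trunc n Lf).1.
have [F LF cF] := riesz_fischer L (H1_trunc_cauchy Lf).
by have := @xgetPex _ (fun=> 0) (hart_lim f) (ex_intro _ F (conj LF cF)); rewrite /hart (svalP hart_sig).
Qed.

Lemma hart_L2 f : L2 f -> L2 (hart f).
Proof. by move=> /hartP[]. Qed.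

Lemma hart_uniq f F : L2 f -> L2 F ->
  n2 (fun x => H1 (trunc n f) x - F x) @[n --> \oo] --> 0 -> aeq F (hart f).
Proof.
move=> Lf LF cF; have [LH cH] := hartP Lf.
exact: n2_cvg_uniq (fun n => (H1_trunc n Lf).1) LF LH cF cH.
Qed.

Lemma n2_cvg_n2 (u : nat -> R -> R) F : (forall n, L2 (u n)) -> L2 F ->
  n2 (fun x => u n x - F x) @[n --> \oo] --> 0 -> n2 (u n) @[n --> \oo] --> n2 F.
Proof.
move=> Lu LF uF; apply/cvgrPdist_le => e e0.
have /cvgrPdist_le/(_ e e0) := uF; apply: filterS => n.
rewrite sub0r normrN (ger0_norm (n2_ge0 _)); apply: le_trans.
have t1 : n2 F <= n2 (u n) + n2 (fun x => u n x - F x).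
  rewrite n2BC -[X in X <= _](@eq_n2 _ (fun x => u n x + (F x - u n x))).
    exact: n2D (Lu n) (L2B LF (Lu n)).
  by move=> x; rewrite addrC subrK.
have t2 : n2 (u n) <= n2 F + n2 (fun x => u n x - F x).
  rewrite -[X in X <= _](@eq_n2 _ (fun x => F x + (u n x - F x))).
    exact: n2D LF (L2B (Lu n) LF).
  by move=> x; rewrite addrC subrK.
by rewrite ler_norml; apply/andP; split; lra.
Qed.

Lemma n2_cvg_ip (u v : nat -> R -> R) F G : (forall n, L2 (u n)) -> L2 F ->
  (forall n, L2 (v n)) -> L2 G ->
  n2 (fun x => u n x - F x) @[n --> \oo] --> 0 ->
  n2 (fun x => v n x - G x) @[n --> \oo] --> 0 -> ip (u n) (v n) @[n --> \oo] --> ip F G.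
Proof.
move=> Lu LF Lv LG uF vG; apply/subr_cvg0/norm_cvg0P.
apply: (@cvg0_le _ _ (fun n => n2 (fun x => u n x - F x) * n2 (v n) +
  n2 F * n2 (fun x => v n x - G x))) => [n|].
  rewrite normr_ge0/=.
  have -> : ip (u n) (v n) - ip F G =
    ip (fun x => u n x - F x) (v n) + ip F (fun x => v n x - G x).
    have e1 := ipBl (Lu n) LF (Lv n); have e2 := ipBl (Lv n) LG LF.
    rewrite e1 (ipC F (fun x => v n x - G x)) e2 !(ipC _ F).
    by move: (ip _ _) (ip _ _) (ip _ _) => *; ring.
  apply: le_trans (ler_normD _ _) _; rewrite lerD//; apply: cauchy_schwarz => //;
    exact: L2B.
rewrite -[X in _ --> X](addr0 0); apply: cvgD.
  by rewrite -[X in _ --> X](mul0r (n2 G)); apply: cvgM => //; exact: n2_cvg_n2.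
by rewrite -[X in _ --> X](mulr0 (n2 F)); apply: cvgM => //; exact: cvg_cst.
Qed.

Lemma hart_le f : L2 f -> n2 (hart f) <= n2 f.
Proof.
move=> Lf; have [LH cH] := hartP Lf.
have L n := (H1_trunc n Lf).1.
have c1 := n2_cvg_n2 L LH cH.
have c2 := n2_cvg_n2 (fun n => trunc_L2 n Lf) Lf (trunc_cvg Lf).
apply: (ler_cvg_to c1 c2); apply: nearW => n.
exact: (H1_trunc n Lf).2.
Qed.

Lemma hart_sym f g : L2 f -> L2 g -> ip (hart f) g = ip f (hart g).
Proof.
move=> Lf Lg; have [LHf cf] := hartP Lf; have [LHg cg] := hartP Lg.
have T n := trunc_L2 n Lf; have T' n := trunc_L2 n Lg.
have c1 := n2_cvg_ip (fun n => (H1_trunc n Lf).1) LHf T' Lg cf (trunc_cvg Lg).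
have c2 := n2_cvg_ip T Lf (fun n => (H1_trunc n Lg).1) LHg (trunc_cvg Lf) cg.
rewrite -(cvg_lim (@Rhausdorff R) c1) -(cvg_lim (@Rhausdorff R) c2).
rewrite (_ : (fun n => _) = fun n => ip (trunc n f) (H1 (trunc n g)))//.
by apply/funext => n; rewrite H1_sym//; exact: trunc_L1.
Qed.

Lemma hart_ind a b : a < b -> aeq (H1 (ind a b)) (hart (ind a b)).
Proof.
move=> ab; have Li := L2_ind a b.
have [LI _] : L2 (H1 (ind a b)) /\ n2 (H1 (ind a b)) <= n2 (ind a b).
  by apply: (H1_contr (ltW ab) Li) => x; rewrite -expr2 ind_sqr.
apply: hart_uniq => //; apply: cvg_near_cst; near=> n.
have -> : trunc n (ind a b) = ind a b.
  apply/funext => x; rewrite /trunc /ind !in_itv/=.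
  case: (boolP (a <= x <= b)) => [/andP[ax xb]|_]; last by rewrite mul0r.
  rewrite -ler_norml (_ : _ <= _) ?mulr1//.
  apply: (@le_trans _ _ (`|a| + `|b|)).
    rewrite ler_norml; have := ler_norm b; have := ler_norm (- a); rewrite normrN.
    have := normr_ge0 a; have := normr_ge0 b => *; apply/andP; split; lra.
  by near: n; exact: nbhs_infty_ger.
rewrite (@eq_n2 _ _ (fun=> 0)) ?n20// => x; exact: subrr.
Unshelve. all: by end_near. Qed.

Lemma hart_parseval_ind f a b : a < b -> L2 f ->
  ip (hart f) (hart (ind a b)) = ip f (ind a b).
Proof.
move=> ab Lf; have [LH cH] := hartP Lf.
have Li := L2_ind a b; have [LI _] := hartP Li.
have z : n2 (fun=> 0 : R) @[_ --> \oo] --> 0.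
  by rewrite n20; exact: cvg_cst.
have cz (g : R -> R) : n2 (fun x => g x - g x) @[n --> \oo] --> 0.
  by rewrite (@eq_n2 _ _ (fun=> 0)) // => x; exact: subrr.
have c1 := n2_cvg_ip (fun n => (H1_trunc n Lf).1) LH (fun=> LI) LI cH (cz _).
have c2 := n2_cvg_ip (fun n => trunc_L2 n Lf) Lf (fun=> Li) Li (trunc_cvg Lf) (cz _).
rewrite -(cvg_lim (@Rhausdorff R) c1) -(cvg_lim (@Rhausdorff R) c2).
rewrite (_ : (fun n => _) = fun n => ip (trunc n f) (ind a b))//.
apply/funext => n; rewrite -(H1_parseval_ind ab (nn_le n) (trunc_L2 n Lf) (@trunc_supp n f)).
apply: ip_aeq.
- exact: (H1_trunc n Lf).1.1.
- exact: (H1_trunc n Lf).1.1.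
- exact: LI.1.
- exact: H1_meas (L1_ind a b).
- exact: aeqW.
- exact/aeq_sym/hart_ind.
Qed.

(** Symmetry moves one transform onto an indicator and [hart_parseval_ind] concludes; pairings with
    indicators determine an element of L2. *)
Lemma hartK f : L2 f -> aeq (hart (hart f)) f.
Proof.
move=> Lf; apply: ip_ind_aeq => // [|a b ab]; first exact/hart_L2/hart_L2.
by rewrite hart_sym ?hart_parseval_ind//; [exact: hart_L2|exact: L2_ind].
Qed.

(** The reverse inequality is the contraction property applied to [hart f], whose transform is [f]
    again. *)
Lemma hart_n2 f : L2 f -> n2 (hart f) = n2 f.
Proof.
move=> Lf; apply/eqP; rewrite eq_le hart_le//=.
have LH := hart_L2 Lf; have LHH := hart_L2 LH.
rewrite -(n2_aeq LHH.1 Lf.1 (hartK Lf)); exact: hart_le.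
Qed.

Lemma hart_aeq f g : L2 f -> L2 g -> aeq f g -> aeq (hart f) (hart g).
Proof.
move=> Lf Lg fg; have [LH cH] := hartP Lf; apply: (hart_uniq Lg LH).
rewrite (_ : (fun n => _) = fun n => n2 (fun x => H1 (trunc n f) x - hart f x)); first exact: cH.
apply/funext => n; congr n2; apply/funext => x; congr (_ - _).
apply: H1_aeq (trunc_L1 n Lg) (trunc_L1 n Lf) _.
by apply: ae_S fg => y; rewrite /trunc => ->.
Qed.

Lemma hartB f g : L2 f -> L2 g ->
  aeq (hart (fun x => f x - g x)) (fun x => hart f x - hart g x).
Proof.
move=> Lf Lg; have [LHf cf] := hartP Lf; have [LHg cg] := hartP Lg.
apply/aeq_sym/hart_uniq; [exact: L2B|exact: L2B|].
apply: (@cvg0_le _ _ (fun n => n2 (fun x => H1 (trunc n f) x - hart f x) +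
   n2 (fun x => H1 (trunc n g) x - hart g x))) => [n|].
  rewrite n2_ge0/=.
  have L := L2B (H1_trunc n Lf).1 LHf; have L' := L2B (H1_trunc n Lg).1 LHg.
  apply: le_trans (n2B L L'); rewrite le_eqVlt; apply/orP; left; apply/eqP.
  apply: eq_n2 => x.
  have -> : trunc n (fun x => f x - g x) = fun x => trunc n f x - trunc n g x.
    by apply/funext => y; rewrite /trunc mulrBl.
  rewrite (H1B _ (trunc_L1 n Lf) (trunc_L1 n Lg)).
  by move: (H1 _ x) (H1 _ x) (hart _ x) (hart _ x) => *; ring.
exact: (cvg0D cf cg).
Qed.

Lemma hartZ k f : L2 f -> aeq (hart (fun x => k * f x)) (fun x => k * hart f x).
Proof.
move=> Lf; have [LHf cf] := hartP Lf.
apply/aeq_sym/hart_uniq; [exact: L2Z|exact: L2Z|].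
apply: (@cvg0_le _ _ (fun n => `|k| * n2 (fun x => H1 (trunc n f) x - hart f x))) => [n|].
  rewrite n2_ge0/= -n2Z; last exact: L2B (H1_trunc n Lf).1 LHf.
  rewrite le_eqVlt; apply/orP; left; apply/eqP; apply: eq_n2 => x.
  have -> : trunc n (fun x => k * f x) = fun x => k * trunc n f x.
    by apply/funext => y; rewrite /trunc mulrA.
  by rewrite H1Z ?mulrBr//; exact: trunc_L1.
exact: (cvg0Z `|k| cf).
Qed.

Lemma hartD f g : L2 f -> L2 g ->
  aeq (hart (fun x => f x + g x)) (fun x => hart f x + hart g x).
Proof.
move=> Lf Lg; have Ng := L2N Lg.
have e1 := hartB Lf Ng; have e2 := hartZ (-1) Lg.
rewrite (_ : (fun x => f x + g x) = fun x => f x - - g x); last first.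
  by apply/funext => x; rewrite opprK.
apply: aeq_trans e1 _.
rewrite (_ : (fun x => - g x) = fun x => -1 * g x); last first.
  by apply/funext => x; rewrite mulN1r.
by apply: ae_S e2 => x ->; rewrite mulN1r opprK.
Qed.

End Hartley.

(** * Absolutely continuous functions *)

Section Primitive.
Context {R : realType}.
Local Notation mu := (@lebesgue_measure R).
Implicit Types (f g h u w : R -> R) (a b c d x y e xi : R).

(* [f] is locally absolutely continuous, with derivative [f1]. *)
Record prim f f1 : Prop := MkPrim { _ : loc f1;
  _ : forall a b, a <= b -> \int[mu]_x (f1 x * ind a b x) = f b - f a }.
Coercion pair_of_prim f f1 (H : prim f f1) := let: MkPrim m i := H in (m, i).

Lemma primD f g f1 g1 : prim f f1 -> prim g g1 ->
  prim (fun x => f x + g x) (fun x => f1 x + g1 x).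
Proof.
move=> [lf pf] [lg pg]; split; first exact: locD.
move=> a b ab; have := pf a b ab; have := pg a b ab => eg ef.
rewrite (@eq_int _ _ (fun x => f1 x * ind a b x + g1 x * ind a b x)); last first.
  by move=> x; rewrite mulrDl.
by rewrite (intD (lf.2 a b) (lg.2 a b)) ef eg; ring.
Qed.

Lemma primZ k f f1 : prim f f1 -> prim (fun x => k * f x) (fun x => k * f1 x).
Proof.
move=> [lf pf]; split; first exact: locZ.
move=> a b ab; rewrite (@eq_int _ _ (fun x => k * (f1 x * ind a b x))); last first.
  by move=> x; rewrite mulrA.
by rewrite (intZ _ (lf.2 a b)) (pf a b ab) mulrBr.
Qed.

Lemma primB f g f1 g1 : prim f f1 -> prim g g1 ->
  prim (fun x => f x - g x) (fun x => f1 x - g1 x).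
Proof.
move=> pf /(primZ (-1)) pg; have := primD pf pg.
have e (u v : R -> R) : (fun x => u x - v x) = fun x => u x + -1 * v x.
  by apply/funext => x; rewrite mulN1r.
by rewrite -!e.
Qed.

Lemma prim_cst c : prim (fun=> c) (fun=> 0).
Proof.
split; first by apply: cont_loc => x; exact: cvg_cst.
move=> a b _; rewrite (@eq_int _ _ (fun=> 0)); last by move=> x; rewrite mul0r.
by rewrite subrr /Rintegral integral0.
Qed.

Lemma loc_aeq f g : measurable_fun setT g -> aeq f g -> loc f -> loc g.
Proof.
move=> mg fg [mf lf]; split=> // a b; apply: L1_aeq (lf a b).
  by apply: measurable_funM => //; exact: meas_ind.
by apply: ae_S fg => x ->.
Qed.

Lemma prim_aeq f f1 g1 : measurable_fun setT g1 -> aeq f1 g1 -> prim f f1 -> prim f g1.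
Proof.
move=> mg fg [lf pf]; split; first exact: loc_aeq fg lf.
move=> a b ab; rewrite -(pf a b ab); apply: int_aeq.
- by apply: measurable_funM => //; exact: meas_ind.
- by apply: measurable_funM (meas_ind _ _); exact: lf.1.
- by apply: ae_S fg => x ->.
Qed.

Lemma prim_uniq f f1 g1 : prim f f1 -> prim f g1 -> aeq f1 g1.
Proof.
move=> [lf pf] [lg pg]; have := int_itv0_aeq (locB lf lg).
move=> /(_ _)/wrap[].
  move=> a b ab; rewrite (@eq_int _ _ (fun x => f1 x * ind a b x - g1 x * ind a b x)).
    by rewrite (intB (lf.2 a b) (lg.2 a b)) pf ?pg ?ltW// subrr.
  by move=> x; rewrite mulrBl.
by apply: ae_S => x /subr0_eq.
Qed.

Lemma prim_cont f f1 : prim f f1 -> continuous f.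
Proof.
move=> [lf pf] x.
have x1 : x - 1 <= x + 1 by lra.
have ii : mu.-integrable `[x - 1, x + 1] (EFin \o f1) by apply/L1_itv; [exact: lf.1|exact: lf.2].
have := @parameterized_integral_continuous R _ _ f1 x1 ii.
move=> /continuous_within_itvP; have x2 : x - 1 < x + 1 by lra.
move=> /(_ x2)[+ _ _] => /(_ x); rewrite in_itv/=.
move=> /(_ _)/wrap[]; first by apply/andP; split; lra.
move=> cx; have e y : x - 1 <= y -> f y = f (x - 1) + parameterized_integral mu (x - 1) y f1.
  by move=> h; rewrite /parameterized_integral int_itv (pf _ _ h); ring.
have : (fun y => f (x - 1) + parameterized_integral mu (x - 1) y f1) @ x --> f x.
  rewrite [f x]e ?gerBl//.
  exact: (cvgD (cvg_cst (f (x - 1))) (cx : _ --> parameterized_integral mu (x - 1) x f1)).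
apply: cvg_trans; apply: near_eq_cvg; near=> y; apply/esym/e.
by near: y; apply: lt_le_nbhsr; lra.
Unshelve. all: by end_near. Qed.

Lemma derv_prim f f1 : (forall x, is_derive x 1 f (f1 x)) -> continuous f1 -> prim f f1.
Proof.
move=> df cf; split; first exact: cont_loc.
by move=> a b ab; exact: ftc2.
Qed.

Lemma meas_le2 : meas2 (fun x y : R => (y <= x)%R%:R : R).
Proof.
rewrite /meas2 (_ : (fun z : R * R => _) = \1_[set z : R * R | (z.2 <= z.1)%R]).
  apply: measurable_indic; rewrite -[X in measurable X]setTI.
  exact: (measurable_fun_ler measurable_snd measurable_fst).
by apply/funext => z; rewrite indicE mem_setE.
Qed.

Lemma cont_bdd_itv g a b : continuous g -> exists C, forall x, `|g x * ind a b x| <= C.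
Proof.
move=> cg; have ck : compact (g @` `[a, b]).
  by apply: continuous_compact; [exact: continuous_subspaceT|exact: segment_compact].
have [M [_ /(_ (`|M| + 1)) MK]] := compact_bounded ck.
exists (`|M| + 1) => x; rewrite /ind; case: (boolP (x \in _)) => xab; last first.
  by rewrite mulr0 normr0 addr_ge0.
rewrite mulr1; apply: MK; last by exists x.
by rewrite (le_lt_trans (ler_norm _))// ltrDl.
Qed.

Lemma locM_cont f g : loc f -> continuous g -> loc (fun x => f x * g x).
Proof.
move=> [mf lf] cg; have mg := continuous_measurable_fun cg.
split=> [|a b]; first exact: measurable_funM.
have [C bC] := cont_bdd_itv a b cg.
have mgi : measurable_fun setT (fun x => g x * ind a b x).
  by apply: measurable_funM => //; exact: meas_ind.
apply: eq_L1 (L1M_bd (lf a b) mgi bC) => x.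
by rewrite -[in RHS](ind_sqr a b x); ring.
Qed.

(** Fubini for [f1 x * g1 y] on the triangle a <= y <= x <= b: integrating first in [y] or first in
    [x] produces the two terms of the integration by parts. *)
Lemma primM f g f1 g1 : prim f f1 -> prim g g1 ->
  prim (fun x => f x * g x) (fun x => f1 x * g x + f x * g1 x).
Proof.
move=> pF pG; have cf := prim_cont pF; have cg := prim_cont pG.
have [lf pf] := pF; have [lg pg] := pG.
have l1 := locM_cont lf cg; have l2 := locM_cont lg cf.
have l2' : loc (fun x => f x * g1 x).
  by rewrite (_ : (fun x => f x * g1 x) = fun x => g1 x * f x)//; apply/funext => x; rewrite mulrC.
split; first exact: locD.
move=> a b ab.
have b1 x y : `|(y <= x)%R%:R : R| <= 1 by rewrite normr_nat lern1 leq_b1.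
have [_ E] := swap (lf.2 a b) (lg.2 a b) meas_le2 b1.
have E1 : \int[mu]_x (f1 x * ind a b x * \int[mu]_y (g1 y * ind a b y * (y <= x)%R%:R)) =
    \int[mu]_x (f1 x * g x * ind a b x - g a * (f1 x * ind a b x)).
  apply: eq_int => x; rewrite {1 3 4}/ind in_itv/=.
  case: (boolP (a <= x <= b)) => [/andP[ax xb]|_]; last by rewrite !(mulr0, mul0r) subr0.
  rewrite (@eq_int _ _ (fun y => g1 y * ind a x y)).
    by rewrite (pg a x ax); ring.
  move=> y; rewrite /ind !in_itv/= -mulrA -natrM mulnb; congr (_ * (nat_of_bool _)%:R).
  case: (lerP y x) => yx; last by rewrite !andbF.
  by rewrite (le_trans yx xb) !andbT.
have E2 : \int[mu]_y (g1 y * ind a b y * \int[mu]_x (f1 x * ind a b x * (y <= x)%R%:R)) =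
    \int[mu]_y (f b * (g1 y * ind a b y) - f y * g1 y * ind a b y).
  apply: eq_int => y; rewrite {1 3 4}/ind in_itv/=.
  case: (boolP (a <= y <= b)) => [/andP[ay yb]|_]; last by rewrite !(mulr0, mul0r) subr0.
  rewrite (@eq_int _ _ (fun x => f1 x * ind y b x)).
    by rewrite (pf y b yb); ring.
  move=> x; rewrite /ind !in_itv/= -mulrA -natrM mulnb; congr (_ * (nat_of_bool _)%:R).
  case: (lerP y x) => yx; last by rewrite andbF.
  by rewrite (le_trans ay yx) andbT.
have := E; rewrite E1 E2 (intB (l1.2 a b) (L1Z _ (lf.2 a b))).
rewrite (intB (L1Z _ (lg.2 a b)) (l2'.2 a b)) (intZ _ (lf.2 a b)) (intZ _ (lg.2 a b)).
rewrite (pf a b ab) (pg a b ab).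
move=> h; have -> : \int[mu]_x ((f1 x * g x + f x * g1 x) * ind a b x) =
    \int[mu]_x (f1 x * g x * ind a b x) + \int[mu]_x (f x * g1 x * ind a b x).
  by rewrite -(intD (l1.2 a b) (l2'.2 a b)); apply: eq_int => x; rewrite mulrDl.
move: (\int[mu]_x _) (\int[mu]_x _) h => I J h.
by rewrite -[J](subrK (g a * (f b - f a))) h; ring.
Qed.

(** Otherwise the integral of [f x + f (- x)] over an interval of length [M] beyond [N] would be at
    least [e * M] for every [M]. *)
Lemma L1_small_sym f e (N : nat) : L1 f -> 0 < e -> (forall x, 0 <= f x) ->
  exists2 x, N%:R <= x & f x + f (- x) <= e.
Proof.
move=> Lf e0 f0; apply: contrapT => h.
have {}h x : N%:R <= x -> e <= f x + f (- x).
  by move=> Nx; rewrite leNgt; apply/negP => /ltW fx; apply: h; exists x.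
pose v x := f x + f (- x); have Lv : L1 v := L1D Lf (L1_refl Lf).
have key (M : nat) : e * M%:R <= \int[mu]_x v x.
  have c : continuous (fun _ : R => e) by move=> x; exact: cvg_cst.
  have NM : (N%:R : R) <= N%:R + M%:R by rewrite lerDl.
  have := ftc2 NM (derv_lin e) c; rewrite -mulrBr addrAC subrr add0r => <-.
  apply: int_le => //; first exact: (cont_loc c).2.
  move=> x; rewrite /ind in_itv/=; case: (boolP (_ && _)) => [/andP[Nx _]|_].
    by rewrite mulr1 h.
  by rewrite mulr0 addr_ge0.
set I := \int[mu]_x v x in key.
have := key (Num.Def.truncn (`|I| / e)).+1; apply/negP; rewrite -ltNge.
rewrite (le_lt_trans (ler_norm _))// -ltr_pdivrMl// mulrC; exact: truncnS_gt.
Qed.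

(** Boundary terms are handled without proving decay of [u]: it is enough that [u] is small at one
    pair of far points [x] and [- x], supplied by [L1_small_sym]. *)
Lemma prim_int0 u u1 : prim u u1 -> L1 u -> L1 u1 -> \int[mu]_x u1 x = 0.
Proof.
move=> [_ pu] Lu Lu1; apply/eqP; rewrite -normr_eq0 eq_le normr_ge0 andbT.
apply/ler_addgt0Pl => e e0; rewrite addr0.
have e2 : 0 < e / 2 by rewrite divr_gt0.
have /cvgrPdist_le/(_ _ e2)[N _ NP] := int_trunc_cvg (L1_norm Lu1).
have [x Nx ux] := L1_small_sym N (L1_norm Lu) e2 (fun x => normr_ge0 (u x)).
have x0 : - x <= x by have : (0 : R) <= N%:R by []; lra.
have Li : L1 (fun y => u1 y * ind (- x) x y) by exact: (L1_loc Lu1).2.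
have LN : L1 (fun y => `|u1 y| * ind (- N%:R) N%:R y) by exact: (L1_loc (L1_norm Lu1)).2.
have -> : \int[mu]_x u1 x = \int[mu]_y (u1 y - u1 y * ind (- x) x y) + (u x - u (- x)).
  by rewrite (intB Lu1 Li) (pu _ _ x0) subrK.
rewrite (le_trans (ler_normD _ _))// [e]splitr lerD//; last first.
  by rewrite (le_trans (ler_normB _ _)).
apply: le_trans (int_norm (L1B Lu1 Li)) _.
have h := NP N (leqnn N); rewrite /= ger0_norm in h.
  apply: le_trans h; rewrite -(intB (L1_norm Lu1) LN).
  apply: int_le; [exact/L1_norm/L1B|exact: L1B (L1_norm Lu1) LN|] => y.
  have -> : u1 y - u1 y * ind (- x) x y = u1 y * (1 - ind (- x) x y) by ring.
  have -> : `|u1 y| - `|u1 y| * ind (- N%:R) N%:R y = `|u1 y| * (1 - ind (- N%:R) N%:R y) by ring.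
  rewrite normrM ler_wpM2l// /ind !in_itv/= -!ler_norml.
  case: (lerP `|y| x) => yx; case: (lerP `|y| N%:R) => yN; rewrite ?subrr ?normr0 ?subr0 ?normr1//.
  by have := le_lt_trans (le_trans yN Nx) yx; rewrite ltxx.
rewrite subr_ge0; apply: int_le LN (L1_norm Lu1) _ => y.
by rewrite ler_piMr//; case/andP: (ind01 (- N%:R) N%:R y).
Qed.

(** The transforms of truncations converge pointwise to [H1 h] and in L2 to [hart h]; Fatou forces
    the two limits to agree. *)
Lemma hart_L1 h : L1 h -> L2 h -> aeq (hart h) (H1 h).
Proof.
move=> L1h L2h; have [LH cH] := hartP L2h.
have T n := (H1_trunc n L2h).1.
have pw x : H1 (trunc n h) x @[n --> \oo] --> H1 h x.
  rewrite !H1E; under eq_fun do rewrite H1E.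
  have := int_trunc_cvg (L1M_bd L1h (meas_kH x) (kH_bd x)).
  apply: cvg_trans; apply: near_eq_cvg; apply: nearW => n; apply: eq_int => y.
  by rewrite /trunc; ring.
have mD : measurable_fun setT (fun x => H1 h x - hart h x).
  by apply: measurable_funB (LH.1); exact: H1_meas.
have key e : 0 < e -> L1 (fun x => (H1 h x - hart h x) ^+ 2) /\
    \int[mu]_x ((H1 h x - hart h x) ^+ 2) <= e ^+ 2.
  move=> e0; apply: (@fatouR R (fun n x => (H1 (trunc n h) x - hart h x) ^+ 2)).
  - by move=> n; case: (L2B (T n) LH).
  - by move=> n x; exact: sqr_ge0.
  - by move=> x; exact: sqr_ge0.
  - exact: measurable_funX.
  - apply: aeW => x; have c : (fun n => H1 (trunc n h) x - hart h x) @ \oo --> H1 h x - hart h x.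
      exact: (cvgB (pw x) (cvg_cst (hart h x))).
    exact: (cvgM c c).
  - have /cvgrPdist_le/(_ e e0) := cH; apply: filterS => n.
    rewrite sub0r normrN (ger0_norm (n2_ge0 _)) => le.
    by rewrite -n2sq lerXn2r ?nnegrE ?n2_ge0 ?(ltW e0).
have [LD _] := key 1 ltr01.
have z : \int[mu]_x ((H1 h x - hart h x) ^+ 2) = 0.
  apply/eqP; rewrite eq_le int_ge0 ?andbT; last by move=> x; exact: sqr_ge0.
  apply/ler_addgt0Pl => e e0; rewrite addr0.
  have e0' : 0 < Num.sqrt e by rewrite sqrtr_gt0.
  have [_] := key _ e0'; by rewrite sqr_sqrtr// ltW.
have := int_eq0 LD (fun x => sqr_ge0 _) z; apply: ae_S => x /eqP.
by rewrite sqrf_eq0 subr_eq0 => /eqP ->.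
Qed.

(* Differentiation, seen through the Hartley transform. *)
Definition dsym h xi := - (2 * pi * xi * h (- xi)).

(** The transform of an indicator is a difference of kernel values divided by 2 pi xi, and the
    factor in [dsym] cancels that denominator. *)
Lemma H1_ind_dsym h a b xi : a <= b ->
  dsym h xi * H1 (ind a b) xi = h (- xi) * kH b (- xi) - h (- xi) * kH a (- xi).
Proof.
move=> ab; have [->|x0] := eqVneq xi 0.
  by rewrite /dsym /kH oppr0 !mulr0 mul0r oppr0 mul0r subrr.
set B := 2 * pi * xi; have B0 : B != 0 by rewrite !mulf_neq0// gt_eqF// pi_gt0.
rewrite /dsym -/B.
have -> : H1 (ind a b) xi = (sin (B * b) - cos (B * b)) / B - (sin (B * a) - cos (B * a)) / B.
  have d x : is_derive x 1 (fun x => (sin (B * x) - cos (B * x)) / B) (kH x xi).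
    have h1 := dervM (dervD (derv_sinlin B x) (dervZ (-1) (derv_coslin B x))) (derv_cst B^-1 x).
    rewrite (_ : (fun x => _) = fun x => (sin (B * x) + -1 * cos (B * x)) / B); last first.
      by apply/funext => y; rewrite mulN1r.
    apply: (is_derive_eq h1); rewrite /kH /cas (_ : 2 * pi * x * xi = B * x); last by rewrite /B; ring.
    by field.
  have ck : continuous (fun x => kH x xi).
    move=> x; apply: (@continuous_comp _ _ _ (fun x => 2 * pi * x * xi)); last exact: cont_cas.
    by apply: cvgM; [apply: cvgM; [exact: cvg_cst|exact: cvg_id]|exact: cvg_cst].
  rewrite -(ftc2 ab d ck) H1E; apply: eq_int => x; by rewrite kHC mulrC.
rewrite /kH /cas.
have E c : 2 * pi * c * - xi = - (B * c) by rewrite /B; ring.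
by rewrite !E !cosN !sinN; move: (h _) (sin _) (sin _) (cos _) (cos _) => *; field.
Qed.

(** The integral over [a, b] is a pairing with an indicator; symmetry moves the transform onto the
    indicator, where [H1_ind_dsym] computes it. *)
Lemma prim_hart h : L1 h -> L2 h -> L2 (dsym h) -> prim (H1 h) (hart (dsym h)).
Proof.
move=> L1h L2h Ld; have LH := hart_L2 Ld; split; first exact: L2_loc.
move=> a b; rewrite le_eqVlt => /predU1P[->|ab].
  rewrite subrr -int_itv set_itv1; exact: Rintegral_set1.
have Lk c : L1 (fun x => h x * kH c x) by exact: L1M_bd L1h (meas_kH c) (kH_bd c).
transitivity (ip (dsym h) (H1 (ind a b))).
  rewrite -[LHS]/(ip (hart (dsym h)) (ind a b)) hart_sym//; last exact: L2_ind.
  apply: ip_aeq; [exact: Ld.1|exact: Ld.1|exact: (hart_L2 (L2_ind a b)).1| | |].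
  - exact: H1_meas (L1_ind a b).
  - exact: aeqW.
  - exact/aeq_sym/hart_ind.
rewrite /ip (eq_int (fun xi => H1_ind_dsym h xi (ltW ab))).
rewrite (int_refl (L1B (Lk b) (Lk a))) (intB (Lk b) (Lk a)).
by rewrite !H1E.
Qed.

Lemma dsym_ind_L2 a b : L2 (dsym (ind a b)).
Proof.
have m : measurable_fun setT (dsym (ind a b)).
  apply: measurable_funN; apply: measurable_funM; first exact: measurable_funM.
  by apply: measurableT_comp; [exact: meas_ind|exact: oppr_measurable].
apply: (@L2_le _ _ (fun x => 2 * pi * (`|a| + `|b|) * ind a b (- x))) m _ _.
  move=> x; rewrite /dsym normrN !normrM /ind in_itv/=.
  have p0 := pi_gt0 R; rewrite (gtr0_norm p0) ger0_norm//.
  case: (boolP (_ && _)) => [/andP[ax xb]|_]; last by rewrite normr0 !mulr0.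
  rewrite normr1 !mulr1 ler_wpM2l//; first by rewrite mulr_ge0// ltW.
  rewrite ler_norml; have := ler_norm b; have := ler_norm (- a); rewrite normrN.
  by have := normr_ge0 a; have := normr_ge0 b => *; apply/andP; split; lra.
exact: (L2Z _ (L2_refl (L2_ind a b))).
Qed.

(** By duality: for an indicator [k] the function [H1 k] is absolutely continuous with derivative in
    L2, so the integral of the derivative of [h * H1 k] vanishes by [prim_int0]. Symmetry turns this
    into the claim tested against [k]. *)
Lemma hart_prim h h1 : L2 h -> L2 h1 -> prim h h1 -> aeq (hart h1) (dsym (hart h)).
Proof.
move=> Lh Lh1 ph; have Hh := hart_L2 Lh; have Hh1 := hart_L2 Lh1.
have md : measurable_fun setT (dsym (hart h)).
  apply: measurable_funN; apply: measurable_funM; first exact: measurable_funM.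
  by apply: measurableT_comp; [exact: Hh.1|exact: oppr_measurable].
have ld : loc (dsym (hart h)).
  have l := locM_cont (L2_loc (L2_refl Hh)) (f := _) (g := fun x : R => - (2 * pi * x)).
  rewrite (_ : dsym (hart h) = fun x => hart h (- x) * - (2 * pi * x)).
    by apply: l => x; apply: cvgN; apply: cvgM; [exact: cvg_cst|exact: cvg_id].
  by apply/funext => x; rewrite /dsym; ring.
have := int_itv0_aeq (locB (L2_loc Hh1) ld); move=> /(_ _)/wrap[]; last first.
  by apply: ae_S => x /subr0_eq.
move=> a b ab; set k := ind a b; have Lk : L2 k := L2_ind a b.
have Ldk : L2 (dsym k) := dsym_ind_L2 a b.
rewrite (@eq_int _ _ (fun x => hart h1 x * k x - dsym (hart h) x * k x)); last first.
  by move=> x; rewrite mulrBl.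
rewrite (intB (L2M Hh1 Lk) (ld.2 a b)).
have pk := prim_hart (L1_ind a b) Lk Ldk.
have Lpsi : L2 (H1 k) := L2_aeq (H1_meas (L1_ind a b)) (hart_L1 (L1_ind a b) Lk) (hart_L2 Lk).
have LHd := hart_L2 Ldk.
have P1 := L2M Lh1 Lpsi; have P2 := L2M Lh LHd.
have := prim_int0 (primM ph pk) (L2M Lh Lpsi) (L1D P1 P2); rewrite (intD P1 P2).
have -> : \int[mu]_x (h1 x * H1 k x) = \int[mu]_x (hart h1 x * k x).
  rewrite -[RHS]/(ip (hart h1) k) hart_sym//.
  apply: ip_aeq; [exact: Lh1.1|exact: Lh1.1|exact: Lpsi.1|exact: (hart_L2 Lk).1|exact: aeqW|].
  apply: aeq_sym; exact: hart_L1 (L1_ind a b) Lk.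
have -> : \int[mu]_x (h x * hart (dsym k) x) = - \int[mu]_x (dsym (hart h) x * k x).
  rewrite -[LHS]/(ip h (hart (dsym k))) -hart_sym// /ip.
  rewrite -(int_refl (L2M Hh Ldk)) -mulN1r -(intZ _ (ld.2 a b)).
  apply: eq_int => x; rewrite /dsym opprK; ring.
by [].
Qed.

End Primitive.

(** * Sobolev spaces *)

Section Sobolev.
Context {R : realType}.
Local Notation mu := (@lebesgue_measure R).
Implicit Types (f g h u w a b : R -> R) (c d x y e xi : R) (s k : nat).

Lemma br_sq x : bracket x ^+ 2 = 1 + x ^+ 2.
Proof. by rewrite /bracket sqr_sqrtr// addr_ge0 ?sqr_ge0. Qed.

Lemma br_ge1 x : 1 <= bracket x.
Proof. by rewrite -{1}sqrtr1 /bracket ler_wsqrtr// lerDl sqr_ge0. Qed.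

Lemma br_gt0 x : 0 < bracket x.
Proof. exact: lt_le_trans ltr01 (br_ge1 x). Qed.

Lemma brN x : bracket (- x) = bracket x.
Proof. by rewrite /bracket sqrrN. Qed.

Lemma br_geN x : `|x| <= bracket x.
Proof. by rewrite -sqrtr_sqr /bracket ler_wsqrtr// lerDr. Qed.

Lemma br_leD x : bracket x <= 1 + `|x|.
Proof.
rewrite -(ler_pXn2r (n := 2))// ?nnegrE ?addr_ge0 ?(ltW (br_gt0 _))//.
rewrite br_sq sqrrD expr1n -normrX (ger0_norm (sqr_ge0 x)) mul1r.
by rewrite -addrA lerD2l lerDr mulrn_wge0.
Qed.

Lemma brX_ge1 s x : 1 <= bracket x ^+ s.
Proof. by rewrite exprn_ege1// br_ge1. Qed.

Lemma brX_gt0 s x : 0 < bracket x ^+ s.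
Proof. by rewrite exprn_gt0// br_gt0. Qed.

Lemma brX_le s t x : (s <= t)%N -> bracket x ^+ s <= bracket x ^+ t.
Proof. by move=> st; rewrite ler_weXn2l// br_ge1. Qed.

Lemma cont_br : continuous (@bracket R).
Proof.
move=> x; apply: (@continuous_comp _ _ _ (fun x => 1 + x ^+ 2)); last exact: sqrt_continuous.
by apply: cvgD; [exact: cvg_cst|exact: (@exprn_continuous R 2)].
Qed.

Lemma meas_brX s : measurable_fun setT (fun x : R => bracket x ^+ s).
Proof. by apply: measurable_funX; exact: continuous_measurable_fun cont_br. Qed.

Definition wt s h xi := bracket xi ^+ s * h xi.
Record Wt s h : Prop := MkWt { _ : measurable_fun setT h; _ : L2 (wt s h) }.
Coercion pair_of_Wt s h (H : Wt s h) := let: MkWt m i := H in (m, i).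
Fact wn_sig : {n : nat -> (R -> R) -> R | forall s h, n s h = n2 (wt s h)}.
Proof. by eexists. Qed.
Definition wn := sval wn_sig.

Lemma wnE s h : wn s h = n2 (wt s h). Proof. exact: svalP wn_sig s h. Qed.

Lemma Wt_meas s h : measurable_fun setT h -> measurable_fun setT (wt s h).
Proof. by move=> mh; apply: measurable_funM; [exact: meas_brX|exact: mh]. Qed.

Lemma wt_le s t h x : (s <= t)%N -> `|wt s h x| <= `|wt t h x|.
Proof.
move=> st; rewrite /wt !normrM ler_wpM2r// !ger0_norm ?(ltW (brX_gt0 _ _))//.
exact: brX_le.
Qed.

Lemma Wt_le s t h : (s <= t)%N -> Wt t h -> Wt s h /\ wn s h <= wn t h.
Proof.
move=> st [mh Lh]; have L : L2 (wt s h).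
  by apply: L2_le (Wt_meas s mh) _ (L2_norm Lh) => x; exact: wt_le.
by split; [split|rewrite !wnE; apply: n2_le L Lh _ => x; exact: wt_le].
Qed.

Lemma wt0 h : wt 0 h = h.
Proof. by apply/funext => x; rewrite /wt expr0 mul1r. Qed.

Lemma Wt0P h : Wt 0 h <-> L2 h.
Proof. by split=> [[_]|Lh]; [|split; [exact: Lh.1|]]; rewrite wt0. Qed.

Lemma wn0 h : wn 0 h = n2 h.
Proof. by rewrite !wnE wt0. Qed.

Lemma Wt_L2 s h : Wt s h -> L2 h.
Proof. by move=> /(Wt_le (leq0n s))[] /Wt0P. Qed.

Lemma wt_aeq s h u : aeq h u -> aeq (wt s h) (wt s u).
Proof. by apply: ae_S => x; rewrite /wt => ->. Qed.

Lemma Wt_aeq s h u : measurable_fun setT u -> aeq h u -> Wt s h -> Wt s u.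
Proof.
move=> mu' hu [mh Lh]; split => //; apply: L2_aeq (Wt_meas s mu') (wt_aeq s hu) Lh.
Qed.

Lemma wn_aeq s h u : measurable_fun setT h -> measurable_fun setT u -> aeq h u ->
  wn s h = wn s u.
Proof.
move=> mh mu' hu; rewrite !wnE; exact: n2_aeq (Wt_meas s mh) (Wt_meas s mu') (wt_aeq s hu).
Qed.

Lemma wtD s h u : wt s (fun x => h x + u x) = fun x => wt s h x + wt s u x.
Proof. by apply/funext => x; rewrite /wt mulrDr. Qed.

Lemma wtZ s c h : wt s (fun x => c * h x) = fun x => c * wt s h x.
Proof. by apply/funext => x; rewrite /wt mulrCA. Qed.

Lemma wtB s h u : wt s (fun x => h x - u x) = fun x => wt s h x - wt s u x.
Proof. by apply/funext => x; rewrite /wt mulrBr. Qed.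

Lemma WtD s h u : Wt s h -> Wt s u -> Wt s (fun x => h x + u x).
Proof.
move=> [mh Lh] [mu' Lu]; split; first exact: measurable_funD.
by rewrite wtD; exact: L2D.
Qed.

Lemma WtZ s c h : Wt s h -> Wt s (fun x => c * h x).
Proof.
move=> [mh Lh]; split; first exact: measurable_funM.
by rewrite wtZ; exact: L2Z.
Qed.

Lemma wnD s h u : Wt s h -> Wt s u -> wn s (fun x => h x + u x) <= wn s h + wn s u.
Proof. by move=> [mh Lh] [mu' Lu]; rewrite !wnE wtD; exact: n2D. Qed.

Lemma wnZ s c h : Wt s h -> wn s (fun x => c * h x) = `|c| * wn s h.
Proof. by move=> [mh Lh]; rewrite !wnE wtZ; exact: n2Z. Qed.

Definition ibr x : R := (bracket x)^-1.

Lemma L2_ibr : L2 ibr.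
Proof.
have m : measurable_fun setT ibr.
  apply: continuous_measurable_fun => x; apply: cvgV; last exact: cont_br.
  by rewrite gt_eqF// br_gt0.
split=> //; apply: eq_L1 L1_iS => x.
by rewrite /iS /ibr exprVn br_sq.
Qed.

Definition C1 : R := n2 ibr.

(** Cauchy-Schwarz against the reciprocal bracket, which is square integrable in dimension one. This
    is the source of the embedding of H^s into continuous functions for s >= 1. *)
Lemma Wt_L1 s h : (1 <= s)%N -> Wt s h -> L1 h /\ \int[mu]_x `|h x| <= C1 * wn s h.
Proof.
move=> s1 Wh; have [[mh Lh] le1] := Wt_le s1 Wh.
have e x : ibr x * wt 1 h x = h x by rewrite /wt /ibr expr1 mulKf// gt_eqF// br_gt0.
have L : L1 h by apply: eq_L1 e (L2M L2_ibr Lh).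
split=> //; apply: le_trans (ler_wpM2l (n2_ge0 ibr) le1).
have := cauchy_schwarz L2_ibr (L2_norm Lh); rewrite n2_norm -wnE; apply: le_trans.
apply: le_trans (ler_norm _); rewrite le_eqVlt; apply/orP; left; apply/eqP.
apply: eq_int => x; rewrite -[in LHS]e normrM ger0_norm// /ibr invr_ge0.
exact/ltW/br_gt0.
Qed.

Definition S1 : R := 2 * C1.

Lemma C1_ge0 : 0 <= C1. Proof. exact: n2_ge0. Qed.

Lemma S1_ge0 : 0 <= S1. Proof. by rewrite mulr_ge0// C1_ge0. Qed.

Lemma H1_sup s h x : (1 <= s)%N -> Wt s h -> `|H1 h x| <= S1 * wn s h.
Proof.
move=> s1 Wh; have [L le] := Wt_L1 s1 Wh.
by apply: le_trans (H1_bd x L) _; rewrite /S1 -mulrA ler_pM2l.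
Qed.

(* Elements of H^s, s >= 1, represented by their continuous version. *)
Record A s f : Prop := MkA { _ : L2 f; _ : Wt s (hart f); _ : f = H1 (hart f) }.
Fact nrm_sig : {n : nat -> (R -> R) -> R | forall s f, n s f = wn s (hart f)}.
Proof. by eexists. Qed.
Definition nrm := sval nrm_sig.

Lemma nrmE s f : nrm s f = wn s (hart f). Proof. exact: svalP nrm_sig s f. Qed.

Lemma nrm_ge0 s f : 0 <= nrm s f.
Proof. by rewrite nrmE wnE n2_ge0. Qed.

Lemma H1_hart h : L1 h -> L2 h -> [/\ L2 (H1 h), aeq (hart (H1 h)) h & H1 (hart (H1 h)) = H1 h].
Proof.
move=> L1h L2h; have e := hart_L1 L1h L2h.
have L := L2_aeq (H1_meas L1h) e (hart_L2 L2h).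
have e2 : aeq (hart (H1 h)) h.
  by apply: aeq_trans (hart_aeq L (hart_L2 L2h) (aeq_sym e)) (hartK L2h).
have L1' : L1 (hart (H1 h)) by exact: (L1_aeq (hart_L2 L).1 (aeq_sym e2) L1h).
by split=> //; apply/funext => x; exact: (H1_aeq x L1' L1h e2).
Qed.

Lemma A_H1 s h : (1 <= s)%N -> Wt s h ->
  [/\ A s (H1 h), aeq (hart (H1 h)) h & nrm s (H1 h) = wn s h].
Proof.
move=> s1 Wh; have [L1h _] := Wt_L1 s1 Wh; have L2h := Wt_L2 Wh.
have [L e E] := H1_hart L1h L2h; have mh := (hart_L2 L).1.
split=> //; last by rewrite nrmE; exact: wn_aeq mh Wh.1 e.
by split=> //; exact: Wt_aeq mh (aeq_sym e) Wh.
Qed.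

Lemma A_L1 s f : (1 <= s)%N -> A s f -> L1 (hart f).
Proof. by move=> s1 [_ Wf _]; case: (Wt_L1 s1 Wf). Qed.

Lemma A_L2 s f : A s f -> L2 f.
Proof. by case. Qed.

Lemma A_le s t f : (s <= t)%N -> A t f -> A s f /\ nrm s f <= nrm t f.
Proof.
by move=> st [Lf Wf ef]; have [W le] := Wt_le st Wf; rewrite !nrmE.
Qed.

Lemma A_sup s f x : (1 <= s)%N -> A s f -> `|f x| <= S1 * nrm s f.
Proof. by move=> s1 [Lf Wf ef]; rewrite {1}ef nrmE; exact: H1_sup. Qed.

Lemma A_aeq s f g : (1 <= s)%N -> A s f -> A s g -> aeq f g -> f = g.
Proof.
move=> s1 Af Ag fg; have [Lf _ ef] := Af; have [Lg _ eg] := Ag; rewrite ef eg.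
by apply/funext => x; exact: (H1_aeq x (A_L1 s1 Af) (A_L1 s1 Ag) (hart_aeq Lf Lg fg)).
Qed.

Lemma A_of_L2 s f : (1 <= s)%N -> L2 f -> Wt s (hart f) ->
  A s (H1 (hart f)) /\ aeq (H1 (hart f)) f.
Proof.
move=> s1 Lf Wf; have [AH _ _] := A_H1 s1 Wf; split=> //.
have [L1f _] := Wt_L1 s1 Wf.
exact: aeq_trans (aeq_sym (hart_L1 L1f (hart_L2 Lf))) (hartK Lf).
Qed.

Lemma nrm_aeq s f g : L2 f -> L2 g -> aeq f g -> nrm s f = nrm s g.
Proof.
by move=> Lf Lg fg; rewrite !nrmE; exact: wn_aeq (hart_L2 Lf).1 (hart_L2 Lg).1 (hart_aeq Lf Lg fg).
Qed.

Lemma AD s f g : (1 <= s)%N -> A s f -> A s g ->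
  A s (fun x => f x + g x) /\ nrm s (fun x => f x + g x) <= nrm s f + nrm s g.
Proof.
move=> s1 Af Ag; have [Lf Wf ef] := Af; have [Lg Wg eg] := Ag.
have e := hartD Lf Lg; have Ls := L2D Lf Lg.
have W := WtD Wf Wg; have W' : Wt s (hart (fun x => f x + g x)).
  exact: Wt_aeq (hart_L2 Ls).1 (aeq_sym e) W.
split; last by rewrite !nrmE (wn_aeq s (hart_L2 Ls).1 W.1 e); exact: (wnD Wf Wg).
split=> //; apply/funext => x.
have l : L1 (fun xi => hart f xi + hart g xi) := L1D (A_L1 s1 Af) (A_L1 s1 Ag).
rewrite (H1_aeq x (Wt_L1 s1 W').1 l e) (H1D x (A_L1 s1 Af) (A_L1 s1 Ag)).
by rewrite -ef -eg.
Qed.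

Lemma AZ s c f : (1 <= s)%N -> A s f ->
  A s (fun x => c * f x) /\ nrm s (fun x => c * f x) = `|c| * nrm s f.
Proof.
move=> s1 Af; have [Lf Wf ef] := Af.
have e := hartZ c Lf; have Ls := L2Z c Lf.
have W := WtZ c Wf; have W' : Wt s (hart (fun x => c * f x)).
  exact: Wt_aeq (hart_L2 Ls).1 (aeq_sym e) W.
split; last by rewrite !nrmE (wn_aeq s (hart_L2 Ls).1 W.1 e); exact: (wnZ c Wf).
split=> //; apply/funext => x.
rewrite (H1_aeq x (Wt_L1 s1 W').1 (L1Z c (A_L1 s1 Af)) e) (H1Z c x (A_L1 s1 Af)).
by rewrite -ef.
Qed.

Lemma eq_A s f g : (forall x, f x = g x) -> A s f -> A s g.
Proof. by move=> /funext ->. Qed.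

Lemma eq_nrm s f g : (forall x, f x = g x) -> nrm s f = nrm s g.
Proof. by move=> /funext ->. Qed.

Lemma AB s f g : (1 <= s)%N -> A s f -> A s g ->
  A s (fun x => f x - g x) /\ nrm s (fun x => f x - g x) <= nrm s f + nrm s g.
Proof.
move=> s1 Af /(AZ (-1) s1)[Ag ng]; have [ADs nDs] := AD s1 Af Ag.
have e (x : R) : f x + -1 * g x = f x - g x by rewrite mulN1r.
by split; [exact: eq_A e ADs|rewrite -(eq_nrm s e) (le_trans nDs)// ng normrN normr1 mul1r].
Qed.

Lemma nrmBC s f g : (1 <= s)%N -> A s f -> A s g ->
  nrm s (fun x => f x - g x) = nrm s (fun x => g x - f x).
Proof.
move=> s1 Af Ag; have [AB' _] := AB s1 Ag Af; have [_ e] := AZ (-1) s1 AB'.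
by rewrite -[RHS]mul1r -(normr1 R) -normrN -e; apply: eq_nrm => x; ring.
Qed.

Lemma A0 s : (1 <= s)%N -> A s (fun=> 0) /\ nrm s (fun=> 0) = 0.
Proof.
move=> s1; have z (h : R -> R) : (fun x => 0 * h x) = fun=> 0 by apply/funext => x; rewrite mul0r.
have W : Wt s (fun=> 0 : R).
  split; first exact: measurable_cst.
  by rewrite (_ : wt s _ = fun=> 0); [exact: L20|apply/funext => x; rewrite /wt mulr0].
have [AH _ _] := A_H1 s1 W; have := AZ 0 s1 AH.
by rewrite z normr0 mul0r.
Qed.

Lemma nrm_eq0 s f : (1 <= s)%N -> A s f -> nrm s f = 0 -> forall x, f x = 0.
Proof.
move=> s1 Af n0 x; apply/eqP; rewrite -normr_le0.
by apply: le_trans (A_sup x s1 Af) _; rewrite n0 mulr0.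
Qed.

Lemma Wt_dsym s h : Wt s.+1 h -> Wt s (dsym h) /\ wn s (dsym h) <= 2 * pi * wn s.+1 h.
Proof.
move=> [mh Lh]; have m : measurable_fun setT (dsym h).
  apply: measurable_funN; apply: measurable_funM; first exact: measurable_funM.
  by apply: measurableT_comp; [exact: mh|exact: oppr_measurable].
have Lr : L2 (fun x => 2 * pi * wt s.+1 h (- x)) := L2Z _ (L2_refl Lh).
have bd x : `|wt s (dsym h) x| <= `|2 * pi * wt s.+1 h (- x)|.
  rewrite /wt /dsym brN mulrN normrN !normrM exprSr normrM (ger0_norm (ltW (br_gt0 x))).
  have aux (B H X b p q : R) : 0 <= B -> 0 <= H -> 0 <= p -> 0 <= q -> X <= b ->
      B * (p * q * X * H) <= p * q * (B * b * H).
    move=> B0 H0 p0 q0 Xb.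
    have -> : B * (p * q * X * H) = p * q * B * H * X by ring.
    have -> : p * q * (B * b * H) = p * q * B * H * b by ring.
    by rewrite ler_wpM2l// !mulr_ge0.
  exact: aux (br_geN x).
have L : L2 (wt s (dsym h)) by apply: L2_le (Wt_meas s m) bd (L2_norm Lr).
split=> //; rewrite !wnE; apply: le_trans (n2_le L Lr bd) _.
by rewrite (n2Z _ (L2_refl Lh)) (n2_refl Lh) ger0_norm// mulr_ge0// pi_ge0.
Qed.

(** The continuous representative of the derivative of [f]. *)
Definition dd f := H1 (dsym (hart f)).

Lemma A_dd s f : (1 <= s)%N -> A s.+1 f ->
  [/\ A s (dd f), nrm s (dd f) <= 2 * pi * nrm s.+1 f & prim f (dd f)].
Proof.
move=> s1 Af; have [Lf Wf ef] := Af; have [Wd nd] := Wt_dsym Wf.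
have [AH aH nH] := A_H1 s1 Wd; split=> //; first by rewrite nH nrmE.
have [Ld1 _] := Wt_L1 s1 Wd; have Ld := Wt_L2 Wd.
have := prim_hart (A_L1 (ltn0Sn s) Af) (hart_L2 Lf) Ld; rewrite -ef.
by apply: prim_aeq; [exact: H1_meas|exact: hart_L1].
Qed.

Lemma A1_prim f : A 1 f ->
  exists f1, [/\ L2 f1, n2 f1 <= 2 * pi * nrm 1 f & prim f f1].
Proof.
move=> Af; have [Lf Wf ef] := Af; have [Wd nd] := Wt_dsym Wf.
have Ld := Wt_L2 Wd; exists (hart (dsym (hart f))); split.
- exact: hart_L2.
- by rewrite (hart_n2 Ld) -wn0 nrmE.
- by have := prim_hart (A_L1 (leqnn 1) Af) (hart_L2 Lf) Ld; rewrite -ef.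
Qed.

Lemma wt_dsym_bd s h h1 : (forall x, h1 x = dsym h x) ->
  forall x, `|wt s.+1 h x| <= `|wt s h x| + `|wt s h1 (- x)|.
Proof.
move=> e x; rewrite /wt e /dsym brN opprK mulrN normrN !normrM normrN exprSr normrM.
rewrite (ger0_norm (ltW (br_gt0 x))).
have p2 : 1 <= `|2| * `|pi : R|.
  rewrite ger0_norm// ger0_norm ?pi_ge0//; have := @pi_ge2 R; lra.
have aux (B H X b q : R) : 1 <= q -> 0 <= B -> 0 <= H -> b <= 1 + X -> 0 <= X ->
  B * b * H <= B * H + B * (q * X * H); last exact: aux p2 _ _ (br_leD x) _.
move=> q1 B0 H0 bX X0.
apply: (@le_trans _ _ (B * H * (1 + X))).
  by have -> : B * b * H = B * H * b by [ring]; rewrite ler_wpM2l// mulr_ge0.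
have -> : B * H + B * (q * X * H) = B * H * (1 + q * X) by ring.
by rewrite ler_wpM2l ?mulr_ge0// lerD2l ler_peMl.
Qed.

(** Gain of one order: the transform of [f1] is [dsym] of that of [f], and the bracket is at most 1
    + |xi|. Stated for L2 data rather than for [A] so as to cover [s = 0], the base case of the
    algebra property. *)
Lemma A_up0 s f f1 : L2 f -> L2 f1 -> Wt s (hart f) -> Wt s (hart f1) -> prim f f1 ->
  A s.+1 f /\ nrm s.+1 f <= nrm s f + nrm s f1.
Proof.
move=> Lf Lf1 Wf Wf1 pf; have e := hart_prim Lf Lf1 pf.
have Hf := hart_L2 Lf; have md : measurable_fun setT (dsym (hart f)).
  apply: measurable_funN; apply: measurable_funM; first exact: measurable_funM.
  by apply: measurableT_comp; [exact: Hf.1|exact: oppr_measurable].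
have Wd : Wt s (dsym (hart f)) := Wt_aeq md e Wf1.
have Ls : L2 (fun x => `|wt s (hart f) x| + `|wt s (dsym (hart f)) (- x)|).
  exact: L2D (L2_norm Wf.2) (L2_norm (L2_refl Wd.2)).
have bd := wt_dsym_bd s (fun x => erefl (dsym (hart f) x)).
have L : L2 (wt s.+1 (hart f)).
  apply: L2_le (Wt_meas s.+1 Hf.1) bd Ls.
have W : Wt s.+1 (hart f) by split=> //; exact: Hf.1.
have [Wd' _] := Wt_dsym W; have Ld := Wt_L2 Wd'.
have [L1f _] := Wt_L1 (ltn0Sn s) W.
split; last first.
  rewrite {1}nrmE wnE; apply: (@le_trans _ _ (n2 (fun x => `|wt s (hart f) x| + `|wt s (dsym (hart f)) (- x)|))).
    apply: n2_le L Ls _ => x; apply: le_trans (bd x) _; exact: ler_norm.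
  apply: le_trans (n2D (L2_norm Wf.2) (L2_norm (L2_refl Wd.2))) _.
  rewrite !n2_norm (n2_refl Wd.2) -!wnE -nrmE lerD2l nrmE.
  by rewrite (wn_aeq s (hart_L2 Lf1).1 md e).
split=> //.
have pH := prim_hart L1f Hf Ld.
have eH : aeq (hart (dsym (hart f))) f1.
  by apply: aeq_trans (hart_aeq Ld (hart_L2 Lf1) (aeq_sym e)) (hartK Lf1).
have pD := primB pf (prim_aeq pf.1.1 eH pH).
(* [f] and [H1 (hart f)] have the same derivative almost everywhere, so they differ by a
   constant. *)
have D0 x y : f x - H1 (hart f) x = f y - H1 (hart f) y.
  wlog xy : x y / x <= y.
    by move=> h; case: (leP x y) => [/h//|/ltW /h ->].
  have := pD.2 _ _ xy; rewrite (@eq_int _ _ (fun=> 0)); last by move=> z; rewrite subrr mul0r.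
  by rewrite /Rintegral integral0 => /esym/subr0_eq.
have aH : aeq f (H1 (hart f)).
  exact: aeq_trans (aeq_sym (hartK Lf)) (hart_L1 L1f Hf).
apply/funext => x; apply/subr0_eq.
(* The constant is zero almost everywhere; its integral over [0, 1], an interval of length one, is
   the constant itself. *)
have c0 : aeq (fun y => (f x - H1 (hart f) x) * ind 0 1 y) (fun=> 0).
  by apply: ae_S aH => y; rewrite (D0 x y) => ->; rewrite subrr mul0r.
have m1 : measurable_fun setT (fun y => (f x - H1 (hart f) x) * ind 0 1 y).
  by apply: measurable_funM => //; exact: meas_ind.
have := int_aeq m1 (measurable_cst _) c0.
have cc : continuous (fun _ : R => f x - H1 (hart f) x) by move=> z; exact: cvg_cst.
rewrite (ftc2 ler01 (derv_lin _) cc) mulr1 mulr0 subr0 => ->.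
by rewrite /Rintegral integral0.
Qed.

Lemma A_up s f f1 : (1 <= s)%N -> A s f -> A s f1 -> prim f f1 ->
  A s.+1 f /\ nrm s.+1 f <= nrm s f + nrm s f1.
Proof. by move=> s1 [Lf Wf _] [Lf1 Wf1 _]; exact: A_up0. Qed.

Lemma n2_nrm s f : A s f -> n2 f <= nrm s f.
Proof. by move=> [Lf Wf _]; rewrite -(hart_n2 Lf) -wn0 nrmE; exact: (Wt_le (leq0n s) Wf).2. Qed.

Lemma L2M_sup f g c : L2 f -> measurable_fun setT g -> (forall x, `|g x| <= c) ->
  L2 (fun x => f x * g x) /\ n2 (fun x => f x * g x) <= c * n2 f.
Proof.
move=> Lf mg gc; have L := L2M_bd Lf mg gc; split=> //.
have c0 : 0 <= c := le_trans (normr_ge0 _) (gc 0).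
have <- : n2 (fun x => c * f x) = c * n2 f by rewrite (n2Z c Lf) ger0_norm.
apply: n2_le L (L2Z c Lf) _ => x; rewrite !normrM mulrC ler_wpM2r//.
by rewrite (ger0_norm c0).
Qed.

(** The product rule, with one factor of each term taken in sup norm and the other in L2. *)
Lemma A1M : exists2 K : R, 0 < K & forall f g, A 1 f -> A 1 g ->
  A 1 (fun x => f x * g x) /\ nrm 1 (fun x => f x * g x) <= K * (nrm 1 f * nrm 1 g).
Proof.
(* [S1] bounds the product itself, and each of the two terms of its derivative costs [2 * pi * S1];
   the final 1 keeps the constant positive. *)
exists (S1 * (1 + 4 * pi) + 1) => [|f g Af Ag].
  by rewrite ltr_wpDl// mulr_ge0 ?S1_ge0// addr_ge0// mulr_ge0// pi_ge0.
have [f1 [Lf1 nf1 pf]] := A1_prim Af; have [g1 [Lg1 ng1 pg]] := A1_prim Ag.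
have Lf := A_L2 Af; have Lg := A_L2 Ag.
have sf x : `|f x| <= S1 * nrm 1 f by exact: A_sup Af.
have sg x : `|g x| <= S1 * nrm 1 g by exact: A_sup Ag.
have [La na] := L2M_sup Lf Lg.1 sg.
have [Lb nb] := L2M_sup Lf1 Lg.1 sg.
have [Lc nc] := L2M_sup Lg1 Lf.1 sf.
have Lc' : L2 (fun x => f x * g1 x) by apply: eq_L2 Lc => x; rewrite mulrC.
have nc' : n2 (fun x => f x * g1 x) <= S1 * nrm 1 f * n2 g1.
  by rewrite (@eq_n2 _ _ (fun x => g1 x * f x))// => x; rewrite mulrC.
have Ls := L2D Lb Lc'; have ns := n2D Lb Lc'.
have hL2 u : L2 u -> Wt 0 (hart u) by move=> Lu; apply/Wt0P; exact: hart_L2.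
have [AM nM] := A_up0 La Ls (hL2 _ La) (hL2 _ Ls) (primM pf pg).
split=> //; apply: le_trans nM _; rewrite !nrmE !wn0 (hart_n2 La) (hart_n2 Ls) -!nrmE.
have nf := n2_nrm Af; have ng := n2_nrm Ag.
have F0 := nrm_ge0 1 f; have G0 := nrm_ge0 1 g; have s0 := S1_ge0; have p0 := pi_ge0 R.
move: (nrm 1 f) (nrm 1 g) F0 G0 na nb nc' nf ng nf1 ng1 => F G F0 G0 na nb nc' nf ng nf1 ng1.
have a1 : n2 (fun x => f x * g x) <= S1 * (F * G).
  by apply: le_trans na _; rewrite -mulrA ler_wpM2l// mulrC ler_wpM2r.
have a2 : n2 (fun x => f1 x * g x) <= S1 * (2 * pi * (F * G)).
  apply: le_trans nb _; rewrite -mulrA ler_wpM2l//.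
  by have -> : 2 * pi * (F * G) = G * (2 * pi * F) by [ring]; rewrite ler_wpM2l.
have a3 : n2 (fun x => f x * g1 x) <= S1 * (2 * pi * (F * G)).
  apply: le_trans nc' _; rewrite -mulrA ler_wpM2l//.
  by have -> : 2 * pi * (F * G) = F * (2 * pi * G) by [ring]; rewrite ler_wpM2l.
have FG : 0 <= F * G by rewrite mulr_ge0.
have := lerD a1 (le_trans ns (lerD a2 a3)).
have -> : S1 * (F * G) + (S1 * (2 * pi * (F * G)) + S1 * (2 * pi * (F * G))) =
  (S1 * (1 + 4 * pi)) * (F * G) by ring.
by move/le_trans; apply; rewrite ler_wpM2r// lerDl.
Qed.

(** Induction on the order: the product and its derivative lie in the previous space, and [A_up]
    gains one order. *)
Lemma AM_ex s : (1 <= s)%N -> exists2 K : R, 0 < K & forall f g, A s f -> A s g ->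
  A s (fun x => f x * g x) /\ nrm s (fun x => f x * g x) <= K * (nrm s f * nrm s g).
Proof.
case: s => // s _; elim: s => [|s [K K0 IH]]; first exact: A1M.
exists (K * (1 + 4 * pi)) => [|f g Af Ag].
  by rewrite mulr_gt0// ltr_pwDl// mulr_ge0// pi_ge0.
have s1 : (1 <= s.+1)%N by [].
have [Af' nf'] := A_le (leqnSn s.+1) Af; have [Ag' ng'] := A_le (leqnSn s.+1) Ag.
have [Adf ndf pf] := A_dd s1 Af; have [Adg ndg pg] := A_dd s1 Ag.
have [Afg nfg] := IH f g Af' Ag'.
have [Ab nb] := IH (dd f) g Adf Ag'; have [Ac nc] := IH f (dd g) Af' Adg.
have [Abc nbc] := AD s1 Ab Ac.
have [AM nM] := A_up s1 Afg Abc (primM pf pg); split=> //.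
apply: le_trans nM _.
have p0 := pi_ge0 R.
have := nrm_ge0 s.+1 f; have := nrm_ge0 s.+1 g; have := nrm_ge0 s.+1 (dd f); have := nrm_ge0 s.+1 (dd g).
move: (nrm _ (dd f)) (nrm _ (dd g)) (nrm s.+1 f) (nrm s.+1 g) (nrm s.+2 f) (nrm s.+2 g)
  ndf ndg nf' ng' nfg nb nc nbc => DF DG F G F2 G2 ndf ndg nf' ng' nfg nb nc nbc DG0 DF0 G0 F0.
have a1 : K * (F * G) <= K * (F2 * G2) by rewrite ler_wpM2l ?(ltW K0)// ler_pM.
have a2 : K * (DF * G) <= K * (2 * pi * F2 * G2) by rewrite ler_wpM2l ?(ltW K0)// ler_pM.
have a3 : K * (F * DG) <= K * (F2 * (2 * pi * G2)) by rewrite ler_wpM2l ?(ltW K0)// ler_pM.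
have -> : K * (1 + 4 * pi) * (F2 * G2) =
   K * (F2 * G2) + (K * (2 * pi * F2 * G2) + K * (F2 * (2 * pi * G2))) by ring.
apply: lerD; first exact: le_trans nfg a1.
by apply: le_trans nbc _; apply: lerD; [exact: le_trans nb a2|exact: le_trans nc a3].
Qed.

(** Completeness is that of L2, transported by the weight on the transform side. *)
Lemma A_complete s (u : nat -> R -> R) : (1 <= s)%N -> (forall n, A s (u n)) ->
  (forall e, 0 < e -> exists N, forall n m, (N <= n)%N -> (N <= m)%N ->
     nrm s (fun x => u n x - u m x) <= e) ->
  exists2 f, A s f & nrm s (fun x => u n x - f x) @[n --> \oo] --> 0.
Proof.
move=> s1 Au Cu; pose v n := wt s (hart (u n)).
have Wu n : Wt s (hart (u n)) by case: (Au n).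
have Lv n : L2 (v n) := (Wu n).2.
have ev n m : nrm s (fun x => u n x - u m x) = n2 (fun x => v n x - v m x).
  have [Ln _ _] := Au n; have [Lm _ _] := Au m.
  rewrite !nrmE (wn_aeq s (hart_L2 (L2B Ln Lm)).1 _ (hartB Ln Lm)).
    by rewrite !wnE wtB.
  by apply: measurable_funB; [exact: (hart_L2 Ln).1|exact: (hart_L2 Lm).1].
have [G LG cG] : exists2 f, L2 f & n2 (fun x => v n x - f x) @[n --> \oo] --> 0.
  apply: riesz_fischer Lv _ => e e0; have [N NP] := Cu e e0.
  by exists N => n m Nn Nm; rewrite -ev; exact: NP.
pose h x := G x / bracket x ^+ s.
have hG : wt s h = G.
  by apply/funext => x; rewrite /wt /h mulrC divfK// gt_eqF// brX_gt0.
have mh : measurable_fun setT h.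
  apply: measurable_funM; first exact: LG.1.
  apply: continuous_measurable_fun => x; apply: cvgV; first by rewrite gt_eqF// brX_gt0.
  apply: (@continuous_comp _ _ _ (@bracket R) (fun x => x ^+ s)); first exact: cont_br.
  exact: exprn_continuous.
have Wh : Wt s h by split=> //; rewrite hG.
have [AH aH nH] := A_H1 s1 Wh; exists (H1 h) => //.
rewrite (_ : (fun n => _) = fun n => n2 (fun x => v n x - G x)); first exact: cG.
apply/funext => n; have [Ln _ _] := Au n; have [LH _ _] := AH.
have e : aeq (hart (fun x => u n x - H1 h x)) (fun x => hart (u n) x - h x).
  apply: aeq_trans (hartB Ln LH) _; by apply: ae_S aH => x ->.
rewrite !nrmE (wn_aeq s (hart_L2 (L2B Ln LH)).1 _ e).
  by rewrite !wnE wtB hG.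
by apply: measurable_funB; [exact: (hart_L2 Ln).1|exact: mh].
Qed.

End Sobolev.

(** * Fourier multipliers *)

Section Multipliers.
Context {R : realType}.
Local Notation mu := (@lebesgue_measure R).
Implicit Types (f g h u w a b : R -> R) (C c d x y e xi : R) (s k : nat).

(* The Fourier multiplier of symbol [a + i b] with [a] even and [b] odd, up to the
   sign of [b]: such symbols are those that preserve real functions. *)
Record sym C a b : Prop := MkSym { sym_ma : measurable_fun setT a; sym_mb : measurable_fun setT b;
  sym_ev : forall xi, a (- xi) = a xi; sym_od : forall xi, b (- xi) = - b xi;
  sym_ba : forall xi, `|a xi| <= C; sym_bb : forall xi, `|b xi| <= C }.

Lemma sym_ge0 C a b : sym C a b -> 0 <= C.
Proof. by move=> S; apply: le_trans (sym_ba S 0). Qed.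

Lemma symD C C' a b a' b' : sym C a b -> sym C' a' b' ->
  sym (C + C') (fun x => a x + a' x) (fun x => b x + b' x).
Proof.
move=> [ma mb ea ob ba bb] [ma' mb' ea' ob' ba' bb']; split.
- exact: measurable_funD.
- exact: measurable_funD.
- by move=> x; rewrite ea ea'.
- by move=> x; rewrite ob ob' opprD.
- by move=> x; apply: le_trans (ler_normD _ _) _; exact: lerD.
- by move=> x; apply: le_trans (ler_normD _ _) _; exact: lerD.
Qed.

Lemma symZ C c a b : sym C a b -> sym (`|c| * C) (fun x => c * a x) (fun x => c * b x).
Proof.
move=> [ma mb ea ob ba bb]; split.
- exact: measurable_funM.
- exact: measurable_funM.
- by move=> x; rewrite ea.
- by move=> x; rewrite ob mulrN.
- by move=> x; rewrite normrM ler_wpM2l.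
- by move=> x; rewrite normrM ler_wpM2l.
Qed.

(** The real part of the Fourier transform is the even part of [h] and the imaginary part is minus
    its odd part. Multiplication by an imaginary symbol exchanges the two, which on [h] is a
    reflection. *)
Definition mul2 a b h xi := a xi * h xi + b xi * h (- xi).

Lemma wt_mul2 s a b h xi : wt s (mul2 a b h) xi = wt s h xi * a xi + wt s h (- xi) * b xi.
Proof. by rewrite /wt /mul2 brN mulrDr; congr (_ + _); rewrite mulrCA mulrC. Qed.

Lemma meas_refl h : measurable_fun setT h -> measurable_fun setT (fun x => h (- x)).
Proof. by move=> mh; apply: measurableT_comp; [exact: mh|exact: oppr_measurable]. Qed.

Lemma mul2_meas C a b h : sym C a b -> measurable_fun setT h -> measurable_fun setT (mul2 a b h).
Proof.
move=> S mh; apply: measurable_funD; apply: measurable_funM; first exact: (sym_ma S).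
- exact: mh.
- exact: (sym_mb S).
- exact: meas_refl.
Qed.

Lemma mul2_Wt C s a b h : sym C a b -> Wt s h ->
  Wt s (mul2 a b h) /\ wn s (mul2 a b h) <= 2 * C * wn s h.
Proof.
move=> S [mh Lh].
have [La na] := L2M_sup Lh (sym_ma S) (sym_ba S).
have [Lb nb] := L2M_sup (L2_refl Lh) (sym_mb S) (sym_bb S).
rewrite (n2_refl Lh) in nb.
split; first by split; [exact: mul2_meas S mh|apply: eq_L2 (L2D La Lb) => x; rewrite wt_mul2].
rewrite !wnE (eq_n2 (wt_mul2 s a b h)); apply: le_trans (n2D La Lb) _.
by apply: le_trans (lerD na nb) _; move: (n2 _) => z; have -> : 2 * C * z = C * z + C * z by ring.
Qed.

Definition Op a b f := H1 (mul2 a b (hart f)).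

Lemma Op_A C s a b f : (1 <= s)%N -> sym C a b -> A s f ->
  [/\ A s (Op a b f), nrm s (Op a b f) <= 2 * C * nrm s f &
      aeq (hart (Op a b f)) (mul2 a b (hart f))].
Proof.
move=> s1 S [Lf Wf _]; have [W n] := mul2_Wt S Wf; have [AO e nO] := A_H1 s1 W.
by split=> //; rewrite nO nrmE.
Qed.

(** The mirror image of a null set is null. *)
Lemma aeq_refl h u : aeq h u -> aeq (fun x => h (- x)) (fun x => u (- x)).
Proof.
move=> [N0 [mN0 N00 sN0]]; pose N : set R := N0.
have mN : measurable N := mN0; have N0' : mu N = 0 := N00.
have sN : ~` [set x | h x = u x] `<=` N := sN0.
have m' : measurable ((fun x : R => - x) @^-1` N).
  by rewrite -[_ @^-1` _]setTI; exact: (oppr_measurable measurableT mN).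
exists ((fun x : R => - x) @^-1` N); split => //; last by move=> x /= nx; apply: sN.
have e1 : (\int[mu]_x (\1_N x)%:E = mu N)%E by rewrite integral_indic// setIT.
have e2 : (\int[mu]_x (\1_((fun x : R => (- x)%R) @^-1` N) x)%:E = mu ((fun x : R => (- x)%R) @^-1` N))%E.
  by rewrite integral_indic// setIT.
rewrite -[LHS]e2 -N0' -e1 (@ge0_int_refl R (fun x => (\1_N x)%:E))//.
exact/measurable_EFinP/measurable_indic.
Qed.

Lemma mul2_aeq C a b h u : sym C a b -> aeq h u -> aeq (mul2 a b h) (mul2 a b u).
Proof. by move=> S e; apply: ae_S2 e (aeq_refl e) => x ex ex'; rewrite /mul2 ex ex'. Qed.

Lemma mul2_L1 C s a b f : (1 <= s)%N -> sym C a b -> A s f -> L1 (mul2 a b (hart f)).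
Proof.
by move=> s1 S [_ Wf _]; have [W _] := mul2_Wt S Wf; exact: (Wt_L1 s1 W).1.
Qed.

Lemma Op_eqs C C' s a b a' b' f f' c c' g1 x : (1 <= s)%N -> sym C a b -> sym C' a' b' ->
  A s f -> A s f' -> L1 g1 -> aeq g1 (fun xi => c * mul2 a b (hart f) xi + c' * mul2 a' b' (hart f') xi) ->
  H1 g1 x = c * Op a b f x + c' * Op a' b' f' x.
Proof.
move=> s1 S S' Af Af' Lg e.
have L := mul2_L1 s1 S Af; have L' := mul2_L1 s1 S' Af'.
have Lc := L1Z c L; have Lc' := L1Z c' L'.
by rewrite (H1_aeq x Lg (L1D Lc Lc') e) (H1D x Lc Lc') (H1Z _ x L) (H1Z _ x L').
Qed.

Lemma OpB C s a b f g x : (1 <= s)%N -> sym C a b -> A s f -> A s g ->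
  Op a b (fun x => f x - g x) x = Op a b f x - Op a b g x.
Proof.
move=> s1 S Af Ag; have [Afg _] := AB s1 Af Ag.
have := Op_eqs (c := 1) (c' := -1) x s1 S S Af Ag (mul2_L1 s1 S Afg).
rewrite mulN1r mul1r; apply.
apply: aeq_trans (mul2_aeq S (hartB (A_L2 Af) (A_L2 Ag))) _.
by apply: aeqW => xi; rewrite /mul2; ring.
Qed.

Lemma Op_lin2 C C' s a b a' b' f c c' x : (1 <= s)%N -> sym C a b -> sym C' a' b' -> A s f ->
  Op (fun xi => c * a xi + c' * a' xi) (fun xi => c * b xi + c' * b' xi) f x =
  c * Op a b f x + c' * Op a' b' f x.
Proof.
move=> s1 S S' Af; apply: (Op_eqs x s1 S S' Af Af).
  exact: mul2_L1 s1 (symD (symZ c S) (symZ c' S')) Af.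
by apply: aeqW => xi; rewrite /mul2; ring.
Qed.

Lemma Op_id s f x : (1 <= s)%N -> A s f -> Op (fun=> 1) (fun=> 0) f x = f x.
Proof.
move=> s1 [_ _ {2}->]; congr (H1 _ x).
by apply/funext => xi; rewrite /mul2 mul1r mul0r addr0.
Qed.

(** Composition multiplies the symbols as complex numbers; the minus sign comes from the oddness of
    [b] under the reflection in [mul2]. *)
Lemma Op_comp C C' s a b a' b' f x : (1 <= s)%N -> sym C a b -> sym C' a' b' -> A s f ->
  Op a' b' (Op a b f) x =
  Op (fun xi => a' xi * a xi - b' xi * b xi) (fun xi => a' xi * b xi + b' xi * a xi) f x.
Proof.
move=> s1 S S' Af; have [AO _ e] := Op_A s1 S Af.
have E xi : mul2 a' b' (mul2 a b (hart f)) xi =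
    mul2 (fun xi => a' xi * a xi - b' xi * b xi) (fun xi => a' xi * b xi + b' xi * a xi) (hart f) xi.
  by rewrite /mul2 (sym_ev S) (sym_od S) opprK; ring.
have L : L1 (mul2 a' b' (mul2 a b (hart f))).
  have [W _] := mul2_Wt S (let: MkA _ W _ := Af in W).
  by have [W' _] := mul2_Wt S' W; exact: (Wt_L1 s1 W').1.
rewrite /Op (H1_aeq x (mul2_L1 s1 S' AO) L (mul2_aeq S' e)).
by congr (H1 _ x); apply/funext.
Qed.

Lemma Op_prim C C' s a b f : (1 <= s)%N -> sym C a b ->
  sym C' (fun xi => 2 * pi * xi * b xi) (fun xi => - (2 * pi * xi * a xi)) -> A s f ->
  prim (Op a b f) (Op (fun xi => 2 * pi * xi * b xi) (fun xi => - (2 * pi * xi * a xi)) f).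
Proof.
move=> s1 S S' Af; have Wf : Wt s (hart f) by case: Af.
have [W _] := mul2_Wt S Wf; have [W' _] := mul2_Wt S' Wf.
set F := mul2 _ _ _ in W'; have E : dsym (mul2 a b (hart f)) = F.
  apply/funext => xi; rewrite /F /dsym /mul2 opprK (sym_ev S) (sym_od S); ring.
have Ld : L2 (dsym (mul2 a b (hart f))) by rewrite E; exact: Wt_L2 W'.
have := prim_hart (mul2_L1 s1 S Af) (Wt_L2 W) Ld; rewrite E => p.
have [AO _ _] := A_H1 s1 W'.
apply: prim_aeq (A_L2 AO).1 _ p.
exact: hart_L1 (Wt_L1 s1 W').1 (Wt_L2 W').
Qed.

Lemma n2_dct (F : nat -> R -> R) G : (forall n, measurable_fun setT (F n)) ->
  (forall x, F ^~ x @ \oo --> (0 : R)) -> L2 G -> (forall n x, `|F n x| <= G x) ->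
  n2 (F n) @[n --> \oo] --> 0.
Proof.
move=> mF cF [mG LG] bd.
have G0 x : 0 <= G x by apply: le_trans (bd 0%N x).
have [||||_ c //] := @dct _ (fun n x => F n x ^+ 2) (fun=> 0) _ _ _ _ LG.
- by move=> n; exact: measurable_funX.
- exact: measurable_cst.
- by apply: aeW => x; rewrite -[X in _ --> X](mulr0 0); exact: (cvgM (cF x) (cF x)).
- by move=> n x; rewrite normrX lerXn2r// nnegrE.
have z : \int[mu]_x (fun=> 0 : R) x = 0 by rewrite /Rintegral integral0.
under eq_fun do rewrite n2E.
have <- : Num.sqrt 0 = 0 :> R by exact: sqrtr0.
apply: continuous_cvg; first exact: sqrt_continuous.
by rewrite -z.
Qed.

Lemma Op_cvg0 C s (a b : nat -> R -> R) a0 b0 f : (1 <= s)%N ->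
  (forall n, sym C (a n) (b n)) -> sym C a0 b0 ->
  (forall xi, a n xi @[n --> \oo] --> a0 xi) -> (forall xi, b n xi @[n --> \oo] --> b0 xi) ->
  A s f -> nrm s (fun x => Op (a n) (b n) f x - Op a0 b0 f x) @[n --> \oo] --> 0.
Proof.
move=> s1 S S0 ca cb Af; have Wf : Wt s (hart f) by case: Af.
pose a' n xi := 1 * a n xi + -1 * a0 xi; pose b' n xi := 1 * b n xi + -1 * b0 xi.
have S' n := symD (symZ 1 (S n)) (symZ (-1) S0).
have C0 := sym_ge0 S0.
have E n : nrm s (fun x => Op (a n) (b n) f x - Op a0 b0 f x) = n2 (wt s (mul2 (a' n) (b' n) (hart f))).
  have [W _] := mul2_Wt (S' n) Wf; have [_ _ nO] := A_H1 s1 W.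
  rewrite -wnE -nO; apply: eq_nrm => x.
  by rewrite -/(Op _ _ _) (Op_lin2 _ _ _ s1 (S n) S0 Af) mul1r mulN1r.
under eq_fun do rewrite E.
have mul_cvg (u : nat -> R) (u0 : R) c : u n @[n --> \oo] --> u0 ->
    (fun n => c * (1 * u n + -1 * u0)) @ \oo --> (0 : R).
  move=> cu; have <- : c * (u0 - u0) = 0 by rewrite subrr mulr0.
  under eq_fun do rewrite mul1r mulN1r.
  by apply: cvgM; [exact: cvg_cst|apply: cvgB => //; exact: cvg_cst].
apply: (@n2_dct _ (fun x => (`|1| * C + `|-1| * C) * `|wt s (hart f) x| +
   (`|1| * C + `|-1| * C) * `|wt s (hart f) (- x)|)).
- by move=> n; apply: Wt_meas; exact: mul2_meas (S' n) (Wf.1).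
- move=> x; under eq_fun do rewrite wt_mul2.
  by apply: cvg0D; exact: mul_cvg.
- exact: L2D (L2Z _ (L2_norm Wf.2)) (L2Z _ (L2_norm (L2_refl Wf.2))).
- move=> n x; rewrite wt_mul2; apply: le_trans (ler_normD _ _) _.
  rewrite !normrM [X in X + _]mulrC [X in _ + X]mulrC; apply: lerD.
    by apply: ler_wpM2r => //; exact: (sym_ba (S' n)).
  by apply: ler_wpM2r => //; exact: (sym_bb (S' n)).
Qed.

Definition cvA s (u : nat -> R -> R) u0 :=
  [/\ forall n, A s (u n), A s u0 & nrm s (fun x => u n x - u0 x) @[n --> \oo] --> 0].

Lemma nrm_tri s f g h : (1 <= s)%N -> A s f -> A s g -> A s h ->
  nrm s (fun x => f x - h x) <= nrm s (fun x => f x - g x) + nrm s (fun x => g x - h x).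
Proof.
move=> s1 Af Ag Ah; have [Afg _] := AB s1 Af Ag; have [Agh _] := AB s1 Ag Ah.
have [_] := AD s1 Afg Agh; apply: le_trans; rewrite le_eqVlt; apply/orP; left; apply/eqP.
by apply: eq_nrm => x; ring.
Qed.

(** The uniform bound [C] absorbs the motion of [u n], so that convergence of the multipliers is
    required only on the fixed function [u0]. *)
Lemma cvA_Op C s (a b : nat -> R -> R) a0 b0 (u : nat -> R -> R) u0 : (1 <= s)%N ->
  (forall n, sym C (a n) (b n)) -> sym C a0 b0 ->
  (forall xi, a n xi @[n --> \oo] --> a0 xi) -> (forall xi, b n xi @[n --> \oo] --> b0 xi) ->
  cvA s u u0 -> cvA s (fun n => Op (a n) (b n) (u n)) (Op a0 b0 u0).
Proof.
move=> s1 S S0 ca cb [Au Au0 cu]; have C0 := sym_ge0 S0.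
have AO n := Op_A s1 (S n) (Au n); have [AO0 _ _] := Op_A s1 S0 Au0.
have AOn n := Op_A s1 (S n) Au0.
split=> // [n|]; first by case: (AO n).
apply: (@cvg0_le _ _ (fun n => 2 * C * nrm s (fun x => u n x - u0 x) +
   nrm s (fun x => Op (a n) (b n) u0 x - Op a0 b0 u0 x))); last first.
  by apply: cvg0D; [exact: cvg0Z|exact: Op_cvg0 S S0 ca cb Au0].
move=> n; rewrite nrm_ge0 /=.
have [A1' _ _] := AO n; have [A2' _ _] := AOn n.
apply: le_trans (nrm_tri s1 A1' A2' AO0) _; rewrite lerD2r.
have [AB' _] := AB s1 (Au n) Au0; have [_ n' _] := Op_A s1 (S n) AB'.
apply: le_trans n'; rewrite le_eqVlt; apply/orP; left; apply/eqP.
by apply: eq_nrm => x; rewrite (OpB x s1 (S n) (Au n) Au0).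
Qed.

End Multipliers.

(** * H^s as a Banach algebra, contractions and their calculus *)

Section Algebra.
Context {R : realType}.
Local Notation mu := (@lebesgue_measure R).
Implicit Types (f g h w a b : R -> R) (u v : nat -> R -> R) (C c d x y e xi : R).

(* Scaled by [Ka s], the norm of H^s is submultiplicative. *)
Fact Ka_ex (s : nat) : exists K : R, 0 < K /\ ((1 <= s)%N -> forall f g, A s f -> A s g ->
  A s (fun x => f x * g x) /\ nrm s (fun x => f x * g x) <= K * (nrm s f * nrm s g)).
Proof.
case: s => [|s]; first by exists 1.
by have [K K0 KP] := @AM_ex R s.+1 (ltn0Sn s); exists K.
Qed.

Fact Ka_sig (s : nat) : {K : R | 0 < K /\ ((1 <= s)%N -> forall f g, A s f -> A s g ->
  A s (fun x => f x * g x) /\ nrm s (fun x => f x * g x) <= K * (nrm s f * nrm s g))}.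
Proof. exact: cid (Ka_ex s). Qed.

Definition Ka s : R := sval (Ka_sig s).

Lemma Ka_gt0 s : 0 < Ka s. Proof. exact: (svalP (Ka_sig s)).1. Qed.

Fact nn_sig : {n : nat -> (R -> R) -> R | forall s f, n s f = Ka s * nrm s f}.
Proof. by eexists. Qed.
Definition nn := sval nn_sig.

Lemma nnE s f : nn s f = Ka s * nrm s f. Proof. exact: svalP nn_sig s f. Qed.

Context (s : nat) (s1 : (1 <= s)%N).
Local Notation X := (A s).
Local Notation N := (nn s).

Lemma eq_nn f g : (forall x, f x = g x) -> N f = N g.
Proof. by move=> /funext ->. Qed.

Lemma nn_ge0 f : 0 <= N f.
Proof. by rewrite nnE mulr_ge0 ?nrm_ge0// ltW// Ka_gt0. Qed.

Lemma XM f g : X f -> X g -> X (fun x => f x * g x) /\ N (fun x => f x * g x) <= N f * N g.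
Proof.
move=> Af Ag; have [AM n] := (svalP (Ka_sig s)).2 s1 f g Af Ag; split=> //.
rewrite !nnE mulrACA -mulrA ler_wpM2l ?(ltW (Ka_gt0 s))//.
Qed.

Lemma XD f g : X f -> X g -> X (fun x => f x + g x) /\ N (fun x => f x + g x) <= N f + N g.
Proof.
move=> Af Ag; have [AS n] := AD s1 Af Ag; split=> //.
by rewrite !nnE -mulrDr ler_wpM2l ?(ltW (Ka_gt0 s)).
Qed.

Lemma XB f g : X f -> X g -> X (fun x => f x - g x) /\ N (fun x => f x - g x) <= N f + N g.
Proof.
move=> Af Ag; have [AS n] := AB s1 Af Ag; split=> //.
by rewrite !nnE -mulrDr ler_wpM2l ?(ltW (Ka_gt0 s)).
Qed.

Lemma XZ c f : X f -> X (fun x => c * f x) /\ N (fun x => c * f x) = `|c| * N f.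
Proof. by move=> Af; have [AS n] := AZ c s1 Af; split=> //; rewrite !nnE n mulrCA. Qed.

Lemma X0 : X (fun=> 0 : R) /\ N (fun=> 0 : R) = 0.
Proof. by have [AS n] := @A0 R s s1; split=> //; rewrite nnE n mulr0. Qed.

Lemma nnBC f g : X f -> X g -> N (fun x => f x - g x) = N (fun x => g x - f x).
Proof. by move=> Af Ag; rewrite !nnE (nrmBC s1 Af Ag). Qed.

Lemma nn_tri f g h : X f -> X g -> X h ->
  N (fun x => f x - h x) <= N (fun x => f x - g x) + N (fun x => g x - h x).
Proof.
by move=> Af Ag Ah; rewrite !nnE -mulrDr ler_wpM2l ?(ltW (Ka_gt0 s))//; exact: nrm_tri.
Qed.

Lemma nn_eq0 f g : X f -> X g -> N (fun x => f x - g x) <= 0 -> f = g.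
Proof.
move=> Af Ag; rewrite nnE pmulr_rle0 ?Ka_gt0// => n.
have n0 : nrm s (fun x => f x - g x) = 0 by apply/eqP; rewrite eq_le n nrm_ge0.
by apply/funext => x; apply/subr0_eq; exact: nrm_eq0 s1 (AB s1 Af Ag).1 n0 x.
Qed.

Lemma nn_leD f g : X f -> X g -> N f <= N g + N (fun x => f x - g x).
Proof.
move=> Af Ag; have [_] := XD Ag (XB Af Ag).1; apply: le_trans.
by rewrite le_eqVlt; apply/orP; left; apply/eqP/eq_nn => x; rewrite subrKC.
Qed.

Lemma cvAP u (u0 : R -> R) : cvA s u u0 <->
  [/\ forall n, X (u n), X u0 & N (fun x => u n x - u0 x) @[n --> \oo] --> 0].
Proof.
have K0 := Ka_gt0 s; split=> -[Au A0' c]; split=> //.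
  by under eq_fun do rewrite nnE; exact: cvg0Z.
rewrite (_ : (fun n => _) = fun n => (Ka s)^-1 * N (fun x => u n x - u0 x)).
  exact: cvg0Z.
by apply/funext => n; rewrite nnE mulKf// gt_eqF.
Qed.

Lemma le_nn_eq f g : (forall x, f x = g x) -> N f <= N g.
Proof. by move=> /funext ->. Qed.

Lemma cvA_cst f : X f -> cvA s (fun=> f) f.
Proof.
move=> Af; apply/cvAP; split=> //; rewrite (_ : (fun n => _) = fun=> 0); first exact: cvg_cst.
by apply/funext => n; rewrite -X0.2; apply: eq_nn => x; rewrite subrr.
Qed.

Lemma cvA_D u v (u0 v0 : R -> R) : cvA s u u0 -> cvA s v v0 ->
  cvA s (fun n x => u n x + v n x) (fun x => u0 x + v0 x).
Proof.
move=> /cvAP[Au Au0 cu] /cvAP[Av Av0 cv]; apply/cvAP; split=> [n||].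
- exact: (XD (Au n) (Av n)).1.
- exact: (XD Au0 Av0).1.
apply: (@cvg0_le _ _ (fun n => N (fun x => u n x - u0 x) + N (fun x => v n x - v0 x))).
  move=> n; rewrite nn_ge0 /=; have [_] := XD (XB (Au n) Au0).1 (XB (Av n) Av0).1.
  by apply: le_trans; apply: le_nn_eq => x; ring.
exact: cvg0D.
Qed.

Lemma cvA_Z (c : nat -> R) c0 u (u0 : R -> R) : c @ \oo --> c0 -> cvA s u u0 ->
  cvA s (fun n x => c n * u n x) (fun x => c0 * u0 x).
Proof.
move=> cc /cvAP[Au Au0 cu]; apply/cvAP; split=> [n||].
- exact: (XZ _ (Au n)).1.
- exact: (XZ _ Au0).1.
apply: (@cvg0_le _ _ (fun n => `|c n| * N (fun x => u n x - u0 x) + N u0 * `|c n - c0|)).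
  move=> n; rewrite nn_ge0 /=; have [Ad _] := XB (Au n) Au0.
  have [Z1 z1] := XZ (c n) Ad; have [Z2 z2] := XZ (c n - c0) Au0.
  rewrite -z1 [N u0 * _]mulrC -z2.
  have [_] := XD Z1 Z2; apply: le_trans; apply: le_nn_eq => x; ring.
apply: cvg0D.
  rewrite -[X in _ --> X](mulr0 `|c0|); apply: (@cvgM _ _ _ _ (fun n => `|c n|) _ _ _ _ cu).
  by apply: cvg_norm.
apply: cvg0Z; rewrite -[X in _ --> X](@normr0 _ R); apply: cvg_norm.
by rewrite -(subrr c0); apply: cvgB => //; exact: cvg_cst.
Qed.

Lemma cvA_B u v (u0 v0 : R -> R) : cvA s u u0 -> cvA s v v0 ->
  cvA s (fun n x => u n x - v n x) (fun x => u0 x - v0 x).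
Proof.
have c1 : (fun _ : nat => -1 : R) @ \oo --> (-1 : R) by exact: cvg_cst.
move=> cu cv; have := cvA_D cu (cvA_Z c1 cv).
have E (f g : R -> R) : (fun x => f x + -1 * g x) = fun x => f x - g x.
  by apply/funext => x; rewrite mulN1r.
by rewrite E (_ : (fun n => _) = fun n x => u n x - v n x)//; apply/funext => n.
Qed.

Lemma cvA_M u v (u0 v0 : R -> R) : cvA s u u0 -> cvA s v v0 ->
  cvA s (fun n x => u n x * v n x) (fun x => u0 x * v0 x).
Proof.
move=> /cvAP[Au Au0 cu] /cvAP[Av Av0 cv]; apply/cvAP; split=> [n||].
- exact: (XM (Au n) (Av n)).1.
- exact: (XM Au0 Av0).1.
have cv' : (fun n => N (fun x => v n x - v0 x) + N v0) @ \oo --> 0 + N v0.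
  by apply: cvgD => //; exact: cvg_cst.
apply: (@cvg0_le _ _ (fun n => N (fun x => u n x - u0 x) * (N (fun x => v n x - v0 x) + N v0) +
   N u0 * N (fun x => v n x - v0 x))).
  move=> n; rewrite nn_ge0 /=.
  have [Bu _] := XB (Au n) Au0; have [Bv _] := XB (Av n) Av0.
  have [M1 m1] := XM Bu (Av n); have [M2 m2] := XM Au0 Bv.
  have [_ le] := XD M1 M2.
  apply: le_trans (le_trans _ le) _; first by apply: le_nn_eq => x; ring.
  apply: lerD m2; apply: le_trans m1 _; apply: ler_wpM2l; first exact: nn_ge0.
  by rewrite addrC; exact: nn_leD.
apply: cvg0D; last exact: cvg0Z.
by rewrite -[X in _ --> X](mul0r (0 + N v0)); exact: (cvgM cu cv').
Qed.

Lemma cvA_sum (I : Type) (r : seq I) (u : I -> nat -> R -> R) (u0 : I -> R -> R) :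
  (forall i, cvA s (u i) (u0 i)) ->
  cvA s (fun n x => \sum_(i <- r) u i n x) (fun x => \sum_(i <- r) u0 i x).
Proof.
move=> cu; elim: r => [|i r IH].
  rewrite (_ : (fun n => _) = fun _ _ => 0); last first.
    by apply/funext => n; apply/funext => x; rewrite big_nil.
  rewrite (_ : (fun x => _) = fun _ => 0); first exact: cvA_cst X0.1.
  by apply/funext => x; rewrite big_nil.
have := cvA_D (cu i) IH.
rewrite (_ : (fun n x => u i n x + _) = fun n x => \sum_(i <- i :: r) u i n x); last first.
  by apply/funext => n; apply/funext => x; rewrite big_cons.
rewrite (_ : (fun x => u0 i x + _) = fun x => \sum_(i <- i :: r) u0 i x)//.
by apply/funext => x; rewrite big_cons.
Qed.

(** Applied repeatedly along a chain of successive derivatives, this turns convergence in H^s of all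
    members into convergence of the first one in a higher space. *)
Lemma cvA_up u (u0 : R -> R) v (v0 : R -> R) : cvA s u u0 -> cvA s v v0 -> (forall n, prim (u n) (v n)) ->
  prim u0 v0 -> cvA s.+1 u u0.
Proof.
move=> [Au Au0 cu] [Av Av0 cv] p p0; split=> [n||].
- exact: (A_up s1 (Au n) (Av n) (p n)).1.
- exact: (A_up s1 Au0 Av0 p0).1.
apply: (@cvg0_le _ _ (fun n => nrm s (fun x => u n x - u0 x) + nrm s (fun x => v n x - v0 x))).
  move=> n; rewrite nrm_ge0 /=.
  exact: (A_up s1 (AB s1 (Au n) Au0).1 (AB s1 (Av n) Av0).1 (primB (p n) p0)).2.
exact: cvg0D.
Qed.

(** The contraction principle on a closed ball, with factor one half. *)
Lemma banach (F : (R -> R) -> R -> R) r : 0 <= r ->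
  (forall g, X g -> N g <= r -> X (F g) /\ N (F g) <= r) ->
  (forall g h, X g -> N g <= r -> X h -> N h <= r ->
     N (fun x => F g x - F h x) <= 2^-1 * N (fun x => g x - h x)) ->
  exists g, [/\ X g, N g <= r & F g = g].
Proof.
move=> r0 FX Fc; pose u n := iter n F (fun=> 0).
have [z0 z1] := X0.
have Xu n : X (u n) /\ N (u n) <= r.
  by elim: n => [|n [Xn Nn]]; [rewrite z1|exact: FX].
have st n : N (fun x => u n.+1 x - u n x) <= (2 * r) * 2 ^- n.
  elim: n => [|n IH].
    rewrite invr1 mulr1; apply: le_trans (XB (Xu 1%N).1 (Xu 0%N).1).2 _.
    by rewrite mulr_natl mulr2n; apply: lerD; [exact: (Xu 1%N).2|exact: (Xu 0%N).2].
  apply: le_trans (Fc _ _ (Xu n.+1).1 (Xu n.+1).2 (Xu n).1 (Xu n).2) _.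
  have -> : 2 * r * 2 ^- n.+1 = 2^-1 * (2 * r * 2 ^- n).
    by rewrite exprS invfM mulrCA.
  by rewrite ler_wpM2l.
(* The increments from [n] to [n + k] form a geometric sum, kept in closed form so that the
   induction on [k] goes through. *)
have stk n k : N (fun x => u (n + k)%N x - u n x) <= (2 * r) * (2 * 2 ^- n - 2 * 2 ^- (n + k)).
  elim: k => [|k IH].
    rewrite addn0 subrr mulr0 -z1; apply: le_nn_eq => x; exact: subrr.
  rewrite addnS; apply: le_trans (nn_tri (Xu (n + k).+1).1 (Xu (n + k)%N).1 (Xu n).1) _.
  apply: le_trans (lerD (st (n + k)%N) IH) _.
  have -> : 2 * r * (2 * 2 ^- n - 2 * 2 ^- (n + k).+1) =
     2 * r * 2 ^- (n + k) + 2 * r * (2 * 2 ^- n - 2 * 2 ^- (n + k)).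
    rewrite (exprS _ (n + k)) invfM mulrA mulfV ?mul1r; last by rewrite pnatr_eq0.
    ring.
  exact: lexx.
have K0 := Ka_gt0 s.
have gm e : 0 < e -> exists n0, forall n, (n0 <= n)%N -> (2 * r) * (2 * 2 ^- n) <= e.
  move=> e0; have c : (fun n => (2 * r * 2) * (2^-1) ^+ n) @ \oo --> (0 : R).
    apply: cvg0Z; apply: cvg_expr.
    by rewrite ger0_norm ?invr_ge0// invf_lt1// ltr1n.
  have /cvgrPdist_le/(_ e e0)[n0 _ H] := c; exists n0 => n /H.
  rewrite sub0r normrN => /(le_trans (ler_norm _)); rewrite exprVn; apply: le_trans.
  by rewrite mulrA.
have [f Af cf] : exists2 f, X f & nrm s (fun x => u n x - f x) @[n --> \oo] --> 0.
  apply: A_complete => // [n|e e0']; first exact: (Xu n).1.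
  have [n0 n0P] := gm (Ka s * e) (mulr_gt0 K0 e0').
  have H n m : (n0 <= n)%N -> (n <= m)%N -> nrm s (fun x => u m x - u n x) <= e.
    move=> n0n nm; rewrite -(ler_pM2l K0) -nnE -(subnKC nm).
    apply: le_trans (stk _ _) (le_trans _ (n0P n n0n)).
    by rewrite ler_wpM2l ?mulr_ge0// gerBl mulr_ge0// invr_ge0 exprn_ge0.
  exists n0 => n m n0n n0m; case: (leqP n m) => [nm|/ltnW mn]; last exact: H.
  by rewrite (nrmBC s1 (Xu n).1 (Xu m).1); exact: H.
have cf' : N (fun x => u n x - f x) @[n --> \oo] --> 0.
  by case: (iffLR (cvAP u f) (And3 (fun n => (Xu n).1) Af cf)).
have le_of_cvg c d : (forall n, c <= d + N (fun x => u n x - f x)) -> c <= d.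
  move=> h; apply/ler_addgt0Pr => e e0'.
  have /cvgrPdist_le/(_ e e0')[n _ /(_ n (leqnn n))] := cf'.
  rewrite sub0r normrN => /(le_trans (ler_norm _)) => H.
  by apply: le_trans (h n) _; rewrite lerD2l.
have Nf : N f <= r.
  apply: le_of_cvg => n; apply: le_trans (nn_leD Af (Xu n).1) _.
  by rewrite (nnBC Af (Xu n).1) lerD2r; exact: (Xu n).2.
have XF := FX f Af Nf.
exists f; split=> //; apply: (nn_eq0 XF.1 Af).
have cf2 : (fun n => 2^-1 * N (fun x => u n x - f x) + N (fun x => u n.+1 x - f x)) @ \oo --> (0 : R).
  apply: cvg0D; first exact: cvg0Z.
  by have := cvg_comp _ _ (@cvg_addnr 1) cf'; apply: cvg_trans; apply: near_eq_cvg; near=> n; rewrite /= addn1.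
apply/ler_addgt0Pr => e e0'.
have /cvgrPdist_le/(_ e e0')[n _ /(_ n (leqnn n))] := cf2.
rewrite sub0r normrN add0r => /(le_trans (ler_norm _)); apply: le_trans.
apply: le_trans (nn_tri XF.1 (Xu n.+1).1 Af) _; rewrite lerD2r.
by rewrite (nnBC (Xu n).1 Af); exact: (Fc f (u n) Af Nf (Xu n).1 (Xu n).2).
Unshelve. all: by end_near.
Qed.

(* [ord e C F]: on the ball of radius [rho], [F] is bounded by [C e (K rho)] and
   Lipschitz with constant [C e K]; linear terms have [e = 1], quadratic ones
   [e = K rho]. *)
Section Lipschitz.
Context (K rho : R) (K0 : 0 <= K) (rho0 : 0 <= rho).
Local Notation t := (K * rho).
Implicit Types F G : (R -> R) -> R -> R.

Record ord e C F : Prop := MkOrd { ord_C : 0 <= C;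
  ord_X : forall g, X g -> N g <= rho -> X (F g);
  ord_le : forall g, X g -> N g <= rho -> N (F g) <= C * e * t;
  ord_lip : forall g h, X g -> N g <= rho -> X h -> N h <= rho ->
    N (fun x => F g x - F h x) <= C * e * K * N (fun x => g x - h x) }.

Lemma eq_ord e C F G : (forall g x, F g x = G g x) -> ord e C F -> ord e C G.
Proof. by move=> E; suff -> : F = G by []; apply/funext => g; apply/funext => x. Qed.

Lemma ordW e e' C F : 0 <= e -> e <= e' -> ord e C F -> ord e' C F.
Proof.
move=> e0 ee [C0 FX Fl Fd]; split=> // [g Xg Ng|g h Xg Ng Xh Nh].
  apply: le_trans (Fl g Xg Ng) _.
  by rewrite ler_wpM2r ?mulr_ge0// ler_wpM2l.
apply: le_trans (Fd g h Xg Ng Xh Nh) _.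
by rewrite ler_wpM2r ?nn_ge0// ler_wpM2r// ler_wpM2l.
Qed.

Lemma ordD e C C' F G : ord e C F -> ord e C' G -> ord e (C + C') (fun g x => F g x + G g x).
Proof.
move=> [C0 FX Fl Fd] [C0' GX Gl Gd]; split=> [|g Xg Ng|g Xg Ng|g h Xg Ng Xh Nh].
- exact: addr_ge0.
- exact: (XD (FX g Xg Ng) (GX g Xg Ng)).1.
- apply: le_trans (XD (FX g Xg Ng) (GX g Xg Ng)).2 _.
  by rewrite !mulrDl; exact: lerD (Fl g Xg Ng) (Gl g Xg Ng).
- have [BF _] := XB (FX g Xg Ng) (FX h Xh Nh); have [BG _] := XB (GX g Xg Ng) (GX h Xh Nh).
  have [_ n] := XD BF BG.
  rewrite !mulrDl; apply: le_trans (le_trans n (lerD (Fd g h Xg Ng Xh Nh) (Gd g h Xg Ng Xh Nh))).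
  by apply: le_nn_eq => x; ring.
Qed.

Lemma ordZ e C c F : ord e C F -> ord e (`|c| * C) (fun g x => c * F g x).
Proof.
move=> [C0 FX Fl Fd]; split=> [|g Xg Ng|g Xg Ng|g h Xg Ng Xh Nh].
- exact: mulr_ge0.
- exact: (XZ _ (FX g Xg Ng)).1.
- rewrite (XZ c (FX g Xg Ng)).2; have -> : `|c| * C * e * t = `|c| * (C * e * t) by ring.
  by rewrite ler_wpM2l//; exact: Fl.
- have [BF _] := XB (FX g Xg Ng) (FX h Xh Nh); have [_ n] := XZ c BF.
  rewrite (@eq_nn _ (fun x => c * (F g x - F h x))) => [|x]; last by rewrite mulrBr.
  rewrite n; move: (Fd g h Xg Ng Xh Nh); move: (N _) (N _) => q p pq.
  have -> : `|c| * C * e * K * q = `|c| * (C * e * K * q) by ring.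
  by rewrite ler_wpM2l.
Qed.

(** The factor 2 is due to the Lipschitz estimate, where the difference of products splits into two
    terms. *)
Lemma ordM e e' C C' F G : 0 <= e -> 0 <= e' -> ord e C F -> ord e' C' G ->
  ord (e * e' * t) (2 * C * C') (fun g x => F g x * G g x).
Proof.
move=> e0 e0' [C0 FX Fl Fd] [C0' GX Gl Gd]; have t0 : 0 <= t by rewrite mulr_ge0.
have p1 : 0 <= C * e * t by rewrite !mulr_ge0.
have p2 : 0 <= C' * e' * t by rewrite !mulr_ge0.
split=> [|g Xg Ng|g Xg Ng|g h Xg Ng Xh Nh].
- by rewrite !mulr_ge0.
- exact: (XM (FX g Xg Ng) (GX g Xg Ng)).1.
- apply: le_trans (XM (FX g Xg Ng) (GX g Xg Ng)).2 _.
  apply: le_trans (ler_pM (nn_ge0 _) (nn_ge0 _) (Fl g Xg Ng) (Gl g Xg Ng)) _.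
  have -> : 2 * C * C' * (e * e' * t) * t = 2 * (C * e * t * (C' * e' * t)) by ring.
  by rewrite ler_peMl ?ler1n// mulr_ge0.
- have [BF _] := XB (FX g Xg Ng) (FX h Xh Nh); have [BG _] := XB (GX g Xg Ng) (GX h Xh Nh).
  have [M1 m1] := XM BF (GX g Xg Ng); have [M2 m2] := XM (FX h Xh Nh) BG.
  have [_ n] := XD M1 M2.
  rewrite (@eq_nn _ (fun x => (F g x - F h x) * G g x + F h x * (G g x - G h x))) => [|x]; last by ring.
  apply: le_trans n _; apply: le_trans (lerD (le_trans m1 _) (le_trans m2 _)) _.
  - exact: ler_pM (nn_ge0 _) (nn_ge0 _) (Fd g h Xg Ng Xh Nh) (Gl g Xg Ng).
  - exact: ler_pM (nn_ge0 _) (nn_ge0 _) (Fl h Xh Nh) (Gd g h Xg Ng Xh Nh).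
  - by move: (N (fun x => g x - h x)) => d; rewrite le_eqVlt; apply/orP; left; apply/eqP; ring.
Qed.

(* Only the product with a linear term is needed; it does not lower the order. *)
Lemma ordM1 e C C' F G : 0 <= e -> t <= 1 -> ord e C F -> ord 1 C' G ->
  ord e (2 * C * C') (fun g x => F g x * G g x).
Proof.
move=> e0 t1 oF oG; have := ordM e0 ler01 oF oG; apply: ordW.
  by rewrite mulr1 !mulr_ge0.
by rewrite mulr1 ler_piMr.
Qed.

(** The constant 2 counts the two terms of [mul2]. A coefficient [c] is absorbed as long as its
    product with the bound of the symbol stays below [K]. *)
Lemma ord_Op C c a b : sym C a b -> `|c| * C <= K -> ord 1 2 (fun g x => c * Op a b g x).
Proof.
move=> S cK; have C0 := sym_ge0 S.
have XO g : X g -> X (Op a b g) /\ N (Op a b g) <= 2 * C * N g.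
  move=> Xg; have [XO n _] := Op_A s1 S Xg; split=> //.
  by rewrite !nnE mulrCA ler_wpM2l ?(ltW (Ka_gt0 s)).
have le z : 0 <= z -> `|c| * (2 * C * z) <= 2 * 1 * K * z.
  by move=> z0; rewrite mulr1 !mulrA ler_wpM2r// [`|c| * 2]mulrC -!mulrA ler_wpM2l.
split=> [//|g Xg Ng|g Xg Ng|g h Xg Ng Xh Nh].
- exact: (XZ c (XO g Xg).1).1.
- rewrite (XZ c (XO g Xg).1).2; apply: le_trans (ler_wpM2l (normr_ge0 c) (XO g Xg).2) _.
  by apply: le_trans (le _ (nn_ge0 g)) _; rewrite mulrA ler_wpM2l// mulr_ge0// mulr1.
- have [XB' _] := XB Xg Xh; have [XOB n] := XO _ XB'.
  rewrite (@eq_nn _ (fun x => c * Op a b (fun x => g x - h x) x)) => [|x]; last first.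
    by rewrite (OpB x s1 S Xg Xh) mulrBr.
  rewrite (XZ c XOB).2; apply: le_trans (ler_wpM2l (normr_ge0 c) n) _.
  exact: le (nn_ge0 _).
Qed.

(** A constant map has no Lipschitz cost, so its order is read from its size alone: data of size
    [t ^+ 2] count as quadratic. *)
Lemma ord_cst f e : X f -> 0 <= e -> N f <= e * t -> ord e 1 (fun _ => f).
Proof.
move=> Xf e0 Nf; split=> [//|//|g _ _|g h _ _ _ _]; first by rewrite mul1r.
rewrite (@eq_nn _ (fun=> 0)) => [|x]; last exact: subrr.
by rewrite X0.2 !mulr_ge0// nn_ge0.
Qed.

End Lipschitz.

(* [w = f / (1 + f)] is the fixed point of [w |-> f - f w]. *)
Lemma nn_inv f : X f -> N f <= 2^-1 ->
  exists w, [/\ X w, N w <= 1 & forall x, w x * (1 + f x) = f x].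
Proof.
move=> Xf Nf.
have [|g Xg Ng|g h Xg Ng Xh Nh|w [Xw Nw e]] := @banach (fun w x => f x - f x * w x) 1.
- exact: ler01.
- have [XM' n] := XM Xf Xg; have [XB' n'] := XB Xf XM'; split=> //; apply: le_trans n' _.
  have : N f * N g <= 2^-1 * 1 by rewrite ler_pM ?nn_ge0.
  by move: (N f) (N g) (N (fun x => f x * g x)) Nf n => *; lra.
- have [XB' _] := XB Xh Xg; have [_ n] := XM Xf XB'.
  rewrite (@eq_nn _ (fun x => f x * (h x - g x))) => [|x]; last by ring.
  by apply: le_trans n _; rewrite (nnBC Xh Xg) ler_wpM2r ?nn_ge0.
exists w; split=> // x; have := congr1 (fun h => h x) e.
by move: (f x) (w x) => a b E; rewrite mulrDr mulr1 -[X in X + _]E; ring.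
Qed.

Lemma inv_neq0 f w : (forall x, w x * (1 + f x) = f x) -> forall x, 1 + f x != 0.
Proof.
move=> e x; apply/eqP => z; have := e x; rewrite z mulr0 => f0.
by move: z; rewrite -f0 addr0 => /eqP; rewrite oner_eq0.
Qed.

Lemma cvA_inv u (u0 : R -> R) (w : nat -> R -> R) (w0 : R -> R) : cvA s u u0 -> (forall n, N (u n) <= 2^-1) ->
  (forall n, X (w n) /\ forall x, w n x * (1 + u n x) = u n x) ->
  X w0 -> N w0 <= 1 -> (forall x, w0 x * (1 + u0 x) = u0 x) -> cvA s w w0.
Proof.
move=> /cvAP[Xu Xu0 cu] Nu Hw Xw0 Nw0 ew0; apply/cvAP; split=> // [n|]; first by case: (Hw n).
(* The difference d of the two quotients satisfies |d| <= |u - u0| + |d| / 2 + |u - u0| in norm, by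
   the bounds on [u n] and [w0]; absorbing the middle term gives 4. *)
apply: (@cvg0_le _ _ (fun n => 4 * N (fun x => u n x - u0 x))); last exact: cvg0Z.
move=> n; rewrite nn_ge0 /=; have [Xw ew] := Hw n.
have [Bw _] := XB Xw Xw0; have [Bu _] := XB (Xu n) Xu0.
have [M1 m1] := XM (Xu n) Bw; have [M2 m2] := XM Bu Xw0.
have [S2 n2] := XD M1 M2; have [_ n3] := XB Bu S2.
have E x : w n x - w0 x = u n x - u0 x - (u n x * (w n x - w0 x) + (u n x - u0 x) * w0 x).
  have := ew x; have := ew0 x; move: (w n x) (w0 x) (u n x) (u0 x) => a b c d h1 h2.
  have e1 : a = c - a * c by rewrite -[X in X - _]h2; ring.
  have e2 : b = d - b * d by rewrite -[X in X - _]h1; ring.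
  rewrite [in LHS]e1 [in LHS]e2; ring.
have m1' : N (u n) * N (fun x => w n x - w0 x) <= 2^-1 * N (fun x => w n x - w0 x).
  by rewrite ler_wpM2r ?nn_ge0.
have m2' : N (fun x => u n x - u0 x) * N w0 <= N (fun x => u n x - u0 x) * 1.
  by rewrite ler_wpM2l ?nn_ge0.
have n3' := le_trans (le_nn_eq E) n3.
move: (N (u n) * _) (N _ * N w0) m1 m1' m2 m2' => c d m1 m1' m2 m2'.
by move: (N _) (N _) (N _) (N _) (N _) m1 m1' m2 m2' n2 n3' => *; lra.
Qed.

End Algebra.

(** * The symbols of the linearized problem *)

Section Symbols.
Context {R : realType}.
Implicit Types (C c d x y e xi : R) (k : nat) (i : regime) (p : @param R).

(* All multiplier bounds below are powers of this quantity, which depends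
   continuously on the parameters. *)
Definition kap i p : R := let: (gam, m, sig) := p in
  1 + gam + gam^-1 + `|m| + `|sig| + `|1 - gam|^-1 +
  (if i is regime3 then (`|m| + `|sig|)^-1 else 0).

(** The number 512 dominates (2 pi)^3 through pi <= 4, the price of three derivatives. The fifth
    power is dictated by the lower bound [ell_lb]. *)
Definition bnd i p : R := 512 * kap i p ^+ 5.

Lemma param_gam i p : param_set i p -> 0 < p.1.1.
Proof.
by case: p => -[gam m] sig; case: i => /=; [case/andP|case=> /(lt_trans ltr01)|case=> /(lt_trans ltr01)].
Qed.

Lemma kap_ge i p : param_set i p -> let: (gam, m, sig) := p in
  [/\ 1 <= kap i p, gam <= kap i p, gam^-1 <= kap i p & `|m| <= kap i p /\ `|sig| <= kap i p] /\
  `|1 - gam|^-1 <= kap i p /\ (i = regime3 -> (`|m| + `|sig|)^-1 <= kap i p).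
Proof.
move=> hp; have g0 := param_gam hp; move: hp; case: p g0 => -[gam m] sig /= g0 hp.
have h1 : 0 < gam^-1 by rewrite invr_gt0.
have h2 : 0 <= `|1 - gam|^-1 by rewrite invr_ge0.
have h3 := normr_ge0 m; have h4 := normr_ge0 sig.
have h5 : 0 <= (if i is regime3 then (`|m| + `|sig|)^-1 else 0).
  by case: i {hp} => //; rewrite invr_ge0 addr_ge0.
have aux (a b c d e z : R) : 0 < a -> 0 < b -> 0 <= c -> 0 <= d -> 0 <= e -> 0 <= z ->
  let K := 1 + a + b + c + d + e + z in
  [/\ 1 <= K, a <= K, b <= K & c <= K /\ d <= K] /\ e <= K /\ z <= K.
  by move=> a0 b0 c0 d0 e0 z0 K; rewrite /K; do ! split; lra.
have [H1 [H2 H3]] := aux _ _ _ _ _ _ g0 h1 h3 h4 h2 h5.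
by split=> //; split=> // ei; move: H3; rewrite {1}ei.
Qed.

Lemma br2 m xi : bracket (m * xi) ^+ 2 = 1 + m ^+ 2 * xi ^+ 2.
Proof. by rewrite br_sq exprMn. Qed.

Lemma br_le_sq x : bracket x <= bracket x ^+ 2.
Proof. by rewrite expr2 ler_peMl ?br_ge1// ltW// br_gt0. Qed.

Lemma symbol_ge1 i p xi : 1 <= symbol i p xi.
Proof.
case: p => -[gam m] sig; rewrite /symbol.
have h : 1 <= bracket (m * xi) ^+ 2 by exact: brX_ge1.
apply: (le_trans h); rewrite lerDl; case: i.
- by rewrite mulr_ge0 ?(ltW (br_gt0 _))// ltW// brX_gt0.
- exact: ltW (br_gt0 _).
- by rewrite mulr_ge0 ?addr_ge0 ?(ltW (br_gt0 _))// ltW// brX_gt0.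
Qed.

Lemma symbol_gt0 i p xi : 0 < symbol i p xi.
Proof. by apply: lt_le_trans (symbol_ge1 i p xi). Qed.

Lemma symbolN i p xi : symbol i p (- xi) = symbol i p xi.
Proof. by case: p => -[gam m] sig; rewrite /symbol !mulrN !brN. Qed.

Lemma cont_symbol i p : continuous (symbol i p).
Proof.
case: p => -[gam m] sig xi; rewrite /symbol.
have cb (c : R) : (fun xi => bracket (c * xi)) @ xi --> bracket (c * xi).
  apply: (@continuous_comp _ _ _ (fun xi : R => c * xi) bracket); last exact: cont_br.
  by apply: cvgM; [exact: cvg_cst|exact: cvg_id].
have cb2 (c : R) : (fun xi => bracket (c * xi) ^+ 2) @ xi --> bracket (c * xi) ^+ 2.
  by rewrite (_ : (fun _ => _) = fun xi => bracket (c * xi) * bracket (c * xi)) //; exact: cvgM.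
have cb1 : bracket xi @[xi --> xi] --> bracket xi by exact: cont_br.
apply: cvgD; first exact: cb2.
case: i => //; first exact: cvgM.
by apply: cvgM; [apply: cvgD; exact: cb|exact: cb2].
Qed.

Lemma symbol_cvg i (p : nat -> @param R) p0 xi :
  (fun n => (p n).1.2) @ \oo --> p0.1.2 -> (fun n => (p n).2) @ \oo --> p0.2 ->
  (fun n => symbol i (p n) xi) @ \oo --> symbol i p0 xi.
Proof.
move=> cm cs; have E n : symbol i (p n) xi = symbol i (0, (p n).1.2, (p n).2) xi.
  by case: (p n) => -[].
have E0 : symbol i p0 xi = symbol i (0, p0.1.2, p0.2) xi by case: (p0) => -[].
rewrite E0; under eq_fun do rewrite E.
rewrite /symbol.
have cb (u : nat -> R) (u0 : R) : u @ \oo --> u0 -> (fun n => bracket (u n * xi)) @ \oo --> bracket (u0 * xi).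
  move=> cu; apply: continuous_cvg; first exact: cont_br.
  by apply: cvgM => //; exact: cvg_cst.
have cb2 (u : nat -> R) (u0 : R) : u @ \oo --> u0 ->
    (fun n => bracket (u n * xi) ^+ 2) @ \oo --> bracket (u0 * xi) ^+ 2.
  move=> /cb cu; rewrite expr2 (_ : (fun _ => _) = fun n => bracket (u n * xi) * bracket (u n * xi)) //.
  exact: cvgM.
apply: cvgD; first exact: cb2.
case: i {E E0}; last 2 first.
- exact: cvg_cst.
- by apply: cvgM; [apply: cvgD; exact: cb|exact: cb2].
- by apply: cvgM; [exact: cvg_cst|exact: cb2].
Qed.

(* [dcoef k xi^k] is the symbol of the [k]-th derivative, up to the power of [i]
   accounted for by the parity splitting in [sa] and [sb]. *)
Fixpoint dcoef k : R := if k is k'.+1 then (if odd k' then 2 * pi else - (2 * pi)) * dcoef k' else 1.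

Definition sy i p c k xi := c * dcoef k * xi ^+ k / symbol i p xi.
Definition sa i p c k xi := if odd k then 0 else sy i p c k xi.
Definition sb i p c k xi := if odd k then sy i p c k xi else 0.
(* [c] times the [k]-th derivative of [P^-1 f]. *)
Definition T i p c k f := Op (sa i p c k) (sb i p c k) f.

Definition bdd i p c k C := forall xi, `|c * dcoef k| * `|xi| ^+ k <= C * symbol i p xi.

Lemma cont_sy i p c k : continuous (sy i p c k).
Proof.
move=> xi; apply: cvgM; last first.
  by apply: cvgV; [rewrite gt_eqF// symbol_gt0|exact: cont_symbol].
by apply: cvgM; [exact: cvg_cst|exact: exprn_continuous].
Qed.

Lemma syN i p c k xi : sy i p c k (- xi) = (-1) ^+ k * sy i p c k xi.
Proof.
by rewrite /sy symbolN (exprNn xi) [in RHS]mulrA; congr (_ / _); rewrite mulrCA.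
Qed.

Lemma sy_bd i p c k C xi : bdd i p c k C -> `|sy i p c k xi| <= C.
Proof.
move=> b; rewrite /sy !normrM normfV (ger0_norm (ltW (symbol_gt0 i p xi))).
by rewrite ler_pdivrMr ?symbol_gt0// normrX -normrM; exact: b.
Qed.

Lemma bdd_ge0 i p c k C : bdd i p c k C -> 0 <= C.
Proof.
move=> /(_ 0); have := symbol_gt0 i p 0 => s0 h.
by rewrite -(pmulr_lge0 _ s0); apply: le_trans h; rewrite mulr_ge0 ?exprn_ge0.
Qed.

Lemma T_sym i p c k C : bdd i p c k C -> sym C (sa i p c k) (sb i p c k).
Proof.
move=> b; have C0 := bdd_ge0 b.
have ms : measurable_fun setT (sy i p c k) by apply: continuous_measurable_fun; exact: cont_sy.
rewrite /sa /sb; split.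
- by case: (odd k) => //; exact: measurable_cst.
- by case: (odd k) => //; exact: measurable_cst.
- by move=> xi; rewrite syN -signr_odd; case: (odd k); rewrite ?mul1r.
- by move=> xi; rewrite syN -signr_odd; case: (odd k); rewrite ?oppr0// expr1 mulN1r.
- by move=> xi; case: (odd k); rewrite ?normr0//; exact: sy_bd.
- by move=> xi; case: (odd k); rewrite ?normr0//; exact: sy_bd.
Qed.

Lemma sa_S i p c k xi : sa i p c k.+1 xi = 2 * pi * xi * sb i p c k xi.
Proof.
rewrite /sa /sb /sy /=; case: (odd k) => /=; last by rewrite mulr0.
by rewrite exprS; ring.
Qed.

Lemma sb_S i p c k xi : sb i p c k.+1 xi = - (2 * pi * xi * sa i p c k xi).
Proof.
rewrite /sa /sb /sy /=; case: (odd k) => /=; first by rewrite mulr0 oppr0.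
by rewrite exprS; ring.
Qed.

Lemma T_prim s i p c k C C' f : (1 <= s)%N -> bdd i p c k C -> bdd i p c k.+1 C' -> A s f ->
  prim (T i p c k f) (T i p c k.+1 f).
Proof.
move=> s1 b b' Af; have := T_sym b'; rewrite /T.
have -> : sa i p c k.+1 = fun xi => 2 * pi * xi * sb i p c k xi by apply/funext => xi; exact: sa_S.
have -> : sb i p c k.+1 = fun xi => - (2 * pi * xi * sa i p c k xi) by apply/funext => xi; exact: sb_S.
by move=> S'; exact: Op_prim s1 (T_sym b) S' Af.
Qed.

Lemma T_Z s i p c d k C f x : (1 <= s)%N -> bdd i p c k C -> A s f ->
  T i p (d * c) k f x = d * T i p c k f x.
Proof.
move=> s1 b Af; have S := T_sym b; have := Op_lin2 d 0 x s1 S S Af.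
rewrite mul0r addr0 => <-; congr (Op _ _ f x); apply/funext => xi; rewrite mul0r addr0.
  by rewrite /sa /sy; case: (odd k); rewrite ?mulr0//; ring.
by rewrite /sb /sy; case: (odd k); rewrite ?mulr0//; ring.
Qed.

(** * Derivatives controlled by the symbol of P *)

Lemma pi_le4 : pi <= 4 :> R.
Proof. by have := @pihalf_lt2 R; lra. Qed.

Lemma absD3 m sig xi : 0 < `|m| + `|sig| ->
  `|xi| <= (`|m| + `|sig|)^-1 * (`|m * xi| + `|sig * xi|).
Proof. by move=> h; rewrite !normrM -mulrDl mulKf// gt_eqF. Qed.

(** In every regime the symbol controls one derivative. In the third one [bracket xi] is absent, and
    |xi| is recovered from |mu xi| + |sigma xi|, which is why [kap] contains the inverse of |mu| +
    |sigma| there. *)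
Lemma xi_le i p xi : param_set i p -> `|xi| <= kap i p * symbol i p xi.
Proof.
move=> hp; have := kap_ge hp; move: (symbol_ge1 i p xi) hp.
case: p => -[gam m] sig S1' hp [[k1 _ _ _] [_ k3]].
have S0 : 0 <= symbol i (gam, m, sig) xi by apply: le_trans S1'.
have [b1 b2 b3] : [/\ `|xi| <= bracket xi, `|m * xi| <= bracket (m * xi) & `|sig * xi| <= bracket (sig * xi)].
  by rewrite !br_geN.
have g1 := br_ge1 (sig * xi); have g2 := br_ge1 (m * xi); have g0 := br_ge1 xi.
have q1 := br_le_sq (sig * xi); have q2 := br_le_sq (m * xi).
move: (kap _ _) k1 k3 => kk k1 k3; case: i hp S1' S0 k3 => /= hp S1' S0 k3.
- apply: le_trans _ (ler_peMl S0 k1).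
  apply: le_trans b1 _; apply: (@le_trans _ _ (bracket xi * bracket (sig * xi) ^+ 2)).
    by rewrite ler_peMr//; [lra|exact: brX_ge1].
  by rewrite lerDr; apply: ltW; exact: brX_gt0.
- apply: le_trans _ (ler_peMl S0 k1).
  by apply: le_trans b1 _; rewrite lerDr; apply: ltW; exact: brX_gt0.
- case: hp => _ hp; apply: le_trans (absD3 xi hp) _.
  apply: ler_pM; [by rewrite invr_ge0 ltW|by rewrite addr_ge0|exact: k3|].
  apply: lerD; first exact: le_trans b2 q2.
  apply: le_trans b3 _; apply: le_trans q1 _.
  rewrite ler_peMl//; [by rewrite ltW// brX_gt0|lra].
Qed.

Lemma m_le i p xi : p.1.2 ^+ 2 * `|xi| ^+ 2 <= symbol i p xi.
Proof.
have S1' := symbol_ge1 i p xi; move: S1'; case: p => -[gam m] sig /= S1'.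
have g1 := br_ge1 (sig * xi); have g2 := br_ge1 (m * xi); have g0 := br_ge1 xi.
have q3 := brX_ge1 2 (sig * xi).
have -> : `|xi| ^+ 2 = xi ^+ 2 by rewrite real_normK ?num_real.
rewrite br2.
have: 0 <= match i with
   | regime1 => bracket xi * bracket (sig * xi) ^+ 2
   | regime2 => bracket xi
   | regime3 => (bracket (sig * xi) + bracket (m * xi)) * bracket (sig * xi) ^+ 2
   end.
  by case: i {S1'}; rewrite ?mulr_ge0 ?addr_ge0//; lra.
by move=> h; apply: (@le_trans _ _ (1 + m ^+ 2 * xi ^+ 2)); [rewrite lerDr|rewrite lerDl].
Qed.

Lemma s_le i p xi : param_set i p -> p.2 ^+ 2 * `|xi| ^+ 2 <= symbol i p xi.
Proof.
case: p => -[gam m] sig hp /=.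
have g1 := br_ge1 (sig * xi); have g2 := br_ge1 (m * xi); have g0 := br_ge1 xi.
have q2 := brX_ge1 2 (m * xi).
have -> : `|xi| ^+ 2 = xi ^+ 2 by rewrite real_normK ?num_real.
have e := br2 sig xi.
have h (c : R) : 1 <= c -> sig ^+ 2 * xi ^+ 2 <= c * bracket (sig * xi) ^+ 2.
  move=> c1; apply: (@le_trans _ _ (bracket (sig * xi) ^+ 2)); first by rewrite e lerDr.
  by rewrite ler_peMl// ltW// brX_gt0.
case: i hp => hp.
- by have := h _ g0; move: (bracket xi * _) => z; lra.
- by case: hp => _ ->; rewrite expr0n /= mul0r; lra.
- have := h (bracket (sig * xi) + bracket (m * xi)) _.
  by move: (_ * bracket (sig * xi) ^+ 2) => z; lra.
Qed.

(** The factor sigma^2 xi^2 is absorbed by the squared bracket of sigma xi, and the remaining |xi|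
    is treated as in [xi_le]. *)
Lemma s3_le i p xi : param_set i p -> p.2 ^+ 2 * `|xi| ^+ 3 <= kap i p * symbol i p xi.
Proof.
move=> hp; have := kap_ge hp; move: (symbol_ge1 i p xi) hp.
case: p => -[gam m] sig S1' hp [[k1 _ _ _] [_ k3]].
have S0 : 0 <= symbol i (gam, m, sig) xi by apply: le_trans S1'.
have [b1 b2 b3] : [/\ `|xi| <= bracket xi, `|m * xi| <= bracket (m * xi) & `|sig * xi| <= bracket (sig * xi)].
  by rewrite !br_geN.
have q2 := brX_ge1 2 (m * xi).
have -> : `|xi| ^+ 3 = `|xi| * xi ^+ 2 by rewrite exprS real_normK ?num_real.
have e := br2 sig xi.
have e1 : sig ^+ 2 * xi ^+ 2 <= bracket (sig * xi) ^+ 2 by rewrite e lerDr.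
have e0 : 0 <= sig ^+ 2 * xi ^+ 2 by rewrite mulr_ge0 ?sqr_ge0.
rewrite [(_, _, _).2]/= mulrCA.
move: (kap _ _) k1 k3 => kk k1 k3; case: i hp S1' S0 k3 => /= hp S1' S0 k3.
- apply: le_trans _ (ler_peMl S0 k1).
  apply: (@le_trans _ _ (bracket xi * bracket (sig * xi) ^+ 2)); first exact: ler_pM.
  by rewrite lerDr; lra.
- by case: hp => _ ->; rewrite expr0n /= mul0r mulr0 mulr_ge0//; lra.
- case: hp => _ hp.
  have k0 : 0 <= (`|m| + `|sig|)^-1 by rewrite invr_ge0 ltW.
  apply: le_trans (ler_wpM2r e0 (absD3 xi hp)) _; rewrite -mulrA.
  apply: ler_pM => //; [by rewrite mulr_ge0 ?addr_ge0|exact: k3|].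
  apply: (@le_trans _ _ ((bracket (sig * xi) + bracket (m * xi)) * bracket (sig * xi) ^+ 2)).
    by apply: ler_pM; [rewrite addr_ge0|exact: e0|rewrite [leRHS]addrC lerD|exact: e1].
  by rewrite lerDr; lra.
Qed.

(* The symbol of the linearized operator is [(ell1 + i ell2) / symbol]. *)
Definition ell1 p xi : R := let: (gam, m, sig) := p in gam + 16 * pi ^+ 2 * gam * m ^+ 2 * xi ^+ 2.
Definition ell2 p xi : R := let: (gam, m, sig) := p in
  2 * pi * xi * (1 - gam ^+ 2 + 4 * pi ^+ 2 * sig ^+ 2 * xi ^+ 2).

(** * Lower bound for the linearized symbol *)

Lemma powers (kk z : R) : 1 <= kk -> 0 <= z ->
  [/\ z <= kk ^+ 5 * z, kk * z <= kk ^+ 5 * z & kk ^+ 3 * z <= kk ^+ 5 * z].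
Proof.
move=> k1 z0; split; first by rewrite ler_peMl// exprn_ege1.
  by rewrite ler_wpM2r// -{1}(expr1 kk) ler_weXn2l.
by rewrite ler_wpM2r// ler_weXn2l.
Qed.

(** In this group of real inequalities [x] stands for |xi|, [S] and [M] for sigma^2 xi^2 and mu^2
    xi^2, [a] and [B] for (lower bounds of) the sizes of [ell1] and [ell2], and [kk] for [kap]. *)
Lemma ell_alpha (kk gam M a : R) : 0 < gam -> 1 <= kk -> gam^-1 <= kk -> 0 <= M ->
  gam + gam * M <= a -> 1 + M <= kk * a /\ kk ^+ 2 <= kk ^+ 3 * a.
Proof.
move=> g0 k1 kg M0 ha; have g1 : 1 <= kk * gam by rewrite -ler_pdivrMr// mul1r.
have h : 1 + M <= kk * a.
  apply: (@le_trans _ _ (kk * (gam + gam * M))); last by rewrite ler_wpM2l//; lra.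
  by have -> : kk * (gam + gam * M) = kk * gam * (1 + M) by [ring]; rewrite ler_peMl//; lra.
split=> //; have -> : kk ^+ 3 * a = kk ^+ 2 * (kk * a) by ring.
by rewrite ler_peMr ?sqr_ge0//; lra.
Qed.

Lemma inv_mul_le (kk c x B : R) : 0 < c -> c^-1 <= kk -> 0 <= x -> x * c <= B -> x <= kk * B.
Proof.
move=> c0 kc x0 h; have g1 : 1 <= kk * c by rewrite -ler_pdivrMr// mul1r.
have k0 : 0 <= kk by apply: le_trans kc; rewrite invr_ge0 ltW.
apply: (@le_trans _ _ (kk * (x * c))); last by rewrite ler_wpM2l.
by have -> : kk * (x * c) = kk * c * x by [ring]; rewrite ler_peMl.
Qed.

(** For gamma < 1 the two terms of [ell2] have the same sign, so [B] controls both of them without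
    cancellation. *)
Lemma ell_lb1 (kk gam a x S M B : R) : 1 <= kk -> gam^-1 <= kk -> (1 - gam)^-1 <= kk ->
  0 < gam < 1 -> 0 <= x -> 0 <= S -> 0 <= M -> S <= kk ^+ 2 + x * S ->
  gam + gam * M <= a -> x * (1 - gam) + x * S <= B ->
  1 + M + (1 + x) * (1 + S) <= 8 * kk ^+ 5 * (a + B).
Proof.
move=> k1 kg kg' /andP[g0 g1] x0 S0 M0 hS ha hB.
have [h1 h2] := ell_alpha g0 k1 kg M0 ha.
have xS0 : 0 <= x * S by rewrite mulr_ge0.
have xg0 : 0 <= x * (1 - gam) by rewrite mulr_ge0//; lra.
have hx : x <= kk * B by apply: (@inv_mul_le kk (1 - gam)) => //; lra.
have B0 : 0 <= B by lra.
have a0 : 0 <= a by apply: le_trans ha; rewrite addr_ge0 ?mulr_ge0// ltW.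
have [p1 p2 p3] := powers k1 a0; have [q1 q2 q3] := powers k1 B0.
move: (kk ^+ 5 * a) (kk ^+ 5 * B) (kk ^+ 3 * a) (kk * a) (kk * B) (kk ^+ 2) (x * S) (mulrDr (8 * kk ^+ 5) a B)
  (mulrA 8 (kk ^+ 5) a) (mulrA 8 (kk ^+ 5) B) (mulrDl 1 x (1 + S)) (mulrDr x 1 S)
  h1 h2 hx hS p1 p2 p3 q1 q2 q3 hB xS0 => A5 B5 A3 A1 B1 k2 xS -> <- <- -> ->.
by lra.
Qed.

(** With sigma = 0 only the first-order term of [ell2] is left, and it is bounded below because
    gamma stays away from 1. *)
Lemma ell_lb2 (kk gam a x M B : R) : 1 <= kk -> gam^-1 <= kk -> (gam - 1)^-1 <= kk ->
  1 < gam -> 0 <= x -> 0 <= M ->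
  gam + gam * M <= a -> x * (gam - 1) <= B ->
  1 + M + (1 + x) <= 8 * kk ^+ 5 * (a + B).
Proof.
move=> k1 kg kg' g1 x0 M0 ha hB; have g0 : 0 < gam by lra.
have [h1 h2] := ell_alpha g0 k1 kg M0 ha.
have xg0 : 0 <= x * (gam - 1) by rewrite mulr_ge0//; lra.
have hx : x <= kk * B by apply: (@inv_mul_le kk (gam - 1)) => //; lra.
have B0 : 0 <= B by lra.
have a0 : 0 <= a by apply: le_trans ha; rewrite addr_ge0 ?mulr_ge0// ltW.
have [p1 p2 p3] := powers k1 a0; have [q1 q2 q3] := powers k1 B0.
move: (kk ^+ 5 * a) (kk ^+ 5 * B) (kk * a) (kk * B) (mulrDr (8 * kk ^+ 5) a B)
  (mulrA 8 (kk ^+ 5) a) (mulrA 8 (kk ^+ 5) B)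
  h1 hx p1 p2 q1 q2 => A5 B5 A1 B1 -> <- <-.
by lra.
Qed.

(** Here [A] and [b] are the brackets of sigma xi and mu xi. For gamma > 1 the terms of [ell2] have
    opposite signs and may cancel. The disjunction separates frequencies where sigma xi is bounded,
    so that [A] is bounded and [a] suffices, from those where the cubic term prevails. *)
Lemma ell_lb3 (kk gam a x s0 S mu0 M B A b am asg : R) : 1 <= kk -> gam^-1 <= kk ->
  1 < gam -> 0 <= x -> 0 <= s0 -> 0 <= mu0 -> S = s0 ^+ 2 -> M = mu0 ^+ 2 ->
  1 <= A -> 1 <= b -> A ^+ 2 = 1 + S -> b ^+ 2 = 1 + M -> A <= 1 + s0 -> b <= 1 + mu0 ->
  0 <= am -> 0 <= asg -> am <= kk -> asg <= kk -> s0 = asg * x -> mu0 = am * x ->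
  gam + gam * M <= a -> 0 <= B -> (S <= kk ^+ 2 \/ x * S <= B /\ S <= kk ^+ 2 + x * S) ->
  b ^+ 2 + (A + b) * A ^+ 2 <= 8 * kk ^+ 5 * (a + B).
Proof.
move=> k1 kg g1 x0 s00 m0 eS eM A1 b1 eA eb hA hb am0 as0 amk ask es em ha B0 H.
have S0 : 0 <= S by rewrite eS sqr_ge0.
have M0 : 0 <= M by rewrite eM sqr_ge0.
have g0 : 0 < gam by lra.
have k0 : 0 <= kk by lra.
have [h1 h2] := ell_alpha g0 k1 kg M0 ha.
have a0 : 0 <= a by apply: le_trans ha; rewrite addr_ge0 ?mulr_ge0// ltW.
have [p1 p2 p3] := powers k1 a0; have [q1 q2 q3] := powers k1 B0.
have ka1 : 1 <= kk * a by lra.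
case: H => [hS|[hx hS]].
- have hA2 : A ^+ 2 <= 1 + kk ^+ 2 by rewrite eA lerD2l.
  have hAA : A <= 1 + kk ^+ 2 by apply: le_trans hA2; rewrite expr2 ler_peMl//; lra.
  have hbb : b <= kk * a by apply: le_trans h1; rewrite -eb expr2 ler_peMl//; lra.
  have h3 : (A + b) * A ^+ 2 <= (1 + kk ^+ 2 + kk * a) * (1 + kk ^+ 2).
    apply: ler_pM => //; [lra|exact: sqr_ge0|exact: lerD].
  have h4 : (1 + kk ^+ 2) ^+ 2 <= (1 + kk ^+ 2) ^+ 2 * (kk * a) by rewrite ler_peMr ?sqr_ge0.
  have e3 : (1 + kk ^+ 2 + kk * a) * (1 + kk ^+ 2) = (1 + kk ^+ 2) ^+ 2 + kk * a + kk ^+ 3 * a by ring.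
  have e4 : (1 + kk ^+ 2) ^+ 2 * (kk * a) = kk * a + 2 * (kk ^+ 3 * a) + kk ^+ 5 * a by ring.
  have e5 : 8 * kk ^+ 5 * (a + B) = 8 * (kk ^+ 5 * a) + 8 * (kk ^+ 5 * B) by ring.
  have B50 : 0 <= kk ^+ 5 * B by rewrite mulr_ge0// exprn_ge0.
  rewrite e3 in h3; rewrite e4 in h4; rewrite e5 eb.
  move: (kk ^+ 5 * a) (kk ^+ 5 * B) (kk ^+ 3 * a) (kk * a) ((1 + kk ^+ 2) ^+ 2) ((A + b) * _) h1 h3 h4 p1 p2 p3 B50 => *; lra.
- have f1 : A * A ^+ 2 <= (1 + s0) * (1 + S) by rewrite eA ler_wpM2r//; lra.
  have f2 : b * A ^+ 2 <= (1 + mu0) * (1 + S) by rewrite eA ler_wpM2r//; lra.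
  have f3 : s0 <= 1 + S by have := sqr_ge0 (s0 - 1); rewrite eS; nra.
  have f4 : mu0 <= 1 + M by have := sqr_ge0 (mu0 - 1); rewrite eM; nra.
  have xS0 : 0 <= x * S by rewrite mulr_ge0.
  have f5 : s0 * S <= kk * B.
    by rewrite es -mulrA; apply: ler_pM.
  have f6 : mu0 * S <= kk * B.
    by rewrite em -mulrA; apply: ler_pM.
  have e1 : (1 + s0) * (1 + S) = 1 + s0 + S + s0 * S by ring.
  have e2 : (1 + mu0) * (1 + S) = 1 + mu0 + S + mu0 * S by ring.
  have e5 : 8 * kk ^+ 5 * (a + B) = 8 * (kk ^+ 5 * a) + 8 * (kk ^+ 5 * B) by ring.
  rewrite e1 in f1; rewrite e2 in f2; rewrite e5 eb mulrDl.
  move: (kk ^+ 5 * a) (kk ^+ 5 * B) (kk ^+ 3 * a) (kk * a) (kk * B) (kk ^+ 2) (A * _) (b * _) (s0 * S) (mu0 * S) (x * S)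
    h1 h2 p1 p2 p3 q1 q2 hx hS f1 f2 f5 f6 xS0 => *; lra.
Qed.

(** For [x <= 1] the left side is at most sigma^2; for larger [x] the extra factor [x] only
    helps. *)
Lemma sq_split (x sg kk : R) : 0 <= x -> 1 <= kk -> `|sg| <= kk ->
  sg ^+ 2 * x ^+ 2 <= kk ^+ 2 + x * (sg ^+ 2 * x ^+ 2).
Proof.
move=> x0 k1 hs; have S0 : 0 <= sg ^+ 2 * x ^+ 2 by rewrite mulr_ge0 ?sqr_ge0.
have [x1|x1] := leP x 1.
  apply: (@le_trans _ _ (kk ^+ 2)); last by rewrite lerDl mulr_ge0.
  have h1 : sg ^+ 2 <= kk ^+ 2 by rewrite -(real_normK (num_real sg)) lerXn2r// nnegrE//; lra.
  by apply: le_trans h1; rewrite ler_piMr ?sqr_ge0// expr_le1.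
by apply: (@le_trans _ _ (x * (sg ^+ 2 * x ^+ 2))); [rewrite ler_peMl// ltW|rewrite lerDr sqr_ge0].
Qed.

(** The even part [ell1] is at least gamma and grows like mu^2 xi^2; the odd part [ell2] supplies
    the growth in |xi| and in sigma^2 |xi|^3 wherever it does not cancel. *)
Lemma ell_lb i p xi : param_set i p ->
  symbol i p xi <= 8 * kap i p ^+ 5 * (`|ell1 p xi| + `|ell2 p xi|).
Proof.
move=> hp; have g0 := param_gam hp; have := kap_ge hp; move: hp g0.
case: p => -[gam m] sig hp; rewrite [_.1.1]/= => g0 [[k1 kg kig [km ks]] [k2 k3]].
move: (kap _ _) k1 kg kig km ks k2 k3 => kk k1 kg kig km ks k2 k3.
have x2 : `|xi| ^+ 2 = xi ^+ 2 by rewrite real_normK ?num_real.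
set M := m ^+ 2 * xi ^+ 2; set S := sig ^+ 2 * xi ^+ 2.
have M0 : 0 <= M by rewrite mulr_ge0 ?sqr_ge0.
have S0 : 0 <= S by rewrite mulr_ge0 ?sqr_ge0.
have x0 := normr_ge0 xi.
have hS : S <= kk ^+ 2 + `|xi| * S.
  by have := sq_split x0 k1 ks; rewrite x2.
have p2 := @pi_ge2 R; have pp : 4 <= pi ^+ 2 :> R.
  by have := ler_pM (ler0n R 2) (ler0n R 2) p2 p2; rewrite -expr2; lra.
have a1 : gam + gam * M <= `|ell1 (gam, m, sig) xi|.
  apply: le_trans (ler_norm _); rewrite /ell1 lerD2l /M.
  have -> : 16 * pi ^+ 2 * gam * m ^+ 2 * xi ^+ 2 = 16 * pi ^+ 2 * (gam * M) by rewrite /M; ring.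
  by rewrite ler_peMl; [|rewrite mulr_ge0 ?(ltW g0)|lra].
have a2 : `|ell2 (gam, m, sig) xi| = 2 * pi * `|xi| * `|1 - gam ^+ 2 + 4 * pi ^+ 2 * S|.
  rewrite /ell2 !normrM (ger0_norm (pi_ge0 R)) ger0_norm//; congr (_ * `|_|); rewrite /S; ring.
have PS0 : S <= 4 * pi ^+ 2 * S by rewrite ler_peMl//; lra.
have br_xi := br_leD xi.
have hb2 := br2 m xi; have hs2 := br2 sig xi.
case: i hp k3 => hp k3; rewrite /symbol.
- case/andP: hp => _ g1.
  apply: le_trans (_ : _ <= 1 + M + (1 + `|xi|) * (1 + S)) _.
    by rewrite hb2 hs2 -/M -/S lerD2l ler_wpM2r//; lra.
  apply: (ell_lb1 k1 kig _ _ x0 S0 M0 hS a1).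
  + by rewrite ger0_norm in k2; lra.
  + by rewrite g0.
  + rewrite a2 -mulrDr; have g2 : gam ^+ 2 <= gam by rewrite expr2 ler_piMl// ltW.
    rewrite (ger0_norm (_ : 0 <= 1 - gam ^+ 2 + 4 * pi ^+ 2 * S)); last lra.
    apply: ler_pM => //; [lra| |lra].
    by rewrite ler_peMl//; lra.
- case: hp => g1 s0.
  have S00 : S = 0 by rewrite /S s0 expr0n mul0r.
  apply: le_trans (_ : _ <= 1 + M + (1 + `|xi|)) _; first by rewrite hb2 lerD2l.
  apply: (ell_lb2 k1 kig _ g1 x0 M0 a1).
    by rewrite ltr0_norm in k2; [rewrite opprB in k2|lra].
  rewrite a2 S00 mulr0 addr0; have g2 : gam <= gam ^+ 2 by rewrite expr2 ler_peMl// ltW.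
  rewrite (ler0_norm (_ : 1 - gam ^+ 2 <= 0)); last lra.
  apply: ler_pM => //; [lra| |lra].
  by rewrite ler_peMl//; lra.
- case: hp => g1 ms.
  apply: (@ell_lb3 kk gam _ `|xi| `|sig * xi| S `|m * xi| M _ _ _ `|m| `|sig|) => //.
  + by rewrite real_normK ?num_real// exprMn.
  + by rewrite real_normK ?num_real// exprMn.
  + exact: br_ge1.
  + exact: br_ge1.
  + exact: br_leD.
  + exact: br_leD.
  + exact: normrM.
  + exact: normrM.
  (* Below this threshold sigma^2 xi^2 is at most a multiple of gamma^2, hence at most [kk ^+ 2].
     Above it the cubic term is at least twice the linear one it competes with, so half of it
     survives. *)
  + have [h|h] := leP (4 * pi ^+ 2 * S) (2 * (gam ^+ 2 - 1)); [left|right].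
      have : gam ^+ 2 <= kk ^+ 2 by rewrite lerXn2r// nnegrE; lra.
      have : 16 * S <= 4 * pi ^+ 2 * S by rewrite ler_wpM2r//; lra.
      by lra.
    split=> //; rewrite a2.
    have h1 : S <= `|1 - gam ^+ 2 + 4 * pi ^+ 2 * S|.
      apply: le_trans (ler_norm _).
      have : 16 * S <= 4 * pi ^+ 2 * S by rewrite ler_wpM2r//; lra.
      by lra.
    by apply: ler_pM => //; rewrite ler_peMl//; lra.
Qed.

(** The factors 1 and -1 are kept so that the expression is literally an iterated combination of the
    form produced by [symD] and [symZ] and split by [Op_lin2]; [lAE] and [lBE] give the closed
    form. *)
Definition lA i p xi : R := let: (gam, m, sig) := p in
  1 * (gam * sa i p 1 0 xi + (1 - gam ^+ 2) * sa i p 1 1 xi) +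
  1 * (- (4 * gam) * sa i p (m ^+ 2) 2 xi + -1 * sa i p (sig ^+ 2) 3 xi).
Definition lB i p xi : R := let: (gam, m, sig) := p in
  1 * (gam * sb i p 1 0 xi + (1 - gam ^+ 2) * sb i p 1 1 xi) +
  1 * (- (4 * gam) * sb i p (m ^+ 2) 2 xi + -1 * sb i p (sig ^+ 2) 3 xi).

Lemma lAE i p xi : lA i p xi = ell1 p xi / symbol i p xi.
Proof.
case: p => -[gam m] sig; rewrite /lA /sa /sy; set q := (symbol _ _ _)^-1; rewrite /= expr0; ring.
Qed.

Lemma lBE i p xi : lB i p xi = - (ell2 p xi / symbol i p xi).
Proof.
case: p => -[gam m] sig; rewrite /lB /sb /sy; set q := (symbol _ _ _)^-1; rewrite /=; ring.
Qed.

Lemma ell_ge1 i p xi : param_set i p -> 1 <= 8 * kap i p ^+ 5 * (`|lA i p xi| + `|lB i p xi|).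
Proof.
move=> hp; rewrite lAE lBE normrN !normrM -mulrDl mulrA normfV.
by rewrite (ger0_norm (ltW (symbol_gt0 i p xi))) ler_pdivlMr ?symbol_gt0// mul1r; exact: ell_lb.
Qed.

Definition den i p xi := lA i p xi ^+ 2 + lB i p xi ^+ 2.
(* Real and imaginary parts of the inverse of [lA + i lB]. *)
Definition ia i p xi := lA i p xi / den i p xi.
Definition ib i p xi := - (lB i p xi / den i p xi).

Lemma kap_ge1 i p : param_set i p -> 1 <= kap i p.
Proof. by move=> /kap_ge; case: p => -[gam m] sig [[]]. Qed.

Lemma den_gt0 i p xi : param_set i p -> 0 < den i p xi.
Proof.
move=> hp; rewrite lt0r addr_ge0 ?sqr_ge0// andbT; apply/eqP => /eqP.
rewrite paddr_eq0 ?sqr_ge0// !sqrf_eq0 => /andP[/eqP a0 /eqP b0].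
by have := ell_ge1 xi hp; rewrite a0 b0 normr0 addr0 mulr0 ler10.
Qed.

(** Multiplying |a| by the hypothesis bounds it by [K * (a ^+ 2 + |a| * |b|)], and the mixed term is
    absorbed into the squares. *)
Lemma inv_bd (K a b : R) : 0 <= K -> 1 <= K * (`|a| + `|b|) -> 0 < a ^+ 2 + b ^+ 2 ->
  `|a / (a ^+ 2 + b ^+ 2)| <= 2 * K.
Proof.
move=> K0 h d0; rewrite normrM normfV (ger0_norm (ltW d0)) ler_pdivrMr//.
rewrite -(real_normK (num_real a)) -(real_normK (num_real b)).
have aux (x y : R) : 0 <= x -> 0 <= y -> 1 <= K * (x + y) -> x <= 2 * K * (x ^+ 2 + y ^+ 2); last exact: aux.
move=> x0 y0 h'.
apply: (@le_trans _ _ (x * (K * (x + y)))); first by rewrite ler_peMr.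
(* This is exactly twice the difference of the two sides to be compared. *)
have : 0 <= K * ((x - y) ^+ 2 + x ^+ 2 + y ^+ 2 + y ^+ 2 + y ^+ 2) by rewrite mulr_ge0// !addr_ge0 ?sqr_ge0.
have -> : x * (K * (x + y)) = K * (x * x) + K * (x * y) by ring.
have -> : 2 * K * (x ^+ 2 + y ^+ 2) = 2 * (K * (x * x)) + 2 * (K * (y * y)) by ring.
have -> : K * ((x - y) ^+ 2 + x ^+ 2 + y ^+ 2 + y ^+ 2 + y ^+ 2) =
  2 * (K * (x * x)) + 4 * (K * (y * y)) - 2 * (K * (x * y)) by ring.
have : 0 <= K * (x * x) by rewrite !mulr_ge0.
have : 0 <= K * (y * y) by rewrite !mulr_ge0.
by move: (K * (x * x)) (K * (y * y)) (K * (x * y)) => *; lra.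
Qed.

Lemma cont_ell i p : continuous (lA i p) /\ continuous (lB i p).
Proof.
case: p => -[gam m] sig.
have c1 : continuous (sy i (gam, m, sig) 1 0) := @cont_sy _ _ _ _.
have c2 : continuous (sy i (gam, m, sig) 1 1) := @cont_sy _ _ _ _.
have c3 : continuous (sy i (gam, m, sig) (m ^+ 2) 2) := @cont_sy _ _ _ _.
have c4 : continuous (sy i (gam, m, sig) (sig ^+ 2) 3) := @cont_sy _ _ _ _.
split=> x; rewrite /lA /lB /sa /sb /=.
  apply: cvgD; apply: cvgM; first exact: cvg_cst.
  - by apply: cvgD; apply: cvgM; try exact: cvg_cst; exact: c1.
  - exact: cvg_cst.
  - by apply: cvgD; apply: cvgM; try exact: cvg_cst; exact: c3.
apply: cvgD; apply: cvgM; first exact: cvg_cst.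
- by apply: cvgD; apply: cvgM; try exact: cvg_cst; exact: c2.
- exact: cvg_cst.
- by apply: cvgD; apply: cvgM; try exact: cvg_cst; exact: c4.
Qed.

Lemma inv_sym i p : param_set i p -> sym (16 * kap i p ^+ 5) (ia i p) (ib i p).
Proof.
move=> hp; have [cA cB] := cont_ell i p.
have cd : continuous (den i p).
  by move=> x; apply: cvgD; rewrite expr2; apply: cvgM; [exact: cA|exact: cA|exact: cB|exact: cB].
have cq (f : R -> R) : continuous f -> measurable_fun setT (fun x => f x / den i p x).
  move=> cf; apply: continuous_measurable_fun => x; apply: cvgM; first exact: cf.
  by apply: cvgV; [rewrite gt_eqF// den_gt0|exact: cd].
have eA xi : lA i p (- xi) = lA i p xi.
  by rewrite !lAE symbolN; congr (_ / _); case: (p) => -[gam m] sig; rewrite /ell1 sqrrN.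
have eB xi : lB i p (- xi) = - lB i p xi.
  rewrite !lBE symbolN; congr (- _); rewrite -mulNr; congr (_ / _).
  by case: (p) => -[gam m] sig; rewrite /ell2 sqrrN mulrN mulNr.
have ed xi : den i p (- xi) = den i p xi by rewrite /den eA eB sqrrN.
have K0 : 0 <= 8 * kap i p ^+ 5 by rewrite mulr_ge0// exprn_ge0// (le_trans ler01)// kap_ge1.
have e16 : 16 * kap i p ^+ 5 = 2 * (8 * kap i p ^+ 5) by ring.
split.
- exact: cq.
- by apply: measurable_funN; exact: cq.
- by move=> xi; rewrite /ia eA ed.
- by move=> xi; rewrite /ib eB ed mulNr.
- move=> xi; rewrite e16; apply: inv_bd => //; [exact: ell_ge1|exact: den_gt0].
- move=> xi; rewrite e16 normrN /den addrC; apply: inv_bd => //; first by rewrite addrC; exact: ell_ge1.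
  by rewrite addrC; exact: den_gt0.
Qed.

Lemma bnd_le i p (z : R) : param_set i p -> 0 <= z ->
  forall j, (j <= 5)%N -> forall c : R, 0 <= c <= 512 -> c * (kap i p ^+ j * z) <= bnd i p * z.
Proof.
move=> hp z0 j j5 c /andP[c0 c1]; have k1 := kap_ge1 hp; rewrite /bnd -[leRHS]mulrA.
apply: ler_pM => //; first by rewrite mulr_ge0// exprn_ge0// (le_trans ler01).
by rewrite ler_wpM2r// ler_weXn2l.
Qed.

Lemma bnd_ge1 i p : param_set i p -> 1 <= bnd i p.
Proof.
by move=> hp; have := @bnd_le i p 1 hp ler01 0 isT 1; rewrite ler01 expr0 !mulr1; apply; rewrite /= ler1n.
Qed.

Lemma bnd_kap i p : param_set i p -> kap i p <= bnd i p.
Proof.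
by move=> hp; have := @bnd_le i p 1 hp ler01 1 isT 1; rewrite ler01 expr1 !mulr1 mul1r; apply; rewrite /= ler1n.
Qed.

Lemma pi_pow : [/\ 2 * pi <= 8 :> R, 4 * pi ^+ 2 <= 64 :> R & 8 * pi ^+ 3 <= 512 :> R].
Proof.
have p4 := pi_le4; have p0 := pi_ge0 R.
have h2 : pi ^+ 2 <= 4 ^+ 2 :> R by rewrite lerXn2r// nnegrE.
have h3 : pi ^+ 3 <= 4 ^+ 3 :> R by rewrite lerXn2r// nnegrE.
split; first lra.
  by have -> : 64 = 4 * 4 ^+ 2 :> R by [ring]; rewrite ler_wpM2l.
by have -> : 512 = 8 * 4 ^+ 3 :> R by [ring]; rewrite ler_wpM2l.
Qed.

(** With [bdd_m] and [bdd_s]: the inverse of P gains one derivative always, two after multiplication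
    by mu^2, three after multiplication by sigma^2. These are the exponents s+1, s+2, s+3 of the
    theorem. *)
Lemma bdd_1 i p : param_set i p -> bdd i p 1 0 (bnd i p) /\ bdd i p 1 1 (bnd i p).
Proof.
move=> hp; have [p2 _ _] := pi_pow; have p0 := pi_ge0 R.
split=> xi; have S0 := ltW (symbol_gt0 i p xi).
  rewrite /= mulr1 normr1 expr0 mulr1; apply: le_trans (symbol_ge1 i p xi) _.
  by rewrite ler_peMl// bnd_ge1.
rewrite /= mulr1 mul1r normrN expr1 ger0_norm ?mulr_ge0//.
apply: le_trans (bnd_le hp S0 (j := 1) isT (c := 2 * pi) _); last first.
  by rewrite mulr_ge0//=; lra.
by rewrite expr1 ler_wpM2l ?mulr_ge0//; exact: xi_le.
Qed.

Lemma bdd_m i p : param_set i p ->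
  [/\ bdd i p (p.1.2 ^+ 2) 0 (bnd i p), bdd i p (p.1.2 ^+ 2) 1 (bnd i p) &
      bdd i p (p.1.2 ^+ 2) 2 (bnd i p)].
Proof.
move=> hp; have [p2 p4 _] := pi_pow; have p0 := pi_ge0 R; have k1 := kap_ge1 hp.
have m2 : p.1.2 ^+ 2 <= kap i p ^+ 2.
  have := kap_ge hp; case: (p) k1 => -[gam m] sig k1 [[_ _ _ [km _]] _] /=.
  by rewrite -(real_normK (num_real m)) lerXn2r// nnegrE//; apply: le_trans k1.
have m0 := sqr_ge0 p.1.2.
split=> xi; have S0 := ltW (symbol_gt0 i p xi).
- rewrite /= mulr1 expr0 mulr1 ger0_norm//; apply: le_trans m2 _.
  apply: le_trans (bnd_le hp S0 (j := 2) isT (c := 1) _); last by rewrite ler01 ler1n.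
  by rewrite mul1r ler_peMr ?sqr_ge0//; exact: symbol_ge1.
- have -> : `|p.1.2 ^+ 2 * dcoef 1| = 2 * pi * p.1.2 ^+ 2.
    by rewrite /= mulr1 mulrN normrN ger0_norm; [ring|exact: mulr_ge0 m0 (mulr_ge0 (ler0n R 2) p0)].
  apply: le_trans (bnd_le hp S0 (j := 3) isT (c := 2 * pi) _); last by rewrite mulr_ge0//=; lra.
  rewrite expr1 -[leLHS]mulrA.
  rewrite ler_wpM2l ?mulr_ge0// [in leRHS]exprSr -[leRHS]mulrA.
  by apply: ler_pM => //; exact: xi_le.
- rewrite /= mulr1 !mulrN normrN ger0_norm; last first.
    exact: mulr_ge0 m0 (mulr_ge0 (mulr_ge0 (ler0n R 2) p0) (mulr_ge0 (ler0n R 2) p0)).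
  have -> : p.1.2 ^+ 2 * (2 * pi * (2 * pi)) * `|xi| ^+ 2 = 4 * pi ^+ 2 * (p.1.2 ^+ 2 * `|xi| ^+ 2) by ring.
  apply: le_trans (bnd_le hp S0 (j := 0) isT (c := 4 * pi ^+ 2) _).
    by rewrite expr0 mul1r ler_wpM2l ?mulr_ge0//; exact: m_le.
  by have := sqr_ge0 (pi : R); move: (pi ^+ 2) p4 => z *; apply/andP; split; lra.
Qed.

Lemma bdd_s i p : param_set i p -> forall k, (k <= 3)%N -> bdd i p (p.2 ^+ 2) k (bnd i p).
Proof.
move=> hp; have [p2 p4 p8] := pi_pow; have p0 := pi_ge0 R; have k1 := kap_ge1 hp.
have m2 : p.2 ^+ 2 <= kap i p ^+ 2.
  have := kap_ge hp; case: (p) k1 => -[gam m] sig k1 [[_ _ _ [_ km]] _] /=.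
  by rewrite -(real_normK (num_real sig)) lerXn2r// nnegrE//; apply: le_trans k1.
have m0 := sqr_ge0 p.2.
case=> [|[|[|[|k]]]]// _ xi; have S0 := ltW (symbol_gt0 i p xi).
- rewrite /= mulr1 expr0 mulr1 ger0_norm//; apply: le_trans m2 _.
  apply: le_trans (bnd_le hp S0 (j := 2) isT (c := 1) _); last by rewrite ler01 ler1n.
  by rewrite mul1r ler_peMr ?sqr_ge0//; exact: symbol_ge1.
- have -> : `|p.2 ^+ 2 * dcoef 1| = 2 * pi * p.2 ^+ 2.
    by rewrite /= mulr1 mulrN normrN ger0_norm; [ring|exact: mulr_ge0 m0 (mulr_ge0 (ler0n R 2) p0)].
  apply: le_trans (bnd_le hp S0 (j := 3) isT (c := 2 * pi) _); last by rewrite mulr_ge0//=; lra.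
  rewrite expr1 -[leLHS]mulrA.
  rewrite ler_wpM2l ?mulr_ge0// [in leRHS]exprSr -[leRHS]mulrA.
  by apply: ler_pM => //; exact: xi_le.
- rewrite /= mulr1 !mulrN normrN ger0_norm; last first.
    exact: mulr_ge0 m0 (mulr_ge0 (mulr_ge0 (ler0n R 2) p0) (mulr_ge0 (ler0n R 2) p0)).
  have -> : p.2 ^+ 2 * (2 * pi * (2 * pi)) * `|xi| ^+ 2 = 4 * pi ^+ 2 * (p.2 ^+ 2 * `|xi| ^+ 2) by ring.
  apply: le_trans (bnd_le hp S0 (j := 0) isT (c := 4 * pi ^+ 2) _).
    by rewrite expr0 mul1r ler_wpM2l ?mulr_ge0//; exact: s_le.
  by have := sqr_ge0 (pi : R); move: (pi ^+ 2) p4 => z *; apply/andP; split; lra.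
- rewrite /= mulr1 !(mulrN, mulNr) opprK ger0_norm; last first.
    by apply: mulr_ge0 m0 _; do ! apply: mulr_ge0.
  have -> : p.2 ^+ 2 * (2 * pi * (2 * pi * (2 * pi))) * `|xi| ^+ 3 = 8 * pi ^+ 3 * (p.2 ^+ 2 * `|xi| ^+ 3) by ring.
  apply: le_trans (bnd_le hp S0 (j := 1) isT (c := 8 * pi ^+ 3) _).
    by rewrite expr1 ler_wpM2l ?mulr_ge0 ?exprn_ge0//; exact: s3_le.
  by rewrite p8 mulr_ge0 ?exprn_ge0.
Qed.

Lemma inv_sym_bnd i p : param_set i p -> sym (bnd i p) (ia i p) (ib i p).
Proof.
move=> hp; have [ma mb ea ob ba bb] := inv_sym hp; have k1 := kap_ge1 hp.
have h : 16 * kap i p ^+ 5 <= bnd i p.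
  by rewrite ler_wpM2r ?exprn_ge0// ?(le_trans ler01 k1)// ler_nat.
by split=> // xi; [exact: le_trans (ba xi) h|exact: le_trans (bb xi) h].
Qed.

End Symbols.

(** * The fixed point problem *)

Section Solve.
Context {R : realType} (i : regime) (s : nat) (s1 : (1 <= s)%N) (l : nat).
Implicit Types (f g h u w : R -> R) (C c d x y e xi : R) (k : nat) (p : @param R) (ta ph : 'I_l.+1 -> R -> R).
Local Notation X := (A s).
Local Notation N := (nn s).

Definition eta_of p := T i p 1 0.
Definition eta1 p := T i p 1 1.
Definition mD p := T i p (p.1.2 ^+ 2).
Definition sD p := T i p (p.2 ^+ 2).

Definition Lin p g x : R := p.1.1 * eta_of p g x + (1 - p.1.1 ^+ 2) * eta1 p g x
  - 4 * p.1.1 * mD p 2 g x - sD p 3 g x.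

Definition Forc p ta ph g x : R := \sum_(j < l.+1) eta_of p g x ^+ j * (ta j x * eta1 p g x + ph j x).

(* The momentum equation, multiplied by [(1 + eta)^2], is [Lin g + Rem g = 0]. *)
Definition Rem p ta ph g x : R := let E := eta_of p g x in let F := Forc p ta ph g x in
  p.1.1 * E * E + -4 * (p.1.1 * mD p 2 g x * E) + 4 * (p.1.1 * mD p 1 g x * eta1 p g x)
  + (3 * E + 3 * (E * E) + E * E * E) * (eta1 p g x - sD p 3 g x)
  + (F + (E * F + E * F) + E * (E * F)).

(** One factor bounds the multipliers, the other leaves room for the coefficient gamma, as in
    [gam_KK]. *)
Definition KK p : R := bnd i p ^+ 2.

Lemma KK_ge1 p : param_set i p -> 1 <= KK p.
Proof. by move=> hp; rewrite /KK exprn_ege1// bnd_ge1. Qed.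

Lemma bnd_le_KK p : param_set i p -> bnd i p <= KK p.
Proof.
by move=> hp; have := bnd_ge1 hp => b1; rewrite /KK expr2 ler_peMl// (le_trans ler01).
Qed.

Lemma gam_KK p : param_set i p -> `|p.1.1| * bnd i p <= KK p.
Proof.
move=> hp; have b1 := bnd_ge1 hp; rewrite /KK expr2 ler_wpM2r ?(le_trans ler01)//.
rewrite gtr0_norm ?(param_gam hp)//; apply: le_trans (bnd_kap hp).
by have := kap_ge hp; case: (p) => -[gam m] sig [[]].
Qed.

Lemma ord2M K rho C C' F G : 0 <= K -> 0 <= rho -> ord s K rho 1 C F -> ord s K rho 1 C' G ->
  ord s K rho (K * rho) (2 * C * C') (fun g x => F g x * G g x).
Proof. by move=> K0 r0 oF oG; have := ordM s1 K0 r0 ler01 ler01 oF oG; rewrite !mul1r. Qed.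

Lemma ord_sum K rho e (C : nat -> R) (F : nat -> (R -> R) -> R -> R) n : 0 <= K -> 0 <= rho -> 0 <= e ->
  (forall j, (j < n)%N -> ord s K rho e (C j) (F j)) ->
  ord s K rho e (\sum_(j < n) C j) (fun g x => \sum_(j < n) F j g x).
Proof.
move=> K0 r0 e0; elim: n => [|n IH] oF.
  rewrite big_ord0; have [X0' N0] := @X0 R s s1.
  have E0 : (fun x : R => \sum_(j < 0) F j (fun=> 0) x) = fun=> 0.
    by apply/funext => x; rewrite big_ord0.
  have E g : (fun x : R => \sum_(j < 0) F j g x) = fun=> 0.
    by apply/funext => x; rewrite big_ord0.
  split=> // [g _ _|g _ _|g h _ _ _ _].
  - by rewrite E.
  - by rewrite E N0 !mul0r.
  - rewrite (@eq_nn _ _ _ (fun=> 0)) => [|x]; last by rewrite !big_ord0 subrr.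
    by rewrite N0 !mul0r.
have := ordD s1 (IH (fun j jn => oF j (ltnW jn))) (oF n (ltnSn n)).
rewrite big_ord_recr /=; apply: eq_ord => g x; by rewrite big_ord_recr.
Qed.

(** Each further factor [G] costs 2 * 2 by [ordM1] and keeps the order [e]. *)
Lemma ord_pow K rho e C F G j : 0 <= K -> 0 <= rho -> 0 <= e -> K * rho <= 1 ->
  ord s K rho e C F -> ord s K rho 1 2 G ->
  ord s K rho e (4 ^+ j * C) (fun g x => G g x ^+ j * F g x).
Proof.
move=> K0 r0 e0 t1 oF oG; elim: j => [|j IH].
  by rewrite expr0 mul1r; apply: eq_ord oF => g x; rewrite expr0 mul1r.
have := ordM1 s1 K0 r0 e0 t1 IH oG.
have -> : 2 * (4 ^+ j * C) * 2 = 4 ^+ j.+1 * C by rewrite exprS; ring.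
by apply: eq_ord => g x; rewrite exprS; ring.
Qed.

Lemma ord_T K rho p c d k C : 0 <= K -> bdd i p c k C -> `|d| * C <= K ->
  ord s K rho 1 2 (fun g x => d * T i p c k g x).
Proof. by move=> K0 b dK; exact: (ord_Op s1 rho K0 (T_sym b) dK). Qed.

Lemma ord_T1 K rho p c k C : 0 <= K -> bdd i p c k C -> C <= K ->
  ord s K rho 1 2 (T i p c k).
Proof.
move=> K0 b CK; have := @ord_T K rho p c 1 k C K0 b; rewrite normr1 mul1r => /(_ CK).
by apply: eq_ord => g x; rewrite mul1r.
Qed.

Lemma ord_Rem_ex : exists B : R, 1 <= B /\ forall p rho ta ph, param_set i p -> 0 <= rho ->
  KK p * rho <= 1 -> (forall j, X (ta j) /\ N (ta j) <= (KK p * rho) ^+ 2) ->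
  (forall j, X (ph j) /\ N (ph j) <= (KK p * rho) ^+ 2) ->
  ord s (KK p) rho (KK p * rho) B (Rem p ta ph).
Proof.
have [B HB] : exists B : R, forall p rho ta ph, param_set i p -> 0 <= rho ->
  KK p * rho <= 1 -> (forall j, X (ta j) /\ N (ta j) <= (KK p * rho) ^+ 2) ->
  (forall j, X (ph j) /\ N (ph j) <= (KK p * rho) ^+ 2) ->
  ord s (KK p) rho (KK p * rho) B (Rem p ta ph).
  (* The constant is found by unification from the assembled [ord] lemmas; since it is created
     before the parameters and the data are introduced, it cannot depend on them. *)
  eexists => p rho ta ph hp r0 t1 Hta Hph.
  have K0 : 0 <= KK p by apply: le_trans (KK_ge1 hp).
  have t0 : 0 <= KK p * rho by rewrite mulr_ge0.
  have bK := bnd_le_KK hp; have gK := gam_KK hp.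
  have [b0 b1] := bdd_1 hp; have [m0 m1 m2] := bdd_m hp; have b3 := bdd_s hp (leqnn 3).
  have oE : ord s (KK p) rho 1 2 (eta_of p) := ord_T1 rho K0 b0 bK.
  have oD : ord s (KK p) rho 1 2 (eta1 p) := ord_T1 rho K0 b1 bK.
  have oS : ord s (KK p) rho 1 2 (sD p 3) := ord_T1 rho K0 b3 bK.
  have ogE : ord s (KK p) rho 1 2 (fun g x => p.1.1 * eta_of p g x) := ord_T rho K0 b0 gK.
  have ogM1 : ord s (KK p) rho 1 2 (fun g x => p.1.1 * mD p 1 g x) := ord_T rho K0 m1 gK.
  have ogM2 : ord s (KK p) rho 1 2 (fun g x => p.1.1 * mD p 2 g x) := ord_T rho K0 m2 gK.
  have oF : ord s (KK p) rho (KK p * rho) (\sum_(j < l.+1) 4 ^+ j * 5) (Forc p ta ph).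
    (* [ord_sum] is indexed by natural numbers, whence the detour through [inord]. *)
    have := @ord_sum (KK p) rho (KK p * rho) (fun j => 4 ^+ j * 5)
      (fun j g x => eta_of p g x ^+ j * (ta (inord j) x * eta1 p g x + ph (inord j) x)) l.+1 K0 r0 t0.
    have H j : (j < l.+1)%N -> ord s (KK p) rho (KK p * rho) (4 ^+ j * 5)
       (fun g x => eta_of p g x ^+ j * (ta (inord j) x * eta1 p g x + ph (inord j) x)).
      move=> _; have [Xt Nt] := Hta (inord j); have [Xp Np] := Hph (inord j).
      rewrite expr2 in Nt; rewrite expr2 in Np.
      have oT := ordM1 s1 K0 r0 t0 t1 (ord_cst s1 K0 Xt t0 Nt) oD.
      have := ordD s1 oT (ord_cst s1 K0 Xp t0 Np).
      have -> : 2 * 1 * 2 + 1 = 5 :> R by ring.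
      by move=> o; exact: (ord_pow j K0 r0 t0 t1 o oE).
    move=> /(_ H); apply: eq_ord => g x; apply: eq_bigr => j _.
    by rewrite inord_val.
  have o1 := ord2M K0 r0 ogE oE.
  have o2 := ordZ s1 (-4) (ord2M K0 r0 ogM2 oE).
  have o3 := ordZ s1 4 (ord2M K0 r0 ogM1 oD).
  have oE2 := ordM1 s1 K0 r0 ler01 t1 oE oE.
  have oE3 := ordM1 s1 K0 r0 ler01 t1 oE2 oE.
  have oq := ordD s1 (ordD s1 (ordZ s1 3 oE) (ordZ s1 3 oE2)) oE3.
  have oDS := ordD s1 oD (ordZ s1 (-1) oS).
  have o4 := ord2M K0 r0 oq oDS.
  have oEF := ordM1 s1 K0 r0 t0 t1 oF oE.
  have oEEF := ordM1 s1 K0 r0 t0 t1 oEF oE.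
  have o5 := ordD s1 (ordD s1 oF (ordD s1 oEF oEF)) oEEF.
  have o := ordD s1 (ordD s1 (ordD s1 (ordD s1 o1 o2) o3) o4) o5.
  apply: eq_ord o => g x; rewrite /Rem.
  move: (eta_of p g x) (eta1 p g x) (mD p 2 g x) (mD p 1 g x) (sD p 3 g x) (Forc p ta ph g x) (p.1.1).
  by move=> *; ring.
exists (`|B| + 1); split=> [|p rho ta ph hp r0 t1 Hta Hph]; first by rewrite lerDr.
have [C0 HX Hle Hd] := HB p rho ta ph hp r0 t1 Hta Hph.
have K0 : 0 <= KK p by apply: le_trans (KK_ge1 hp).
have t0 := mulr_ge0 K0 r0.
have BB : B <= `|B| + 1 by apply: le_trans (ler_norm B) _; rewrite lerDl.
split=> [|//|g Xg Ng|g h Xg Ng Xh Nh]; first exact: le_trans C0 BB.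
  by apply: le_trans (Hle g Xg Ng) _; do 2 ! apply: ler_wpM2r => //.
apply: le_trans (Hd g h Xg Ng Xh Nh) _; apply: ler_wpM2r; first exact: nn_ge0.
by do 2 ! apply: ler_wpM2r => //.
Qed.

Fact Bsig : {B : R | 1 <= B /\ forall p rho ta ph, param_set i p -> 0 <= rho ->
  KK p * rho <= 1 -> (forall j, X (ta j) /\ N (ta j) <= (KK p * rho) ^+ 2) ->
  (forall j, X (ph j) /\ N (ph j) <= (KK p * rho) ^+ 2) ->
  ord s (KK p) rho (KK p * rho) B (Rem p ta ph)}.
Proof. exact: cid ord_Rem_ex. Qed.

Definition BB : R := sval Bsig.
(** Solves 2K * (B * (K rho) * K) = 1/2, where 2K is the norm of the inverse of [Lin] and the
    bracket is the Lipschitz constant of [Rem]. The bound [del] on the data is the square of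
    [KK p * rho p], so that the forcing is of quadratic size. *)
Definition rho p : R := (4 * BB * KK p ^+ 3)^-1.
Definition del p : R := (KK p * rho p) ^+ 2.
Definition small p ta := forall j, X (ta j) /\ N (ta j) <= del p.

Lemma BB1 : 1 <= BB. Proof. exact: (svalP Bsig).1. Qed.

Lemma rho_aux (B K : R) : 1 <= B -> 1 <= K -> [/\ 0 < (4 * B * K ^+ 3)^-1,
  K * (4 * B * K ^+ 3)^-1 <= 4^-1 & 4 * B * K ^+ 3 * (4 * B * K ^+ 3)^-1 = 1].
Proof.
move=> b1 k1; have k0 : 0 < K by apply: lt_le_trans k1.
have b0 : 0 < B by apply: lt_le_trans b1.
have d0 : 0 < 4 * B * K ^+ 3 by rewrite !mulr_gt0// exprn_gt0.
split; [by rewrite invr_gt0| |by rewrite mulfV// gt_eqF].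
rewrite ler_pdivrMr//; have -> : 4^-1 * (4 * B * K ^+ 3) = K * (B * K ^+ 2) by field.
by rewrite ler_peMr ?(ltW k0)// -[1]mul1r ler_pM// exprn_ege1.
Qed.

Lemma rho_gt0 p : param_set i p -> 0 < rho p.
Proof. by move=> hp; have [] := rho_aux BB1 (KK_ge1 hp). Qed.

Lemma rho_KK p : param_set i p -> KK p * rho p <= 4^-1.
Proof. by move=> hp; have [] := rho_aux BB1 (KK_ge1 hp). Qed.

Lemma del_gt0 p : param_set i p -> 0 < del p.
Proof.
move=> hp; have r0 := rho_gt0 hp; have k0 := lt_le_trans ltr01 (KK_ge1 hp).
by rewrite exprn_gt0//; exact: mulr_gt0 k0 r0.
Qed.

Lemma ord_Rem p ta ph : param_set i p -> small p ta -> small p ph ->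
  ord s (KK p) (rho p) (KK p * rho p) BB (Rem p ta ph).
Proof.
move=> hp st sp; apply: (svalP Bsig).2 => //; first exact: ltW (rho_gt0 hp).
by apply: le_trans (rho_KK hp) _; rewrite invf_le1 ?ler1n.
Qed.

Definition Linv p u := Op (ia i p) (ib i p) u.

Lemma Linv_X p u : param_set i p -> X u -> X (Linv p u) /\ N (Linv p u) <= 2 * KK p * N u.
Proof.
move=> hp Xu; have [XO n _] := Op_A s1 (inv_sym_bnd hp) Xu; split=> //.
rewrite !nnE mulrCA ler_wpM2l ?(ltW (Ka_gt0 s))//; apply: le_trans n _.
by rewrite ler_wpM2r ?nrm_ge0// ler_wpM2l//; exact: bnd_le_KK.
Qed.

Lemma L_sym p : param_set i p -> exists C, sym C (lA i p) (lB i p).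
Proof.
move=> hp; have [b0 b1] := bdd_1 hp; have [m0 m1 m2] := bdd_m hp; have b3 := bdd_s hp (leqnn 3).
move: hp b0 b1 m2 b3; case: p {m0 m1} => -[gam m] sig hp b0 b1 m2 b3; eexists.
exact: symD (symZ 1 (symD (symZ gam (T_sym b0)) (symZ (1 - gam ^+ 2) (T_sym b1))))
  (symZ 1 (symD (symZ (- (4 * gam)) (T_sym m2)) (symZ (-1) (T_sym b3)))).
Qed.

Lemma L_Op p g x : param_set i p -> X g -> Op (lA i p) (lB i p) g x = Lin p g x.
Proof.
move=> hp Xg; have [b0 b1] := bdd_1 hp; have [m0 m1 m2] := bdd_m hp; have b3 := bdd_s hp (leqnn 3).
move: hp b0 b1 m2 b3; case: p {m0 m1} => -[gam m] sig hp b0 b1 m2 b3.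
have S1 := symD (symZ gam (T_sym b0)) (symZ (1 - gam ^+ 2) (T_sym b1)).
have S2 := symD (symZ (- (4 * gam)) (T_sym m2)) (symZ (-1) (T_sym b3)).
rewrite (Op_lin2 1 1 x s1 S1 S2 Xg) (Op_lin2 _ _ x s1 (T_sym b0) (T_sym b1) Xg).
rewrite (Op_lin2 _ _ x s1 (T_sym m2) (T_sym b3) Xg) /Lin.
rewrite -!/(T _ _ _ _ _) /eta_of /eta1 /mD /sD /=.
move: (T _ _ _ _ _ _) (T _ _ _ _ _ _) (T _ _ _ _ _ _) (T _ _ _ _ _ _) => *; ring.
Qed.

Lemma ia_ib p xi : param_set i p -> ia i p xi * lA i p xi - ib i p xi * lB i p xi = 1 /\
  ia i p xi * lB i p xi + ib i p xi * lA i p xi = 0.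
Proof.
move=> hp; have := den_gt0 xi hp; rewrite /ia /ib /den; move: (lA i p xi) (lB i p xi) => a b d0.
by split; field; rewrite gt_eqF.
Qed.

Lemma LinvK p g : param_set i p -> X g -> Linv p (Lin p g) = g.
Proof.
move=> hp Xg; have [C S] := L_sym hp; have S' := inv_sym_bnd hp.
have -> : Lin p g = Op (lA i p) (lB i p) g by apply/funext => x; rewrite L_Op.
apply/funext => x; rewrite /Linv (Op_comp x s1 S S' Xg) -[RHS](Op_id x s1 Xg).
by congr (Op _ _ g x); apply/funext => xi; have [] := ia_ib xi hp.
Qed.

Lemma Lin_inv p u x : param_set i p -> X u -> Lin p (Linv p u) x = u x.
Proof.
move=> hp Xu; have [C S] := L_sym hp; have S' := inv_sym_bnd hp.
have [XO _] := Linv_X hp Xu.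
rewrite -(L_Op _ hp XO) /Linv (Op_comp x s1 S' S Xu) -[RHS](Op_id x s1 Xu).
congr (Op _ _ u x); apply/funext => xi; have [e1 e2] := ia_ib xi hp.
  by rewrite -e1; ring.
by rewrite -e2; ring.
Qed.

Definition Fix p ta ph g x : R := -1 * Linv p (Rem p ta ph g) x.

(** The image lies in the ball of half the radius. This gives the strict inequality required by an
    open ball, and keeps a solution inside the nearby balls when the radius varies with the
    parameters. *)
Lemma Fix_contr p ta ph : param_set i p -> small p ta -> small p ph ->
  (forall g, X g -> N g <= rho p -> X (Fix p ta ph g) /\ N (Fix p ta ph g) <= rho p / 2) /\
  (forall g h, X g -> N g <= rho p -> X h -> N h <= rho p ->
     N (fun x => Fix p ta ph g x - Fix p ta ph h x) <= 2^-1 * N (fun x => g x - h x)).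
Proof.
move=> hp st sp; have [_ HX Hle Hd] := ord_Rem hp st sp.
have k1 := KK_ge1 hp; have b1 := BB1; have k0 : 0 < KK p by apply: lt_le_trans k1.
have r0 := rho_gt0 hp.
have er : 4 * BB * KK p ^+ 3 * rho p = 1 by have [] := rho_aux b1 k1.
have N1 : `|-1 : R| = 1 by rewrite normrN normr1.
split=> [g Xg Ng|g h Xg Ng Xh Nh].
  have [XL n] := Linv_X hp (HX g Xg Ng); have [XZ' nZ] := XZ s1 (-1) XL; split=> //.
  rewrite nZ N1 mul1r; apply: le_trans n _.
  have := ler_wpM2l (mulr_ge0 (ler0n R 2) (ltW k0)) (Hle g Xg Ng).
  move/le_trans; apply.
  move: BB (KK p) (rho p) er => B K r er.
  have -> : 2 * K * (B * (K * r) * (K * r)) = 4 * B * K ^+ 3 * r * (r / 2) by field.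
  by rewrite er mul1r.
have XRg := HX g Xg Ng; have XRh := HX h Xh Nh.
have [XB' _] := XB s1 XRg XRh; have [XL n] := Linv_X hp XB'; have [XZ' nZ] := XZ s1 (-1) XL.
rewrite (@eq_nn _ _ _ (fun x => -1 * Linv p (fun x => Rem p ta ph g x - Rem p ta ph h x) x)); last first.
  by move=> x; rewrite /Fix /Linv (OpB x s1 (inv_sym_bnd hp) XRg XRh); ring.
rewrite nZ N1 mul1r; apply: le_trans n _.
have := ler_wpM2l (mulr_ge0 (ler0n R 2) (ltW k0)) (Hd g h Xg Ng Xh Nh).
move/le_trans; apply; move: (N (fun x => g x - h x)) BB (KK p) (rho p) er => d B K r er.
have -> : 2 * K * (B * (K * r) * K * d) = 4 * B * K ^+ 3 * r * (2^-1 * d) by field.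
by rewrite er mul1r.
Qed.

(** [Lin] and [Linv] are mutually inverse on H^s, so the fixed point equation and the momentum
    equation are obtained from each other by applying one or the other. *)
Lemma FixP p ta ph g : param_set i p -> small p ta -> small p ph -> X g -> N g <= rho p ->
  Fix p ta ph g = g <-> forall x, Lin p g x + Rem p ta ph g x = 0.
Proof.
move=> hp st sp Xg Ng; have [_ HX _ _] := ord_Rem hp st sp.
have XR := HX g Xg Ng; have [XL _] := Linv_X hp XR.
split=> [e x|e].
  have [C S] := L_sym hp; have z : Lin p g x = -1 * Lin p (Linv p (Rem p ta ph g)) x.
    have XF : X (Fix p ta ph g) := (XZ s1 (-1) XL).1.
    rewrite -{1}e -(L_Op _ hp XF) -(L_Op _ hp XL).
    have := Op_eqs (c := -1) (c' := 0) x s1 S S XL XL (mul2_L1 s1 S (XZ s1 (-1) XL).1).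
    rewrite mul0r addr0; apply.
    apply: aeq_trans (mul2_aeq S (hartZ (-1) (A_L2 XL))) _.
    by apply: aeqW => xi; rewrite /mul2; ring.
  by rewrite z Lin_inv// mulN1r addNr.
have eR : Rem p ta ph g = fun x => -1 * Lin p g x.
  by apply/funext => x; rewrite mulN1r; apply/eqP; rewrite -addr_eq0 addrC e.
have XLg : X (Lin p g).
  have [C S] := L_sym hp; have -> : Lin p g = Op (lA i p) (lB i p) g by apply/funext => x; rewrite L_Op.
  by have [] := Op_A s1 S Xg.
have S := inv_sym_bnd hp.
apply/funext => x; rewrite /Fix eR.
have -> : Linv p (fun x => -1 * Lin p g x) x = -1 * Linv p (Lin p g) x.
  have := Op_eqs (c := -1) (c' := 0) x s1 S S XLg XLg (mul2_L1 s1 S (XZ s1 (-1) XLg).1).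
  rewrite mul0r addr0; apply.
  apply: aeq_trans (mul2_aeq S (hartZ (-1) (A_L2 XLg))) _.
  by apply: aeqW => xi; rewrite /mul2; ring.
by rewrite LinvK// mulrA mulrNN !mul1r.
Qed.

Lemma solve p ta ph : param_set i p -> small p ta -> small p ph ->
  exists g, [/\ X g, N g <= rho p / 2, forall x, Lin p g x + Rem p ta ph g x = 0 &
    forall h, X h -> N h <= rho p -> (forall x, Lin p h x + Rem p ta ph h x = 0) -> h = g].
Proof.
move=> hp st sp; have r0 := rho_gt0 hp; have [H1 H2] := Fix_contr hp st sp.
have r2 : rho p / 2 <= rho p by rewrite ler_pdivrMr// ler_peMr ?(ltW r0)// ler1n.
have [g Xg Ng|g [Xg Ng e]] := banach s1 (ltW r0) _ H2.
  by have [h1 h2] := H1 g Xg Ng; split=> //; exact: le_trans h2 r2.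
exists g; split=> //; first by rewrite -e; case: (H1 g Xg Ng).
  exact/FixP.
move=> h Xh Nh eh; have {}eh := iffRL (FixP hp st sp Xh Nh) eh.
apply: (nn_eq0 s1 Xh Xg); have := H2 h g Xh Nh Xg Ng; rewrite eh e.
by move: (N _) => d; lra.
Qed.

Section Sequences.
Context (p : nat -> @param R) (p0 : @param R) (Cb : R)
  (hp : forall n, param_set i (p n)) (hp0 : param_set i p0)
  (cg : (fun n => (p n).1.1) @ \oo --> p0.1.1)
  (cm : (fun n => (p n).1.2) @ \oo --> p0.1.2)
  (cs : (fun n => (p n).2) @ \oo --> p0.2)
  (bC : forall n, bnd i (p n) <= Cb) (bC0 : bnd i p0 <= Cb).

Lemma cvg_sy (c : nat -> R) c0 k xi : c @ \oo --> c0 ->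
  (fun n => sy i (p n) (c n) k xi) @ \oo --> sy i p0 c0 k xi.
Proof.
move=> cc; apply: cvgM; last first.
  by apply: cvgV; [rewrite gt_eqF// symbol_gt0|exact: symbol_cvg].
apply: cvgM; last exact: cvg_cst.
by apply: cvgM => //; exact: cvg_cst.
Qed.

Lemma cvg_sa (c : nat -> R) c0 k xi : c @ \oo --> c0 ->
  (fun n => sa i (p n) (c n) k xi) @ \oo --> sa i p0 c0 k xi.
Proof. by move=> cc; rewrite /sa; case: (odd k); [exact: cvg_cst|exact: cvg_sy]. Qed.

Lemma cvg_sb (c : nat -> R) c0 k xi : c @ \oo --> c0 ->
  (fun n => sb i (p n) (c n) k xi) @ \oo --> sb i p0 c0 k xi.
Proof. by move=> cc; rewrite /sb; case: (odd k); [exact: cvg_sy|exact: cvg_cst]. Qed.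

Lemma bdd_W (q : @param R) c k C C' : C <= C' -> bdd i q c k C -> bdd i q c k C'.
Proof.
by move=> CC b xi; apply: le_trans (b xi) _; rewrite ler_wpM2r// ltW// symbol_gt0.
Qed.

Lemma cvA_T (c : nat -> R) c0 k (u : nat -> R -> R) (u0 : R -> R) : c @ \oo --> c0 ->
  (forall n, bdd i (p n) (c n) k (bnd i (p n))) -> bdd i p0 c0 k (bnd i p0) ->
  cvA s u u0 -> cvA s (fun n => T i (p n) (c n) k (u n)) (T i p0 c0 k u0).
Proof.
move=> cc b b0 cu; apply: (cvA_Op s1 (C := Cb)) => // [n||xi|xi].
- by apply: T_sym; exact: bdd_W (bC n) (b n).
- by apply: T_sym; exact: bdd_W bC0 b0.
- exact: cvg_sa.
- exact: cvg_sb.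
Qed.

Lemma cvg_m2 : (fun n => (p n).1.2 ^+ 2) @ \oo --> p0.1.2 ^+ 2.
Proof. by rewrite expr2; under eq_fun do rewrite expr2; exact: (cvgM cm cm). Qed.

Lemma cvg_s2 : (fun n => (p n).2 ^+ 2) @ \oo --> p0.2 ^+ 2.
Proof. by rewrite expr2; under eq_fun do rewrite expr2; exact: (cvgM cs cs). Qed.

Lemma cvg_g2 : (fun n => (p n).1.1 ^+ 2) @ \oo --> p0.1.1 ^+ 2.
Proof. by rewrite expr2; under eq_fun do rewrite expr2; exact: (cvgM cg cg). Qed.

Lemma cvg_lA xi : (fun n => lA i (p n) xi) @ \oo --> lA i p0 xi.
Proof.
have E q : lA i q xi = 1 * (q.1.1 * sa i q 1 0 xi + (1 - q.1.1 ^+ 2) * sa i q 1 1 xi) +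
  1 * (- (4 * q.1.1) * sa i q (q.1.2 ^+ 2) 2 xi + -1 * sa i q (q.2 ^+ 2) 3 xi).
  by case: q => -[].
rewrite E; under eq_fun do rewrite E.
have c1 : (fun _ : nat => 1 : R) @ \oo --> (1 : R) by exact: cvg_cst.
apply: cvgD; (apply: cvgM; first exact: cvg_cst); apply: cvgD; apply: cvgM.
- exact: cg.
- exact: cvg_sa.
- by apply: cvgB => //; exact: cvg_g2.
- exact: cvg_sa.
- by apply: cvgN; apply: cvgM => //; exact: cvg_cst.
- exact: cvg_sa cvg_m2.
- exact: cvg_cst.
- exact: cvg_sa cvg_s2.
Qed.

Lemma cvg_lB xi : (fun n => lB i (p n) xi) @ \oo --> lB i p0 xi.
Proof.
have E q : lB i q xi = 1 * (q.1.1 * sb i q 1 0 xi + (1 - q.1.1 ^+ 2) * sb i q 1 1 xi) +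
  1 * (- (4 * q.1.1) * sb i q (q.1.2 ^+ 2) 2 xi + -1 * sb i q (q.2 ^+ 2) 3 xi).
  by case: q => -[].
rewrite E; under eq_fun do rewrite E.
have c1 : (fun _ : nat => 1 : R) @ \oo --> (1 : R) by exact: cvg_cst.
apply: cvgD; (apply: cvgM; first exact: cvg_cst); apply: cvgD; apply: cvgM.
- exact: cg.
- exact: cvg_sb.
- by apply: cvgB => //; exact: cvg_g2.
- exact: cvg_sb.
- by apply: cvgN; apply: cvgM => //; exact: cvg_cst.
- exact: cvg_sb cvg_m2.
- exact: cvg_cst.
- exact: cvg_sb cvg_s2.
Qed.

Lemma cvA_Linv (u : nat -> R -> R) (u0 : R -> R) : cvA s u u0 ->
  cvA s (fun n => Linv (p n) (u n)) (Linv p0 u0).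
Proof.
have cd xi : (fun n => den i (p n) xi) @ \oo --> den i p0 xi.
  rewrite /den !expr2; under eq_fun do rewrite !expr2.
  by apply: cvgD; apply: cvgM; [exact: cvg_lA|exact: cvg_lA|exact: cvg_lB|exact: cvg_lB].
have ci xi : (fun n => (den i (p n) xi)^-1) @ \oo --> (den i p0 xi)^-1.
  by apply: cvgV => //; rewrite gt_eqF// den_gt0.
have W q : param_set i q -> bnd i q <= Cb -> sym Cb (ia i q) (ib i q).
  move=> /inv_sym_bnd[ma mb ea ob ba bb] h.
  by split=> // xi; [exact: le_trans (ba xi) h|exact: le_trans (bb xi) h].
move=> cu; apply: (cvA_Op s1 (C := Cb)) => // [n||xi|xi].
- exact: W.
- exact: W.
- by apply: cvgM => //; exact: cvg_lA.
- by apply: cvgN; apply: cvgM => //; exact: cvg_lB.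
Qed.

Lemma cvA_eta (u : nat -> R -> R) (u0 : R -> R) : cvA s u u0 ->
  cvA s (fun n => eta_of (p n) (u n)) (eta_of p0 u0) /\ cvA s (fun n => eta1 (p n) (u n)) (eta1 p0 u0).
Proof.
by move=> cu; split; apply: cvA_T => //; try exact: cvg_cst; try (move=> n);
  [exact: (bdd_1 (hp n)).1|exact: (bdd_1 hp0).1|exact: (bdd_1 (hp n)).2|exact: (bdd_1 hp0).2].
Qed.

Lemma bdd_mk (q : @param R) k : param_set i q -> (k <= 2)%N -> bdd i q (q.1.2 ^+ 2) k (bnd i q).
Proof. by move=> /bdd_m[b0 b1 b2]; case: k => [|[|[|]]]. Qed.

Lemma cvA_mD k (u : nat -> R -> R) (u0 : R -> R) : (k <= 2)%N -> cvA s u u0 ->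
  cvA s (fun n => mD (p n) k (u n)) (mD p0 k u0).
Proof.
move=> k2 cu; apply: cvA_T => //; [exact: cvg_m2|move=> n; exact: bdd_mk|exact: bdd_mk].
Qed.

Lemma cvA_sD k (u : nat -> R -> R) (u0 : R -> R) : (k <= 3)%N -> cvA s u u0 ->
  cvA s (fun n => sD (p n) k (u n)) (sD p0 k u0).
Proof.
move=> k2 cu; apply: cvA_T => //; [exact: cvg_s2|move=> n; exact: bdd_s|exact: bdd_s].
Qed.

Lemma cvA_pow (u : nat -> R -> R) (u0 : R -> R) v (v0 : R -> R) k : cvA s u u0 -> cvA s v v0 ->
  cvA s (fun n x => u n x ^+ k * v n x) (fun x => u0 x ^+ k * v0 x).
Proof.
move=> cu cv; elim: k => [|k IH].
  have E (a b : R -> R) : (fun x => a x ^+ 0 * b x) = b.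
    by apply/funext => x; rewrite expr0 mul1r.
  by rewrite E (_ : (fun n => _) = v)//; apply/funext => n; rewrite E.
have E (a b : R -> R) : (fun x => a x ^+ k.+1 * b x) = fun x => a x * (a x ^+ k * b x).
  by apply/funext => x; rewrite exprS mulrA.
rewrite E (_ : (fun n => _) = fun n x => u n x * (u n x ^+ k * v n x)); last first.
  by apply/funext => n; rewrite E.
exact (cvA_M s1 cu IH).
Qed.

Lemma cvA_Rem ta0 ph0 (ta ph : nat -> 'I_l.+1 -> R -> R) (u : nat -> R -> R) (u0 : R -> R) :
  (forall j, cvA s (fun n => ta n j) (ta0 j)) -> (forall j, cvA s (fun n => ph n j) (ph0 j)) ->
  cvA s u u0 -> cvA s (fun n => Rem (p n) (ta n) (ph n) (u n)) (Rem p0 ta0 ph0 u0).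
Proof.
move=> ct cp cu; have [cE cD] := cvA_eta cu.
have c2 := cvA_mD (leqnn 2) cu; have c1 := cvA_mD (isT : (1 <= 2)%N) cu.
have c3 := cvA_sD (leqnn 3) cu.
have cF : cvA s (fun n => Forc (p n) (ta n) (ph n) (u n)) (Forc p0 ta0 ph0 u0).
  apply: (cvA_sum s1 _ (u := fun j n x => eta_of (p n) (u n) x ^+ (j : 'I_l.+1) *
     (ta n j x * eta1 (p n) (u n) x + ph n j x))) => j.
  by apply: cvA_pow => //; exact: (cvA_D s1 (cvA_M s1 (ct j) cD) (cp j)).
have k (c : R) : (fun _ : nat => c) @ \oo --> c by exact: cvg_cst.
have o1 := cvA_M s1 (cvA_Z s1 cg cE) cE.
have o2 := cvA_Z s1 (k (-4)) (cvA_M s1 (cvA_Z s1 cg c2) cE).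
have o3 := cvA_Z s1 (k 4) (cvA_M s1 (cvA_Z s1 cg c1) cD).
have oE2 := cvA_M s1 cE cE.
have oq := cvA_D s1 (cvA_D s1 (cvA_Z s1 (k 3) cE) (cvA_Z s1 (k 3) oE2)) (cvA_M s1 oE2 cE).
have o4 := cvA_M s1 oq (cvA_B s1 cD c3).
have oEF := cvA_M s1 cE cF.
have o5 := cvA_D s1 (cvA_D s1 cF (cvA_D s1 oEF oEF)) (cvA_M s1 cE oEF).
exact: (cvA_D s1 (cvA_D s1 (cvA_D s1 (cvA_D s1 o1 o2) o3) o4) o5).
Qed.

(** By contraction the distance from [g n] to [g0] is at most twice that from [Fix] at step n,
    applied to [g0], to [g0]. The latter evaluates varying operators at a fixed function only. The
    condition on the radii puts [g0] in the ball where every [Fix] contracts. *)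
Lemma cvA_sol ta0 ph0 (ta ph : nat -> 'I_l.+1 -> R -> R) (g : nat -> R -> R) (g0 : R -> R) :
  (forall j, cvA s (fun n => ta n j) (ta0 j)) -> (forall j, cvA s (fun n => ph n j) (ph0 j)) ->
  (forall n, small (p n) (ta n)) -> (forall n, small (p n) (ph n)) -> small p0 ta0 -> small p0 ph0 ->
  (forall n, rho p0 / 2 <= rho (p n)) ->
  (forall n, [/\ X (g n), N (g n) <= rho (p n) &
     forall x, Lin (p n) (g n) x + Rem (p n) (ta n) (ph n) (g n) x = 0]) ->
  X g0 -> N g0 <= rho p0 / 2 -> (forall x, Lin p0 g0 x + Rem p0 ta0 ph0 g0 x = 0) -> cvA s g g0.
Proof.
move=> ct cp st sp st0 sp0 hr Hg Xg0 Ng0 e0.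
have r0 := rho_gt0 hp0.
have Ng0' : N g0 <= rho p0 by apply: le_trans Ng0 _; move: (rho p0) r0 => z; lra.
have k (c : R) : (fun _ : nat => c) @ \oo --> c by exact: cvg_cst.
pose u n := Fix (p n) (ta n) (ph n) g0.
have cu : cvA s u g0.
  rewrite -(iffRL (FixP hp0 st0 sp0 Xg0 Ng0') e0).
  exact: (cvA_Z s1 (k (-1)) (cvA_Linv (cvA_Rem ct cp (cvA_cst s1 Xg0)))).
have [Xu _ cu'] := iffLR (cvAP s u g0) cu.
apply/cvAP; split=> // [n|]; first by case: (Hg n).
apply: (@cvg0_le _ _ (fun n => 2 * N (fun x => u n x - g0 x))); last exact: cvg0Z.
move=> n; rewrite nn_ge0 /=; have [Xg Ng e] := Hg n.
have ng : N g0 <= rho (p n) := le_trans Ng0 (hr n).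
have [_ H2] := Fix_contr (hp n) (st n) (sp n).
have eg := iffRL (FixP (hp n) (st n) (sp n) Xg Ng) e.
have := H2 (g n) g0 Xg Ng Xg0 ng; rewrite eg -/(u n).
have := nn_tri s1 Xg (Xu n) Xg0.
by move: (N _) (N _) (N _) => a b c; lra.
Qed.

End Sequences.

End Solve.

(** * The velocity *)

Section Velocity.
Context {R : realType} (i : regime) (s : nat) (s1 : (1 <= s)%N) (l : nat).
Implicit Types (f g h u w : R -> R) (C c d x y e xi : R) (k : nat) (p : @param R) (ta ph : 'I_l.+1 -> R -> R).
Local Notation X := (A s).
Local Notation N := (nn s).
Local Notation eta_of := (@eta_of R i).
Local Notation eta1 := (@eta1 R i).
Local Notation mD := (@mD R i).
Local Notation sD := (@sD R i).

Lemma eq_prim f f' g g' : (forall x, f x = f' x) -> (forall x, g x = g' x) -> prim f g -> prim f' g'.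
Proof. by move=> /funext -> /funext ->. Qed.

(** Since [w] lies in H^1 it has some derivative; differentiating [w * (1 + f) = f] and using
    uniqueness of derivatives identifies it. *)
Lemma prim_inv f f1 w : X w -> prim f f1 -> (forall x, w x * (1 + f x) = f x) ->
  prim w (fun x => f1 x * (1 - w x) ^+ 2).
Proof.
move=> Xw pf e; have [A1w _] := A_le s1 Xw; have [w1 [Lw1 _ pw]] := A1_prim A1w.
have p1 := primM pw (primD (prim_cst 1) pf).
have p2 : prim f (fun x => w1 x * (1 + f x) + w x * (0 + f1 x)).
  by apply: eq_prim p1 => // x; exact: e.
have E := prim_uniq p2 pf.
apply: (@prim_aeq _ _ w1) => //.
  apply: measurable_funM; first exact: pf.1.1.
  by apply: measurable_funX; apply: measurable_funB => //; exact: (A_L2 Xw).1.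
apply: ae_S E => x; have d0 := inv_neq0 e x; have := e x.
move: (w1 x) (w x) (f x) (f1 x) d0 => a b c d d0 h1 h2.
have hb : (1 - b) * (1 + c) = 1 by rewrite mulrBl h1; ring.
have -> : d * (1 - b) ^+ 2 = (d - b * (0 + d)) * (1 - b) by ring.
rewrite -{1}h2; have -> : (a * (1 + c) + b * (0 + d) - b * (0 + d)) * (1 - b) = a * ((1 - b) * (1 + c)) by ring.
by rewrite hb mulr1.
Qed.

(* As [1 - w = (1 + f)^-1] for [w = f / (1 + f)], this is [u / (1 + f)]. *)
Definition qw w u x : R := u x - u x * w x.

Lemma cvA_qw (u w : nat -> R -> R) (u0 w0 : R -> R) : cvA s u u0 -> cvA s w w0 ->
  cvA s (fun n => qw (w n) (u n)) (qw w0 u0).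
Proof. by move=> cu cw; exact: (cvA_B s1 cu (cvA_M s1 cu cw)). Qed.

Lemma T_prim_p p g c k : param_set i p -> X g -> bdd i p c k (bnd i p) -> bdd i p c k.+1 (bnd i p) ->
  prim (T i p c k g) (T i p c k.+1 g).
Proof. by move=> hp Xg b b'; exact: T_prim s1 b b' Xg. Qed.

Lemma mDE p g x : param_set i p -> X g -> mD p 0 g x = p.1.2 ^+ 2 * eta_of p g x /\
  mD p 1 g x = p.1.2 ^+ 2 * eta1 p g x.
Proof.
move=> hp Xg; have [b0 b1] := bdd_1 hp.
by rewrite -(T_Z _ x s1 b0 Xg) -(T_Z _ x s1 b1 Xg) mulr1.
Qed.

Lemma sDE p g x : param_set i p -> X g -> sD p 0 g x = p.2 ^+ 2 * eta_of p g x /\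
  sD p 1 g x = p.2 ^+ 2 * eta1 p g x.
Proof.
move=> hp Xg; have [b0 b1] := bdd_1 hp.
by rewrite -(T_Z _ x s1 b0 Xg) -(T_Z _ x s1 b1 Xg) mulr1.
Qed.

Lemma prim_eta p g : param_set i p -> X g -> prim (eta_of p g) (eta1 p g).
Proof. by move=> hp Xg; have [b0 b1] := bdd_1 hp; exact: T_prim_p. Qed.

Lemma prim_mD p g k : param_set i p -> X g -> (k <= 1)%N -> prim (mD p k g) (mD p k.+1 g).
Proof.
by move=> hp Xg k1; apply: T_prim_p => //; apply: bdd_mk => //; exact: leqW.
Qed.

Lemma prim_sD p g k : param_set i p -> X g -> (k <= 2)%N -> prim (sD p k g) (sD p k.+1 g).
Proof.
by move=> hp Xg k1; apply: T_prim_p => //; apply: bdd_s => //; exact: leqW.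
Qed.

(** Used with [c] equal to sigma^2 and [f] equal to eta'. Only [c * f] is known to be absolutely
    continuous: for [c = 0] nothing is known about [f], but then [h] vanishes almost everywhere. *)
Lemma primSq c f h : measurable_fun setT f -> prim (fun x => c * f x) h ->
  prim (fun x => c * f x * f x) (fun x => 2 * h x * f x).
Proof.
move=> mf ph; have [c0|c0] := eqVneq c 0.
  have z : aeq (fun=> 0) h.
    apply: prim_uniq (prim_cst 0) _; apply: eq_prim ph => // x; by rewrite c0 mul0r.
  apply: (@prim_aeq _ _ (fun=> 0)).
  - by do 2 ! apply: measurable_funM => //; exact: ph.1.1.
  - by apply: ae_S z => x <-; rewrite mulr0 mul0r.
  - by apply: eq_prim (prim_cst 0) => // x; rewrite c0 !mul0r.
have pf : prim f (fun x => c^-1 * h x).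
  by apply: eq_prim (primZ c^-1 ph) => // x; rewrite mulKf.
apply: eq_prim (primZ c (primM pf pf)) => x; first by rewrite mulrA.
by rewrite mulrDr !mulrA mulfV// mul1r [c * f x * c^-1]mulrAC mulfV//; ring.
Qed.

Section Chain.
Context (p : @param R) (g w : R -> R) (hp : param_set i p) (Xg : X g) (Xw : X w)
  (ew : forall x, w x * (1 + eta_of p g x) = eta_of p g x).
Local Notation E := (eta_of p g).
Local Notation D := (eta1 p g).
Local Notation q := (qw w).

Lemma prim_w : prim w (fun x => D x * (1 - w x) ^+ 2).
Proof. exact: prim_inv Xw (prim_eta hp Xg) ew. Qed.

(** These are the negative powers of 1 + eta, since [1 - w] is its inverse. *)
Lemma prim_1w k : prim (fun x => (1 - w x) ^+ k.+1) (fun x => - (k.+1%:R * D x * (1 - w x) ^+ k.+2)).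
Proof.
have p0 := primB (prim_cst 1) prim_w.
elim: k => [|k IH]; first by apply: eq_prim p0 => x; rewrite ?expr1// sub0r mul1r.
apply: eq_prim (primM IH p0) => x; first by rewrite -exprSr.
have e : k.+2%:R = k.+1%:R + 1 :> R by rewrite natr1.
rewrite sub0r e !exprS; move: (D x) (1 - w x) (k.+1%:R) => a b c; move: (b ^+ k) => d; ring.
Qed.

Lemma prim_q k u u1 : prim u u1 -> prim (fun x => u x * (1 - w x) ^+ k.+1)
  (fun x => u1 x * (1 - w x) ^+ k.+1 - k.+1%:R * (u x * D x) * (1 - w x) ^+ k.+2).
Proof.
move=> pu; apply: eq_prim (primM pu (prim_1w k)) => // x.
by move: (1 - w x) (u x) (u1 x) (D x) => a b c d; ring.
Qed.

(* The derivatives of [mu^2 w] and [sigma^2 w], organized so that the factor [mu^2]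
   or [sigma^2] always multiplies the derivatives of [eta] of order two and three. *)
Definition mW k x : R := match k with
  | 0 => p.1.2 ^+ 2 * w x
  | 1 => q (q (mD p 1 g)) x
  | _ => q (q (mD p 2 g)) x - 2 * q (q (q (fun x => mD p 1 g x * D x))) x end.

Definition sW k x : R := match k with
  | 0 => p.2 ^+ 2 * w x
  | 1 => q (q (sD p 1 g)) x
  | 2 => q (q (sD p 2 g)) x - 2 * q (q (q (fun x => sD p 1 g x * D x))) x
  | _ => q (q (sD p 3 g)) x - 6 * q (q (q (fun x => sD p 2 g x * D x))) x
         + 6 * q (q (q (q (fun x => sD p 1 g x * D x * D x)))) x end.

Lemma prim_mW k : (k <= 1)%N -> prim (mW k) (mW k.+1).
Proof.
case: k => [|[|]]// _.
  apply: eq_prim (primZ (p.1.2 ^+ 2) prim_w) => // x.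
  by rewrite /mW /qw (mDE x hp Xg).2; move: (D x) (w x) (p.1.2) => *; ring.
apply: eq_prim (prim_q 1 (prim_mD hp Xg (leqnn 1))) => x; rewrite /mW /qw;
  by move: (D x) (w x) (mD p 1 g x) (mD p 2 g x) => *; ring.
Qed.

Lemma prim_sW k : (k <= 2)%N -> prim (sW k) (sW k.+1).
Proof.
case: k => [|[|[|]]]// _.
- apply: eq_prim (primZ (p.2 ^+ 2) prim_w) => // x.
  by rewrite /sW /qw (sDE x hp Xg).2; move: (D x) (w x) (p.2) => *; ring.
- apply: eq_prim (prim_q 1 (prim_sD hp Xg (isT : (1 <= 2)%N))) => x; rewrite /sW /qw;
    by move: (D x) (w x) (sD p 1 g x) (sD p 2 g x) => *; ring.
have mD' : measurable_fun setT D by case: (prim_eta hp Xg) => -[].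
have pS : prim (fun x => p.2 ^+ 2 * D x) (sD p 2 g).
  by apply: eq_prim (prim_sD hp Xg (isT : (1 <= 2)%N)) => // x; exact: (sDE x hp Xg).2.
(* Differentiates sigma^2 eta'^2 / (1 + eta)^3, the nonlinear part of sigma^2 w''. *)
have p3 := prim_q 2 (primSq mD' pS).
have p2 := prim_q 1 (prim_sD hp Xg (leqnn 2)).
apply: eq_prim (primB p2 (primZ 2 p3)) => x; rewrite /sW /qw -?(sDE x hp Xg).2;
  by move: (D x) (w x) (sD p 1 g x) (sD p 2 g x) (sD p 3 g x) => *; ring.
Qed.

(* The derivative of [v], and of the viscous flux [4 mu^2 (1 + eta) v']. *)
Definition vel1 x : R := p.1.1 * (D x * (1 - w x) ^+ 2).
Definition visc1 x : R := 4 * p.1.1 * (mD p 2 g x * (1 - w x) - mD p 1 g x * D x * (1 - w x) ^+ 2).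

Lemma w1K x : (1 - w x) * (1 + E x) = 1.
Proof. by rewrite mulrBl ew; ring. Qed.

Lemma velocityE x : velocity p.1.1 E x = p.1.1 * w x.
Proof.
have n0 := inv_neq0 ew x; rewrite /velocity.
by apply: (mulIf n0); rewrite mulfVK// -mulrA ew.
Qed.

Lemma prim_vel : prim (velocity p.1.1 E) vel1.
Proof. by apply: eq_prim (primZ p.1.1 prim_w) => // x; rewrite velocityE. Qed.

Lemma prim_visc : prim (fun x => p.1.2 ^+ 2 * ((1 + E x) * (4 * vel1 x))) visc1.
Proof.
apply: eq_prim (primZ (4 * p.1.1) (prim_q 0 (prim_mD hp Xg (leqnn 1)))) => x.
  rewrite (mDE x hp Xg).2 /vel1 expr1; have := w1K x.
  move: (D x) (1 - w x) (1 + E x) (p.1.1) (p.1.2 ^+ 2) => a b c d e h.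
  have -> : e * (c * (4 * (d * (a * b ^+ 2)))) = (b * c) * (4 * d * (e * a * b)) by ring.
  by rewrite h mul1r.
by rewrite /visc1 expr1 mul1r.
Qed.

Lemma mass x : (1 + E x) * (velocity p.1.1 E x - p.1.1) = - p.1.1.
Proof.
rewrite velocityE; have := w1K x; move: (w x) (1 + E x) (p.1.1) => a b c h.
by have -> : b * (c * a - c) = - (c * ((1 - a) * b)) by [ring]; rewrite h mulr1.
Qed.

(** The left side is the residual of the momentum equation times (1 + eta)^2. It becomes polynomial
    once every factor [1 - w] is paired with a factor [1 + E]. *)
Lemma residual ta ph x :
  ((1 + E x) * (velocity p.1.1 E x - p.1.1) * vel1 x + velocity p.1.1 E x - visc1 x
   + (1 + E x) * (D x - sD p 3 g x)
   + \sum_(j < l.+1) E x ^+ j * (ta j x * D x + ph j x)) * (1 + E x) ^+ 2 =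
  Lin i p g x + Rem i p ta ph g x.
Proof.
rewrite mass velocityE /vel1 /visc1 /Lin /Rem /Forc.
have := w1K x; have := ew x.
set F0 := \sum_(j < l.+1) _; move: F0 (D x) (mD p 2 g x) (mD p 1 g x) (sD p 3 g x) (p.1.1) => F d m2 m1 s3 c.
move: (w x) (E x) => a b h1 h2.
(* Regrouped so that [1 - a] occurs only next to [1 + b] and each such product can be replaced by
   1. *)
have -> : (- c * (c * (d * (1 - a) ^+ 2)) + c * a - 4 * c * (m2 * (1 - a) - m1 * d * (1 - a) ^+ 2) +
  (1 + b) * (d - s3) + F) * (1 + b) ^+ 2 =
  - c * (c * d) * ((1 - a) * (1 + b)) ^+ 2 + c * (a * (1 + b)) * (1 + b) -
  4 * c * (m2 * ((1 - a) * (1 + b)) * (1 + b) - m1 * d * ((1 - a) * (1 + b)) ^+ 2) +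
  (1 + b) ^+ 3 * (d - s3) + F * (1 + b) ^+ 2 by ring.
by rewrite h1 h2; ring.
Qed.

End Chain.

Section Sequences.
Context (p : nat -> @param R) (p0 : @param R) (Cb : R)
  (hp : forall n, param_set i (p n)) (hp0 : param_set i p0)
  (cg : (fun n => (p n).1.1) @ \oo --> p0.1.1)
  (cm : (fun n => (p n).1.2) @ \oo --> p0.1.2)
  (cs : (fun n => (p n).2) @ \oo --> p0.2)
  (bC : forall n, bnd i (p n) <= Cb) (bC0 : bnd i p0 <= Cb).
Context (g w : nat -> R -> R) (g0 w0 : R -> R) (cvg : cvA s g g0) (cvw : cvA s w w0)
  (ew : forall n x, w n x * (1 + eta_of (p n) (g n) x) = eta_of (p n) (g n) x)
  (ew0 : forall x, w0 x * (1 + eta_of p0 g0 x) = eta_of p0 g0 x).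

Let Xg n : X (g n). Proof. by case: cvg. Qed.
Let Xg0 : X g0. Proof. by case: cvg. Qed.
Let Xw n : X (w n). Proof. by case: cvw. Qed.
Let Xw0 : X w0. Proof. by case: cvw. Qed.
Let cE := cvA_eta s1 hp hp0 cm cs bC bC0 cvg.

Lemma cvA_eta_up : cvA s.+1 (fun n => eta_of (p n) (g n)) (eta_of p0 g0).
Proof. by apply: (cvA_up s1 cE.1 cE.2) => [n|]; exact: prim_eta. Qed.

Lemma cvA_w_up : cvA s.+1 w w0.
Proof.
have c1 : cvA s (fun n => qw (w n) (qw (w n) (eta1 (p n) (g n)))) (qw w0 (qw w0 (eta1 p0 g0))).
  by do 2 ! apply: cvA_qw => //; exact: cE.2.
have E p' g' w' x : eta1 p' g' x * (1 - w' x) ^+ 2 = qw w' (qw w' (eta1 p' g')) x.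
  by rewrite /qw; move: (eta1 p' g' x) (w' x) => *; ring.
apply: (cvA_up s1 cvw c1) => [n|].
  by apply: eq_prim (prim_w (hp n) (Xg n) (Xw n) (@ew n)) => // x.
by apply: eq_prim (prim_w hp0 Xg0 Xw0 ew0) => // x.
Qed.

(** Each member of the chain [mD 0], [mD 1], [mD 2] is the derivative of the previous one and all
    converge in H^s; [cvA_up] is applied along the resulting triangle. The three lemmas after this
    one climb in the same way. *)
Lemma cvA_m_up : cvA s.+2 (fun n => mD (p n) 0 (g n)) (mD p0 0 g0).
Proof.
have c k (k2 : (k <= 2)%N) := cvA_mD s1 hp hp0 cm cs bC bC0 k2 cvg.
have c0 := c 0%N isT; have c1 := c 1%N isT; have c2 := c 2%N isT.
have p0' n : prim (mD (p n) 0 (g n)) (mD (p n) 1 (g n)) by exact: prim_mD.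
have p1' n : prim (mD (p n) 1 (g n)) (mD (p n) 2 (g n)) by exact: prim_mD.
have q0 : prim (mD p0 0 g0) (mD p0 1 g0) by exact: prim_mD.
have q1 : prim (mD p0 1 g0) (mD p0 2 g0) by exact: prim_mD.
exact: (cvA_up (ltn0Sn s) (cvA_up s1 c0 c1 p0' q0) (cvA_up s1 c1 c2 p1' q1) p0' q0).
Qed.

Lemma cvA_s_up : cvA s.+3 (fun n => sD (p n) 0 (g n)) (sD p0 0 g0).
Proof.
have c k (k3 : (k <= 3)%N) := cvA_sD s1 hp hp0 cm cs bC bC0 k3 cvg.
have c0 := c 0%N isT; have c1 := c 1%N isT; have c2 := c 2%N isT; have c3 := c 3%N isT.
have P k n : (k <= 2)%N -> prim (sD (p n) k (g n)) (sD (p n) k.+1 (g n)) by exact: prim_sD.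
have Q k : (k <= 2)%N -> prim (sD p0 k g0) (sD p0 k.+1 g0) by exact: prim_sD.
have u0 := cvA_up s1 c0 c1 (P 0%N ^~ isT) (Q 0%N isT).
have u1 := cvA_up s1 c1 c2 (P 1%N ^~ isT) (Q 1%N isT).
have u2 := cvA_up s1 c2 c3 (P 2%N ^~ isT) (Q 2%N isT).
have v0 := cvA_up (ltn0Sn s) u0 u1 (P 0%N ^~ isT) (Q 0%N isT).
have v1 := cvA_up (ltn0Sn s) u1 u2 (P 1%N ^~ isT) (Q 1%N isT).
exact: (cvA_up (ltn0Sn _) v0 v1 (P 0%N ^~ isT) (Q 0%N isT)).
Qed.

Lemma cvA_mw_up : cvA s.+2 (fun n x => (p n).1.2 ^+ 2 * w n x) (fun x => p0.1.2 ^+ 2 * w0 x).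
Proof.
have c k (k2 : (k <= 2)%N) := cvA_mD s1 hp hp0 cm cs bC bC0 k2 cvg.
have k2 (z : R) : (fun _ : nat => z) @ \oo --> z by exact: cvg_cst.
have d0 : cvA s (fun n => mW (p n) (g n) (w n) 0) (mW p0 g0 w0 0) := cvA_Z s1 (cvg_m2 cm) cvw.
have d1 : cvA s (fun n => mW (p n) (g n) (w n) 1) (mW p0 g0 w0 1).
  by do 2 ! apply: cvA_qw => //; exact: c.
have d2 : cvA s (fun n => mW (p n) (g n) (w n) 2) (mW p0 g0 w0 2).
  apply: (cvA_B s1); first by do 2 ! apply: cvA_qw => //; exact: c.
  apply: (cvA_Z s1 (k2 2)); do 3 ! apply: cvA_qw => //.
  exact: (cvA_M s1 (c 1%N isT) cE.2).
have P k n : (k <= 1)%N -> prim (mW (p n) (g n) (w n) k) (mW (p n) (g n) (w n) k.+1).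
  exact: prim_mW.
have Q k : (k <= 1)%N -> prim (mW p0 g0 w0 k) (mW p0 g0 w0 k.+1) by exact: prim_mW.
have u0 := cvA_up s1 d0 d1 (P 0%N ^~ isT) (Q 0%N isT).
have u1 := cvA_up s1 d1 d2 (P 1%N ^~ isT) (Q 1%N isT).
exact: (cvA_up (ltn0Sn s) u0 u1 (P 0%N ^~ isT) (Q 0%N isT)).
Qed.

Lemma cvA_sw_up : cvA s.+3 (fun n x => (p n).2 ^+ 2 * w n x) (fun x => p0.2 ^+ 2 * w0 x).
Proof.
have c k (k3 : (k <= 3)%N) := cvA_sD s1 hp hp0 cm cs bC bC0 k3 cvg.
have k2 (z : R) : (fun _ : nat => z) @ \oo --> z by exact: cvg_cst.
have d0 : cvA s (fun n => sW (p n) (g n) (w n) 0) (sW p0 g0 w0 0) := cvA_Z s1 (cvg_s2 cs) cvw.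
have d1 : cvA s (fun n => sW (p n) (g n) (w n) 1) (sW p0 g0 w0 1).
  by do 2 ! apply: cvA_qw => //; exact: c.
have cp k : (k <= 3)%N -> cvA s (fun n x => sD (p n) k (g n) x * eta1 (p n) (g n) x)
    (fun x => sD p0 k g0 x * eta1 p0 g0 x).
  by move=> k3; exact: (cvA_M s1 (c k k3) cE.2).
have d2 : cvA s (fun n => sW (p n) (g n) (w n) 2) (sW p0 g0 w0 2).
  apply: (cvA_B s1); first by do 2 ! apply: cvA_qw => //; exact: c.
  by apply: (cvA_Z s1 (k2 2)); do 3 ! apply: cvA_qw => //; exact: cp.
have d3 : cvA s (fun n => sW (p n) (g n) (w n) 3) (sW p0 g0 w0 3).
  apply: (cvA_D s1); last first.
    by apply: (cvA_Z s1 (k2 6)); do 4 ! apply: cvA_qw => //; exact: (cvA_M s1 (cp 1%N isT) cE.2).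
  apply: (cvA_B s1); first by do 2 ! apply: cvA_qw => //; exact: c.
  by apply: (cvA_Z s1 (k2 6)); do 3 ! apply: cvA_qw => //; exact: cp.
have P k n : (k <= 2)%N -> prim (sW (p n) (g n) (w n) k) (sW (p n) (g n) (w n) k.+1).
  exact: prim_sW.
have Q k : (k <= 2)%N -> prim (sW p0 g0 w0 k) (sW p0 g0 w0 k.+1) by exact: prim_sW.
have u0 := cvA_up s1 d0 d1 (P 0%N ^~ isT) (Q 0%N isT).
have u1 := cvA_up s1 d1 d2 (P 1%N ^~ isT) (Q 1%N isT).
have u2 := cvA_up s1 d2 d3 (P 2%N ^~ isT) (Q 2%N isT).
have v0 := cvA_up (ltn0Sn s) u0 u1 (P 0%N ^~ isT) (Q 0%N isT).
have v1 := cvA_up (ltn0Sn s) u1 u2 (P 1%N ^~ isT) (Q 1%N isT).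
exact: (cvA_up (ltn0Sn _) v0 v1 (P 0%N ^~ isT) (Q 0%N isT)).
Qed.

End Sequences.

End Velocity.

(** * Distributional derivatives *)

Section WeakDerivatives.
Context {R : realType}.
Local Notation mu := (@lebesgue_measure R).
Implicit Types (f g h u w : R -> R) (C a b c d x y e t : R) (k n : nat).

(** The (n+1)-th power of t / (n+1) <= exp(t / (n+1)). *)
Lemma pow_exp_le n t : 0 <= t -> t ^+ n.+1 * expR (- t) <= n.+1%:R ^+ n.+1.
Proof.
move=> t0; rewrite expRN ler_pdivrMr ?expR_gt0//.
have h : (t / n.+1%:R) ^+ n.+1 <= expR t.
  rewrite (_ : expR t = expR (t / n.+1%:R) ^+ n.+1); last first.
    by rewrite -expRM_natl mulrCA mulfV ?mulr1// pnatr_eq0.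
  apply: lerXn2r; rewrite ?nnegrE ?expR_ge0 ?divr_ge0//.
  by apply: le_trans (expR_ge1Dx _); rewrite lerDr.
have -> : t ^+ n.+1 = n.+1%:R ^+ n.+1 * (t / n.+1%:R) ^+ n.+1.
  by rewrite -exprMn mulrCA mulfV ?mulr1// pnatr_eq0.
by rewrite ler_wpM2l// exprn_ge0.
Qed.

(* A family closed under differentiation, up to linear combinations. *)
Definition bk k x : R := if 0 < x then x^-1 ^+ k * expR (- x^-1) else 0.

(** Flatness at the origin. A quadratic bound is what [derv_quad] needs to obtain derivative zero
    there. *)
Lemma bk_bd k : exists C, forall x, `|bk k x| <= C * x ^+ 2.
Proof.
exists (k.+2%:R ^+ k.+2) => x; rewrite /bk; case: ifPn => [x0|_]; last first.
  by rewrite normr0 mulr_ge0 ?sqr_ge0// exprn_ge0.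
rewrite ger0_norm; last by rewrite mulr_ge0 ?expR_ge0// exprn_ge0// invr_ge0 ltW.
rewrite -ler_pdivrMr ?exprn_gt0// -exprVn.
have -> : x^-1 ^+ k * expR (- x^-1) * x^-1 ^+ 2 = x^-1 ^+ k.+2 * expR (- x^-1).
  by rewrite mulrAC -exprD addn2.
by apply: pow_exp_le; rewrite invr_ge0 ltW.
Qed.

Lemma derv_quad f C : (forall y, `|f y| <= C * y ^+ 2) -> is_derive (0 : R) 1 f 0.
Proof.
move=> fC; have f0 : f 0 = 0.
  by apply/eqP; rewrite -normr_le0; apply: le_trans (fC 0) _; rewrite expr0n mulr0.
have C0 : 0 <= C by have := fC 1; rewrite expr1n mulr1; apply: le_trans.
have c : (fun h : R => h^-1 *: ((f \o shift 0) (h *: 1) - f 0)) @ 0^' --> (0 : R).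
  apply/cvgrPdist_le => e e0; near=> h.
  have h0 : h != 0 by near: h; exact: nbhs_dnbhs_neq.
  have he : `|h| <= e / (C + 1).
    by near: h; apply: dnbhs0_le; rewrite divr_gt0// ltr_wpDl.
  rewrite sub0r normrN /= f0 subr0 addr0 /GRing.scale /= mulr1 normrM normfV mulrC.
  rewrite ler_pdivrMr ?normr_gt0//; apply: le_trans (fC h) _.
  rewrite -(real_normK (num_real h)) expr2 mulrA ler_wpM2r//.
  apply: (@le_trans _ _ ((C + 1) * `|h|)); first by rewrite ler_wpM2r// lerDl.
  by rewrite mulrC -ler_pdivlMr// ltr_wpDl.
by apply: DeriveDef; [exact: (cvgP _ c)|exact: (cvg_lim (@Rhausdorff R) c)].
Unshelve. all: by end_near. Qed.

Lemma derv_inv x : x != 0 -> is_derive x 1 (fun y => y^-1) (- x^-1 ^+ 2).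
Proof.
move=> x0; have := @is_deriveV R (fun y => y) x 1 1 x0 (derv_id x).
by rewrite /GRing.scale /= mulr1 exprVn.
Qed.

Lemma derv_expinv k x : 0 < x -> is_derive x 1 (fun y => y^-1 ^+ k * expR (- y^-1))
  (- k%:R * (x^-1 ^+ k.+1 * expR (- x^-1)) + x^-1 ^+ k.+2 * expR (- x^-1)).
Proof.
move=> x0; have xn : x != 0 by rewrite gt_eqF.
have dI := derv_inv xn.
elim: k => [|k IH].
  have dN : is_derive x 1 (fun y => -1 * y^-1) (-1 * - x^-1 ^+ 2) := dervZ (-1) dI.
  have := derv_comp (is_derive_expR _) dN.
  rewrite (_ : (fun _ => _) = fun y => y^-1 ^+ 0 * expR (- y^-1)); last first.
    by apply/funext => y; rewrite mulN1r mul1r.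
  by rewrite !mulN1r opprK oppr0 mul0r add0r mulrC.
have := dervM dI IH.
rewrite (_ : (fun _ => _) = fun y => y^-1 ^+ k.+1 * expR (- y^-1)); last first.
  by apply/funext => y; rewrite exprS mulrA.
congr (is_derive _ _ _ _); rewrite -(natr1 k) !exprS.
move: (x^-1) (expR _) (k%:R) => a b c; move: (a ^+ k) => d; ring.
Qed.

Lemma derv_bk k x : is_derive x 1 (bk k) (- k%:R * bk k.+1 x + bk k.+2 x).
Proof.
have [x0|x0|->] := ltgtP x 0.
- have -> : - k%:R * bk k.+1 x + bk k.+2 x = 0.
    by rewrite /bk ltNge (ltW x0) /= mulr0 addr0.
  apply: (near_eq_is_derive _ (derv_cst 0 x)); near=> y.
  by rewrite /bk ltNge ltW//=; near: y; exact: lt_nbhsl.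
- have -> : - k%:R * bk k.+1 x + bk k.+2 x = - k%:R * (x^-1 ^+ k.+1 * expR (- x^-1)) + x^-1 ^+ k.+2 * expR (- x^-1).
    by rewrite /bk x0.
  apply: near_eq_is_derive (derv_expinv k x0); near=> y.
  have -> : bk k y = if 0 < y then y^-1 ^+ k * expR (- y^-1) else 0 by [].
  by rewrite ifT//; near: y; exact: lt_nbhsr.
- have [C bd] := bk_bd k; have := derv_quad bd.
  by rewrite /bk ltxx mulr0 addr0.
Unshelve. all: by end_near. Qed.

Lemma bk01 x : 0 <= bk 0 x <= 1.
Proof.
rewrite /bk; case: ifPn => [x0|_]; last by rewrite lexx ler01.
by rewrite mul1r expR_ge0 -[leRHS]expR0 ler_expR oppr_le0 invr_ge0 ltW.
Qed.

(** A class of functions that contains its own derivatives: smoothness of all orders follows by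
    induction, without formulas for the higher derivatives. *)
Inductive cls : (R -> R) -> Prop :=
| cls_b k c d : cls (fun x => bk k (c * x + d))
| cls_Z c f : cls f -> cls (fun x => c * f x)
| cls_D f g : cls f -> cls g -> cls (fun x => f x + g x)
| cls_M f g : cls f -> cls g -> cls (fun x => f x * g x).

Lemma cls_derv f : cls f -> exists2 f', cls f' & forall x, is_derive x 1 f (f' x).
Proof.
elim=> {f} [k c d|c f _ [f' cf df]|f g _ [f' cf df] _ [g' cg dg]|f g cf0 [f' cf df] cg0 [g' cg dg]].
- exists (fun x => c * (- k%:R * bk k.+1 (c * x + d) + bk k.+2 (c * x + d))).
    by apply/cls_Z/cls_D; [exact/cls_Z/cls_b|exact: cls_b].
  move=> x; have dl : is_derive x 1 (fun x => c * x + d) (c + 0) := dervD (derv_lin c x) (derv_cst d x).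
  by rewrite addr0 in dl; rewrite mulrC; exact: derv_comp (derv_bk k _) dl.
- by exists (fun x => c * f' x); [exact: cls_Z|move=> x; exact: dervZ].
- by exists (fun x => f' x + g' x); [exact: cls_D|move=> x; exact: dervD].
- exists (fun x => f' x * g x + f x * g' x); last by move=> x; exact: dervM.
  by apply: cls_D; exact: cls_M.
Qed.

Lemma cls_cont f : cls f -> continuous f.
Proof. by move=> /cls_derv[f' _ df]; exact: cont_derv df. Qed.

Lemma derv1E f f' : (forall x, is_derive x 1 f (f' x)) -> derive1 f = f'.
Proof. by move=> df; apply/funext => x; rewrite derive1E derive_val. Qed.

Lemma cls_n f n : cls f -> cls (derive1n n f).
Proof.
move=> cf; elim: n => [//|n IH]; rewrite derive1nS.
by have [f' cf' df] := cls_derv IH; rewrite (derv1E df).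
Qed.

(** The dilation by n+1 lets both factors tend to 1 inside (a, b), because exp(-1/t) tends to 1 for
    large t; no normalization is involved. *)
Definition bump a b n x : R := bk 0 (n.+1%:R * x + - (n.+1%:R * a)) * bk 0 (- n.+1%:R * x + n.+1%:R * b).

Lemma bump_cls a b n : cls (bump a b n).
Proof. by apply: cls_M; exact: cls_b. Qed.

Lemma bumpE a b n x : bump a b n x = bk 0 (n.+1%:R * (x - a)) * bk 0 (n.+1%:R * (b - x)).
Proof. by rewrite /bump mulrBr; congr (_ * bk 0 _); ring. Qed.

Lemma bk_le0 k n x : x <= 0 -> bk k (n.+1%:R * x) = 0.
Proof. by move=> x0; rewrite /bk ltNge mulr_ge0_le0. Qed.

Lemma bump_ind a b n x : bump a b n x = bump a b n x * ind a b x.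
Proof.
rewrite /ind in_itv /=; have [xa|xa] /= := leP a x; last first.
  by rewrite mulr0 bumpE bk_le0 ?mul0r// subr_le0 ltW.
have [xb|xb] := leP x b; first by rewrite mulr1.
by rewrite mulr0 bumpE [X in _ * X]bk_le0 ?mulr0// subr_le0 ltW.
Qed.

Lemma bump01 a b n x : `|bump a b n x| <= 1.
Proof.
rewrite bumpE; have /andP[a0 a1] := bk01 (n.+1%:R * (x - a)).
have /andP[b0 b1] := bk01 (n.+1%:R * (b - x)).
by rewrite ger0_norm ?mulr_ge0// -[leRHS]mul1r ler_pM.
Qed.

Lemma bump_test a b n : test_function (bump a b n).
Proof.
split=> [k x|].
  by have [f' _ df] := cls_derv (cls_n k (bump_cls a b n)); have [] := df x.
exists (`|a| + `|b|) => x hx; rewrite bump_ind /ind in_itv /=.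
rewrite (_ : (a <= x <= b) = false) ?mulr0//.
apply/negP => /andP[ax xb]; move: hx; rewrite ltNge => /negP; apply.
rewrite ler_norml; apply/andP; split.
  have := ler_norm (- a); rewrite normrN; have := normr_ge0 b.
  by move: `|a| `|b| => A B; lra.
have := ler_norm b; have := normr_ge0 a.
by move: `|a| `|b| => A B; lra.
Qed.

Lemma bk_cvg1 x : 0 < x -> (fun n => bk 0 (n.+1%:R * x)) @ \oo --> (1 : R).
Proof.
move=> x0; have E n : bk 0 (n.+1%:R * x) = expR (- (x^-1 * harmonic n)).
  by rewrite /bk mulr_gt0// mul1r invfM mulrC.
under eq_fun do rewrite E; have <- : expR (- (x^-1 * 0)) = 1 :> R by rewrite mulr0 oppr0 expR0.
apply: continuous_cvg; first exact: continuous_expR.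
by apply: cvgN; apply: cvgM; [exact: cvg_cst|exact: cvg_harmonic].
Qed.

(** Convergence fails at the endpoints, where every bump vanishes. *)
Lemma bump_cvg a b : {ae mu, forall x, (fun n => bump a b n x) @ \oo --> ind a b x}.
Proof.
apply: ae_S2 (ae_neq a) (ae_neq b) => x xa xb; under eq_fun do rewrite bumpE.
rewrite /ind in_itv /=; have [h1|h1|h1] := ltgtP a x; last by rewrite h1 eqxx in xa.
  have [h2|h2|h2] := ltgtP x b; last by rewrite h2 eqxx in xb.
    have <- : 1 * 1 = (true && true)%:R :> R by rewrite mulr1.
    by apply: cvgM; apply: bk_cvg1; rewrite subr_gt0.
  rewrite (_ : (fun n => _) = fun=> 0); first exact: cvg_cst.
  by apply/funext => n; rewrite [X in _ * X]bk_le0 ?mulr0// subr_le0 ltW.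
rewrite (_ : (fun n => _) = fun=> 0); first exact: cvg_cst.
by apply/funext => n; rewrite bk_le0 ?mul0r// subr_le0 ltW.
Qed.

Lemma loc_bump h a b n : loc h -> L1 (fun x => h x * bump a b n x).
Proof.
move=> [mh Lh]; have mb : measurable_fun setT (bump a b n).
  by apply: continuous_measurable_fun; exact: cls_cont (bump_cls a b n).
by apply: eq_L1 (L1M_bd (Lh a b) mb (bump01 a b n)) => x; rewrite -mulrA [ind _ _ _ * _]mulrC -bump_ind.
Qed.

Lemma loc_bump0 h : loc h -> (forall a b n, \int[mu]_x (h x * bump a b n x) = 0) -> aeq h (fun=> 0).
Proof.
move=> lh h0; apply: int_itv0_aeq => // a b ab; have [mh Lh] := lh.
have mb n : measurable_fun setT (bump a b n).
  by apply: continuous_measurable_fun; exact: cls_cont (bump_cls a b n).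
have [||||_ c] := @dct _ (fun n x => h x * bump a b n x) (fun x => h x * ind a b x) _ _ _ _ (L1_norm (Lh a b)).
- by move=> n; exact: measurable_funM.
- by apply: measurable_funM => //; exact: meas_ind.
- by apply: ae_S (bump_cvg a b) => x c; apply: cvgM; [exact: cvg_cst|exact: c].
- move=> n x; rewrite bump_ind mulrCA normrM ler_piMl//; exact: bump01.
have := cvg_lim (@Rhausdorff R) c => <-; rewrite (_ : (fun n => _) = fun=> 0).
  exact: lim_cst.
by apply/funext => n; exact: h0.
Qed.

(** Bumps are test functions that approximate indicators of intervals boundedly, so they separate
    locally integrable functions. *)
Lemma weak_uniq k f f' g g' : weak_derive k f g -> weak_derive k f' g' -> aeq f f' -> aeq g g'.
Proof.
move=> [lf lg Hg] [lf' lg' Hg'] ff.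
have {}lf := locint_loc lf; have {}lf' := locint_loc lf'.
have {}lg := locint_loc lg; have {}lg' := locint_loc lg'.
suff : aeq (fun x => g x - g' x) (fun=> 0) by apply: ae_S => x /subr0_eq.
apply: loc_bump0 => [|a b n]; first exact: locB.
have T := bump_test a b n.
have E : \int[mu]_x (f x * derive1n k (bump a b n) x) = \int[mu]_x (f' x * derive1n k (bump a b n) x).
  have mb : measurable_fun setT (derive1n k (bump a b n)).
    by apply: continuous_measurable_fun; exact: cls_cont (cls_n k (bump_cls a b n)).
  apply: int_aeq; [exact: measurable_funM lf.1 mb|exact: measurable_funM lf'.1 mb|].
  by apply: ae_S ff => x ->.
rewrite (eq_int (fun x => mulrBl _ _ _)) (intB (loc_bump a b n lg) (loc_bump a b n lg')).
have := Hg _ T; rewrite E Hg'// => e; apply/eqP; rewrite subr_eq0; apply/eqP.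
have s0 : (-1) ^+ k != 0 :> R by rewrite expf_neq0// oppr_eq0 oner_eq0.
by apply: (mulfI s0); rewrite e.
Qed.

Lemma test_derv (phi : R -> R) : test_function phi -> test_function (derive1 phi).
Proof.
move=> [s [M sM]]; split=> [n x|]; first by rewrite -derive1Sn; exact: s.
exists M => x Mx; rewrite derive1E.
have d : is_derive x 1 phi 0.
  apply: (near_eq_is_derive _ (derv_cst 0 x)); near=> y; apply/esym/sM; near: y.
  have : (fun y : R => `|y|) @ x --> `|x| by exact: norm_continuous.
  by move/(_ [set z | M < z]); apply; exact: lt_nbhsr.
by rewrite derive_val.
Unshelve. all: by end_near. Qed.

Lemma test_is_derv (phi : R -> R) x : test_function phi -> is_derive x 1 phi (derive1 phi x).
Proof. by move=> [s _]; rewrite derive1E; apply/derivableP; exact: (s 0%N). Qed.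

Lemma test_cont (phi : R -> R) : test_function phi -> continuous phi.
Proof. by move=> T; apply: cont_derv => x; exact: test_is_derv. Qed.

Lemma loc_test h (phi : R -> R) : loc h -> test_function phi -> L1 (fun x => h x * phi x) /\
  exists M : R, 0 <= M /\ forall m : R, M < m -> phi m = 0 /\ phi (- m) = 0 /\
    forall x, phi x = phi x * ind (- m) m x.
Proof.
move=> lh T; have [_ [M sM]] := T.
have P (m : R) : `|M| < m -> phi m = 0 /\ phi (- m) = 0 /\ forall x, phi x = phi x * ind (- m) m x.
  move=> Mm; have m0 : 0 < m by apply: le_lt_trans Mm.
  have Mm' : M < m by apply: le_lt_trans Mm; exact: ler_norm.
  split; first by apply: sM; rewrite gtr0_norm.
  split; first by apply: sM; rewrite normrN gtr0_norm.
  move=> x; rewrite /ind in_itv /= -ler_norml; have [_|xm] := leP `|x| m; first by rewrite mulr1.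
  by rewrite mulr0; apply: sM; exact: lt_trans xm.
split; last by exists `|M|.
have Mm : `|M| < `|M| + 1 by rewrite ltrDl.
have [_ [_ e]] := P _ Mm.
have [_ Li] := locM_cont lh (test_cont T).
by apply: eq_L1 (Li (- (`|M| + 1)) (`|M| + 1)) => x; rewrite -mulrA -e.
Qed.

(** The product rule on a symmetric interval that exceeds the supports of the test function and of
    its derivative, so that the boundary terms vanish. *)
Lemma prim_parts f f1 (phi : R -> R) : prim f f1 -> test_function phi ->
  \int[mu]_x (f x * derive1 phi x) = - \int[mu]_x (f1 x * phi x).
Proof.
move=> pf T; have T' := test_derv T.
have [La [M [M0 HM]]] := loc_test pf.1 T.
have [Lb [M' [M0' HM']]] := loc_test (cont_loc (prim_cont pf)) T'.
pose m := M + M' + 1.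
have h1 : M < m by rewrite /m; lra.
have h2 : M' < m by rewrite /m; lra.
have h3 : - m <= m by rewrite /m; lra.
have [e1 [e2 e3]] := HM m h1; have [_ [_ e4]] := HM' m h2.
have cT := test_cont T'.
have pT := derv_prim (fun x => test_is_derv x T) cT.
have := (primM pf pT).2 _ _ h3; rewrite e1 e2 !mulr0 subrr.
rewrite (@eq_int _ _ (fun x => f1 x * phi x + f x * derive1 phi x)); last first.
  by move=> x; rewrite mulrDl -!mulrA -e3 -e4.
by rewrite (intD La Lb) addrC => /eqP; rewrite addr_eq0 => /eqP.
Qed.

Lemma prim_weak1 f f1 : prim f f1 -> weak_derive 1 f f1.
Proof.
move=> pf; split=> [||phi T].
- exact: loc_locint (cont_loc (prim_cont pf)).
- exact: loc_locint pf.1.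
by rewrite derive1n1 expr1 mulN1r; exact: prim_parts.
Qed.

Lemma prim_weak3 f f1 f2 f3 : prim f f1 -> prim f1 f2 -> prim f2 f3 -> weak_derive 3 f f3.
Proof.
move=> p1 p2 p3; split=> [||phi T].
- exact: loc_locint (cont_loc (prim_cont p1)).
- exact: loc_locint p3.1.
have T1 := test_derv T; have T2 := test_derv T1.
rewrite !derive1nS derive1n0 (prim_parts p1 T2) (prim_parts p2 T1) (prim_parts p3 T).
by rewrite !exprS expr0; ring.
Qed.

End WeakDerivatives.

(** * From Hartley to Fourier transforms *)

Section Bridge.
Context {R : realType}.
Local Notation mu := (@lebesgue_measure R).
Implicit Types (f g h u w : R -> R) (F : R -> R[i]) (c x y e xi : R) (s k n : nat).

Lemma Lnorm2E u : Lnorm mu 2%:E (fun x => (u x)%:E) = ((\int[mu]_x (u x ^+ 2)%:E) `^ 2^-1)%E.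
Proof.
rewrite unlock; congr (poweR _ _); apply: eq_integral => x _.
rewrite (_ : `|(u x)%:E|%E = (`|u x|%R)%:E)// poweR_EFin powR_mulrn// real_normK ?num_real//.
Qed.

Lemma Lnorm2_n2 u : L2 u -> Lnorm mu 2%:E (fun x => (u x)%:E) = (n2 u)%:E.
Proof.
move=> [mu' Lu]; rewrite Lnorm2E (EFin_int Lu) poweR_EFin powR12_sqrt ?n2E//.
by apply: int_ge0 => x; exact: sqr_ge0.
Qed.

Lemma Lnorm2_L2 u : measurable_fun setT u -> (Lnorm mu 2%:E (fun x => (u x)%:E) < +oo)%E -> L2 u.
Proof.
move=> mu'; rewrite Lnorm2E => /(lty_poweRy (invr_neq0 _)) h; split=> //.
apply/ge0_L1P; [exact: measurable_funX|by move=> x; exact: sqr_ge0|].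
by apply: h; rewrite pnatr_eq0.
Qed.

Lemma Lfun_L2 f : f \in Lfun mu 2%:E <-> L2 f.
Proof.
split=> [|Lf].
  by rewrite inE => /andP[]; rewrite !inE /= => mf ff; exact: Lnorm2_L2.
apply/andP; rewrite !inE /=; split; first exact: Lf.1.
by rewrite /finite_norm (Lnorm2_n2 Lf) ltry.
Qed.

Definition FR h xi : R := (h xi + h (- xi)) / 2.
Definition FI h xi : R := - ((h xi - h (- xi)) / 2).
(* The Fourier transform of [f], when [h] is its Hartley transform. *)
Definition FT h xi : R[i] := Complex (FR h xi) (FI h xi).
Definition ReF F xi : R := complex.Re (F xi).
Definition ImF F xi : R := complex.Im (F xi).

Definition wabs s F xi : R := bracket xi ^+ s * Normc.normc (F xi).

Lemma wabs_sq s F xi : wabs s F xi ^+ 2 = wt s (ReF F) xi ^+ 2 + wt s (ImF F) xi ^+ 2.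
Proof.
rewrite /wabs /wt /ReF /ImF exprMn; case: (F xi) => a b /=.
by rewrite sqr_sqrtr ?addr_ge0 ?sqr_ge0// mulrDr !exprMn.
Qed.

Lemma wabs_ge0 s F xi : 0 <= wabs s F xi.
Proof.
by rewrite /wabs mulr_ge0 ?(ltW (brX_gt0 _ _))//; case: (F xi) => a b; exact: sqrtr_ge0.
Qed.

Lemma wabs_meas s F : measurable_fun setT (ReF F) -> measurable_fun setT (ImF F) ->
  measurable_fun setT (wabs s F).
Proof.
move=> mr mi; rewrite (_ : wabs s F = fun xi => Num.sqrt (wt s (ReF F) xi ^+ 2 + wt s (ImF F) xi ^+ 2)).
  apply: (measurableT_comp (f := @Num.sqrt R)).
    by apply: continuous_measurable_fun; exact: sqrt_continuous.
  by apply: measurable_funD; apply: measurable_funX; exact: Wt_meas.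
by apply/funext => xi; rewrite -wabs_sq sqrtr_sqr ger0_norm ?wabs_ge0.
Qed.

Lemma wabs_L2 s F : Wt s (ReF F) -> Wt s (ImF F) -> L2 (wabs s F).
Proof.
move=> [mr Lr] [mi Li]; split; first exact: wabs_meas.
by apply: eq_L1 (L1D Lr.2 Li.2) => xi; rewrite wabs_sq.
Qed.

Lemma wnormE s F : Wt s (ReF F) -> Wt s (ImF F) -> wnorm s F = (n2 (wabs s F))%:E.
Proof. by move=> Wr Wi; exact: Lnorm2_n2 (wabs_L2 Wr Wi). Qed.

Lemma wnorm_fin s F : measurable_fun setT (ReF F) -> measurable_fun setT (ImF F) ->
  (wnorm s F < +oo)%E -> Wt s (ReF F) /\ Wt s (ImF F).
Proof.
move=> mr mi h; have L := Lnorm2_L2 (wabs_meas s mr mi) h.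
have le1 xi : `|wt s (ReF F) xi| <= wabs s F xi.
  rewrite -(ler_pXn2r (n := 2)) ?nnegrE ?wabs_ge0// wabs_sq real_normK ?num_real// lerDl sqr_ge0//.
have le2 xi : `|wt s (ImF F) xi| <= wabs s F xi.
  rewrite -(ler_pXn2r (n := 2)) ?nnegrE ?wabs_ge0// wabs_sq real_normK ?num_real// lerDr sqr_ge0//.
by split; split=> //; [exact: L2_le (Wt_meas s mr) le1 L|exact: L2_le (Wt_meas s mi) le2 L].
Qed.

Lemma n2_wabs_aeq s F G : measurable_fun setT (ReF F) -> measurable_fun setT (ImF F) ->
  measurable_fun setT (ReF G) -> measurable_fun setT (ImF G) ->
  aeq (ReF F) (ReF G) -> aeq (ImF F) (ImF G) -> n2 (wabs s F) = n2 (wabs s G).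
Proof.
move=> m1 m2 m3 m4 er ei; apply: n2_aeq; [exact: wabs_meas|exact: wabs_meas|].
apply: ae_S2 er ei => xi; rewrite /ReF /ImF /wabs.
by case: (F xi) => a b; case: (G xi) => c d /= -> ->.
Qed.

Lemma FR_meas h : measurable_fun setT h -> measurable_fun setT (FR h).
Proof.
by move=> mh; apply: measurable_funM => //; apply: measurable_funD => //; exact: meas_refl.
Qed.

Lemma FI_meas h : measurable_fun setT h -> measurable_fun setT (FI h).
Proof.
move=> mh; apply: measurable_funN; apply: measurable_funM => //.
by apply: measurable_funB => //; exact: meas_refl.
Qed.

Lemma Wt_refl s h : Wt s h -> Wt s (fun x => h (- x)).
Proof.
move=> [mh Lh]; split; first exact: meas_refl.
by apply: eq_L2 (L2_refl Lh) => x; rewrite /wt brN.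
Qed.

Lemma Wt_FT s h : Wt s h -> Wt s (FR h) /\ Wt s (FI h).
Proof.
move=> Wh; have Wr := Wt_refl Wh; split.
  rewrite (_ : FR h = fun x => 2^-1 * (h x + h (- x))); first exact: WtZ (WtD Wh Wr).
  by apply/funext => x; rewrite /FR mulrC.
rewrite (_ : FI h = fun x => - 2^-1 * (h x + -1 * h (- x))); first exact: WtZ (WtD Wh (WtZ _ Wr)).
by apply/funext => x; rewrite /FI mulN1r mulrC mulNr.
Qed.

(** The squared modulus of the Fourier transform is the average of the values of h^2 at xi and - xi,
    and the weight is even. *)
Lemma wnorm_FT s h : Wt s h -> wnorm s (FT h) = (wn s h)%:E.
Proof.
move=> Wh; have [W1 W2] := Wt_FT Wh; rewrite (@wnormE s (FT h) W1 W2) wnE !n2E; congr (Num.sqrt _)%:E.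
have L := Wh.2.2; have Lr := L1_refl L.
rewrite (@eq_int _ _ (fun x => 2^-1 * wt s h x ^+ 2 + 2^-1 * wt s h (- x) ^+ 2)); last first.
  move=> x; rewrite wabs_sq /wt /ReF /ImF /= /FR /FI brN.
  by move: (bracket x ^+ s) (h x) (h (- x)) => a b c; field.
rewrite (intD (L1Z _ L) (L1Z _ Lr)) (intZ _ L) (intZ _ Lr) (int_refl L) -mulrDl.
by rewrite -[2^-1]mul1r -mulrDl mulfV ?mul1r// pnatr_eq0.
Qed.

Lemma FT_inv h xi : FR h xi - FI h xi = h xi.
Proof. by rewrite /FR /FI; move: (h xi) (h (- xi)) => a b; field. Qed.

Lemma trunc_FT f n : L2 f -> fourier_trunc f n = FT (H1 (trunc n f)).
Proof.
move=> Lf; have Lt := trunc_L1 n Lf; apply/funext => xi.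
have mc (t : R) : measurable_fun setT (fun x : R => cos (2 * pi * x * t)).
  apply: continuous_measurable_fun => x; apply: (@continuous_comp _ _ _ (fun x : R => 2 * pi * x * t) cos).
    by apply: cvgM; [apply: cvgM; [exact: cvg_cst|exact: cvg_id]|exact: cvg_cst].
  exact: continuous_cos.
have ms (t : R) : measurable_fun setT (fun x : R => sin (2 * pi * x * t)).
  apply: continuous_measurable_fun => x; apply: (@continuous_comp _ _ _ (fun x : R => 2 * pi * x * t) sin).
    by apply: cvgM; [apply: cvgM; [exact: cvg_cst|exact: cvg_id]|exact: cvg_cst].
  exact: continuous_sin.
have bc (t x : R) : `|cos (2 * pi * x * t)| <= 1 by rewrite ler_norml cos_geN1 cos_le1.
have bs (t x : R) : `|sin (2 * pi * x * t)| <= 1 by rewrite ler_norml sin_geN1 sin_le1.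
have Lc := L1M_bd Lt (mc xi) (bc xi).
have Ls := L1M_bd Lt (ms xi) (bs xi).
have Hp : H1 (trunc n f) xi = \int[mu]_x (trunc n f x * cos (2 * pi * x * xi)) +
   \int[mu]_x (trunc n f x * sin (2 * pi * x * xi)).
  by rewrite H1E0 -(intD Lc Ls); apply: eq_int => x; rewrite /kH /cas mulrDr.
have Hm : H1 (trunc n f) (- xi) = \int[mu]_x (trunc n f x * cos (2 * pi * x * xi)) -
   \int[mu]_x (trunc n f x * sin (2 * pi * x * xi)).
  by rewrite H1E0 -(intB Lc Ls); apply: eq_int => x; rewrite /kH /cas mulrN cosN sinN mulrBr.
rewrite /fourier_trunc /FT /FR /FI Hp Hm !int_itv.
have e1 : \int[mu]_x (f x * cos (2 * pi * x * xi) * ind (- n%:R) n%:R x) =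
   \int[mu]_x (trunc n f x * cos (2 * pi * x * xi)) by apply: eq_int => x; rewrite /trunc mulrAC.
have e2 : \int[mu]_x (f x * sin (2 * pi * x * xi) * ind (- n%:R) n%:R x) =
   \int[mu]_x (trunc n f x * sin (2 * pi * x * xi)) by apply: eq_int => x; rewrite /trunc mulrAC.
rewrite e1 e2; move: (\int[mu]_x _) (\int[mu]_x _) => a b.
by congr Complex; field.
Qed.

Lemma FTB h u xi : FT h xi - FT u xi = FT (fun x => h x - u x) xi.
Proof.
rewrite /FT /FR /FI; move: (h xi) (h (- xi)) (u xi) (u (- xi)) => a b c d.
by congr Complex; rewrite /=; field.
Qed.

Lemma is_fourier_hart f : L2 f -> is_fourier f (FT (hart f)).
Proof.
move=> Lf; have LH := hart_L2 Lf; split.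
- exact/Lfun_L2.
- exact: FR_meas LH.1.
- exact: FI_meas LH.1.
have E n : wnorm 0 (fun xi => FT (hart f) xi - fourier_trunc f n xi) =
    (n2 (fun x => H1 (trunc n f) x - hart f x))%:E.
  have Ln := (H1_trunc n Lf).1; rewrite (trunc_FT n Lf) n2BC -wn0 -wnorm_FT; last first.
    by apply/Wt0P; exact: L2B.
  by congr wnorm; apply/funext => xi; exact: FTB.
under eq_fun do rewrite E.
by apply: cvg_EFin; [exact: nearW|exact: (hartP Lf).2].
Qed.

(** Real and imaginary parts are handled as two L2 limits of the same truncated transforms, each
    compared with the corresponding part built from [hart f]. *)
Lemma is_fourier_uniq f F : is_fourier f F -> [/\ L2 f, measurable_fun setT (ReF F),
  measurable_fun setT (ImF F), aeq (ReF F) (FR (hart f)) & aeq (ImF F) (FI (hart f))].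
Proof.
move=> [/Lfun_L2 Lf mr mi c]; have LH := hart_L2 Lf.
pose G n xi := F xi - fourier_trunc f n xi.
have Ln n := (H1_trunc n Lf).1.
have EG n : ReF (G n) = (fun x => ReF F x - FR (H1 (trunc n f)) x) /\
    ImF (G n) = (fun x => ImF F x - FI (H1 (trunc n f)) x).
  by split; apply/funext => x; rewrite /ReF /ImF /G (trunc_FT n Lf) /FT; case: (F x).
have mG n : measurable_fun setT (ReF (G n)) /\ measurable_fun setT (ImF (G n)).
  rewrite (EG n).1 (EG n).2; split; apply: measurable_funB => //.
    exact: FR_meas (Ln n).1.
  exact: FI_meas (Ln n).1.
have WT n : L2 (FR (H1 (trunc n f))) /\ L2 (FI (H1 (trunc n f))).
  by have [/Wt0P h1 /Wt0P h2] := Wt_FT (iffRL (Wt0P _) (Ln n)).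
(* Square integrability of [F] is not part of [is_fourier]. Convergence to zero makes the distance
   to some truncated transform finite, and that transform is in L2. *)
have [n0 fin0] : exists n, (wnorm 0 (G n) < +oo)%E.
  have := c => /fine_cvgP[[n0 _ H] _]; exists n0.
  by have := H n0 (leqnn n0) => /=; rewrite ge0_fin_numE// Lnorm_ge0.
have [/Wt0P L1' /Wt0P L2'] := wnorm_fin (mG n0).1 (mG n0).2 fin0.
have LR : L2 (ReF F).
  by apply: eq_L2 (L2D L1' (WT n0).1) => x; rewrite (EG n0).1 subrK.
have LI : L2 (ImF F).
  by apply: eq_L2 (L2D L2' (WT n0).2) => x; rewrite (EG n0).2 subrK.
have LG n : Wt 0 (ReF (G n)) /\ Wt 0 (ImF (G n)).
  by rewrite (EG n).1 (EG n).2; split; apply/Wt0P; [exact: L2B LR (WT n).1|exact: L2B LI (WT n).2].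
have c' : n2 (wabs 0 (G n)) @[n --> \oo] --> 0.
  have /fine_cvgP[_] := c; rewrite (_ : _ \o _ = fun n => n2 (wabs 0 (G n)))//.
  by apply/funext => n; rewrite /= (wnormE (LG n).1 (LG n).2).
have cR : n2 (fun x => FR (H1 (trunc n f)) x - ReF F x) @[n --> \oo] --> 0.
  apply: cvg0_le c' => n; rewrite n2_ge0 n2BC -(EG n).1 /=.
  apply: n2_le (iffLR (Wt0P _) (LG n).1) (wabs_L2 (LG n).1 (LG n).2) _ => x.
  rewrite (ger0_norm (wabs_ge0 _ _ _)) -(ler_pXn2r (n := 2)) ?nnegrE ?wabs_ge0//.
  by rewrite wabs_sq !wt0 real_normK ?num_real// lerDl sqr_ge0.
have cI : n2 (fun x => FI (H1 (trunc n f)) x - ImF F x) @[n --> \oo] --> 0.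
  apply: cvg0_le c' => n; rewrite n2_ge0 n2BC -(EG n).2 /=.
  apply: n2_le (iffLR (Wt0P _) (LG n).2) (wabs_L2 (LG n).1 (LG n).2) _ => x.
  rewrite (ger0_norm (wabs_ge0 _ _ _)) -(ler_pXn2r (n := 2)) ?nnegrE ?wabs_ge0//.
  by rewrite wabs_sq !wt0 real_normK ?num_real// lerDr sqr_ge0.
have [/Wt0P LFR /Wt0P LFI] := Wt_FT (iffRL (Wt0P _) LH).
have LD n : L2 (fun x => H1 (trunc n f) x - hart f x) := L2B (Ln n) LH.
(* [P] stands for [FR] or [FI]; both are linear and dominated by the average of |h| at xi and -
   xi. *)
have cRI (P : (R -> R) -> R -> R) : (forall h u x, P h x - P u x = P (fun x => h x - u x) x) ->
    (forall h x, `|P h x| <= 2^-1 * (`|h x| + `|h (- x)|)) ->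
    (forall h, L2 h -> L2 (P h)) ->
    n2 (fun x => P (H1 (trunc n f)) x - P (hart f) x) @[n --> \oo] --> 0.
  move=> PB Pb PL; apply: cvg0_le (hartP Lf).2 => n; rewrite n2_ge0 (eq_n2 (PB _ _)) /=.
  have La := L2_norm (LD n); have Lb := L2_norm (L2_refl (LD n)).
  have Ls := L2Z 2^-1 (L2D La Lb).
  apply: (@le_trans _ _ (n2 (fun x => 2^-1 * (`|H1 (trunc n f) x - hart f x| + `|H1 (trunc n f) (- x) - hart f (- x)|)))).
    apply: (n2_le (PL _ (LD n)) Ls) => x; apply: le_trans (Pb _ x) _; exact: ler_norm.
  rewrite (n2Z _ (L2D La Lb)); have := n2D La Lb; rewrite !n2_norm (n2_refl (LD n)).
  move: (n2 _) (n2 _) => a b; rewrite ger0_norm ?invr_ge0// => h; lra.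
split=> //.
- apply: n2_cvg_uniq (fun n => (WT n).1) LR LFR cR _.
  apply: cRI => [h u x|h x|h Lh].
  + by rewrite /FR; move: (h x) (h (- x)) (u x) (u (- x)) => a b c1 d; field.
  + by rewrite /FR normrM mulrC ger0_norm ?invr_ge0// ler_wpM2l ?invr_ge0//; exact: ler_normD.
  + by have [/Wt0P] := Wt_FT (iffRL (Wt0P _) Lh).
- apply: n2_cvg_uniq (fun n => (WT n).2) LI LFI cI _.
  apply: cRI => [h u x|h x|h Lh].
  + by rewrite /FI; move: (h x) (h (- x)) (u x) (u (- x)) => a b c1 d; field.
  + by rewrite /FI normrN normrM mulrC ger0_norm ?invr_ge0// ler_wpM2l ?invr_ge0//; exact: ler_normB.
  + by have [_ /Wt0P] := Wt_FT (iffRL (Wt0P _) Lh).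
Qed.

Lemma sobolevP s f : sobolev s f <-> L2 f /\ Wt s (hart f).
Proof.
split=> [[F /is_fourier_uniq[Lf mr mi er ei] fin]|[Lf Wf]]; last first.
  by exists (FT (hart f)); [exact: is_fourier_hart|rewrite (wnorm_FT Wf) ltry].
split=> //; have [Wr Wi] := wnorm_fin mr mi fin; have mh := (hart_L2 Lf).1.
have W1 := Wt_aeq (FR_meas mh) er Wr; have W2 := Wt_aeq (FI_meas mh) ei Wi.
rewrite (_ : hart f = fun x => FR (hart f) x + -1 * FI (hart f) x); first exact: WtD W1 (WtZ _ W2).
by apply/funext => x; rewrite mulN1r FT_inv.
Qed.

Lemma sobolev_normE s f : sobolev s f -> sobolev_norm s f = (nrm s f)%:E.
Proof.
move=> /sobolevP[Lf Wf]; have H : is_fourier f (fourier f).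
  by apply: xgetPex; exists (FT (hart f)); exact: is_fourier_hart.
have [_ mr mi er ei] := is_fourier_uniq H.
have [W1 W2] := Wt_FT Wf.
have Wr := Wt_aeq mr (aeq_sym er) W1; have Wi := Wt_aeq mi (aeq_sym ei) W2.
rewrite /sobolev_norm (wnormE Wr Wi) nrmE -(wnorm_FT Wf) (@wnormE s (FT (hart f)) W1 W2).
by rewrite (@n2_wabs_aeq s _ (FT (hart f)) mr mi (FR_meas (hart_L2 Lf).1) (FI_meas (hart_L2 Lf).1) er ei).
Qed.

Lemma is_fourier_aeq f F G : is_fourier f F -> measurable_fun setT (ReF G) ->
  measurable_fun setT (ImF G) -> aeq (ReF F) (ReF G) -> aeq (ImF F) (ImF G) -> is_fourier f G.
Proof.
move=> H; have [Lf _ _ _ _] := is_fourier_uniq H; move: H => [Lf' mr mi c] mr' mi' er ei.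
split=> //; rewrite (_ : (fun n => _) = fun n => wnorm 0 (fun xi => F xi - fourier_trunc f n xi))//.
apply/funext => n; rewrite /wnorm !Lnorm2E; congr (poweR _ _).
have Ln := (H1_trunc n Lf).1.
have EG K : ReF (fun xi => K xi - fourier_trunc f n xi) = (fun x => ReF K x - FR (H1 (trunc n f)) x) /\
    ImF (fun xi => K xi - fourier_trunc f n xi) = (fun x => ImF K x - FI (H1 (trunc n f)) x).
  by split; apply/funext => x; rewrite /ReF /ImF (trunc_FT n Lf) /FT; case: (K x).
have mK K : measurable_fun setT (ReF K) -> measurable_fun setT (ImF K) ->
   measurable_fun setT (fun xi => (wabs 0 (fun xi => K xi - fourier_trunc f n xi) xi ^+ 2)%:E).
  move=> m1 m2; apply/measurable_EFinP; apply: measurable_funX; apply: wabs_meas.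
    by rewrite (EG K).1; apply: measurable_funB => //; exact: FR_meas Ln.1.
  by rewrite (EG K).2; apply: measurable_funB => //; exact: FI_meas Ln.1.
apply: ae_eq_integral => //; [exact: mK|exact: mK|].
apply: ae_S2 er ei => xi; rewrite /ReF /ImF /=.
by case: (F xi) => a b; case: (G xi) => c1 d /= -> -> _.
Qed.

(** An even real symbol commutes with the reflection, so multiplying the Fourier transform by it
    amounts to multiplying the Hartley transform. *)
Lemma multP (m : R -> R) f g : measurable_fun setT m -> (forall xi, m (- xi) = m xi) ->
  fourier_multiplier m f g <-> [/\ L2 f, L2 g & aeq (hart g) (fun xi => m xi * hart f xi)].
Proof.
move=> mm em.
have cM xi F : complex.Re ((m xi)%:C%C * F xi) = m xi * ReF F xi /\
   complex.Im ((m xi)%:C%C * F xi) = m xi * ImF F xi.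
  by rewrite /ReF /ImF; case: (F xi) => a b /=; rewrite !mul0r subr0 addr0.
split=> [[F HF HG]|[Lf Lg e]].
  have [Lf mr mi er ei] := is_fourier_uniq HF.
  have [Lg _ _ er' ei'] := is_fourier_uniq HG; split=> //.
  have e1 : aeq (FR (hart g)) (fun xi => m xi * FR (hart f) xi).
    by apply: ae_S2 er er' => xi <- <-; rewrite /ReF (cM xi F).1.
  have e2 : aeq (FI (hart g)) (fun xi => m xi * FI (hart f) xi).
    by apply: ae_S2 ei ei' => xi <- <-; rewrite /ImF (cM xi F).2.
  by apply: ae_S2 e1 e2 => xi h1 h2; rewrite -(FT_inv (hart g)) h1 h2 -mulrBr FT_inv.
exists (FT (hart f)); first exact: is_fourier_hart.
have mf := (hart_L2 Lf).1.
have E1 : ReF (fun xi => (m xi)%:C%C * FT (hart f) xi) = fun xi => m xi * FR (hart f) xi.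
  by apply/funext => xi; rewrite /ReF (cM xi _).1.
have E2 : ImF (fun xi => (m xi)%:C%C * FT (hart f) xi) = fun xi => m xi * FI (hart f) xi.
  by apply/funext => xi; rewrite /ImF (cM xi _).2.
apply: (is_fourier_aeq (is_fourier_hart Lg)).
- by rewrite E1; apply: measurable_funM => //; exact: FR_meas.
- by rewrite E2; apply: measurable_funM => //; exact: FI_meas.
- rewrite E1; apply: ae_S2 e (aeq_refl e) => xi h1 h2.
  by rewrite /ReF /= /FR h1 h2 em; move: (m xi) (hart f xi) (hart f (- xi)) => *; field.
- rewrite E2; apply: ae_S2 e (aeq_refl e) => xi h1 h2.
  by rewrite /ImF /= /FI h1 h2 em; move: (m xi) (hart f xi) (hart f (- xi)) => *; field.
Qed.

End Bridge.

(** * Solutions of the system *)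

Section Waves.
Context {R : realType} (i : regime) (s : nat) (s1 : (1 <= s)%N) (l : nat).
Local Notation mu := (@lebesgue_measure R).
Implicit Types (f g h u w : R -> R) (c x y e xi : R) (k n : nat) (p : @param R).
Local Notation X := (A s).
Local Notation N := (nn s).
Local Notation eta_of := (@eta_of R i).
Local Notation eta1 := (@eta1 R i).
Local Notation mD := (@mD R i).
Local Notation sD := (@sD R i).
Local Notation rho := (@rho R i s s1 l).
Local Notation del := (@del R i s s1 l).
Local Notation small := (@small R i s s1 l).
Local Notation KK := (@KK R i).

(** The continuous representative of the class of [f]. *)
Definition rep f := H1 (hart f).

Lemma rep_A f : sobolev s f -> [/\ X (rep f), aeq (rep f) f & N (rep f) = N f].
Proof.
move=> /sobolevP[Lf Wf]; have [AH e] := A_of_L2 s1 Lf Wf; split=> //.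
by rewrite !nnE (nrm_aeq s (A_L2 AH) Lf e).
Qed.

Lemma A_sobolev t g : A t g -> sobolev t g.
Proof. by move=> [Lg Wg _]; apply/sobolevP. Qed.

Lemma sobolevB t f g : sobolev t f -> sobolev t g -> sobolev t (fun x => f x - g x).
Proof.
move=> /sobolevP[Lf Wf] /sobolevP[Lg Wg]; apply/sobolevP; have Ls := L2B Lf Lg; split=> //.
apply: (Wt_aeq (hart_L2 Ls).1 (aeq_sym (hartB Lf Lg))).
have := WtD Wf (WtZ (-1) Wg); congr (Wt _ _); apply/funext => x; by rewrite mulN1r.
Qed.

(** The bound 1/2 is the one required by [nn_inv]; it results from [KK p * rho p <= 1/4] and the
    factor 2 in the norm of a multiplier. *)
Lemma eta_small p g : param_set i p -> X g -> N g <= rho p ->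
  X (eta_of p g) /\ N (eta_of p g) <= 2^-1.
Proof.
move=> hp Xg Ng; have [b0 _] := bdd_1 hp.
have [XO n _] := Op_A s1 (T_sym b0) Xg; split=> //.
have K0 : 0 <= KK p by apply: le_trans (KK_ge1 hp).
have h1 : N (eta_of p g) <= 2 * KK p * N g.
  rewrite !nnE mulrCA ler_wpM2l ?(ltW (Ka_gt0 s))//; apply: le_trans n _.
  by rewrite ler_wpM2r ?nrm_ge0// ler_wpM2l//; exact: bnd_le_KK.
apply: le_trans h1 _; have := rho_KK s1 l hp; have := ler_wpM2l K0 Ng.
rewrite -mulrA; move: (KK p * N g) (KK p * rho p) => a b; lra.
Qed.

Lemma eta_hart p g : param_set i p -> X g ->
  aeq (hart (eta_of p g)) (fun xi => (symbol i p xi)^-1 * hart g xi).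
Proof.
move=> hp Xg; have [b0 _] := bdd_1 hp; have [_ _ e] := Op_A s1 (T_sym b0) Xg.
apply: aeq_trans e _; apply: aeqW => xi.
by rewrite /mul2 /sa /sb /sy /= !mul1r mul0r addr0.
Qed.

Lemma symbol_meas p : measurable_fun setT (symbol i p).
Proof. by apply: continuous_measurable_fun; exact: cont_symbol. Qed.

Lemma eta_mult p g g' : param_set i p -> X g -> L2 g' -> aeq g g' ->
  fourier_multiplier (symbol i p) (eta_of p g) g'.
Proof.
move=> hp Xg Lg' e; apply/(multP _ _ (symbol_meas p) (symbolN i p)).
have [b0 _] := bdd_1 hp; have [XO _ _] := Op_A s1 (T_sym b0) Xg.
split=> //; first exact: A_L2 XO.
apply: aeq_trans (hart_aeq Lg' (A_L2 Xg) (aeq_sym e)) _.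
apply: ae_S (eta_hart hp Xg) => xi ->.
by rewrite mulrA mulfV ?mul1r// gt_eqF// symbol_gt0.
Qed.

(** The symbol never vanishes, so the relation can be divided by it on the transform side: the class
    of P eta determines that of eta. *)
Lemma mult_eta p f g' : param_set i p -> sobolev s g' ->
  fourier_multiplier (symbol i p) f g' -> aeq f (eta_of p (rep g')).
Proof.
move=> hp Sg' /(multP _ _ (symbol_meas p) (symbolN i p))[Lf Lg e].
have [XR er _] := rep_A Sg'; have [b0 _] := bdd_1 hp; have [XO _ _] := Op_A s1 (T_sym b0) XR.
have LO := A_L2 XO.
have e1 : aeq (hart f) (hart (eta_of p (rep g'))).
  have e2 := hart_aeq (A_L2 XR) Lg er.
  apply: aeq_trans (aeq_sym (eta_hart hp XR)).
  by apply: ae_S2 e e2 => xi h1 ->; rewrite h1 mulrA mulVf ?mul1r// gt_eqF// symbol_gt0.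
apply: aeq_trans (aeq_sym (hartK Lf)) _.
apply: aeq_trans (hart_aeq (hart_L2 Lf) (hart_L2 LO) e1) _.
exact: hartK LO.
Qed.

Lemma ae_and (P Q : R -> Prop) : {ae mu, forall x, P x} -> {ae mu, forall x, Q x} ->
  {ae mu, forall x, P x /\ Q x}.
Proof. exact: ae_S2. Qed.

Lemma aeq_sum (I : Type) (r : seq I) (F G : I -> R -> R) : (forall j, aeq (F j) (G j)) ->
  aeq (fun x => \sum_(j <- r) F j x) (fun x => \sum_(j <- r) G j x).
Proof.
move=> e; elim: r => [|j r IH]; first by apply: aeqW => x; rewrite !big_nil.
by apply: ae_S2 (e j) IH => x h1 h2; rewrite !big_cons h1 h2.
Qed.

Section Fixed.
Context (p : @param R) (g w : R -> R) (hp : param_set i p) (Xg : X g) (Xw : X w)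
  (ew : forall x, w x * (1 + eta_of p g x) = eta_of p g x).
Context (ta ph ta' ph' : 'I_l.+1 -> R -> R) (et : forall j, aeq (ta j) (ta' j))
  (ep : forall j, aeq (ph j) (ph' j)).
Local Notation E := (eta_of p g).
Local Notation D := (eta1 p g).

Let resid (ta ph : 'I_l.+1 -> R -> R) f (v v1 e1 vi ca : R -> R) x := (1 + f x) * (v x - p.1.1) * v1 x + v x - vi x
        + (1 + f x) * (e1 x - ca x)
        + \sum_(j < l.+1) f x ^+ j * (ta j x * e1 x + ph j x).

Lemma wave_intro : (forall x, Lin i p g x + Rem i p ta ph g x = 0) ->
  traveling_wave p ta' ph' (velocity p.1.1 E) E.
Proof.
move=> eq0; have pv := prim_vel s1 hp Xg Xw ew; have pe := prim_eta s1 hp Xg.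
have pvi := prim_visc s1 hp Xg Xw ew.
have pS k := prim_sD s1 (k := k) hp Xg.
have n0 := inv_neq0 ew.
have r0 x : resid ta ph E (velocity p.1.1 E) (vel1 i p g w) D (visc1 i p g w) (sD p 3 g) x = 0.
  have := residual ew ta ph x; rewrite eq0 => /eqP.
  by rewrite mulf_eq0 => /orP[/eqP//|]; rewrite expf_eq0 (negbTE (n0 x)) andbF.
have ms := mass ew.
move: pv pe pvi pS r0 ms; rewrite /resid; case: (p) hp => -[gam m] sig hp' pv pe pvi pS r0 ms.
exists (vel1 i (gam, m, sig) g w), (eta1 (gam, m, sig) g), (visc1 i (gam, m, sig) g w), (sD (gam, m, sig) 3 g).
split.
- exact: prim_weak1 pv.
- exact: prim_weak1 pe.
- exact: prim_weak1 pvi.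
- have := prim_weak3 (pS 0%N isT) (pS 1%N isT) (pS 2%N isT); congr (weak_derive _ _ _).
  by apply/funext => x; exact: (sDE s1 x hp' Xg).1.
- split; first by apply: prim_weak1; apply: eq_prim (prim_cst (- gam)) => // x; rewrite ms.
  have F j : aeq (fun x => eta_of (gam, m, sig) g x ^+ (j : 'I_l.+1) * (ta j x * eta1 (gam, m, sig) g x + ph j x))
     (fun x => eta_of (gam, m, sig) g x ^+ j * (ta' j x * eta1 (gam, m, sig) g x + ph' j x)).
    by apply: ae_S2 (et j) (ep j) => x -> ->.
  by apply: ae_S (aeq_sum (index_enum 'I_l.+1) F) => x <-; exact: r0.
Qed.

(** By uniqueness of distributional derivatives, those in [traveling_wave] agree almost everywhere
    with the ones computed from [g] and [w], and [residual] converts the momentum equation. *)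
Lemma wave_elim f : small p ta -> small p ph -> N g <= rho p ->
  aeq f E -> traveling_wave p ta' ph' (velocity p.1.1 f) f ->
  forall x, Lin i p g x + Rem i p ta ph g x = 0.
Proof.
move=> st sp Ng ef tw; have pv := prim_vel s1 hp Xg Xw ew; have pe := prim_eta s1 hp Xg.
have pvi := prim_visc s1 hp Xg Xw ew.
have pS k := prim_sD s1 (k := k) hp Xg.
have [_ HX _ _] := ord_Rem hp st sp.
have XL : X (Lin i p g).
  have [C S] := L_sym hp; have -> : Lin i p g = Op (lA i p) (lB i p) g.
    by apply/funext => x; rewrite (L_Op s1 _ hp Xg).
  by have [] := Op_A s1 S Xg.
have [XS _] := XD s1 XL (HX g Xg Ng).
(* Both sides are continuous representatives in H^s, hence equality almost everywhere is equality
   everywhere. *)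
suff e0 : aeq (fun x => Lin i p g x + Rem i p ta ph g x) (fun=> 0).
  have := A_aeq s1 XS (X0 s1).1 e0 => /(congr1 (fun h => h)) H x.
  by have := congr1 (fun h => h x) H.
have [v' [eta' [visc [capil [w1 w2 w3 w4 [_ eq]]]]]] :
  exists v' eta' visc capil : R -> R,
  [/\ weak_derive 1 (velocity p.1.1 f) v', weak_derive 1 f eta',
      weak_derive 1 (fun x => p.1.2 ^+ 2 * ((1 + f x) * (4 * v' x))) visc,
      weak_derive 3 (fun x => p.2 ^+ 2 * f x) capil &
      weak_derive 1 (fun x => (1 + f x) * (velocity p.1.1 f x - p.1.1)) (cst 0) /\
      {ae mu, forall x, resid ta' ph' f (velocity p.1.1 f) v' eta' visc capil x = 0}].
  by move: tw; rewrite /resid; case: (p) => -[].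
have ev : aeq (velocity p.1.1 f) (velocity p.1.1 E) by apply: ae_S ef => x; rewrite /velocity => ->.
have e1 : aeq v' (vel1 i p g w) := weak_uniq w1 (prim_weak1 pv) ev.
have e2 : aeq eta' D := weak_uniq w2 (prim_weak1 pe) ef.
have e3 : aeq visc (visc1 i p g w).
  by apply: (weak_uniq w3 (prim_weak1 pvi)); apply: ae_S2 ef e1 => x -> ->.
have e4 : aeq capil (sD p 3 g).
  have := prim_weak3 (pS 0%N isT) (pS 1%N isT) (pS 2%N isT) => w5.
  by apply: (weak_uniq w4 w5); apply: ae_S ef => x ->; rewrite (sDE s1 x hp Xg).1.
have F j : aeq (fun x => f x ^+ (j : 'I_l.+1) * (ta' j x * eta' x + ph' j x))
   (fun x => E x ^+ j * (ta j x * D x + ph j x)).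
  have e5 := ae_and ef e2.
  have e6 := ae_and (et j) (ep j).
  by apply: ae_S2 e5 e6 => x [-> ->] [-> ->].
have e7 := aeq_sum (index_enum 'I_l.+1) F.
have f1 := ae_and ef e2.
have f2 := ae_and e1 e3.
have f3 := ae_and e4 e7.
have f4 := ae_and f1 f2.
have f5 := ae_and f3 ev.
have f6 := ae_and f4 f5.
apply: ae_S2 f6 eq => x [[[h1 h2] [h3 h4]] [[h5 h6] h7]] h8.
rewrite -(residual ew ta ph x) -[RHS](mul0r ((1 + E x) ^+ 2)); congr (_ * _).
by move: h8; rewrite /resid h6 h7 h1 h2 h3 h4 h5.
Qed.

End Fixed.

(** Dividing by [Ka s] passes from the submultiplicative norm back to the Sobolev norm. *)
Definition eps p : R := rho p / Ka s.

Lemma eps_gt0 p : param_set i p -> 0 < eps p.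
Proof. by move=> hp; rewrite divr_gt0 ?Ka_gt0//; exact: rho_gt0. Qed.

Lemma norm_lt f p : sobolev s f -> (sobolev_norm s f < (eps p)%:E)%E = (N f < rho p).
Proof. by move=> Sf; rewrite (sobolev_normE Sf) lte_fin /eps ltr_pdivlMr ?Ka_gt0// mulrC nnE. Qed.

Definition treps (t : 'I_l.+1 -> Hs R s) j := rep (t j).

(* [gw = (g, w)] solves the problem for [x], with [g = P eta], [w = eta / (1 + eta)]. *)
Definition good (x : @data R l s) (gw : (R -> R) * (R -> R)) := let: (p, ta, ph) := x in
  [/\ X gw.1, N gw.1 <= rho p / 2,
     forall y, Lin i p gw.1 y + Rem i p (treps ta) (treps ph) gw.1 y = 0,
     X gw.2 /\ N gw.2 <= 1 & forall y, gw.2 y * (1 + eta_of p gw.1 y) = eta_of p gw.1 y].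

Definition Uset : set (@data R l s) := [set x | param_set i x.1.1 /\
  (forall j, N (x.1.2 j : Hs R s) < del x.1.1) /\ (forall j, N (x.2 j : Hs R s) < del x.1.1)].

Lemma Uset_small (x : @data R l s) : Uset x -> [/\ param_set i x.1.1, small x.1.1 (treps x.1.2) & small x.1.1 (treps x.2)].
Proof.
move=> [hp [h1 h2]]; split=> // j; have [XR _ eN] := rep_A (Hs_sobolev (x.1.2 j));
  have [XR' _ eN'] := rep_A (Hs_sobolev (x.2 j)).
  by split=> //; rewrite eN ltW.
by split=> //; rewrite eN' ltW.
Qed.

Lemma half_rho p : param_set i p -> rho p / 2 < rho p.
Proof. by move=> /(rho_gt0 s1 l) r0; rewrite ltr_pdivrMr// ltr_pMr// ltr1n. Qed.

Lemma good_ex (x : @data R l s) : Uset x -> exists gw, good x gw.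
Proof.
move=> /Uset_small; case: x => -[p ta] ph /= [hp st sp].
have [g [Xg Ng eq _]] := solve hp st sp.
have [XE NE] := eta_small hp Xg (le_trans Ng (ltW (half_rho hp))).
by have [w [Xw Nw ew]] := nn_inv s1 XE NE; exists (g, w).
Qed.

(** Any competitor in the open ball gives, through [rep], a solution of the fixed point problem in
    the closed ball of radius [rho], where [solve] grants uniqueness. *)
Lemma good_wave (x : @data R l s) gw : Uset x -> good x gw ->
  wave_in_ball i (eps x.1.1) x (eta_of x.1.1 gw.1) /\
  forall f, wave_in_ball i (eps x.1.1) x f -> aeq f (eta_of x.1.1 gw.1).
Proof.
move=> /Uset_small; case: x gw => -[p ta] ph [g w] /= [hp st sp] [Xg Ng eq [Xw Nw] ew].
have et (t : 'I_l.+1 -> Hs R s) j : aeq (treps t j) (t j).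
  by have [] := rep_A (Hs_sobolev (t j)).
split.
  split.
  - have Sg := A_sobolev Xg; exists (MkHs Sg) => /=; split.
      exact: eta_mult hp Xg (A_L2 Xg) (aeqW _).
    by rewrite (norm_lt p Sg); exact: le_lt_trans Ng (half_rho hp).
  - by apply: aeW => y; exact: inv_neq0 ew y.
  - exact: (wave_intro hp Xg Xw ew (et ta) (et ph) eq).
move=> f [[g' [mf]]]; have Sg' := Hs_sobolev g'; rewrite (norm_lt p Sg') => ng' _ tw.
have [XR er eN] := rep_A Sg'; have ef := mult_eta hp Sg' mf.
have NR : N (rep g') <= rho p by rewrite eN ltW.
have [XE NE] := eta_small hp XR NR.
have [w' [Xw' Nw' ew']] := nn_inv s1 XE NE.
have eq' := wave_elim hp XR Xw' ew' (et ta) (et ph) st sp NR ef tw.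
have [g0 [_ _ _ uniq]] := solve hp st sp.
have -> : g = g0 by apply: uniq => //; exact: le_trans Ng (ltW (half_rho hp)).
by rewrite -(uniq _ XR NR eq').
Qed.

End Waves.

(** * Continuity of the solution maps *)

Section Topology.
Context {R : realType}.
Implicit Types (f g h : R -> R) (s t n : nat).

Lemma dist_rep t f g : (1 <= t)%N -> sobolev t f -> sobolev t g ->
  nrm t (fun x => f x - g x) = nrm t (fun x => rep f x - rep g x).
Proof.
move=> t1 Sf Sg; have [Af ef _] := rep_A t1 Sf; have [Ag eg _] := rep_A t1 Sg.
have [/sobolevP[Lf _] /sobolevP[Lg _]] := (Sf, Sg).
apply: nrm_aeq; [exact: L2B|exact: L2B (A_L2 Af) (A_L2 Ag)|].
by apply: ae_S2 ef eg => x -> ->.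
Qed.

(* Stated for an abstract [B]: with a concrete one, the conversion unfolds it. *)
Lemma cvg_near (D : Type) (V : topologicalType) (F : set_system D) (T : D -> V) (y : V) (B : set V) :
  T @ F --> y -> nbhs y B -> \forall x \near F, B (T x).
Proof. by move=> cT yB; exact: (cT _ yB). Qed.

Lemma Hs_ballE t (f g : Hs R t) (r : R) : Hs_ball f r g = (nrm t (fun x => g x - f x) < r) :> Prop.
Proof.
by rewrite /Hs_ball /= (sobolev_normE (sobolevB (Hs_sobolev g) (Hs_sobolev f))) lte_fin.
Qed.

(** Open sets were declared to be those that contain a ball around each of their points; that a ball
    is itself open requires the triangle inequality, obtained here on representatives. *)
Lemma Hs_ball_nbhs t (f : Hs R t) (r : R) : (1 <= t)%N -> 0 < r -> nbhs f (Hs_ball f r).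
Proof.
move=> t1 r0; rewrite nbhsE; exists (Hs_ball f r); last exact: subset_refl.
have dr (u v : Hs R t) : nrm t (fun x => u x - v x) = nrm t (fun x => rep u x - rep v x).
  exact: dist_rep (Hs_sobolev u) (Hs_sobolev v).
have Xr (u : Hs R t) : A t (rep u) by have [] := rep_A t1 (Hs_sobolev u).
split; last first.
  rewrite Hs_ballE dr (@eq_nrm _ _ _ (fun=> 0)) => [|x]; last exact: subrr.
  by rewrite (@A0 R t t1).2.
move=> g; rewrite Hs_ballE => gf; exists (r - nrm t (fun x => g x - f x)); first by rewrite subr_gt0.
move=> h; rewrite !Hs_ballE ltrBrDr; apply: le_lt_trans.
by rewrite !dr; exact: nrm_tri (Xr h) (Xr g) (Xr f).
Qed.

Lemma Hs_cvg t (T : Type) (F : set_system T) {FF : Filter F} (S : T -> Hs R t) (y : Hs R t) :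
  (forall e : R, 0 < e -> \forall x \near F, nrm t (fun z => S x z - y z) < e) -> S @ F --> y.
Proof.
move=> H B; rewrite nbhsE => -[B' [oB' yB'] sB].
have [r r0 rB] := oB' y yB'.
rewrite /nbhs /=; apply: filterS (H r r0) => x xr; apply: sB; apply: rB.
by rewrite Hs_ballE.
Qed.

Lemma data_cvg l s (x0 : @data R l s) :
  [/\ (fun x : @data R l s => x.1.1.1.1) @ x0 --> x0.1.1.1.1,
      (fun x : @data R l s => x.1.1.1.2) @ x0 --> x0.1.1.1.2,
      (fun x : @data R l s => x.1.1.2) @ x0 --> x0.1.1.2,
      (forall j, (fun x : @data R l s => x.1.2 j) @ x0 --> (x0.1.2 j : Hs R s)) &
      (forall j, (fun x : @data R l s => x.2 j) @ x0 --> (x0.2 j : Hs R s))].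
Proof.
have c1 : (fun x : @data R l s => x.1) @ x0 --> x0.1 by exact: cvg_fst.
have c2 : (fun x : @data R l s => x.2) @ x0 --> x0.2 by exact: cvg_snd.
have cp : (fun x : @data R l s => x.1.1) @ x0 --> x0.1.1.
  by apply: (cvg_comp _ _ c1); exact: cvg_fst.
have ct : (fun x : @data R l s => x.1.2) @ x0 --> x0.1.2.
  by apply: (cvg_comp _ _ c1); exact: cvg_snd.
have cgm : (fun x : @data R l s => x.1.1.1) @ x0 --> x0.1.1.1.
  by apply: (cvg_comp _ _ cp); exact: cvg_fst.
split.
- by apply: (cvg_comp _ _ cgm); exact: cvg_fst.
- by apply: (cvg_comp _ _ cgm); exact: cvg_snd.
- by apply: (cvg_comp _ _ cp); exact: cvg_snd.
- move=> j; have cj := @proj_continuous 'I_l.+1 (fun=> Hs R s) j x0.1.2.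
  exact: cvg_comp ct cj.
- move=> j; have cj := @proj_continuous 'I_l.+1 (fun=> Hs R s) j x0.2.
  exact: cvg_comp c2 cj.
Qed.

(** Continuity is claimed at points of [param_set] only, where none of the inverted quantities
    gamma, |1 - gamma| and, in the third regime, |mu| + |sigma| vanishes. *)
Lemma kap_cvg i (T : Type) (F : set_system T) {FF : Filter F} (p : T -> @param R) (p0 : @param R) :
  param_set i p0 -> (fun x => (p x).1.1) @ F --> p0.1.1 -> (fun x => (p x).1.2) @ F --> p0.1.2 ->
  (fun x => (p x).2) @ F --> p0.2 -> (fun x => kap i (p x)) @ F --> kap i p0.
Proof.
move=> hp cg cm cs; have g0 := param_gam hp.
have E (q : @param R) : kap i q = 1 + q.1.1 + q.1.1^-1 + `|q.1.2| + `|q.2| + `|1 - q.1.1|^-1 +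
  (if i is regime3 then (`|q.1.2| + `|q.2|)^-1 else 0) by case: q => -[].
have c1 (c : R) : (fun _ : T => c) @ F --> c by exact: cvg_cst.
rewrite E; under eq_fun do rewrite E.
apply: cvgD; last first.
  case: i hp {E} => hp; [exact: c1|exact: c1|].
  apply: cvgV; last by apply: cvgD; exact: cvg_norm.
  by rewrite gt_eqF//; case: p0 hp {cg cm cs g0} => -[gam m] sig [].
apply: cvgD; last first.
  apply: cvgV; last by apply: cvg_norm; apply: cvgB.
  rewrite normr_eq0 subr_eq0; apply/eqP => e.
  move: hp; case: p0 e {cg cm cs g0 E} => -[gam m] sig /= <-.
  by case: i => /=; rewrite ?ltxx ?andbF// => -[].
apply: cvgD; last exact: cvg_norm.
apply: cvgD; last exact: cvg_norm.
apply: cvgD; last by apply: cvgV => //; rewrite gt_eqF.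
by apply: cvgD.
Qed.

Lemma cvgX (T : Type) (F : set_system T) {FF : Filter F} (u : T -> R) (u0 : R) n :
  u @ F --> u0 -> (fun x => u x ^+ n) @ F --> u0 ^+ n.
Proof.
move=> cu; elim: n => [|n IH]; first exact: cvg_cst.
rewrite exprS (_ : (fun x => u x ^+ n.+1) = fun x => u x * u x ^+ n); first exact: cvgM.
by apply/funext => x; rewrite exprS.
Qed.

End Topology.

(** * Sequential continuity of the solution maps *)

Section Main.
Context {R : realType} (i : regime) (s : nat) (s1 : (1 <= s)%N) (l : nat).
Local Notation mu := (@lebesgue_measure R).
Implicit Types (f g h u w : R -> R) (y e xi : R) (k n : nat) (p : @param R) (x : @data R l s).
Local Notation X := (A s).
Local Notation N := (nn s).
Local Notation eta_of := (@eta_of R i).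
Local Notation rho := (@rho R i s s1 l).
Local Notation del := (@del R i s s1 l).
Local Notation KK := (@KK R i).
Local Notation Uset := (@Uset R i s s1 l).
Local Notation eps := (@eps R i s s1 l).
Local Notation good := (@good R i s s1 l).

Lemma bounds_cvg x : param_set i x.1.1 ->
  [/\ (fun x : @data R l s => bnd i x.1.1) @ x --> bnd i x.1.1,
      (fun x : @data R l s => rho x.1.1) @ x --> rho x.1.1 &
      (fun x : @data R l s => del x.1.1) @ x --> del x.1.1].
Proof.
move=> hp; have [cg cm cs _ _] := data_cvg x.
have ck : (fun x : @data R l s => kap i x.1.1) @ x --> kap i x.1.1.
  by apply: (kap_cvg (p := fun x : @data R l s => x.1.1) hp cg cm cs).
have cb : (fun x : @data R l s => bnd i x.1.1) @ x --> bnd i x.1.1.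
  by apply: cvgM; [exact: cvg_cst|exact: cvgX].
have cK : (fun x : @data R l s => KK x.1.1) @ x --> KK x.1.1 by exact: cvgX.
have cr : (fun x : @data R l s => rho x.1.1) @ x --> rho x.1.1.
  apply: cvgV; last by apply: cvgM; [exact: cvg_cst|exact: cvgX].
  by have := rho_gt0 s1 l hp; rewrite invr_gt0 => /gt_eqF ->.
by split=> //; apply: cvgX; exact: cvgM.
Qed.

Lemma N_lt (u v : Hs R s) : N u <= N v + Ka s * nrm s (fun y => u y - v y).
Proof.
have [Au eu nu] := rep_A s1 (Hs_sobolev u); have [Av ev nv] := rep_A s1 (Hs_sobolev v).
rewrite (dist_rep s1 (Hs_sobolev u) (Hs_sobolev v)) -nnE -nu -nv.
exact: nn_leD.
Qed.

Lemma near_balls (D : Type) (F : set_system D) (FF : Filter F) (T : 'I_l.+1 -> D -> Hs R s)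
    (t : 'I_l.+1 -> Hs R s) (e : R) : (forall j, T j @ F --> t j) -> 0 < e ->
  \forall x \near F, forall j, Hs_ball (t j) e (T j x).
Proof.
move=> cT e0; have H j : \forall x \near F, Hs_ball (t j) e (T j x).
  exact: (cvg_near (cT j) (Hs_ball_nbhs (t j) s1 e0)).
exact: (filter_forall FF H).
Qed.

Lemma near_data (D : Type) (F : set_system D) (FF : Filter F) (T : 'I_l.+1 -> D -> Hs R s)
    (t : 'I_l.+1 -> Hs R s) (d : D -> R) (d0 : R) :
  (forall j, T j @ F --> t j) -> d @ F --> d0 -> (forall j, N (t j) < d0) ->
  \forall x \near F, forall j, N (T j x) < d x.
Proof.
move=> cT cd h; suff H j : \forall x \near F, N (T j x) < d x by exact: (filter_forall FF H).
pose e := (d0 - N (t j)) / 2; have e0 : 0 < e by rewrite divr_gt0// subr_gt0.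
have K0 := @Ka_gt0 R s; have eK : 0 < e / Ka s by rewrite divr_gt0.
have n1 := near_balls FF cT eK; have /cvgrPdist_lt/(_ _ e0) n2 := cd.
apply: filterS (filterI n1 n2) => x [/(_ j)]; rewrite Hs_ballE ltr_pdivlMr// mulrC => a1.
move=> /(le_lt_trans (ler_norm _)) a2; apply: le_lt_trans (N_lt (T j x) (t j)) _.
by move: a1 a2; rewrite /e; clear; move: (Ka s * _) (N _) (d x) => a b c; lra.
Qed.

(** The radii [del] are continuous at admissible parameters, so every point of [Uset] is interior to
    the set of the smallness conditions; that interior is the open set. *)
Lemma Uset_open : exists O : set (@data R l s), open O /\ Uset = O `&` [set x | param_set i x.1.1].
Proof.
exists (interior [set x : @data R l s | (forall j, N (x.1.2 j : Hs R s) < del x.1.1) /\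
   (forall j, N (x.2 j : Hs R s) < del x.1.1)]); split; first exact: open_interior.
apply/seteqP; split=> x.
  move=> [hp [h1 h2]]; split=> //; have [_ _ cd] := bounds_cvg hp.
  have [_ _ _ ct cp] := data_cvg x.
  have n1 := near_data (T := fun j x => x.1.2 j) (nbhs_filter x) ct cd h1.
  have n2 := near_data (T := fun j x => x.2 j) (nbhs_filter x) cp cd h2.
  exact: (filterI n1 n2).
by move=> [/interior_subset[h1 h2] hp]; split.
Qed.

(** A sequence with n-th term in the n-th set converges to [x0]; the last clause adds the uniform
    bound on the multipliers and the lower bound on the radii used by [cvA_sol]. *)
Definition close (x0 : @data R l s) n x := [/\ `|x0.1.1.1.1 - x.1.1.1.1| < n.+1%:R^-1,
  `|x0.1.1.1.2 - x.1.1.1.2| < n.+1%:R^-1, `|x0.1.1.2 - x.1.1.2| < n.+1%:R^-1,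
  (forall j, nrm s (fun y => (x.1.2 j : Hs R s) y - (x0.1.2 j : Hs R s) y) < n.+1%:R^-1) /\
  (forall j, nrm s (fun y => (x.2 j : Hs R s) y - (x0.2 j : Hs R s) y) < n.+1%:R^-1) &
  bnd i x.1.1 <= bnd i x0.1.1 + 1 /\ rho x0.1.1 / 2 <= rho x.1.1].

Lemma close_nbhs (x0 : @data R l s) n : param_set i x0.1.1 -> nbhs x0 (close x0 n).
Proof.
move=> hp; have [cb cr _] := bounds_cvg hp; have [cg cm cs ct cp] := data_cvg x0.
have e0 : 0 < n.+1%:R^-1 :> R by [].
have r0 := rho_gt0 s1 l hp; have r2 : 0 < rho x0.1.1 / 2 by rewrite divr_gt0.
have /cvgrPdist_lt/(_ _ e0) a1 := cg.
have /cvgrPdist_lt/(_ _ e0) a2 := cm.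
have /cvgrPdist_lt/(_ _ e0) a3 := cs.
have a4 := near_balls (T := fun j x => x.1.2 j) (nbhs_filter x0) ct e0.
have a5 := near_balls (T := fun j x => x.2 j) (nbhs_filter x0) cp e0.
have /cvgrPdist_lt/(_ _ (@ltr01 R)) a6 := cb.
have /cvgrPdist_lt/(_ _ r2) a7 := cr.
apply: filterS (filterI (filterI (filterI a1 a2) (filterI a3 a4)) (filterI a5 (filterI a6 a7))).
move=> x [[[b1 b2] [b3 b4]] [b5 [b6 b7]]]; split=> //.
  by split=> j; rewrite -Hs_ballE; [exact: b4|exact: b5].
split.
  by move: b6; rewrite distrC => /(le_lt_trans (ler_norm _)); move: (bnd _ _) (bnd _ _) => a b; lra.
by move: b7 => /(le_lt_trans (ler_norm _)); move: (rho _) (rho _) => a b; lra.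
Qed.

(** If [P] failed arbitrarily close to [x0], choice would produce a sequence of counterexamples
    inside the sets [close x0 n]; so one index where [P] holds is enough for a contradiction. *)
Lemma seq_near (x0 : @data R l s) (P : @data R l s -> Prop) : param_set i x0.1.1 ->
  (forall xs : nat -> @data R l s, (forall n, close x0 n (xs n)) -> (forall n, Uset (xs n)) ->
     exists n, P (xs n)) ->
  \forall x \near within Uset (nbhs x0), P x.
Proof.
move=> hp H; apply: contrapT => nP.
have E n : exists x, close x0 n x /\ Uset x /\ ~ P x.
  apply: contrapT => nE; apply: nP; rewrite near_withinE.
  apply: filterS (close_nbhs n hp) => x cx Ux; apply: contrapT => nPx.
  by apply: nE; exists x.
have [xs Hxs] := choice E.
have [n Pn] := H xs (fun n => (Hxs n).1) (fun n => (Hxs n).2.1).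
exact: (Hxs n).2.2 Pn.
Qed.

(** The regularity statement common to the coefficients 1, mu^2 and sigma^2, isolated so that the
    construction of the solution map is carried out once. *)
Definition CV r (c : @param R -> R) := forall (p : nat -> @param R) (p0 : @param R) (Cb : R),
  (forall n, param_set i (p n)) -> param_set i p0 ->
  (fun n => (p n).1.1) @ \oo --> p0.1.1 -> (fun n => (p n).1.2) @ \oo --> p0.1.2 ->
  (fun n => (p n).2) @ \oo --> p0.2 -> (forall n, bnd i (p n) <= Cb) -> bnd i p0 <= Cb ->
  forall (g w : nat -> R -> R) (g0 w0 : R -> R), cvA s g g0 -> cvA s w w0 ->
  (forall n y, w n y * (1 + eta_of (p n) (g n) y) = eta_of (p n) (g n) y) ->
  (forall y, w0 y * (1 + eta_of p0 g0 y) = eta_of p0 g0 y) ->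
  cvA r (fun n y => c (p n) * w n y) (fun y => c p0 * w0 y) /\
  cvA r (fun n y => c (p n) * eta_of (p n) (g n) y) (fun y => c p0 * eta_of p0 g0 y).

Lemma inv_cvg (u : nat -> R) (u0 : R) : (forall n, `|u0 - u n| < n.+1%:R^-1) -> u @ \oo --> u0.
Proof.
move=> H; apply/cvgrPdist_lt => e e0.
have /cvgrPdist_lt/(_ e e0)[n0 _ Hn] := @cvg_harmonic R; exists n0 => // n /Hn.
rewrite /= sub0r normrN => h; apply: lt_trans (H n) (le_lt_trans (ler_norm _) h).
Qed.

Lemma close_cvA (T : @data R l s -> Hs R s) (x0 : @data R l s) (xs : nat -> @data R l s) :
  (forall n, nrm s (fun y => T (xs n) y - T x0 y) < n.+1%:R^-1) ->
  cvA s (fun n => rep (T (xs n))) (rep (T x0)).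
Proof.
move=> H; split=> [n||].
- by have [] := rep_A s1 (Hs_sobolev (T (xs n))).
- by have [] := rep_A s1 (Hs_sobolev (T x0)).
apply: (@cvg0_le _ _ (fun n => n.+1%:R^-1)); last exact: cvg_harmonic.
move=> n; rewrite nrm_ge0 /= -(dist_rep s1 (Hs_sobolev _) (Hs_sobolev _)).
exact: ltW (H n).
Qed.

Lemma good_cvA (x0 : @data R l s) (xs : nat -> @data R l s) gw0 gw :
  Uset x0 -> (forall n, Uset (xs n)) -> (forall n, close x0 n (xs n)) ->
  good x0 gw0 -> (forall n, good (xs n) (gw n)) ->
  cvA s (fun n => (gw n).1) gw0.1 /\ cvA s (fun n => (gw n).2) gw0.2.
Proof.
move=> Ux0 Uxs Hc G0 Gn.
have [hp0 st0 sp0] := Uset_small Ux0.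
have hU n := Uset_small (Uxs n).
have hp n : param_set i (xs n).1.1 by case: (hU n).
have cg : (fun n => (xs n).1.1.1.1) @ \oo --> x0.1.1.1.1 by apply: inv_cvg => n; case: (Hc n).
have cm : (fun n => (xs n).1.1.1.2) @ \oo --> x0.1.1.1.2 by apply: inv_cvg => n; case: (Hc n).
have cs : (fun n => (xs n).1.1.2) @ \oo --> x0.1.1.2 by apply: inv_cvg => n; case: (Hc n).
have bC n : bnd i (xs n).1.1 <= bnd i x0.1.1 + 1 by case: (Hc n) => _ _ _ _ [].
have bC0 : bnd i x0.1.1 <= bnd i x0.1.1 + 1 by rewrite lerDl.
have hr n : rho x0.1.1 / 2 <= rho (xs n).1.1 by case: (Hc n) => _ _ _ _ [].
have ct j : cvA s (fun n => treps (xs n).1.2 j) (treps x0.1.2 j).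
  by apply: (close_cvA (T := fun x => x.1.2 j)) => n; case: (Hc n) => _ _ _ [].
have cp j : cvA s (fun n => treps (xs n).2 j) (treps x0.2 j).
  by apply: (close_cvA (T := fun x => x.2 j)) => n; case: (Hc n) => _ _ _ [].
have Ge x gw' : good x gw' -> [/\ X gw'.1, N gw'.1 <= rho x.1.1 / 2,
     forall y, Lin i x.1.1 gw'.1 y + Rem i x.1.1 (treps x.1.2) (treps x.2) gw'.1 y = 0,
     X gw'.2 /\ N gw'.2 <= 1 & forall y, gw'.2 y * (1 + eta_of x.1.1 gw'.1 y) = eta_of x.1.1 gw'.1 y].
  by case: x => -[p' ta] ph.
have [Xg0 Ng0 eq0 [Xw0 Nw0] ew0] := Ge _ _ G0.
have cvg' : cvA s (fun n => (gw n).1) gw0.1.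
  apply: (cvA_sol hp hp0 cg cm cs bC bC0 ct cp _ _ st0 sp0 hr _ Xg0 Ng0 eq0).
  - by move=> n; case: (hU n).
  - by move=> n; case: (hU n).
  - move=> n; have [Xg Ng eq _ _] := Ge _ _ (Gn n); split=> //.
    by apply: le_trans Ng (ltW (half_rho s1 l (hp n))).
split=> //.
have [cE _] := cvA_eta s1 hp hp0 cm cs bC bC0 cvg'.
apply: (cvA_inv s1 cE) => // n; have [Xg Ng eq [Xw Nw] ew] := Ge _ _ (Gn n); last by [].
exact: (eta_small (hp n) Xg (le_trans Ng (ltW (half_rho s1 l (hp n))))).2.
Qed.

Lemma good_ew x gw : good x gw -> [/\ X gw.1, X gw.2 &
  forall y, gw.2 y * (1 + eta_of x.1.1 gw.1 y) = eta_of x.1.1 gw.1 y].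
Proof. by case: x => -[p ta] ph [Xg _ _ [Xw _] ew]. Qed.

Lemma map_exists r (c : @param R -> R) : (1 <= r)%N -> CV r c ->
  exists S, scaled_solution_map (r := r) Uset (fun x eta => wave_in_ball i (eps x.1.1) x eta)
    (fun x => c x.1.1) S.
Proof.
move=> r1 HCV.
(* Outside [Uset] the value is arbitrary: continuity is tested within [Uset] only. *)
have C1 x : exists gw', Uset x -> good x gw'.
  have [Ux|nU] := pselect (Uset x); last by exists (fun=> 0, fun=> 0).
  by have [gw' ?] := good_ex Ux; exists gw'.
have [gw Hgw] := choice C1.
have cst_cvA u : X u -> cvA s (fun _ : nat => u) u := cvA_cst s1 (f := u).
pose V x y := x.1.1.1.1 * (c x.1.1 * (gw x).2 y); pose E x y := c x.1.1 * eta_of x.1.1 (gw x).1 y.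
have AVE x : Uset x -> A r (V x) /\ A r (E x).
  move=> Ux; have [Xg Xw ew] := good_ew (Hgw x Ux); have [hp _] := Ux.
  have k (z : R) : (fun _ : nat => z) @ \oo --> z by exact: cvg_cst.
  (* [HCV] at constant sequences: membership of the limits in H^r is part of the convergence
     statement. *)
  have [[_ A1' _] [_ A2' _]] := HCV (fun=> x.1.1) x.1.1 (bnd i x.1.1) (fun=> hp) hp (k _) (k _) (k _)
    (fun=> lexx _) (lexx _) _ _ _ _ (cst_cvA _ Xg) (cst_cvA _ Xw) (fun=> ew) ew.
  by split=> //; exact: (AZ _ r1 A1').1.
have C2 x : exists Sx : Hs R r * Hs R r, Uset x -> Hs_fun Sx.1 = V x /\ Hs_fun Sx.2 = E x.
  have [Ux|nU] := pselect (Uset x); last by exists (Hs0 R r, Hs0 R r).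
  have [A1' A2'] := AVE x Ux.
  by exists (MkHs (A_sobolev A1'), MkHs (A_sobolev A2')).
have [S HS] := choice C2.
exists S; split; last first.
  move=> x f Ux wf; have [_ uq] := good_wave Ux (Hgw x Ux).
  have ef := uq f wf; have [e1 e2] := HS x Ux; have [Xg Xw ew] := good_ew (Hgw x Ux).
  rewrite e1 e2; split; apply: ae_S ef => y h; last by rewrite /E h.
  by rewrite /V /velocity h -/(velocity _ _ y) (velocityE ew); ring.
apply/subspace_continuousP => x0 Ux0; have [hp0 _] := Ux0.
have [Xg0 Xw0 ew0] := good_ew (Hgw x0 Ux0).
have seqs xs : (forall n, close x0 n (xs n)) -> (forall n, Uset (xs n)) ->
    nrm r (fun y => V (xs n) y - V x0 y) @[n --> \oo] --> 0 /\
    nrm r (fun y => E (xs n) y - E x0 y) @[n --> \oo] --> 0.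
  move=> Hc Uxs; have [c1 c2] := good_cvA Ux0 Uxs Hc (Hgw x0 Ux0) (fun n => Hgw _ (Uxs n)).
  have hp n : param_set i (xs n).1.1 by case: (Uxs n).
  have cg : (fun n => (xs n).1.1.1.1) @ \oo --> x0.1.1.1.1 by apply: inv_cvg => n; case: (Hc n).
  have cm : (fun n => (xs n).1.1.1.2) @ \oo --> x0.1.1.1.2 by apply: inv_cvg => n; case: (Hc n).
  have cs : (fun n => (xs n).1.1.2) @ \oo --> x0.1.1.2 by apply: inv_cvg => n; case: (Hc n).
  have bC n : bnd i (xs n).1.1 <= bnd i x0.1.1 + 1 by case: (Hc n) => _ _ _ _ [].
  have bC0 : bnd i x0.1.1 <= bnd i x0.1.1 + 1 by rewrite lerDl.
  have [d1 d2] := HCV (fun n => (xs n).1.1) x0.1.1 _ hp hp0 cg cm cs bC bC0 _ _ _ _ c1 c2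
    (fun n => let: And3 _ _ ew := good_ew (Hgw _ (Uxs n)) in ew) ew0.
  by split; [have [_ _] := cvA_Z r1 cg d1|have [_ _] := d2].
have [eS1 eS2] := HS x0 Ux0.
have key (T : @data R l s -> Hs R r) (T' : @data R l s -> R -> R) :
    (forall x, Uset x -> Hs_fun (T x) = T' x) ->
    (forall xs, (forall n, close x0 n (xs n)) -> (forall n, Uset (xs n)) ->
       nrm r (fun y => T' (xs n) y - T' x0 y) @[n --> \oo] --> 0) ->
    T @ within Uset (nbhs x0) --> T x0.
  move=> HT Hs'; apply: Hs_cvg => e e0; apply: seq_near => // xs Hc Uxs.
  have /cvgrPdist_lt/(_ e e0)[n _ /(_ n (leqnn n))] := Hs' xs Hc Uxs.
  rewrite sub0r normrN => /(le_lt_trans (ler_norm _)) h; exists n.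
  by rewrite (HT _ (Uxs n)) (HT _ Ux0).
have K1 : (fun x => (S x).1) @ within Uset (nbhs x0) --> (S x0).1.
  by apply: (key _ V) => [x /HS[]//|xs Hc Uxs]; case: (seqs xs Hc Uxs).
have K2 : (fun x => (S x).2) @ within Uset (nbhs x0) --> (S x0).2.
  by apply: (key _ E) => [x /HS[]//|xs Hc Uxs]; case: (seqs xs Hc Uxs).
(* Convergence of the pair is checked on product neighbourhoods from that of the two components. *)
move=> Q [[B1 B2] /= [GA HB] ABP].
have n1 : \forall x \near within Uset (nbhs x0), B1 (S x).1 by exact: K1 GA.
have n2 : \forall x \near within Uset (nbhs x0), B2 (S x).2 by exact: K2 HB.
by apply: filterS (filterI n1 n2) => x [Bx1 Bx2]; exact: ABP.
Qed.

Lemma CV1 : CV s.+1 (fun=> 1).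
Proof.
move=> p p0 Cb hp hp0 cg cm cs bC bC0 g w g0 w0 cvg cvw ew ew0.
have E u : (fun y : R => 1 * u y) = u by apply/funext => y; rewrite mul1r.
have E' (u : nat -> R -> R) : (fun n (y : R) => 1 * u n y) = u.
  by apply/funext => n; rewrite E.
rewrite !E (E' w) (E' (fun n => eta_of (p n) (g n))); split.
  exact: cvA_w_up cvg cvw ew ew0.
exact: cvA_eta_up cvg.
Qed.

Lemma CVm : CV s.+2 (fun p => p.1.2 ^+ 2).
Proof.
move=> p p0 Cb hp hp0 cg cm cs bC bC0 g w g0 w0 cvg cvw ew ew0; split.
  exact: cvA_mw_up cvg cvw ew ew0.
have := cvA_m_up s1 hp hp0 cm cs bC bC0 cvg; have [Xg Xg0 _] := cvg.
have E q u : param_set i q -> X u -> mD i q 0 u = fun y => q.1.2 ^+ 2 * eta_of q u y.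
  by move=> hq Xu; apply/funext => y; exact: (mDE s1 y hq Xu).1.
rewrite (E _ _ hp0 Xg0) (_ : (fun n => mD i (p n) 0 (g n)) = fun n y => (p n).1.2 ^+ 2 * eta_of (p n) (g n) y)//.
by apply/funext => n; exact: E.
Qed.

Lemma CVs : CV s.+3 (fun p => p.2 ^+ 2).
Proof.
move=> p p0 Cb hp hp0 cg cm cs bC bC0 g w g0 w0 cvg cvw ew ew0; split.
  exact: cvA_sw_up cvg cvw ew ew0.
have := cvA_s_up s1 hp hp0 cm cs bC bC0 cvg; have [Xg Xg0 _] := cvg.
have E q u : param_set i q -> X u -> sD i q 0 u = fun y => q.2 ^+ 2 * eta_of q u y.
  by move=> hq Xu; apply/funext => y; exact: (sDE s1 y hq Xu).1.
rewrite (E _ _ hp0 Xg0) (_ : (fun n => sD i (p n) 0 (g n)) = fun n y => (p n).2 ^+ 2 * eta_of (p n) (g n) y)//.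
by apply/funext => n; exact: E.
Qed.

End Main.

Theorem theorem2 (R : realType) (l s : nat) (i : regime) (s1 : (1 <= s)%N) :
  exists (U : set (@data R l s)) (eps : @param R -> R),
  [/\ (exists O : set (@data R l s),
         open O /\ U = O `&` [set x | param_set i x.1.1]),
      (forall p, param_set i p -> U (p, fun=> Hs0 R s, fun=> Hs0 R s)),
      (forall p, param_set i p -> 0 < eps p),
      (forall x, U x ->
         exists eta : R -> R,
           wave_in_ball i (eps x.1.1) x eta /\
           forall eta', wave_in_ball i (eps x.1.1) x eta' ->
             {ae @lebesgue_measure R, forall y, eta' y = eta y}) &
      let sol x eta := wave_in_ball i (eps x.1.1) x eta in
      [/\ exists S, scaled_solution_map (r := s.+1) U sol (fun=> 1) S,
          exists S, scaled_solution_map (r := s.+2) U sol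
                      (fun x => x.1.1.1.2 ^+ 2) S &
          exists S, scaled_solution_map (r := s.+3) U sol
                      (fun x => x.1.1.2 ^+ 2) S]].
Proof.
exists (@Uset R i s s1 l), (@eps R i s s1 l); split.
- exact: Uset_open.
- move=> p hp; split=> //=.
  have h : nn s (Hs0 R s) < @del R i s s1 l p by rewrite (X0 s1).2; exact: del_gt0.
  by split.
- by move=> p; exact: eps_gt0.
- move=> x Ux; have [gw Gx] := good_ex Ux; exists (eta_of i x.1.1 gw.1).
  exact: good_wave.
- by split; [exact: map_exists (ltn0Sn s) (CV1 _)|exact: map_exists (ltn0Sn _) (CVm _)
            |exact: map_exists (ltn0Sn _) (CVs _)].
Qed.
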